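(* Let $\mathfrak g=A(1,1)=\mathfrak{psl}(2,2)$. Then $$J(\mathfrak g)=\{f=c+(u-v)^2g(u,v)\mid c\in\mathbb Z,\ g\in\mathbb Z[u,v]\}.$$ The subring $J(\mathfrak g)^+$ of polynomials of even degree in $J(\mathfrak g)$ (those $f$ all of whose monomials in $u,v$ have even total degree) can be interpreted as the Grothendieck ring of finite dimensional representations of the algebraic supergroup $PSL(2,2)$, i.e. the supercharacter map is a ring isomorphism from that Grothendieck ring onto $J(\mathfrak g)^+$.
   Context: For $\mathfrak g=\mathfrak{psl}(2,2)$, $\mathfrak g_0=\mathfrak{sl}(2)\oplus\mathfrak{sl}(2)$; $\mathfrak h^*$ has basis $\varepsilon,\delta$, where $\pm\varepsilon$ and $\pm\delta$ are the weights of the standard representations of the two copies of $\mathfrak{sl}(2)$, with form $(\varepsilon,\varepsilon)=1$, $(\delta,\delta)=-1$, $(\varepsilon,\delta)=0$. The isotropic roots are $\pm\varepsilon\pm\delta$ (each of multiplicity 2), the weight lattice of $\mathfrak g_0$ is $P_0=\mathbb Z\varepsilon\oplus\mathbb Z\delta$, and $W_0=\mathbb Z_2\times\mathbb Z_2$ changes the signs of $\varepsilon$ and $\delta$. In this case the ring is defined as $J(\mathfrak g)=\{f\in\mathbb Z[P_0]^{W_0}: D_\alpha f\in((e^\alpha-1)^2)\ \text{for every isotropic root }\alpha\}$ with $D_\alpha e^\beta=(\alpha,\beta)e^\beta$ and principal ideals in $\mathbb Z[P_0]$; with $x=e^\varepsilon$, $y=e^\delta$ this is $$J(\mathfrak g)=\Big\{f\in\mathbb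 Z[x^{\pm1},y^{\pm1}]^{\mathbb Z_2\times\mathbb Z_2}\ \Big|\ x\frac{\partial f}{\partial x}+y\frac{\partial f}{\partial y}\in((x-y)^2)\Big\},$$ where $\mathbb Z_2\times\mathbb Z_2$ acts by $x\mapsto x^{-1}$ and $y\mapsto y^{-1}$. Put $u=x+x^{-1}$, $v=y+y^{-1}$. $PSL(2,2)$ is the quotient of $SL(2,2)$ by scalar matrices. The Grothendieck ring of a supergroup is the free abelian group on isomorphism classes of finite dimensional $\mathbb Z_2$-graded algebraic representations modulo $[V_1]-[V]+[V_2]$ for short exact sequences $0\to V_1\to V\to V_2\to0$ and $[V]+[\Pi V]$ ($\Pi$ = parity change), with tensor product; the supercharacter of $V$ is $\sum_\lambda(\dim(V_\lambda)_0-\dim(V_\lambda)_1)e^\lambda$ over the $\mathfrak h$-weights. *)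

(* Defs.v *)
From HB Require Import structures.
From mathcomp Require Import all_boot all_order all_algebra.
From mathcomp Require Import boolp finmap monalg mxtens.
From mathcomp Require mpoly.

Set Implicit Arguments.
Unset Strict Implicit.
Unset Printing Implicit Defensive.

Import GRing.Theory.
Local Open Scope ring_scope.

(* [monalg] only equips {malg int[M]} with a product when the monoid M has no
   nontrivial units, which excludes lattices; the product is therefore redone
   for an arbitrary commutative monoid law. *)
Definition monring (M : choiceType) (e : M) (op : Monoid.com_law e) :=
  {malg int[M]}.

Section MonoidRing.
Variables (M : choiceType) (e : M) (op : Monoid.com_law e).
Local Notation R := (monring op).
Implicit Types f g h : {malg int[M]}.

HB.instance Definition _ := GRing.Zmodule.on R.

Definition mrmul f g : {malg int[M]} :=
  \sum_(a <- msupp f) \sum_(b <- msupp g) << f@_a * g@_b *g op a b >>.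

Local Open Scope fset_scope.

Lemma mrmulEw (d1 d2 : {fset M}) f g :
  msupp f `<=` d1 -> msupp g `<=` d2 ->
  mrmul f g = \sum_(a <- d1) \sum_(b <- d2) << f@_a * g@_b *g op a b >>.
Proof.
move=> le1 le2; rewrite /mrmul (big_fset_incl _ le1) /=.
  apply/eq_bigr=> a _; apply/big_fset_incl => // b _ /mcoeff_outdom ->.
  by rewrite mulr0 monalgU0.
move=> a _ /mcoeff_outdom fa.
by rewrite big1 // => b _; rewrite fa mul0r monalgU0.
Qed.

Lemma mrmulC : commutative mrmul.
Proof.
move=> f g; rewrite /mrmul exchange_big /=; apply/eq_bigr=> a _.
by apply/eq_bigr=> b _; rewrite mulrC Monoid.mulmC.
Qed.

Lemma mrmulDl : left_distributive mrmul +%R.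
Proof.
move=> f1 f2 g.
rewrite [in RHS](mrmulEw (fsubsetUl _ (msupp f2)) (fsubset_refl _)).
rewrite [in RHS](mrmulEw (fsubsetUr (msupp f1) _) (fsubset_refl _)).
rewrite (mrmulEw (msuppD_le _ _) (fsubset_refl _)).
rewrite -big_split /=; apply/eq_bigr=> a _.
rewrite -big_split /=; apply/eq_bigr=> b _.
by rewrite mcoeffD mulrDl monalgUD.
Qed.

Lemma mrmul0 g : mrmul 0 g = 0.
Proof. by rewrite /mrmul msupp0 big_seq_fset0. Qed.

Lemma mrmul_sumr (I : Type) (r : seq I) (F : I -> {malg int[M]}) g :
  mrmul (\sum_(i <- r) F i) g = \sum_(i <- r) mrmul (F i) g.
Proof.
exact: (big_morph (mrmul^~ g) (fun _ _ => mrmulDl _ _ _) (mrmul0 g)).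
Qed.

Lemma mrmul_suml (I : Type) (r : seq I) (F : I -> {malg int[M]}) g :
  mrmul g (\sum_(i <- r) F i) = \sum_(i <- r) mrmul g (F i).
Proof. by rewrite mrmulC mrmul_sumr; apply: eq_bigr => i _; rewrite mrmulC. Qed.

Lemma mrmulUU c1 c2 a b :
  mrmul << c1 *g a >> << c2 *g b >> = << c1 * c2 *g op a b >>.
Proof. by rewrite (mrmulEw msuppU_le msuppU_le) !big_seq_fset1 !mcoeffUU. Qed.

Lemma mrmulA : associative mrmul.
Proof.
move=> f g h; rewrite [f]monalgE [g]monalgE [h]monalgE.
rewrite !mrmul_sumr; apply: eq_bigr => a _.
rewrite [LHS]mrmul_suml [X in _ = mrmul X _]mrmul_suml [RHS]mrmul_sumr.
apply: eq_bigr => b _; rewrite !mrmul_suml; apply: eq_bigr => c _.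
by rewrite !mrmulUU mulrA Monoid.mulmA.
Qed.

Lemma mrmul1 : left_id << e >> mrmul.
Proof.
move=> g; rewrite [in LHS](monalgE g) mrmul_suml [RHS]monalgE.
by apply: eq_bigr => a _; rewrite mrmulUU mul1r Monoid.mul1m.
Qed.

Lemma mrone_neq0 : (<< e >> : {malg int[M]}) != 0.
Proof. by apply/eqP/malgP => /(_ e) /eqP; rewrite mcoeffUU mcoeff0. Qed.

HB.instance Definition _ := GRing.Zmodule_isComNzRing.Build R
  mrmulA mrmulC mrmul1 mrmulDl mrone_neq0.

Definition mrX (a : M) : R := << a >>.

Lemma mrXM a b : mrX a * mrX b = mrX (op a b).
Proof. exact: mrmulUU. Qed.

Lemma mrX1 : mrX e = 1.
Proof. by []. Qed.

End MonoidRing.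

(* (a, b) stands for the weight a ε + b δ. *)
Definition P0 : nmodType := (int * int)%type.

Definition ZP0 := monring (@GRing.add P0).
HB.instance Definition _ := GRing.ComNzRing.on ZP0.

Definition coef (f : ZP0) (b : P0) : int := mcoeff b f.
Definition expw (b : P0) : ZP0 := mrX (@GRing.add P0) b.

Definition form (a b : P0) : int := a.1 * b.1 - a.2 * b.2.

Definition isotropic_roots : seq P0 :=
  [:: (1, 1); (1, -1); (-1, 1); (-1, -1)].

Definition Dder (a : P0) (f : ZP0) : ZP0 :=
  \sum_(b <- msupp f) << form a b * coef f b *g b >>.

Definition W0_invariant (f : ZP0) : Prop :=
  forall a b : int, coef f (- a, b) = coef f (a, b) /\
                    coef f (a, - b) = coef f (a, b).

Definition inJ (f : ZP0) : Prop :=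
  W0_invariant f /\
  forall a, a \in isotropic_roots ->
    exists h : ZP0, Dder a f = h * (expw a - 1) ^+ 2.

Definition uvar : ZP0 := expw (1, 0) + expw (-1, 0).
Definition vvar : ZP0 := expw (0, 1) + expw (0, -1).

(* [mpoly] is imported locally: its notations clash with those of [monalg]. *)
Section PolynomialsUV.
Import mpoly.

Definition ZUV := {mpoly int[2]}.

Definition evalUV (p : ZUV) : ZP0 :=
  mmap intr (fun i : 'I_2 => if i == ord0 then uvar else vvar) p.

Definition even_degree (p : ZUV) : Prop :=
  forall m, m \in msupp p -> ~~ odd (mdeg m).

End PolynomialsUV.

Definition inJplus (f : ZP0) : Prop :=
  inJ f /\ exists p : ZUV, even_degree p /\ f = evalUV p.

Record superalg (k : fieldType) := SuperAlg {
  sa_alg :> algType k;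
  sa_hom : bool -> sa_alg -> Prop;
  sa_hom0 : forall b, sa_hom b 0;
  sa_homP : forall b (c : k) x y,
    sa_hom b x -> sa_hom b y -> sa_hom b (c *: x + y);
  sa_dec : forall x, exists x0 x1,
    [/\ sa_hom false x0, sa_hom true x1 & x = x0 + x1];
  sa_dir : forall x, sa_hom false x -> sa_hom true x -> x = 0;
  sa_hom1 : sa_hom false 1;
  sa_homM : forall b c x y,
    sa_hom b x -> sa_hom c y -> sa_hom (b (+) c) (x * y);
  sa_comm : forall b c x y,
    sa_hom b x -> sa_hom c y -> y * x = (-1) ^+ (b && c) * (x * y)
}.
Arguments sa_hom {k s} b x.

Definition par22 (i : 'I_(2 + 2)) : bool := (2 <= i)%N.

(* An A-point is an even invertible supermatrix (A B; C D) with Berezinian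
   det (A - B D^-1 C) / det D equal to 1; the inverses of det A and det D, the
   remaining generators of the coordinate superalgebra, are part of the data. *)
Record SL22 (k : fieldType) (A : superalg k) := SL22Point {
  sl_mx :> 'M[A]_(2 + 2);
  sl_invA : A;
  sl_invD : A;
  sl_even : forall i j, sa_hom (par22 i (+) par22 j) (sl_mx i j);
  sl_invAP : \det (ulsubmx sl_mx) * sl_invA = 1;
  sl_invDP : \det (drsubmx sl_mx) * sl_invD = 1;
  sl_berP : \det (ulsubmx sl_mx - ursubmx sl_mx
              *m (sl_invD%:M *m \adj (drsubmx sl_mx)) *m dlsubmx sl_mx)
            * sl_invD = 1
}.

(* Regular functions on SL(2,2) are represented by expressions in the
   generators of its coordinate superalgebra, identified through their values
   on all A-points (Yoneda); unlike natural transformations, expressions do not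
   raise the universe level. *)
Inductive regexpr (k : Type) : Type :=
| Entry of 'I_(2 + 2) & 'I_(2 + 2)
| InvDetA
| InvDetD
| Const of k
| Add of regexpr k & regexpr k
| Mul of regexpr k & regexpr k.
Arguments Entry {k}.
Arguments InvDetA {k}.
Arguments InvDetD {k}.

Fixpoint reval (k : fieldType) (A : superalg k) (g : SL22 A) (e : regexpr k) : A :=
  match e with
  | Entry i j => sl_mx g i j
  | InvDetA => sl_invA g
  | InvDetD => sl_invD g
  | Const c => c%:A
  | Add e1 e2 => reval g e1 + reval g e2
  | Mul e1 e2 => reval g e1 * reval g e2
  end.

Definition evalmx (k : fieldType) (A : superalg k) (n : nat)
    (P : 'I_n -> 'I_n -> regexpr k) (g : SL22 A) : 'M[A]_n :=
  \matrix_(i, j) reval g (P i j).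

(* A representation of PSL(2,2), the quotient of SL(2,2) by its scalar
   matrices, is a representation of SL(2,2) on which scalar matrices act
   trivially. The underlying superspace has a homogeneous basis
   e_0, ..., e_(n-1) with parities rep_par, and
   g e_j = sum_i e_i (rep_mx i j)(g), coefficients being written on the
   right. *)
Record rep (k : fieldType) := Rep {
  rep_dim : nat;
  rep_par : 'I_rep_dim -> bool;
  rep_mx : 'I_rep_dim -> 'I_rep_dim -> regexpr k;
  rep_even : forall (A : superalg k) (g : SL22 A) i j,
    sa_hom (rep_par i (+) rep_par j) (reval g (rep_mx i j));
  rep_scal : forall (A : superalg k) (g : SL22 A) (a : A),
    sl_mx g = a%:M -> evalmx rep_mx g = 1%:M;
  rep_mul : forall (A : superalg k) (g h gh : SL22 A),
    sl_mx gh = sl_mx g *m sl_mx h ->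
    evalmx rep_mx gh = evalmx rep_mx g *m evalmx rep_mx h
}.
Arguments rep_par {k} r i.
Arguments rep_mx {k} r i j.

Definition act (k : fieldType) (V : rep k) (A : superalg k) (g : SL22 A) :
  'M[A]_(rep_dim V) := evalmx (rep_mx V) g.

(* Even morphisms, as matrices acting on columns. *)
Definition is_mor (k : fieldType) (V W : rep k)
    (f : 'M[k]_(rep_dim W, rep_dim V)) : Prop :=
  (forall i j, f i j != 0 -> rep_par W i = rep_par V j) /\
  (forall (A : superalg k) (g : SL22 A),
     map_mx (in_alg A) f *m act V g = act W g *m map_mx (in_alg A) f).

Definition iso_rep (k : fieldType) (V W : rep k) : Prop :=
  exists (f : 'M[k]_(rep_dim W, rep_dim V)) (g : 'M[k]_(rep_dim V, rep_dim W)),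
    [/\ is_mor f, is_mor g, f *m g = 1%:M & g *m f = 1%:M].

Definition short_exact (k : fieldType) (V1 V V2 : rep k)
    (f : 'M[k]_(rep_dim V, rep_dim V1)) (g : 'M[k]_(rep_dim V2, rep_dim V)) :
    Prop :=
  [/\ is_mor f, is_mor g,
      forall v : 'cV_(rep_dim V1), f *m v = 0 -> v = 0,
      forall w : 'cV_(rep_dim V2), exists v, g *m v = w &
      forall v : 'cV_(rep_dim V), g *m v = 0 <-> exists w, v = f *m w].

Section Constructions.
Variable k : fieldType.
Implicit Types (V W : rep k) (A : superalg k).

Lemma reval1 A (g : SL22 A) : reval g (Const 1) = 1.
Proof. exact: scale1r. Qed.

Program Definition rep1 : rep k :=
  @Rep k 1 (fun=> false) (fun _ _ => Const 1) _ _ _.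
Next Obligation. by rewrite scale1r; apply: sa_hom1. Qed.
Next Obligation.
by apply/matrixP => i j; rewrite !mxE !ord1 /= scale1r.
Qed.
Next Obligation.
by apply/matrixP => i j; rewrite !mxE big_ord1 !mxE /= scale1r mulr1.
Qed.

Program Definition parity_change V : rep k :=
  @Rep k (rep_dim V) (fun i => ~~ rep_par V i) (rep_mx V) _ _ _.
Next Obligation.
by rewrite addNb addbN negbK; apply: rep_even.
Qed.
Next Obligation. by move: H; apply: (@rep_scal k V). Qed.
Next Obligation. by move: H; apply: (@rep_mul k V). Qed.

Definition tensor_par V W (x : 'I_(rep_dim V * rep_dim W)) : bool :=
  let: (i, p) := mxtens_unindex x in rep_par V i (+) rep_par W p.

(* g (e_j ⊗ e_q) = g e_j ⊗ g e_q; moving the coefficient g_ij of e_i to the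
   right of e_p yields the sign. *)
Definition tensor_mx V W (x y : 'I_(rep_dim V * rep_dim W)) : regexpr k :=
  let: (i, p) := mxtens_unindex x in
  let: (j, q) := mxtens_unindex y in
  Mul (Const ((-1) ^+ ((rep_par V i (+) rep_par V j) && rep_par W p)))
      (Mul (rep_mx V i j) (rep_mx W p q)).

Lemma sum_tens (T : nmodType) m n (F : 'I_(m * n) -> T) :
  \sum_x F x = \sum_i \sum_p F (mxtens_index (i, p)).
Proof.
rewrite pair_big /= (reindex (@mxtens_index m n)) /=.
  by apply: eq_bigr => -[].
by exists (@mxtens_unindex m n) => x _; rewrite ?mxtens_indexK ?mxtens_unindexK.
Qed.

Lemma in_alg_sign A (b : bool) : ((-1) ^+ b : k)%:A = (-1) ^+ b :> A.
Proof. exact: (rmorph_sign (in_alg A)). Qed.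

Lemma tensor_evalE V W A (g : SL22 A) i p j q :
  reval g (tensor_mx (mxtens_index (i, p)) (mxtens_index (j, q))) =
  (-1) ^+ ((rep_par V i (+) rep_par V j) && rep_par W p)
  * (reval g (rep_mx V i j) * reval g (rep_mx W p q)).
Proof. by rewrite /tensor_mx !mxtens_indexK /= in_alg_sign. Qed.

Lemma hom_sign A b (c : bool) (x : A) : sa_hom b x -> sa_hom b ((-1) ^+ c * x).
Proof.
move=> hx; rewrite -in_alg_sign -scalerAl mul1r -[_ *: x]addr0.
by apply: sa_homP => //; apply: sa_hom0.
Qed.

Lemma mulsignA A (b c : bool) (x y : A) :
  (-1) ^+ b * x * ((-1) ^+ c * y) = (-1) ^+ (b (+) c) * (x * y).
Proof.
rewrite signr_addb -!mulrA; congr (_ * _).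
by rewrite !mulrA (commr_sign x c).
Qed.

Lemma act_mul V A (g h gh : SL22 A) i j : sl_mx gh = sl_mx g *m sl_mx h ->
  reval gh (rep_mx V i j) =
  \sum_l reval g (rep_mx V i l) * reval h (rep_mx V l j).
Proof.
move=> /(@rep_mul k V) /matrixP /(_ i j); rewrite !mxE => ->.
by apply: eq_bigr => l _; rewrite !mxE.
Qed.

Lemma tensor_even V W A (g : SL22 A) x y :
  sa_hom (@tensor_par V W x (+) @tensor_par V W y) (reval g (@tensor_mx V W x y)).
Proof.
case: (mxtens_indexP x) => i p; case: (mxtens_indexP y) => j q.
rewrite tensor_evalE /tensor_par !mxtens_indexK addbACA.
by apply/hom_sign/sa_homM; apply: rep_even.
Qed.

Lemma tensor_scal V W A (g : SL22 A) (a : A) :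
  sl_mx g = a%:M -> evalmx (@tensor_mx V W) g = 1%:M.
Proof.
move=> ga; apply/matrixP => x y; case: (mxtens_indexP x) => i p.
case: (mxtens_indexP y) => j q; rewrite mxE tensor_evalE mxE.
have /matrixP/(_ i j) := @rep_scal k V A g a ga; rewrite !mxE => ->.
have /matrixP/(_ p q) := @rep_scal k W A g a ga; rewrite !mxE => ->.
rewrite (can_eq (@mxtens_indexK _ _)) xpair_eqE.
have [->|_] := eqVneq i j; last by rewrite mul0r mulr0.
by rewrite addbb mul1r mul1r; case: (p == q).
Qed.

Lemma tensor_mul V W A (g h gh : SL22 A) : sl_mx gh = sl_mx g *m sl_mx h ->
  evalmx (@tensor_mx V W) gh = evalmx (@tensor_mx V W) g *m evalmx (@tensor_mx V W) h.
Proof.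
move=> ghE; apply/matrixP => x y; case: (mxtens_indexP x) => i p.
case: (mxtens_indexP y) => j q; rewrite mxE tensor_evalE mxE.
rewrite (act_mul _ _ ghE) (act_mul _ _ ghE) sum_tens mulr_suml mulr_sumr.
apply: eq_bigr => l _; rewrite mulr_sumr mulr_sumr; apply: eq_bigr => r _.
rewrite !mxE !tensor_evalE mulsignA.
set a := reval g (rep_mx V i l); set b := reval h (rep_mx V l j).
set c := reval g (rep_mx W p r); set d := reval h (rep_mx W r q).
have cb : b * c = (-1) ^+ ((rep_par W p (+) rep_par W r)
                           && (rep_par V l (+) rep_par V j)) * (c * b).
  exact: (sa_comm (rep_even g p r) (rep_even h l j)).
have -> : a * b * (c * d) = (-1) ^+ ((rep_par W p (+) rep_par W r)
    && (rep_par V l (+) rep_par V j)) * (a * c * (b * d)).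
  rewrite -[a * b * _]mulrA [b * (c * d)]mulrA cb -!mulrA.
  by rewrite mulrA commr_sign !mulrA.
rewrite mulrA -signr_addb; congr (_ ^+ nat_of_bool _ * _).
by case: (rep_par V i) (rep_par V j) (rep_par V l) (rep_par W p) (rep_par W r)
  => [] [] [] [] [].
Qed.

Definition tensor V W : rep k :=
  Rep (@tensor_even V W) (@tensor_scal V W) (@tensor_mul V W).

Lemma par_tensor V W i p :
  rep_par (tensor V W) (mxtens_index (i, p)) = rep_par V i (+) rep_par W p.
Proof. by rewrite [LHS]/(tensor_par _) /tensor_par mxtens_indexK. Qed.

Lemma reval_tensor V W A (g : SL22 A) i p j q :
  reval g (rep_mx (tensor V W) (mxtens_index (i, p)) (mxtens_index (j, q))) =
  (-1) ^+ ((rep_par V i (+) rep_par V j) && rep_par W p)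
  * (reval g (rep_mx V i j) * reval g (rep_mx W p q)).
Proof. exact: tensor_evalE. Qed.

Lemma is_mor1 V : @is_mor k V V 1%:M.
Proof.
split=> [i j|A g]; last by rewrite map_mx1 mul1mx mulmx1.
by rewrite mxE; have [->|] := eqVneq i j; rewrite ?eqxx.
Qed.

Lemma is_mor_comp U V W f g :
  @is_mor k V W f -> @is_mor k U V g -> @is_mor k U W (f *m g).
Proof.
move=> [pf cf] [pg cg]; split=> [i j|A x]; last first.
  by rewrite map_mxM -mulmxA cg mulmxA cf mulmxA.
apply: contra_neq_eq => nij; rewrite mxE big1 // => l _.
have [->|/pf e1] := eqVneq (f i l) 0; first by rewrite mul0r.
have [->|/pg e2] := eqVneq (g l j) 0; first by rewrite mulr0.
by rewrite e1 e2 eqxx in nij.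
Qed.

Lemma iso_refl V : iso_rep V V.
Proof. by exists 1%:M, 1%:M; split; rewrite ?mulmx1 //; apply: is_mor1. Qed.

Lemma iso_sym V W : iso_rep V W -> iso_rep W V.
Proof. by move=> [f [g [? ? ? ?]]]; exists g, f. Qed.

Lemma iso_trans U V W : iso_rep U V -> iso_rep V W -> iso_rep U W.
Proof.
move=> [f [g [mf mg fg gf]]] [f' [g' [mf' mg' fg' gf']]].
exists (f' *m f), (g *m g'); split; try exact: is_mor_comp.
  by rewrite mulmxA -(mulmxA f') fg mulmx1.
by rewrite mulmxA -(mulmxA g) gf' mulmx1.
Qed.

Lemma sum_only (T : nmodType) n (F : 'I_n -> T) i0 :
  (forall i, i != i0 -> F i = 0) -> \sum_i F i = F i0.
Proof. by move=> F0; rewrite (bigD1 i0) //= big1 ?addr0 // => i /F0. Qed.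

Definition signed_mx m n (s : 'I_n -> 'I_m) (sg : 'I_n -> bool) : 'M[k]_(m, n) :=
  \matrix_(x, i) ((x == s i)%:R * (-1) ^+ sg i).

Lemma signed_mor V W (s : 'I_(rep_dim V) -> 'I_(rep_dim W)) t
    (sg : 'I_(rep_dim V) -> bool) :
  cancel s t -> cancel t s ->
  (forall i, rep_par W (s i) = rep_par V i) ->
  (forall A (g : SL22 A) i j, reval g (rep_mx W (s i) (s j)) =
     (-1) ^+ (sg i (+) sg j) * reval g (rep_mx V i j)) ->
  is_mor (signed_mx s sg : 'M[k]_(rep_dim W, rep_dim V)).
Proof.
move=> sK tK hp hm; split=> [x i|A g].
  rewrite mxE; have [->|] := eqVneq x (s i); first by rewrite hp.
  by rewrite mul0r eqxx.
have algM b (c : bool) : (b%:R * (-1) ^+ c : k)%:A = b%:R * (-1) ^+ c :> A.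
  by rewrite -[LHS]/(in_alg A _) rmorphM rmorph_nat rmorph_sign.
apply/matrixP => x j; rewrite !mxE.
rewrite (@sum_only _ _ _ (t x)) => [|i ni]; last first.
  rewrite !mxE /= algM eq_sym (can2_eq sK tK) (negPf ni).
  by rewrite !mul0r.
rewrite (@sum_only _ _ _ (s j)) => [|y ny]; last first.
  by rewrite !mxE /= algM (negPf ny) mul0r mulr0.
rewrite !mxE /= !algM tK !eqxx !mul1r -[in RHS](tK x) hm.
rewrite signr_addb -mulrA -[_ * _ * (-1) ^+ sg j]mulrA.
by rewrite (commr_sign _ (sg j)) signrMK.
Qed.

Lemma signed_mxK m n (s : 'I_n -> 'I_m) t sg : cancel s t -> cancel t s ->
  signed_mx s sg *m signed_mx t (sg \o t) = 1%:M.
Proof.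
move=> sK tK; apply/matrixP => x y; rewrite !mxE.
rewrite (@sum_only _ _ _ (t y)) => [|i ni]; last first.
  by rewrite !mxE (negPf ni) mul0r mulr0.
by rewrite !mxE tK eqxx mul1r -mulrA -signr_addb addbb mulr1.
Qed.

Lemma iso_signed V W (s : 'I_(rep_dim V) -> 'I_(rep_dim W)) t
    (sg : 'I_(rep_dim V) -> bool) :
  cancel s t -> cancel t s ->
  (forall i, rep_par W (s i) = rep_par V i) ->
  (forall A (g : SL22 A) i j, reval g (rep_mx W (s i) (s j)) =
     (-1) ^+ (sg i (+) sg j) * reval g (rep_mx V i j)) ->
  iso_rep V W.
Proof.
move=> sK tK hp hm.
exists (signed_mx s sg), (signed_mx t (sg \o t)); split.
- exact: (signed_mor sK tK).
- apply: (signed_mor tK sK) => [x|A g x y]; first by rewrite -hp tK.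
  by rewrite -{3}(tK x) -{3}(tK y) hm /= mulrA -signr_addb addbb mul1r.
- exact: signed_mxK.
- have -> : signed_mx s sg = signed_mx s ((sg \o t) \o s).
    by apply/matrixP => x i; rewrite !mxE /= sK.
  exact: signed_mxK.
Qed.

Lemma iso_tensorC V W : iso_rep (tensor V W) (tensor W V).
Proof.
pose sw m n (x : 'I_(m * n)) : 'I_(n * m) :=
  mxtens_index ((mxtens_unindex x).2, (mxtens_unindex x).1).
have swK m n : cancel (@sw m n) (@sw n m).
  by move=> x; case: (mxtens_indexP x) => i p; rewrite /sw !mxtens_indexK.
apply: (@iso_signed (tensor V W) (tensor W V) (@sw _ _) (@sw _ _)
  (fun x => rep_par V (mxtens_unindex x).1 && rep_par W (mxtens_unindex x).2)
  (swK _ _) (swK _ _)).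
  move=> x; case: (mxtens_indexP x) => i p.
  by rewrite /sw !mxtens_indexK !par_tensor addbC.
move=> A g x y; case: (mxtens_indexP x) => i p; case: (mxtens_indexP y) => j q.
rewrite /sw !mxtens_indexK !reval_tensor mulrA -signr_addb.
rewrite (sa_comm (rep_even g i j) (rep_even g p q)) mulrA -signr_addb.
congr (_ ^+ nat_of_bool _ * _).
by case: (rep_par V i) (rep_par V j) (rep_par W p) (rep_par W q) => [] [] [] [].
Qed.

Lemma iso_tensorA U V W :
  iso_rep (tensor U (tensor V W)) (tensor (tensor U V) W).
Proof.
pose s (x : 'I_(rep_dim (tensor U (tensor V W)))) :
    'I_(rep_dim (tensor (tensor U V) W)) :=
  let: (i, y) := mxtens_unindex x in let: (p, u) := mxtens_unindex y in
  mxtens_index (mxtens_index (i, p), u).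
pose t (x : 'I_(rep_dim (tensor (tensor U V) W))) :
    'I_(rep_dim (tensor U (tensor V W))) :=
  let: (y, u) := mxtens_unindex x in let: (i, p) := mxtens_unindex y in
  mxtens_index (i, mxtens_index (p, u)).
have sE i p u : s (mxtens_index (i, mxtens_index (p, u))) =
   mxtens_index (mxtens_index (i, p), u) by rewrite /s !mxtens_indexK.
have tE i p u : t (mxtens_index (mxtens_index (i, p), u)) =
   mxtens_index (i, mxtens_index (p, u)) by rewrite /t !mxtens_indexK.
apply: (@iso_signed _ _ s t (fun=> false)).
- move=> x; case: (mxtens_indexP x) => i y; case: (mxtens_indexP y) => p u.
  by rewrite sE tE.
- move=> x; case: (mxtens_indexP x) => y u; case: (mxtens_indexP y) => i p.
  by rewrite tE sE.
- move=> x; case: (mxtens_indexP x) => i y; case: (mxtens_indexP y) => p u.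
  by rewrite sE !par_tensor addbA.
move=> A g x x'; case: (mxtens_indexP x) => i y; case: (mxtens_indexP y) => p u.
case: (mxtens_indexP x') => j y'; case: (mxtens_indexP y') => q v.
rewrite !sE !reval_tensor !par_tensor mul1r.
rewrite !(mulrA, mulrDl) -!mulrA.
rewrite [reval g (rep_mx U i j) * ((-1) ^+ _ * _)]mulrA.
rewrite (commr_sign (reval g (rep_mx U i j))) -!mulrA mulrA -signr_addb.
rewrite [RHS]mulrA -signr_addb; congr (_ ^+ nat_of_bool _ * _).
by case: (rep_par U i) (rep_par U j) (rep_par V p) (rep_par V q)
  (rep_par W u) => [] [] [] [] [].
Qed.

Lemma iso_tensor1 V : iso_rep (tensor rep1 V) V.
Proof.
pose s (x : 'I_(rep_dim (tensor rep1 V))) : 'I_(rep_dim V) :=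
  (mxtens_unindex x : 'I_1 * _).2.
pose t (p : 'I_(rep_dim V)) : 'I_(rep_dim (tensor rep1 V)) :=
  mxtens_index (ord0 : 'I_1, p).
apply: (@iso_signed _ _ s t (fun=> false)).
- move=> x; case: (mxtens_indexP x) => i p.
  by rewrite /s /t mxtens_indexK /= (ord1 i).
- by move=> p; rewrite /s /t mxtens_indexK.
- move=> x; case: (mxtens_indexP x) => i p.
  by rewrite /s mxtens_indexK par_tensor.
move=> A g x x'; case: (mxtens_indexP x) => i p; case: (mxtens_indexP x') => j q.
by rewrite /s !mxtens_indexK reval_tensor /= scale1r !mul1r.
Qed.

Lemma iso_tensor_parity V W :
  iso_rep (tensor (parity_change V) W) (parity_change (tensor V W)).
Proof.
apply: (@iso_signed (tensor (parity_change V) W) (parity_change (tensor V W))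
          id id (fun=> false)) => //.
- move=> x; case: (mxtens_indexP x) => i p.
  by rewrite [LHS]/(~~ rep_par (tensor V W) _) !par_tensor addNb.
move=> A g x x'; case: (mxtens_indexP x) => i p; case: (mxtens_indexP x') => j q.
rewrite mul1r reval_tensor [LHS](@reval_tensor V W A g i p j q).
by congr (_ ^+ nat_of_bool (_ && _) * _); rewrite /= addNb addbN negbK.
Qed.

Definition tens_id m n (f : 'M[k]_(m, n)) r : 'M[k]_(m * r, n * r) :=
  \matrix_(x, y) (f (mxtens_unindex x).1 (mxtens_unindex y).1
                   *+ ((mxtens_unindex x).2 == (mxtens_unindex y).2)).

Lemma tens_idE m n (f : 'M[k]_(m, n)) r i p j q :
  tens_id f r (mxtens_index (i, p)) (mxtens_index (j, q)) = f i j *+ (p == q).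
Proof. by rewrite mxE !mxtens_indexK. Qed.

Lemma tens_id_comp m n r (f : 'M[k]_(m, n)) (g : 'M[k]_(n, r)) d :
  tens_id f d *m tens_id g d = tens_id (f *m g) d.
Proof.
apply/matrixP => x y; case: (mxtens_indexP x) => i p.
case: (mxtens_indexP y) => j q; rewrite mxE sum_tens tens_idE mxE.
rewrite -sumrMnl; apply: eq_bigr => l _; rewrite (@sum_only _ _ _ q).
  by rewrite !tens_idE eqxx mulrnAl.
by move=> u nu; rewrite !tens_idE (negPf nu) mulr0.
Qed.

Lemma tens_id1 n d : tens_id (1%:M : 'M[k]_n) d = 1%:M.
Proof.
apply/matrixP => x y; case: (mxtens_indexP x) => i p.
case: (mxtens_indexP y) => j q; rewrite tens_idE !mxE.
rewrite (can_eq (@mxtens_indexK _ _)) xpair_eqE.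
by case: (i == j); case: (p == q).
Qed.

Definition slice n d (v : 'cV[k]_(n * d)) (p : 'I_d) : 'cV[k]_n :=
  \col_i v (mxtens_index (i, p)) 0.

Lemma slice_inj n d (v w : 'cV[k]_(n * d)) :
  (forall p, slice v p = slice w p) -> v = w.
Proof.
move=> vw; apply/matrixP => x y; case: (mxtens_indexP x) => i p; rewrite ord1.
by have /matrixP/(_ i 0) := vw p; rewrite !mxE.
Qed.

Lemma unslice n d (w : 'I_d -> 'cV[k]_n) :
  exists v : 'cV[k]_(n * d), forall p, slice v p = w p.
Proof.
exists (\col_x w (mxtens_unindex x).2 (mxtens_unindex x).1 0) => p.
by apply/matrixP => i y; rewrite !mxE mxtens_indexK /= ord1.
Qed.

Lemma slice_mul m n (f : 'M[k]_(m, n)) d (v : 'cV[k]_(n * d)) p :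
  slice (tens_id f d *m v) p = f *m slice v p.
Proof.
apply/matrixP => i y; rewrite !mxE sum_tens; apply: eq_bigr => j _.
rewrite (@sum_only _ _ _ p) => [|q nq]; first by rewrite tens_idE eqxx !mxE.
by rewrite tens_idE eq_sym (negPf nq) mul0r.
Qed.

Lemma slice0 n d p : slice (0 : 'cV[k]_(n * d)) p = 0.
Proof. by apply/matrixP => i j; rewrite !mxE. Qed.

Lemma tens_id_mor V V' W (f : 'M[k]_(rep_dim V', rep_dim V)) : is_mor f ->
  @is_mor k (tensor V W) (tensor V' W) (tens_id f (rep_dim W)).
Proof.
move=> [pf cf]; split=> [x y|A g].
  case: (mxtens_indexP x) => i p; case: (mxtens_indexP y) => j q.
  rewrite tens_idE !par_tensor.
  have [->|_] := eqVneq p q; last by rewrite mulr0n eqxx.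
  by rewrite mulr1n => /pf ->.
apply/matrixP => x y; case: (mxtens_indexP x) => i p.
case: (mxtens_indexP y) => j q; rewrite !mxE !sum_tens.
have algE (a : k) (b : bool) : (a *+ b)%:A = a%:A *+ b :> A.
  by case: b; rewrite ?scale0r.
under eq_bigr => l _.
  rewrite (@sum_only _ _ _ p) => [|u nu]; last first.
    by rewrite !mxE !mxtens_indexK eq_sym (negPf nu) /= scale0r mul0r.
  rewrite !mxE reval_tensor !mxtens_indexK eqxx /= mulr1n.
  over.
under [RHS]eq_bigr => l _.
  rewrite (@sum_only _ _ _ q) => [|u nu]; last first.
    by rewrite !mxE !mxtens_indexK (negPf nu) /= scale0r mulr0.
  rewrite !mxE reval_tensor !mxtens_indexK eqxx /= mulr1n.
  over.
have := cf A g; move=> /matrixP /(_ i j); rewrite !mxE => cij.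
have sgL l : (f i l)%:A * ((-1) ^+ ((rep_par V l (+) rep_par V j) && rep_par W p)
      * (reval g (rep_mx V l j) * reval g (rep_mx W p q))) =
    (-1) ^+ ((rep_par V' i (+) rep_par V j) && rep_par W p) *
    ((f i l)%:A * reval g (rep_mx V l j)) * reval g (rep_mx W p q) :> A.
  have [->|/pf ->] := eqVneq (f i l) 0; first by rewrite scale0r !(mul0r, mulr0).
  by rewrite mulrA commr_sign -!mulrA.
have sgR l : ((-1) ^+ ((rep_par V' i (+) rep_par V' l) && rep_par W p)
      * (reval g (rep_mx V' i l) * reval g (rep_mx W p q))) * (f l j)%:A =
    (-1) ^+ ((rep_par V' i (+) rep_par V j) && rep_par W p) *
    (reval g (rep_mx V' i l) * (f l j)%:A) * reval g (rep_mx W p q) :> A.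
  have [->|/pf ->] := eqVneq (f l j) 0; first by rewrite scale0r !(mul0r, mulr0).
  by rewrite -!mulrA; do 2 congr (_ * _); rewrite -scalerAr mulr1 -scalerAl mul1r.
under eq_bigr do rewrite sgL; under [RHS]eq_bigr do rewrite sgR.
rewrite -!mulr_suml -!mulr_sumr; congr (_ * _ * _).
move: cij; under eq_bigr do rewrite !mxE; move=> ->.
by apply: eq_bigr => l _; rewrite !mxE.
Qed.

Lemma iso_tensorl V V' W : iso_rep V V' -> iso_rep (tensor V W) (tensor V' W).
Proof.
move=> [f [g [mf mg fg gf]]].
exists (tens_id f (rep_dim W)), (tens_id g (rep_dim W)).
by split; rewrite ?tens_id_comp ?fg ?gf ?tens_id1 //; apply: tens_id_mor.
Qed.

Lemma iso_tensor V V' W W' :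
  iso_rep V V' -> iso_rep W W' -> iso_rep (tensor V W) (tensor V' W').
Proof.
move=> iV iW; apply: iso_trans (iso_tensorl W iV) _.
apply: iso_trans (iso_tensorC _ _) _; apply: iso_trans _ (iso_tensorC _ _).
exact: iso_tensorl.
Qed.

Lemma short_exact_tensor V1 V V2 f g W : @short_exact k V1 V V2 f g ->
  @short_exact k (tensor V1 W) (tensor V W) (tensor V2 W)
     (tens_id f (rep_dim W)) (tens_id g (rep_dim W)).
Proof.
move=> [mf mg fI gS ex]; split; try exact: tens_id_mor.
- move=> v fv0; apply: slice_inj => p; rewrite slice0; apply: fI.
  by rewrite -slice_mul fv0 slice0.
- move=> w; have /fin_all_exists [v vE] := fun p => gS (slice w p).
  have [v' v'E] := unslice v; exists v'; apply: slice_inj => p.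
  by rewrite slice_mul v'E vE.
- move=> v; split=> [gv0|[w ->]].
    have hp p : exists w, slice v p = f *m w.
      by apply/ex; rewrite -slice_mul gv0 slice0.
    have /fin_all_exists [w wE] := hp; have [w' w'E] := unslice w.
    by exists w'; apply: slice_inj => p; rewrite slice_mul w'E wE.
  apply: slice_inj => p; rewrite !slice_mul slice0.
  by apply/ex; exists (slice w p).
Qed.

Definition sdim V : k := \sum_i (-1) ^+ rep_par V i.

Definition par_mx V : 'M[k]_(rep_dim V) := diag_mx (\row_i (-1) ^+ rep_par V i).

Lemma sdimE V : sdim V = \tr (par_mx V).
Proof. by rewrite mxtrace_diag; apply: eq_bigr => i _; rewrite mxE. Qed.

Lemma par_mx_mor V W f : @is_mor k V W f -> f *m par_mx V = par_mx W *m f.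
Proof.
move=> [pf _]; apply/matrixP => i j; rewrite mul_mx_diag mul_diag_mx !mxE.
have [->|/pf ->] := eqVneq (f i j) 0; first by rewrite mul0r mulr0.
by rewrite mulrC.
Qed.

Lemma mx_factor m n p (f : 'M[k]_(m, n)) (h : 'M[k]_(m, p)) :
  (forall j, exists w, col j h = f *m w) -> exists r, h = f *m r.
Proof.
move=> /fin_all_exists [w wE]; exists (\matrix_(i, j) w j i 0).
apply/matrixP => i j; have /matrixP/(_ i 0) := wE j; rewrite !mxE => ->.
by apply: eq_bigr => l _; rewrite !mxE.
Qed.

Lemma sdim_exact V1 V V2 f g : @short_exact k V1 V V2 f g ->
  sdim V = sdim V1 + sdim V2.
Proof.
move=> [mf mg fI gS ex].
have [s gs] : exists s, 1%:M = g *m s.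
  by apply: mx_factor => j; have [v gv] := gS (col j 1%:M); exists v.
have [r fr] : exists r, 1%:M - s *m g = f *m r.
  apply: mx_factor => j; apply/ex.
  by rewrite colE mulmxA mulmxBr mulmx1 mulmxA -gs mul1mx subrr mul0mx.
have gf : g *m f = 0.
  apply/matrixP => i j; rewrite [RHS]mxE.
  have : g *m (f *m (delta_mx j 0 : 'cV_(rep_dim V1))) = 0.
    by apply/ex; exists (delta_mx j 0).
  by rewrite mulmxA -colE => /matrixP/(_ i 0); rewrite !mxE.
have ffr : f *m r *m f = f.
  by rewrite -fr mulmxBl mul1mx -mulmxA gf mulmx0 subr0.
have rf : r *m f = 1%:M.
  apply/subr0_eq/matrixP => i j; rewrite [RHS]mxE.
  have : f *m ((r *m f - 1%:M) *m (delta_mx j 0 : 'cV_(rep_dim V1))) = 0.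
    by rewrite mulmxA mulmxBr mulmxA ffr mulmx1 subrr mul0mx.
  by move=> /fI; rewrite -colE => /matrixP/(_ i 0); rewrite !mxE.
have eq1 : 1%:M = f *m r + s *m g by rewrite -fr subrK.
rewrite !sdimE -[par_mx V]mulmx1 eq1 mulmxDr mxtraceD; congr (_ + _).
  by rewrite mulmxA -par_mx_mor // mxtrace_mulC !mulmxA rf mul1mx.
by rewrite mulmxA mxtrace_mulC !mulmxA par_mx_mor // -mulmxA -gs mulmx1.
Qed.

Lemma sdim_iso V W : iso_rep V W -> sdim V = sdim W.
Proof.
move=> [f [g [mf mg fg gf]]]; rewrite !sdimE -[par_mx V]mulmx1 -gf.
by rewrite mulmxA -par_mx_mor // -mulmxA mxtrace_mulC -mulmxA fg mulmx1.
Qed.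

Lemma sdim_parity V : sdim (parity_change V) = - sdim V.
Proof.
by rewrite /sdim -sumrN; apply: eq_bigr => i _; rewrite /= signrN.
Qed.

Lemma sdim1 : sdim rep1 = 1.
Proof. by rewrite /sdim big_ord1. Qed.

End Constructions.

Section IsoClasses.
Variable k : fieldType.
Local Open Scope quotient_scope.

HB.instance Definition _ := gen_eqMixin (rep k).
HB.instance Definition _ := gen_choiceMixin (rep k).

Definition isob (V W : rep k) : bool := `[< iso_rep V W >].

Lemma isob_refl : reflexive isob.
Proof. by move=> V; apply/asboolP/iso_refl. Qed.

Lemma isob_sym : symmetric isob.
Proof. by move=> V W; apply/asboolP/asboolP; apply: iso_sym. Qed.

Lemma isob_trans : transitive isob.
Proof.
by move=> V U W /asboolP UV /asboolP VW; apply/asboolP; apply: iso_trans UV VW.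
Qed.

Canonical isob_equiv := EquivRel isob isob_refl isob_sym isob_trans.

Definition isoclass := {eq_quot isob}.
HB.instance Definition _ := Choice.on isoclass.
HB.instance Definition _ := Quotient.on isoclass.
HB.instance Definition _ := EqQuotient.on isoclass.

Definition cls (V : rep k) : isoclass := \pi_isoclass V.

Lemma clsP V W : cls V = cls W <-> iso_rep V W.
Proof. by split=> [/eqmodP/asboolP|?]//; apply/eqmodP/asboolP. Qed.

Lemma cls_repr (a : isoclass) : cls (repr a) = a.
Proof. exact: reprK. Qed.

Lemma repr_cls V : iso_rep (repr (cls V)) V.
Proof. by apply/clsP; rewrite cls_repr. Qed.

Definition cls_tensor (a b : isoclass) : isoclass := cls (tensor (repr a) (repr b)).

Lemma cls_tensorE V W : cls_tensor (cls V) (cls W) = cls (tensor V W).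
Proof. by apply/clsP/iso_tensor; apply: repr_cls. Qed.

Lemma cls_tensorA : associative cls_tensor.
Proof.
move=> a b c; rewrite -(cls_repr a) -(cls_repr b) -(cls_repr c) !cls_tensorE.
exact/clsP/iso_tensorA.
Qed.

Lemma cls_tensorC : commutative cls_tensor.
Proof.
move=> a b; rewrite -(cls_repr a) -(cls_repr b) !cls_tensorE.
exact/clsP/iso_tensorC.
Qed.

Lemma cls_tensor1 : left_id (cls (rep1 k)) cls_tensor.
Proof.
move=> a; rewrite -(cls_repr a) !cls_tensorE; exact/clsP/iso_tensor1.
Qed.

HB.instance Definition _ := Monoid.isComLaw.Build isoclass (cls (rep1 k))
  cls_tensor cls_tensorA cls_tensorC cls_tensor1.

(* The free abelian group on isomorphism classes, with the tensor product. *)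
Definition free_rep := monring cls_tensor.
HB.instance Definition _ := GRing.ComNzRing.on free_rep.

Definition free_cls (V : rep k) : free_rep := mrX cls_tensor (cls V).

Inductive relation : free_rep -> Prop :=
| rel_exact V1 V V2 f g of @short_exact k V1 V V2 f g :
    relation (free_cls V1 - free_cls V + free_cls V2)
| rel_parity V : relation (free_cls V + free_cls (parity_change V))
| rel_zero : relation 0
| rel_sub x y of relation x & relation y : relation (x - y).

Definition relpred : {pred free_rep} := fun x => `[< relation x >].

Lemma rel_opp x : relation x -> relation (- x).
Proof. by rewrite -sub0r; apply: rel_sub; apply: rel_zero. Qed.

Lemma rel_add x y : relation x -> relation y -> relation (x + y).
Proof. by move=> rx ry; rewrite -[y]opprK; apply/rel_sub/rel_opp. Qed.

Lemma free_clsM V W : free_cls V * free_cls W = free_cls (tensor V W).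
Proof.
rewrite [LHS](mrXM cls_tensor); congr mrX; exact: cls_tensorE.
Qed.

Lemma rel_mul_cls x W : relation x -> relation (x * free_cls W).
Proof.
elim=> [V1 V V2 f g ex|V||y z _ ry _ rz].
- rewrite mulrDl mulrBl !free_clsM.
  exact: rel_exact (short_exact_tensor W ex).
- rewrite mulrDl !free_clsM.
  have -> : free_cls (tensor (parity_change V) W) =
            free_cls (parity_change (tensor V W)).
    by congr mrX; apply/clsP/iso_tensor_parity.
  exact: rel_parity.
- by rewrite mul0r; apply: rel_zero.
- by rewrite mulrBl; apply: rel_sub.
Qed.

Lemma rel_mulz x (c : int) : relation x -> relation (x *~ c).
Proof.
move=> rx; case: c => n.
  elim: n => [|n IHn]; first exact: rel_zero.
  by rewrite -pmulrn mulrS; apply: rel_add => //; rewrite pmulrn.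
rewrite NegzE mulrNz; apply: rel_opp.
elim: n.+1 => [|m IHm]; first exact: rel_zero.
by rewrite -pmulrn mulrS; apply: rel_add => //; rewrite pmulrn.
Qed.

Lemma free_repE (x : free_rep) :
  x = \sum_(a <- msupp x) free_cls (repr a) *~ mcoeff a x.
Proof.
rewrite [LHS]monalgE; apply: eq_bigr => a _.
rewrite /free_cls cls_repr /mrX.
rewrite -[LHS]/(mkmalgU a _) -{1}[mcoeff a x]intz.
exact: (raddfMz (mkmalgU a : {additive int -> {malg int[isoclass]}})).
Qed.

Lemma rel_mul x y : relation y -> relation (x * y).
Proof.
move=> ry; rewrite (free_repE x) mulr_suml.
elim/big_rec: _ => [|a z _ rz]; first exact: rel_zero.
apply: rel_add => //; rewrite mulrzAl mulrC.
exact/rel_mulz/rel_mul_cls.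
Qed.

(* The superdimension shows that the quotient ring is nonzero. *)
Definition free_sdim (x : free_rep) : k :=
  \sum_(a <- msupp x) sdim (repr a) *~ mcoeff a x.

Lemma free_sdimEw (d : {fset isoclass}) (x : free_rep) : (msupp x `<=` d)%fset ->
  free_sdim x = \sum_(a <- d) sdim (repr a) *~ mcoeff a x.
Proof.
move=> xd; apply: big_fset_incl => // a _ /mcoeff_outdom ->.
by rewrite mulr0z.
Qed.

Lemma free_sdimB x y : free_sdim (x - y) = free_sdim x - free_sdim y.
Proof.
rewrite (free_sdimEw (msuppB_le _ _)) (free_sdimEw (fsubsetUl _ (msupp y))).
rewrite (free_sdimEw (fsubsetUr (msupp x) _)) -sumrB; apply: eq_bigr => a _.
by rewrite -mulrzBr [mcoeff _ _]mcoeffB.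
Qed.

Lemma free_sdim_cls V : free_sdim (free_cls V) = sdim V.
Proof.
rewrite (free_sdimEw msuppU_le) big_seq_fset1 mcoeffUU.
exact/sdim_iso/repr_cls.
Qed.

Lemma rel_sdim x : relation x -> free_sdim x = 0.
Proof.
have s0 : free_sdim 0 = 0 by rewrite /free_sdim msupp0 big_seq_fset0.
have sD y z : free_sdim (y + z) = free_sdim y + free_sdim z.
  by rewrite -[z in LHS]opprK free_sdimB -[- z]sub0r free_sdimB s0 sub0r opprK.
elim=> [V1 V V2 f g ex|V||y z _ sy _ sz] //.
- by rewrite sD free_sdimB !free_sdim_cls (sdim_exact ex) opprD addNKr addNr.
- by rewrite sD !free_sdim_cls sdim_parity subrr.
- by rewrite free_sdimB sy sz subrr.
Qed.

Lemma relpred_idealr : idealr_closed relpred.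
Proof.
split.
- exact/asboolP/rel_zero.
- apply/negP => /asboolP /rel_sdim; rewrite -mrX1 -/(free_cls (rep1 k)).
  by rewrite free_sdim_cls sdim1 => /eqP; rewrite oner_eq0.
- move=> a x y /asboolP rx /asboolP ry; apply/asboolP.
  by apply: rel_add => //; apply: rel_mul.
Qed.

HB.instance Definition _ := isIdealr.Build free_rep relpred relpred_idealr.

Definition groth := {ideal_quot relpred}.
HB.instance Definition _ := GRing.ComNzRing.on groth.

Definition groth_cls (V : rep k) : groth := \pi_groth (free_cls V).

End IsoClasses.

(* The element diag(p, -p, q, -q) of h, on which ε takes the value p and δ the
   value q. *)
Definition hdiag (k : fieldType) (p q : k) : 'M[k]_(2 + 2) :=
  block_mx (diag_mx (\row_(i < 2) ((-1) ^+ i * p))) 0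
           0 (diag_mx (\row_(i < 2) ((-1) ^+ i * q))).

Definition weight_eval (k : fieldType) (b : P0) (p q : k) : k :=
  b.1%:~R * p + b.2%:~R * q.

(* H in h acts on V by H v = b(H) v if and only if
   (1 + e H) v = (1 + e b(H)) v for every even e of square zero. *)
Definition weight_vec (k : fieldType) (V : rep k) (b : P0)
    (v : 'cV[k]_(rep_dim V)) : Prop :=
  forall (A : superalg k) (e : A) (p q : k) (g : SL22 A),
    sa_hom false e -> e * e = 0 ->
    sl_mx g = 1%:M + e *: map_mx (in_alg A) (hdiag p q) ->
    act V g *m map_mx (in_alg A) v =
    (1 + e * (weight_eval b p q)%:A) *: map_mx (in_alg A) v.

Definition parity_vec (k : fieldType) (V : rep k) (s : bool)
    (v : 'cV[k]_(rep_dim V)) : Prop :=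
  forall i, v i 0 != 0 -> rep_par V i = s.

(* For S a subspace this is its dimension, as a maximal number of independent
   vectors. *)
Definition dim_of (k : fieldType) (n : nat) (S : 'cV[k]_n -> Prop) : nat :=
  \max_(d < n.+1 | `[< exists M : 'M[k]_(n, d),
                        \rank M = d /\ forall j, S (col j M) >]) d.

Definition weight_dim (k : fieldType) (V : rep k) (b : P0) (s : bool) : nat :=
  dim_of (fun v => @weight_vec k V b v /\ @parity_vec k V s v).

Definition is_supercharacter (k : fieldType) (V : rep k) (f : ZP0) : Prop :=
  forall b : P0,
    coef f b = (weight_dim V b false)%:Z - (weight_dim V b true)%:Z.

(* Main.v *)
(* A Laurent polynomial invariant under the sign changes satisfies the root
   condition at [ε - δ] iff, for every [s <> 0], the sums of [f(a, b)] and of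
   [a f(a, b)] over the string [a + b = s] vanish.  Such an [f] whose highest
   term is not constant has one at [(a, b)] with [a >= 2], so subtracting
   multiples of elements with leading weight [(a, b)] reduces it to a constant;
   with [(u - v)^2 u^(a-2) v^b] this gives the description of [J].

   The points of [SL(2,2)] in superalgebras with two square-zero generators make
   [sl(2,2)] act on a representation, and a subspace stable under this action is
   stable under the group: the one-parameter unipotent subgroups and the torus
   stabilize it, and polynomial identities in chart coordinates give the rest.  The
   torus acts diagonally.  On weights with [a + b = s <> 0] the odd root
   operators [X], [Y] of [±(ε - δ)] satisfy [X Y + Y X = c] with [c] a nonzero
   scalar, so the two supertraces along the string vanish and supercharacters lie
   in [J]; they are even since the scalars act trivially.

   A simple representation is determined up to parity by its highest weight, and
   a nonzero combination of simple classes has the leading term of one of them,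
   whence injectivity.  For surjectivity, a suitable vector of a tensor power of
   [V (x) V^*], [V] standard, is killed by the roots positive for two orderings;
   an odd reflection turns it into a highest weight vector whose
   subrepresentation has leading weight [(a, b)] for [a = 2] or [3], and tensor
   products give all even [(a, b)] with [a >= 2]. *)

Require Import Defs.
From HB Require Import structures.
From mathcomp Require Import all_boot all_order all_algebra.
From mathcomp Require Import boolp finmap monalg mxtens zify ring lra.
From mathcomp Require mpoly.

Set Implicit Arguments.
Unset Strict Implicit.
Unset Printing Implicit Defensive.

Import Order.TTheory GRing.Theory Num.Theory.
Local Open Scope ring_scope.

(** * The ring J *)

(** A representation is known only through expressions evaluated at points in all superalgebras, so
    each appeal to the Lie superalgebra or to density becomes a statement about such points. The
    delicate passage is from Lie stability to points whose entries may be nilpotent or zero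
    divisors. With an entry [c] of an SL(2) block as denominator, matrix entries times a power of
    [c] are polynomials; their vanishing is tested at [k]-points and then holds everywhere, and a
    second chart with denominator [d] removes the power, since the row (c, d) is unimodular.

    Representations are not semisimple, and the argument on supercharacters rests on leading terms.
    The height 2 a + b is chosen because it equals s + a on the string a + b = s, so that a top term
    with a = 0 or 1 would stand alone in a string sum. The values a = 2 and a = 3 come from the
    multiplicity two of ε - δ: changing the ordering crosses two root vectors and adds 2 ε - 2 δ,
    which moves the weights (0, 2m) and (1, 2m - 1) found in tensor powers to (2, 2m - 2) and (3, 2m
    - 3). *)

Section LinearExtension.
Variables (M : choiceType) (V : zmodType).
Implicit Types (w : M -> V) (f g : {malg int[M]}).

Definition linext w f : V := \sum_(b <- msupp f) w b *~ mcoeff b f.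

Lemma liftEw (d : {fset M}) w f : (msupp f `<=` d)%fset ->
  linext w f = \sum_(b <- d) w b *~ mcoeff b f.
Proof.
move=> fd; apply: big_fset_incl => // b _ /mcoeff_outdom ->.
by rewrite mulr0z.
Qed.

Lemma liftB w : {morph linext w : f g / f - g}.
Proof.
move=> f g; rewrite (liftEw w (msuppB_le _ _)) (liftEw w (fsubsetUl _ (msupp g))).
rewrite (liftEw w (fsubsetUr (msupp f) _)) -sumrB; apply: eq_bigr => b _.
by rewrite -mulrzBr mcoeffB.
Qed.

HB.instance Definition _ w :=
  GRing.isZmodMorphism.Build {malg int[M]} V (linext w) (liftB w).

Lemma liftU w b c : linext w << c *g b >> = w b *~ c.
Proof. by rewrite (liftEw w msuppU_le) big_seq_fset1 mcoeffUU. Qed.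

Lemma malg_sum f : f = \sum_(b <- msupp f) << b >> *~ mcoeff b f.
Proof.
rewrite [LHS]monalgE; apply: eq_bigr => b _.
rewrite -[mcoeff b f in LHS]intz.
exact: (raddfMz (mkmalgU b : {additive int -> {malg int[M]}})).
Qed.

Lemma lift_only w f b0 :
  (forall b, b != b0 -> mcoeff b f != 0 -> w b = 0) ->
  linext w f = w b0 *~ mcoeff b0 f.
Proof.
move=> H; rewrite (liftEw w (fsubsetUl (msupp f) [fset b0]%fset)).
rewrite (big_fsetD1 b0) /= ?inE ?eqxx ?orbT // big_seq big1 ?addr0 // => b.
rewrite !inE => /andP[nb _]; have [->|fb] := eqVneq (mcoeff b f) 0.
  by rewrite mulr0z.
by rewrite H // mul0rz.
Qed.

Lemma lift_eq0 w f : (forall b, mcoeff b f != 0 -> w b = 0) -> linext w f = 0.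
Proof.
move=> H; rewrite /linext big_seq big1 // => b; rewrite -mcoeff_neq0 => /H ->.
by rewrite mul0rz.
Qed.

End LinearExtension.

Lemma lift_comp (M : choiceType) (V W : zmodType) (h : {additive V -> W})
  (w : M -> V) f : h (linext w f) = linext (h \o w) f.
Proof. by rewrite raddf_sum; apply: eq_bigr => b _; rewrite raddfMz. Qed.

Lemma lift_ext (M : choiceType) (V : zmodType) (w w' : M -> V) f :
  (forall b, mcoeff b f != 0 -> w b = w' b) -> linext w f = linext w' f.
Proof.
move=> H; rewrite /linext big_seq [RHS]big_seq; apply: eq_bigr => b.
by rewrite -mcoeff_neq0 => /H ->.
Qed.

Lemma lift_subw (M : choiceType) (V : zmodType) (w w' : M -> V) f :
  linext (fun b => w b - w' b) f = linext w f - linext w' f.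
Proof. by rewrite -sumrB; apply: eq_bigr => b _; rewrite mulrzBl. Qed.

Lemma lift_mul (M : choiceType) (e : M) (op : Monoid.com_law e) (R : pzRingType)
    (w : M -> R) (f g : monring op) :
  (forall a b, w (op a b) = w a * w b) -> linext w (f * g) = linext w f * linext w g.
Proof.
move=> wM; rewrite {1}(malg_sum f) {1}(malg_sum g).
rewrite -[X in linext w X]/((\sum_(b <- msupp f) (mrX op b) *~ mcoeff b f) *
  (\sum_(b <- msupp g) (mrX op b) *~ mcoeff b g) : monring op).
rewrite mulr_suml (raddf_sum (linext w)) mulr_suml; apply: eq_bigr => a _.
rewrite mulr_sumr (raddf_sum (linext w)) mulr_sumr; apply: eq_bigr => b _.
rewrite !mulrzAl !mulrzAr mrXM (raddfMz (linext w)) (raddfMz (linext w)).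
rewrite -wM; congr (_ *~ _ *~ _); exact: liftU.
Qed.

(** * Coefficients, string sums and leading terms of Laurent polynomials *)

Section Weights.
Implicit Types f g : ZP0.

Lemma coefB_P0 f g b : coef (f - g) b = coef f b - coef g b.
Proof. exact: mcoeffB. Qed.
Lemma coefD_P0 f g b : coef (f + g) b = coef f b + coef g b.
Proof. exact: mcoeffD. Qed.
Lemma coefN_P0 f b : coef (- f) b = - coef f b.
Proof. exact: mcoeffN. Qed.
Lemma coef0_P0 b : coef 0 b = 0.
Proof. exact: mcoeff0. Qed.
Lemma coefMz f b n : coef (f *~ n) b = coef f b *~ n.
Proof. exact: (raddfMz (mcoeff b)). Qed.
Lemma coef_expw b c : coef (expw b) c = (b == c)%:R.
Proof. by rewrite /coef /expw mcoeffU. Qed.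
Lemma coef1_P0 b : coef 1 b = (b == 0)%:R.
Proof. by rewrite eq_sym; exact: (coef_expw 0). Qed.

Lemma coef_sum_P0 (I : Type) (r : seq I) (F : I -> ZP0) b :
  coef (\sum_(i <- r) F i) b = \sum_(i <- r) coef (F i) b.
Proof. exact: (big_morph (coef^~ b) (fun f g => coefD_P0 f g b) (coef0_P0 b)). Qed.

Lemma ZP0_sum f : f = \sum_(b <- msupp f) expw b *~ coef f b.
Proof. exact: malg_sum. Qed.

Lemma ZP0P f g : (forall b, coef f b = coef g b) -> f = g.
Proof. by move=> H; apply/malgP. Qed.

(* Locked: conversion must not unfold the products of [ZP0]. *)
Definition xw (p q : int) : ZP0 := locked (expw (p, q)).

Lemma xwE p q : expw (p, q) = xw p q. Proof. by rewrite /xw -lock. Qed.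

Definition cf f (a b : int) : int := coef f (a, b).

Lemma cfE f a b : coef f (a, b) = cf f a b. Proof. by []. Qed.

Lemma cf_xw p q a b : cf (xw p q) a b = ((p == a) && (q == b))%:R.
Proof. by rewrite -xwE; exact: coef_expw. Qed.

Lemma xwM (a b c d : int) : xw a b * xw c d = xw (a + c) (b + d).
Proof. by rewrite -!xwE; exact: mrXM. Qed.

Lemma xw0 : xw 0 0 = 1.
Proof. by rewrite -xwE. Qed.

Lemma uvarE : uvar = xw 1 0 + xw (-1) 0. Proof. by rewrite -!xwE. Qed.
Lemma vvarE : vvar = xw 0 1 + xw 0 (-1). Proof. by rewrite -!xwE. Qed.

Lemma cfD f g a b : cf (f + g) a b = cf f a b + cf g a b.
Proof. exact: coefD_P0. Qed.

Lemma xw_sum f : f = \sum_(b <- msupp f) xw b.1 b.2 *~ coef f b.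
Proof. by rewrite {1}(ZP0_sum f); apply: eq_bigr => -[a b] _; rewrite -xwE. Qed.

Lemma cf_sum (I : Type) (r : seq I) (F : I -> ZP0) a b :
  cf (\sum_(i <- r) F i) a b = \sum_(i <- r) cf (F i) a b.
Proof. exact: coef_sum_P0. Qed.

Lemma cfMz f a b n : cf (f *~ n) a b = cf f a b *~ n.
Proof. exact: coefMz. Qed.

Lemma cf_mulX f (p q a b : int) : cf (f * xw p q) a b = cf f (a - p) (b - q).
Proof.
rewrite {1}(xw_sum f) mulr_suml cf_sum [in RHS](xw_sum f) cf_sum.
apply: eq_bigr => -[c d] _; rewrite mulrzAl xwM.
apply: etrans (cfMz _ _ _ _) _; apply: etrans _ (esym (cfMz _ _ _ _)).
apply: (congr1 (fun z : int => z *~ _)); apply: etrans (cf_xw _ _ _ _) _.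
by apply: etrans _ (esym (cf_xw _ _ _ _)); congr (nat_of_bool _)%:R; lia.
Qed.

Lemma cf_mulu f a b : cf (f * uvar) a b = cf f (a - 1) b + cf f (a + 1) b.
Proof.
rewrite uvarE mulrDr; apply: etrans (cfD _ _ _ _) _.
by congr (_ + _); apply: etrans (cf_mulX _ _ _ _ _) _; congr (cf f _ _); lia.
Qed.

Lemma cf_mulv f a b : cf (f * vvar) a b = cf f a (b - 1) + cf f a (b + 1).
Proof.
rewrite vvarE mulrDr; apply: etrans (cfD _ _ _ _) _.
by congr (_ + _); apply: etrans (cf_mulX _ _ _ _ _) _; congr (cf f _ _); lia.
Qed.

(** [W0_invariant] in terms of [cf]. The two are convertible, so that one passes freely between them
    and the lemmas on [cf] can rewrite. *)
Definition W0i f := forall a b, cf f (- a) b = cf f a b /\ cf f a (- b) = cf f a b.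

Lemma W0_mulu f : W0_invariant f -> W0_invariant (f * uvar).
Proof.
move=> H; suff: W0i (f * uvar) by [].
have {H} H : W0i f by [].
move=> a b; rewrite !cf_mulu; split; last by rewrite !(H _ b).2.
rewrite -opprD -(opprB 1 a) addrC.
have -> : - a + 1 = - (a - 1) by lia.
by rewrite !(H _ b).1 -(H (1 - a) b).1 opprB.
Qed.

Lemma W0_mulv f : W0_invariant f -> W0_invariant (f * vvar).
Proof.
move=> H; suff: W0i (f * vvar) by [].
have {H} H : W0i f by [].
move=> a b; rewrite !cf_mulv; split; first by rewrite !(H a _).1.
have -> : - b - 1 = - (b + 1) by lia.
have -> : - b + 1 = - (b - 1) by lia.
by rewrite !(H a _).2 addrC.
Qed.

Lemma W0_sub f g : W0_invariant f -> W0_invariant g -> W0_invariant (f - g).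
Proof. by move=> H K a b; rewrite !coefB_P0 !(H _ _).1 !(H _ _).2 !(K _ _).1 !(K _ _).2. Qed.

Lemma W0_one : W0_invariant 1.
Proof. by move=> a b; rewrite !coef1_P0 !xpair_eqE !oppr_eq0. Qed.

Lemma W0_mulz f n : W0_invariant f -> W0_invariant (f *~ n).
Proof. by move=> H a b; rewrite !coefMz !(H _ _).1 !(H _ _).2. Qed.

(* The string sums below, along the root [ε - δ], are what the root condition
   amounts to: [f] restricted to the strings of nonzero pairing is divisible by
   the square of [e^α - 1]. *)
Definition strS (s : int) f : int := linext (fun b => (b.1 + b.2 == s)%:R) f.
Definition strT (s : int) f : int := linext (fun b => b.1 * (b.1 + b.2 == s)%:R) f.

Definition Jstr f := W0_invariant f /\
  forall s, s != 0 -> strS s f = 0 /\ strT s f = 0.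

Lemma Jstr_sub f g : Jstr f -> Jstr g -> Jstr (f - g).
Proof.
move=> [f0 fs] [g0 gs]; split=> [|s s0]; first exact: W0_sub.
by rewrite /strS /strT !raddfB /= -!/(strS _ _) -!/(strT _ _)
  !(fs s s0).1 !(fs s s0).2 !(gs s s0).1 !(gs s s0).2 !subrr.
Qed.

Definition height (c : int * int) (b : P0) : int := c.1 * b.1 + c.2 * b.2.
Local Notation phi := (height (2, 1)).

(** On the string a + b = s the height is s + a. If the top term had a = 0 with b nonzero, or a = 1,
    the other terms counted along its string would be higher, after a sign change of their first
    coordinate if necessary. It would thus be alone in [strS] when a = 0, and in [strT] when a = 1,
    where the factor a discards the term (0, s); its coefficient would vanish. *)
Lemma top_layer f (a b : int) : Jstr f -> coef f (a, b) != 0 ->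
  (forall c, coef f c != 0 -> phi c <= phi (a, b)) ->
  (a == 0) && (b == 0) || (2 <= a) && (0 <= b).
Proof.
rewrite /height /=; move=> [f0 fs] fab top.
have a0 : 0 <= a.
  have := top (- a, b); rewrite (f0 _ _).1 => /(_ fab) /=; lia.
have b0 : 0 <= b.
  have := top (a, - b); rewrite (f0 _ _).2 => /(_ fab) /=; lia.
have [//|a2] := boolP (2 <= a); first by rewrite b0 /= orbT.
rewrite orbF; apply/andP; case: (altP (a =P 0)) => [az|an].
  split=> //; apply/negP => /negP bn.
  have [S0 _] := fs b bn.
  move: S0 fab; rewrite /strS az (@lift_only _ _ _ _ (0, b)) /=.
    rewrite add0r eqxx => E /eqP []; exact: etrans (esym (intz _)) E.
  move=> [c d] ne fcd /=; case: eqP => // sb; move: ne; rewrite xpair_eqE => ne.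
  have /= := top _ fcd; have := top (- c, d); rewrite [coef _ _](f0 _ _).1 => /(_ fcd) /=; lia.
have {}az : a = 1 by lia.
have bn : b + 1 != 0 by lia.
have [_ T0] := fs _ bn; move: T0 fab; rewrite /strT az (@lift_only _ _ _ _ (1, b)) /=.
  rewrite mul1r addrC eqxx => E /eqP []; exact: etrans (esym (intz _)) E.
move=> [c d] ne fcd /=; case: eqP => [sb|_]; last by rewrite mulr0.
move: ne; rewrite xpair_eqE => ne.
have /= := top _ fcd; have := top (- c, d); rewrite [coef _ _](f0 _ _).1 => /(_ fcd) /=; lia.
Qed.

Definition is_lead (c : int * int) (b : P0) g :=
  (coef g b == 1) || (coef g b == -1) /\
  forall d, d != b -> coef g d != 0 -> height c d < height c b.

(** Descent on the height: [top_layer] restricts the weights of the top layer to those for which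
    elements are provided, and subtracting these lowers the height. The predicate [P] on supports
    lets the same descent run over all weights or over weights of even parity. *)
Lemma Jstr_ind (P : P0 -> Prop) (Q : ZP0 -> Prop) :
  (forall f g, Q f -> Q g -> Q (f - g)) -> Q 1 ->
  (forall a b : int, 2 <= a -> 0 <= b -> P (a, b) -> exists g,
     [/\ Jstr g, Q g, is_lead (2, 1) (a, b) g &
         forall c, coef g c != 0 -> P c]) ->
  forall f, Jstr f -> (forall c, coef f c != 0 -> P c) -> Q f.
Proof.
move=> QB Q1 QX.
have Q0 : Q 0 by rewrite -(subrr 1); apply: QB.
have QN g : Q g -> Q (- g) by move=> Qg; rewrite -sub0r; apply: QB.
have QD g h : Q g -> Q h -> Q (g + h).
  by move=> Qg Qh; rewrite -[h]opprK; apply/QB/QN.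
have Qn g n : Q g -> Q (g *+ n).
  by move=> Qg; elim: n => [|n IHn]; rewrite ?mulr0n // mulrS; apply: QD.
have Qz g z : Q g -> Q (g *~ z).
  by move=> Qg; case: z => n; [|rewrite NegzE mulrNz; apply: QN]; apply: Qn.
pose R g := [/\ Jstr g, Q g & forall c, coef g c != 0 -> P c].
have RQ g : R g -> Q g by case.
have RB g h : R g -> R h -> R (g - h).
  move=> [? ? Pg] [? ? Ph]; split; [exact: Jstr_sub|exact: QB|] => c.
  rewrite coefB_P0; have [/eqP->|/Pg//] := boolP (coef g c == 0).
  by rewrite sub0r oppr_eq0 => /Ph.
(* The weight (0, 0) is served by the constant 1, and the leading coefficient is normalized from a
   sign to 1. *)
have {}QX a b : P (a, b) -> (a == 0) && (b == 0) || (2 <= a) && (0 <= b) ->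
    exists g, [/\ R g, coef g (a, b) = 1 &
      forall d, d != (a, b) -> coef g d != 0 -> phi d < phi (a, b)].
  move=> Pab /orP[/andP[/eqP a0 /eqP b0]|/andP[a2 b0]].
    have E0 : (0 : P0) = (a, b) by rewrite a0 b0.
    exists 1; split; [|by rewrite coef1_P0 -E0 eqxx|]; last first.
      by move=> d dn; rewrite coef1_P0 E0 (negPf dn) eqxx.
    split=> //; last by move=> c; rewrite coef1_P0 E0; have [->//|_] := eqVneq c (a, b); rewrite eqxx.
    split=> [|s s0]; first exact: W0_one.
    split; apply: lift_eq0 => d; rewrite -/(coef _ _) coef1_P0;
      have [-> _ /=|_] := eqVneq d 0; rewrite ?eqxx ?mul0r //.
    by rewrite addr0 eq_sym (negPf s0).
  have [g [Jg Qg [lg ld] Pg]] := QX a b a2 b0 Pab.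
  have R0 : R 0.
    split=> //; last by move=> c; rewrite coef0_P0 eqxx.
    by rewrite -(subrr g); apply: Jstr_sub.
  have Rg : R g by [].
  case/orP: lg => /eqP lg; first by exists g.
  exists (- g); split; rewrite ?coefN_P0 ?lg ?opprK //; first by rewrite -sub0r; apply: RB.
  by move=> d dn; rewrite coefN_P0 oppr_eq0; apply: ld.
move=> f Jf Pf.
have nb : exists n : nat, forall c, coef f c != 0 -> phi c < n%:Z.
  exists (\sum_(c <- msupp f) `|phi c|.+1)%N => c.
  rewrite mcoeff_neq0 => cf.
  rewrite (big_fsetD1 c) //=; lia.
case: nb => n nb; elim: n f Jf Pf nb => [|n IHn] f Jf Pf nb.
  (* All heights are negative, while the support is stable under negation. *)
  have -> : f = 0; last by [].
  apply: ZP0P => -[a b]; rewrite coef0_P0; apply/eqP/negPn/negP => fab.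
  have := nb _ fab; rewrite /height /=.
  have Fa := (Jf.1 a b).1; have Fb := (Jf.1 a b).2; have Fab := (Jf.1 a (- b)).1.
  have := nb (-a, b); rewrite Fa => /(_ fab); rewrite /height /=.
  have := nb (a, -b); rewrite Fb => /(_ fab); rewrite /height /=.
  have := nb (-a, -b); rewrite Fab Fb => /(_ fab); rewrite /height /=.
  lia.
have H c : exists g, coef f c != 0 -> phi c = n%:Z ->
    [/\ R g, coef g c = 1 &
        forall d, d != c -> coef g d != 0 -> phi d < phi c].
  have [fc|fc] := boolP (coef f c == 0); first by exists 0.
  have [cn|cn] := eqVneq (phi c) n%:Z; last by exists 0 => _ E; rewrite E eqxx in cn.
  case: c fc cn => a b fc cn.
  have [|g Hg] := QX a b (Pf _ fc); last by exists g.
  apply: (top_layer Jf fc) => d /nb; rewrite cn; lia.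
have [h hP] := choice H.
(* The whole layer of height [n] is removed at once, by combining the chosen elements with the
   coefficients of [f]. *)
pose hh c := if (coef f c != 0) && (phi c == n%:Z) then h c else 0.
pose g := linext hh f.
have Rz x z : R x -> R (x *~ z).
  move=> Rx.
  have R0 : R 0 by rewrite -(subrr x); apply: RB.
  have RN y : R y -> R (- y) by move=> Ry; rewrite -sub0r; apply: RB.
  have Rn m : R (x *+ m).
    by elim: m => [|m IHm]; rewrite ?mulr0n // mulrS -[x *+ m]opprK; apply/RB/RN.
  by case: z => m; [|rewrite NegzE mulrNz; apply: RN]; apply: Rn.
have [/eqP f0|f0] := boolP (f == 0); first by rewrite f0.
have hhR c : coef f c != 0 -> R (hh c) \/ hh c = 0.
  move=> fc; rewrite /hh fc /=; case: eqP => [cn|_]; last by right.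
  by left; have [] := hP c fc cn.
have gR : R g \/ g = 0.
  rewrite /g /linext; elim/big_rec: _ => [|c y _ Hy]; first by right.
  have [->|fc] := eqVneq (mcoeff c f) 0; first by rewrite mulr0z add0r.
  case: (hhR c fc) => [Rc|->]; last by rewrite mul0rz add0r.
  left; case: Hy => [Ry|->]; last by rewrite addr0; apply: Rz.
  have RN z : R z -> R (- z).
    move=> Rz'; rewrite -sub0r; apply: (RB) => //.
    by rewrite -(subrr z); apply: (RB).
  by rewrite -[y]opprK; apply: (RB); [apply: (Rz)|apply: (RN)].
rewrite -[f](subrK g); apply: QD; last by case: gR => [/RQ|->].
have coefg d : phi d >= n%:Z -> coef g d = coef f d.
  move=> dn; rewrite /g /coef (lift_comp (mcoeff d)) (@lift_only _ _ _ _ d) /=.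
    rewrite /hh -/(coef f d); have [->|fd] := eqVneq (coef f d) 0; first by rewrite mulr0z.
    have dn' : phi d = n%:Z by have := nb d fd; lia.
    rewrite dn' eqxx /=; have [_ e1 _] := hP d fd dn'.
    by rewrite -/(coef _ _) e1 intz.
  move=> b bd fb; rewrite /hh; case: ifP => [|_]; last exact: mcoeff0.
  case/andP => fb' /eqP bn; have [_ _ ld] := hP b fb' bn.
  by apply/eqP/negPn/negP => /(ld d); rewrite eq_sym => /(_ bd); lia.
have Pg c : coef g c != 0 -> P c.
  by case: gR => [[_ _ Pg] /Pg//|->]; rewrite coef0_P0 eqxx.
apply: IHn.
- by case: gR => [[Jg _ _]|->]; [apply: Jstr_sub|rewrite subr0].
- move=> c; rewrite coefB_P0.
  have [->|/Pf//] := eqVneq (coef f c) 0.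
  by rewrite sub0r oppr_eq0; apply: Pg.
move=> c; have [cn|//] := leP n%:Z (phi c).
by rewrite coefB_P0 coefg // subrr eqxx.
Qed.

Local Notation form := Defs.form.

Lemma lift_mulX (V : zmodType) (w : P0 -> V) f (p q : int) :
  linext w (f * xw p q) = linext (fun b => w (b.1 + p, b.2 + q)) f.
Proof.
rewrite {1}(xw_sum f) mulr_suml (raddf_sum (linext w)).
apply: eq_bigr => b _; rewrite mulrzAl xwM.
apply: etrans (raddfMz (linext w) _ _) _; congr (_ *~ _).
by rewrite -xwE; apply: etrans (liftU _ _ _) _.
Qed.

Lemma cf_mul g h a b : cf (g * h) a b =
  \sum_(c <- msupp g) cf h (a - c.1) (b - c.2) *~ coef g c.
Proof.
rewrite {1}(xw_sum g) mulr_suml cf_sum; apply: eq_bigr => c _.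
rewrite mulrzAl mulrC; apply: etrans (cfMz _ _ _ _) _.
exact: (congr1 (fun z : int => z *~ _) (cf_mulX _ _ _ _ _)).
Qed.

Lemma heightD c (a b p q : int) :
  height c (a + p, b + q) = height c (a, b) + height c (p, q).
Proof. by rewrite /height /= !mulrDr addrACA. Qed.

Lemma is_leadM c (a b p q : int) g h :
  is_lead c (a, b) g -> is_lead c (p, q) h -> is_lead c (a + p, b + q) (g * h).
Proof.
move=> [lg dg] [lh dh].
have gc d : coef g d != 0 -> d = (a, b) \/ height c d < height c (a, b).
  by move=> gd; have [->|/dg/(_ gd)] := eqVneq d (a, b); [left|right].
have hc d : coef h d != 0 -> d = (p, q) \/ height c d < height c (p, q).
  by move=> gd; have [->|/dh/(_ gd)] := eqVneq d (p, q); [left|right].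
split; last first.
  move=> [x y] xy; apply: contra_neqT; rewrite -leNgt => le; rewrite cfE cf_mul big_seq big1 //.
  move=> [d1 d2]; rewrite -mcoeff_neq0 => gd /=.
  apply/eqP; rewrite mulrz_eq0; apply/orP; right; apply/negPn/negP => hd.
  move: le; have -> : height c (x, y) = height c (d1, d2) + height c (x - d1, y - d2).
    by rewrite -heightD !subrKC.
  rewrite heightD; case: (gc _ gd) => [E|lt1]; case: (hc _ hd) => [E'|lt2].
  - case: E E' => -> -> [] E1 E2; case/eqP: xy; congr (_, _); lia.
  - by rewrite E lerD2l leNgt lt2.
  - by rewrite E' lerD2r leNgt lt1.
  - by rewrite leNgt ltrD.
suff -> : coef (g * h) (a + p, b + q) = coef g (a, b) * coef h (p, q).
  by case/orP: lg => /eqP ->; case/orP: lh => /eqP ->.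
have g0 : (a, b) \in msupp g by rewrite -mcoeff_neq0; case/orP: lg => /eqP; rewrite /coef => ->.
rewrite cfE cf_mul (big_fsetD1 (a, b)) //= big_seq big1 ?addr0.
  have -> : a + p - a = p by lia.
  have -> : b + q - b = q by lia.
  by rewrite mulrC mulrzz.
move=> [d1 d2]; rewrite !inE -mcoeff_neq0 => /andP[dn gd] /=.
have lt := dg _ dn gd.
apply/eqP; rewrite mulrz_eq0; apply/orP; right; apply/negPn/negP => hd.
have E : height c (a + p, b + q) =
    height c (d1, d2) + height c (a + p - d1, b + q - d2).
  by rewrite -heightD !subrKC.
suff : height c (a + p, b + q) != height c (a + p, b + q) by rewrite eqxx.
rewrite {1}E (heightD c a b p q) neq_lt.
by case: (hc _ hd) => [->|lt2]; rewrite ?ltrD2r ?lt // ltrD.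
Qed.

Lemma lift_Dder (V : zmodType) (w : P0 -> V) a f :
  linext w (Dder a f) = linext (fun b => w b *~ form a b) f.
Proof.
rewrite /Dder (raddf_sum (linext w)); apply: eq_bigr => b _.
exact: etrans (liftU _ _ _) (mulrzA _ _ _).
Qed.

Lemma Dder_lift a f : Dder a f = linext (fun b => expw b *~ form a b) f.
Proof.
rewrite {1}(malg_sum (Dder a f)).
transitivity (linext expw (Dder a f)); first by apply: eq_bigr.
exact: lift_Dder.
Qed.

Lemma lift_mulX1 (V : zmodType) (w : P0 -> V) f p q :
  linext w (f * (xw p q - 1)) = linext (fun b => w (b.1 + p, b.2 + q) - w b) f.
Proof.
rewrite mulrBr mulr1; apply: etrans (liftB _ _ _) _.
by apply: etrans (congr1 (fun x => x - _) (lift_mulX _ _ _ _)) _; rewrite lift_subw.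
Qed.

(** Multiplication by e^(ε-δ) - 1 is a finite difference along each string: it kills the sum and, by
    summation by parts, turns the first moment into the sum. *)
Lemma strS_mul s f : strS s (f * (xw 1 (-1) - 1)) = 0.
Proof.
apply: etrans (lift_mulX1 _ _ _ _) _; apply: lift_eq0 => -[a b] _ /=.
have -> : (a + 1 + (b + - 1) == s) = (a + b == s) by lia.
by rewrite subrr.
Qed.

Lemma strT_mul s f : strT s (f * (xw 1 (-1) - 1)) = strS s f.
Proof.
apply: etrans (lift_mulX1 _ _ _ _) _; apply: lift_ext => -[a b] _ /=.
have -> : (a + 1 + (b + - 1) == s) = (a + b == s) by lia.
by case: eqP; lia.
Qed.

Lemma lift_mulr (w : P0 -> int) f s : linext (fun b => w b * s) f = linext w f * s.
Proof. by rewrite mulr_suml; apply: eq_bigr => b _; rewrite mulrzAl. Qed.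

(** On the string a + b = s the derivation attached to ε - δ is multiplication by s, and a multiple
    of the square of e^(ε-δ) - 1 has vanishing sum and first moment; it remains to divide by s. The
    converse [inJP] goes through the explicit form of the elements. *)
Lemma inJ_Jstr f : inJ f -> Jstr f.
Proof.
move=> [f0 fD]; split=> // s s0.
have [|h] := fD (1, -1); first by rewrite !inE eqxx orbT.
rewrite expr2 mulrA xwE => E.
have FS w : linext (fun b => w b * (b.1 + b.2 == s)%:R) (Dder (1, -1) f) =
            linext (fun b => w b * (b.1 + b.2 == s)%:R) f * s.
  rewrite lift_Dder -lift_mulr; apply: lift_ext => -[a b] _ /=.
  rewrite /form /= -mulrzr intz; case: eqP => [<-|_]; last by rewrite mulr0 !mul0r.
  by rewrite mul1r mulN1r opprK.
have SE g : strS s g = linext (fun b => 1 * (b.1 + b.2 == s)%:R) g.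
  by apply: lift_ext => b _; rewrite mul1r.
split; apply/eqP; rewrite -(inj_eq (mulIf s0)) mul0r ?SE /strT -FS E.
  by rewrite -SE strS_mul.
by apply/eqP; apply: etrans (strT_mul _ _) _; rewrite strS_mul.
Qed.

Lemma monomial_ind (R : comNzRingType) (Q : R -> Prop) (x y : R) m n : Q 1 ->
  (forall z, Q z -> Q (z * x)) -> (forall z, Q z -> Q (z * y)) ->
  Q (x ^+ m * y ^+ n).
Proof.
move=> Q1 Qx Qy; elim: n => [|n IHn]; last by rewrite exprSr mulrA; apply: Qy.
by rewrite mulr1; elim: m => [//|m IHm]; rewrite exprSr; apply: Qx.
Qed.

Lemma W0_ind (Q : ZP0 -> Prop) :
  (forall f g, Q f -> Q g -> Q (f - g)) -> Q 1 ->
  (forall f, Q f -> Q (f * uvar)) -> (forall f, Q f -> Q (f * vvar)) ->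
  forall p, Q (evalUV p).
Proof.
move=> QB Q1 Qu Qv p.
have Q0 : Q 0 by rewrite -(subrr 1); apply: (QB).
have QN g : Q g -> Q (- g) by move=> Qg; rewrite -sub0r; apply: (QB).
have QD g h : Q g -> Q h -> Q (g + h).
  by move=> Qg Qh; rewrite -[h]opprK; apply/(QB)/QN.
have Qz g z : Q g -> Q (g *~ z).
  have Qn n : Q g -> Q (g *+ n).
    by move=> Qg; elim: n => [|n IHn]; rewrite ?mulr0n // mulrS; apply: QD.
  by move=> Qg; case: z => n; [|rewrite NegzE mulrNz; apply: QN]; apply: Qn.
rewrite /evalUV /mpoly.mmap; elim/big_rec: _ => // m y _ Qy; apply: (QD) => //.
rewrite mulrzl; apply: Qz; rewrite /mpoly.mmap1 big_ord_recl big_ord1 /=.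
exact: (@monomial_ind ZP0 Q uvar vvar _ _ Q1 Qu Qv).
Qed.

Lemma W0_evalUV p : W0_invariant (evalUV p).
Proof. by apply: W0_ind; [exact: W0_sub|exact: W0_one|exact: W0_mulu|exact: W0_mulv]. Qed.

Lemma ZP0_additive_ext (F G : ZP0 -> ZP0) :
  {morph F : x y / x - y} -> {morph G : x y / x - y} ->
  (forall p q, F (xw p q) = G (xw p q)) -> F =1 G.
Proof.
move=> FB GB FG f.
have FS (H : ZP0 -> ZP0) : {morph H : x y / x - y} ->
    H f = \sum_(b <- msupp f) H (xw b.1 b.2) *~ coef f b.
  move=> HB; pose hm := GRing.isZmodMorphism.Build ZP0 ZP0 H HB.
  pose H' : {additive ZP0 -> ZP0} := HB.pack H hm.
  rewrite -[LHS]/(H' f) {1}(xw_sum f) raddf_sum; apply: eq_bigr => b _.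
  by rewrite raddfMz.
apply: etrans (FS F FB) (etrans _ (esym (FS G GB))).
by apply: eq_bigr => b _; rewrite FG.
Qed.

Lemma Dder_xw a p q : Dder a (xw p q) = xw p q *~ form a (p, q).
Proof. by rewrite -xwE Dder_lift; exact: liftU. Qed.

Lemma Dder_sub a : {morph Dder a : f g / f - g}.
Proof. by move=> f g; rewrite !Dder_lift; exact: liftB. Qed.

Lemma Dder_mul a f g : Dder a (f * g) = Dder a f * g + f * Dder a g.
Proof.
move: f; apply: ZP0_additive_ext => [f h|f h|p q].
- by rewrite mulrBl Dder_sub.
- by rewrite Dder_sub !mulrBl opprD addrACA.
move: g; apply: ZP0_additive_ext => [f h|f h|c d].
- by rewrite mulrBr Dder_sub.
- by rewrite Dder_sub !mulrBr opprD addrACA.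
rewrite xwM; apply: etrans (Dder_xw _ _ _) _.
apply: etrans _ (esym (congr2 (fun x y => x * _ + _ * y) (Dder_xw a p q) (Dder_xw a c d))).
rewrite mulrzAl mulrzAr xwM; apply: etrans _ (mulrzDr _ _ _).
apply: (congr1 (fun n => _ *~ n)); rewrite /form /=; lia.
Qed.

(** This identity and the next three are stated over an arbitrary ring, so that [ring] does not meet
    the concrete product of [ZP0]. *)
Lemma ring_uv (R : comNzRingType) (a b c d x : R) :
  a * x = c -> b * x = d -> c + b - (d + a) = (a - b) * (x - 1).
Proof. by move=> <- <-; ring. Qed.

Lemma ring_Duv (R : comNzRingType) (a b c d x : R) :
  a * x = c -> b * x = d -> c - b - (- d + a) = (b + a) * (x - 1).
Proof. by move=> <- <-; ring. Qed.

Lemma ring_comb (R : comNzRingType) (c c' u x y : R) :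
  c + u * x - (c' + u * y) = c - c' + u * (x - y).
Proof. by ring. Qed.

Lemma ring_Dsquare (R : comNzRingType) (g g' h d x : R) :
  0 + ((g' * x * (g * x) + g * x * (g' * x)) * h + g * x * (g * x) * d) =
  (g * g' * h *+ 2 + g ^+ 2 * d) * x ^+ 2.
Proof. by ring. Qed.

Lemma uvarE_sign s : s \in [:: 1; -1] -> uvar = xw s 0 + xw (- s) 0.
Proof.
rewrite !inE uvarE => /orP[]/eqP->; [by []|rewrite opprK; exact: addrC].
Qed.

Lemma vvarE_sign s : s \in [:: 1; -1] -> vvar = xw 0 s + xw 0 (- s).
Proof.
rewrite !inE vvarE => /orP[]/eqP->; [by []|rewrite opprK; exact: addrC].
Qed.

(** The quotient is y^-t - x^-s: times x^s y^t it becomes x^s - y^t, which supplies the other half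
    of u - v. *)
Lemma uv_root s t : s \in [:: 1; -1] -> t \in [:: 1; -1] ->
  exists h, uvar - vvar = h * (xw s t - 1).
Proof.
move=> hs ht; rewrite (uvarE_sign hs) (vvarE_sign ht).
exists (xw 0 (- t) - xw (- s) 0).
have E1 : xw 0 (- t) * xw s t = xw s 0 by rewrite xwM; apply: (congr2 xw); lia.
have E2 : xw (- s) 0 * xw s t = xw 0 t by rewrite xwM; apply: (congr2 xw); lia.
exact: ring_uv E1 E2.
Qed.

Lemma uv_root_D s t : s \in [:: 1; -1] -> t \in [:: 1; -1] ->
  exists h, Dder (s, t) (uvar - vvar) = h * (xw s t - 1).
Proof.
move=> hs ht; rewrite (uvarE_sign hs) (vvarE_sign ht).
have DD f g : Dder (s, t) (f + g) = Dder (s, t) f + Dder (s, t) g.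
  by rewrite !Dder_lift; exact: (raddfD (linext _)).
have ss : s * s = 1 by move: hs; rewrite !inE => /orP[]/eqP->.
have tt : t * t = 1 by move: ht; rewrite !inE => /orP[]/eqP->.
have F p q n : s * p - t * q = n -> Dder (s, t) (xw p q) = xw p q *~ n.
  by move=> <-; exact: Dder_xw.
have F1 : Dder (s, t) (xw s 0) = xw s 0 by apply: (F _ _ 1); lia.
have F2 : Dder (s, t) (xw (- s) 0) = - xw (- s) 0.
  by apply: etrans (F _ _ (-1) _) (mulrN1z _); lia.
have F3 : Dder (s, t) (xw 0 t) = - xw 0 t.
  by apply: etrans (F _ _ (-1) _) (mulrN1z _); lia.
have F4 : Dder (s, t) (xw 0 (- t)) = xw 0 (- t) by apply: (F _ _ 1); lia.
exists (xw (- s) 0 + xw 0 (- t)).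
apply: etrans (Dder_sub _ _ _) _.
have D1 : Dder (s, t) (xw s 0 + xw (- s) 0) = xw s 0 - xw (- s) 0.
  exact: etrans (DD _ _) (congr2 (fun x y : ZP0 => x + y) F1 F2).
have D2 : Dder (s, t) (xw 0 t + xw 0 (- t)) = - xw 0 t + xw 0 (- t).
  exact: etrans (DD _ _) (congr2 (fun x y : ZP0 => x + y) F3 F4).
apply: etrans (congr2 (fun x y : ZP0 => x - y) D1 D2) _.
have E1 : xw 0 (- t) * xw s t = xw s 0 by rewrite xwM; apply: (congr2 xw); lia.
have E2 : xw (- s) 0 * xw s t = xw 0 t by rewrite xwM; apply: (congr2 xw); lia.
exact: ring_Duv E1 E2.
Qed.

(** By Leibniz the derivative is 2 (u - v) D(u - v) h + (u - v)^2 D(h), and e^α - 1 divides both u -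
    v and D(u - v) for each of the four roots. *)
Lemma inJ_gen c h : W0_invariant h -> inJ (c%:~R + (uvar - vvar) ^+ 2 * h).
Proof.
move=> h0.
have WD f g : W0_invariant f -> W0_invariant g -> W0_invariant (f + g).
  by move=> Hf Hg a b; rewrite !coefD_P0 !(Hf _ _).1 !(Hf _ _).2 !(Hg _ _).1 !(Hg _ _).2.
split.
  apply: WD; first exact/W0_mulz/W0_one.
  have M f : W0_invariant f -> W0_invariant ((uvar - vvar) * f).
    by move=> f0; rewrite mulrC mulrBr; apply: W0_sub; [apply: W0_mulu|apply: W0_mulv].
  by rewrite expr2 -mulrA; apply/M/M.
move=> [s t] st.
have [hs ht] : s \in [:: 1; -1] /\ t \in [:: 1; -1].
  by move: st; rewrite !inE !xpair_eqE; do 4?[case/orP]; case/andP => /eqP-> /eqP->.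
have [g gE] := uv_root hs ht; have [g' gE'] := uv_root_D hs ht.
have Dc : Dder (s, t) (c%:~R) = 0.
  rewrite Dder_lift; apply: etrans (raddfMz (linext _) _ _) _.
  suff E : linext (fun b => expw b *~ form (s, t) b) (1 : ZP0) = 0.
    by apply: etrans (congr1 (fun x => x *~ c) E) (mul0rz _ _).
  rewrite -xw0 -Dder_lift; apply: etrans (Dder_xw _ _ _) _.
  by rewrite /form /= !mulr0 subr0 mulr0z.
have DD f1 f2 : Dder (s, t) (f1 + f2) = Dder (s, t) f1 + Dder (s, t) f2.
  by rewrite !Dder_lift; exact: (raddfD (linext _)).
rewrite xwE.
exists (g * g' * h *+ 2 + g ^+ 2 * Dder (s, t) h).
apply: etrans (DD _ _) _; rewrite Dc; apply: etrans _ (ring_Dsquare _ _ _ _ _).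
apply: (congr1 (fun x => 0 + x)); apply: etrans (Dder_mul _ _ _) _.
rewrite (expr2 (uvar - vvar)); apply: (congr2 (fun x y : ZP0 => x * h + y)).
  apply: etrans (Dder_mul _ _ _) _.
  exact: (congr2 (fun x y : ZP0 => x * y + y * x) gE' gE).
exact: (congr1 (fun x : ZP0 => x * x * _) gE).
Qed.

Lemma cf_u a b : cf uvar a b = ((1 == a) && (0 == b))%:R + ((-1 == a) && (0 == b))%:R.
Proof.
rewrite uvarE; exact: etrans (cfD _ _ _ _) (congr2 +%R (cf_xw _ _ _ _) (cf_xw _ _ _ _)).
Qed.

Lemma cf_v a b : cf vvar a b = ((0 == a) && (1 == b))%:R + ((0 == a) && (-1 == b))%:R.
Proof.
rewrite vvarE; exact: etrans (cfD _ _ _ _) (congr2 +%R (cf_xw _ _ _ _) (cf_xw _ _ _ _)).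
Qed.

Lemma is_lead_uv : is_lead (2, 1) (1, 0) (uvar - vvar).
Proof.
have E a b : coef (uvar - vvar) (a, b) =
    ((1 == a) && (0 == b))%:R + ((-1 == a) && (0 == b))%:R -
    (((0 == a) && (1 == b))%:R + ((0 == a) && (-1 == b))%:R).
  exact: etrans (coefB_P0 _ _ _) (congr2 (fun x y : int => x - y) (cf_u _ _) (cf_v _ _)).
split; first by rewrite E.
by move=> [a b]; rewrite xpair_eqE E /height /=; lia.
Qed.

Lemma is_lead_u c : 0 < c.1 -> is_lead c (1, 0) uvar.
Proof.
case: c => c1 c2 /= c0; split; first by rewrite cfE cf_u.
move=> [a b]; rewrite xpair_eqE cfE cf_u /height /= => n H.
have [-> ->] : a = -1 /\ b = 0 by lia.
by rewrite !mulr0 !addr0 mulrN1 mulr1 gtrN.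
Qed.

Lemma is_lead_v c : 0 < c.2 -> is_lead c (0, 1) vvar.
Proof.
case: c => c1 c2 /= c0; split; first by rewrite cfE cf_v.
move=> [a b]; rewrite xpair_eqE cfE cf_v /height /= => n H.
have [-> ->] : b = -1 /\ a = 0 by lia.
by rewrite !mulr0 !add0r mulrN1 mulr1 gtrN.
Qed.

Lemma is_lead1 c : is_lead c (0, 0) 1.
Proof.
split; first by rewrite coef1_P0 eqxx.
by move=> d dn; rewrite coef1_P0; have [E|_] := eqVneq d 0; [rewrite E eqxx in dn|rewrite eqxx].
Qed.

Lemma is_leadX c (a b : int) g n : is_lead c (a, b) g ->
  is_lead c (a * n%:Z, b * n%:Z) (g ^+ n).
Proof.
move=> lg; elim: n => [|n IHn]; first by rewrite !mulr0; apply: is_lead1.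
have -> : a * n.+1%:Z = a + a * n%:Z by lia.
have -> : b * n.+1%:Z = b + b * n%:Z by lia.
by rewrite exprS; apply: is_leadM.
Qed.

Definition par_supp (q : bool) f :=
  forall c, coef f c != 0 -> odd `|(c.1 + c.2)%R|%N = q.

Lemma odd_absD (x y : int) : odd `|(x + y)%R|%N = odd `|x|%N (+) odd `|y|%N.
Proof.
by case: (boolP (odd `|x|%N)) => ox; case: (boolP (odd `|y|%N)) => oy /=; lia.
Qed.

Lemma par_supp_mul q r f g : par_supp q f -> par_supp r g -> par_supp (q (+) r) (f * g).
Proof.
move=> ef eg [a b]; apply: contra_neq_eq => od; rewrite cfE cf_mul big_seq big1 //.
move=> [d1 d2]; rewrite -mcoeff_neq0 => /ef /= ev.
apply/eqP; rewrite mulrz_eq0; apply/orP; right; apply/negPn/negP => /eg /= E.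
case/eqP: od; rewrite -ev -E -odd_absD; by rewrite addrACA !subrKC.
Qed.

Lemma par_supp1 : par_supp false 1.
Proof. by move=> c; rewrite coef1_P0; have [-> //|_] := eqVneq c 0; rewrite eqxx. Qed.

Lemma par_suppX q f n : par_supp q f -> par_supp (odd n && q) (f ^+ n).
Proof.
move=> pf; elim: n => [|n IHn]; first exact: par_supp1.
rewrite exprS; have := par_supp_mul pf IHn; congr par_supp.
by clear; case: q; rewrite /= ?andbT ?andbF //; case: (odd n).
Qed.

Lemma par_supp_u : par_supp true uvar.
Proof. by move=> [a b]; rewrite cfE cf_u /=; lia. Qed.

Lemma par_supp_v : par_supp true vvar.
Proof. by move=> [a b]; rewrite cfE cf_v /=; lia. Qed.

Lemma par_supp_sub q f g : par_supp q f -> par_supp q g -> par_supp q (f - g).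
Proof.
move=> pf pg c; rewrite coefB_P0; have [->|/pf//] := eqVneq (coef f c) 0.
by rewrite sub0r oppr_eq0 => /pg.
Qed.

Lemma evalUV_monom i j :
  exists p : ZUV, evalUV p = uvar ^+ i * vvar ^+ j /\
    (~~ odd (i + j) -> even_degree p).
Proof.
pose m : mpoly.multinom 2 := mpoly.Multinom [tuple of [:: i; j]].
exists (mpoly.mpolyX _ m); split=> [|ij m'].
  rewrite /evalUV mpoly.mmapX /mpoly.mmap1 big_ord_recl big_ord1 /=.
  by congr (_ ^+ _ * _ ^+ _); rewrite /m !mpoly.multinomE.
rewrite mpoly.msuppX inE => /eqP ->.
by rewrite mpoly.mdegE big_ord_recl big_ord1 !mpoly.multinomE.
Qed.

End Weights.

(** * Polynomials in u and v, and the even subring *)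

Section EvalUV.
Import mpoly.
Implicit Types f : ZP0.

Lemma evalUV_B (p q : mpoly.mpoly 2 int) : evalUV (p - q) = evalUV p - evalUV q.
Proof. exact: (raddfB (mpoly.mmap _ _)). Qed.

(** These elements feed the descent: with weight 2 on the first coordinate of the height, u - v
    leads at (1, 0), so its square contributes (2, 0). *)
Lemma part1_gen i j : exists g : ZUV,
  [/\ (uvar - vvar) ^+ 2 * (uvar ^+ i * vvar ^+ j) = (uvar - vvar) ^+ 2 * evalUV g,
      Jstr ((uvar - vvar) ^+ 2 * evalUV g) &
      is_lead (2, 1) (i%:Z + 2, j%:Z) ((uvar - vvar) ^+ 2 * evalUV g)].
Proof.
have [g [gE _]] := evalUV_monom i j; exists g; split.
- exact: (congr1 (fun x : ZP0 => _ * x) (esym gE)).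
- rewrite -[X in Jstr X]add0r; exact/inJ_Jstr/(inJ_gen 0)/W0_evalUV.
rewrite gE.
have := is_leadX 2 is_lead_uv.
have := is_leadM (is_leadX i (@is_lead_u (2, 1) isT)) (is_leadX j (@is_lead_v (2, 1) isT)).
move=> l1 l2; have := is_leadM l2 l1.
rewrite !mul0r !mul1r !add0r addr0; congr is_lead.
by congr (_, _); rewrite addrC.
Qed.

Lemma Jstr_form f : Jstr f ->
  exists (c : int) (g : ZUV), f = c%:~R + (uvar - vvar) ^+ 2 * evalUV g.
Proof.
move=> Jf.
move: f Jf (fun c (_ : coef f c != 0) => I).
apply: (@Jstr_ind (fun=> True)).
- move=> f1 f2 [c1 [g1 ->]] [c2 [g2 ->]]; exists (c1 - c2), ((g1 : mpoly.mpoly 2 int) - g2).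
  by rewrite evalUV_B intrB; apply: ring_comb.
- exists 1; exists (0 : mpoly.mpoly 2 int). have -> : evalUV (0 : mpoly.mpoly 2 int) = 0.
    exact: (raddf0 (mpoly.mmap _ _)).
  by rewrite mulr0 addr0.
move=> a b a2 b0 _.
have [g [_ Jg lg]] := part1_gen `|a - 2|%N `|b|%N.
exists ((uvar - vvar) ^+ 2 * evalUV g); split=> //.
  by exists 0, g; rewrite add0r.
by move: lg; congr is_lead; congr (_, _); lia.
Qed.

Lemma inJ_form f : inJ f <->
  exists (c : int) (g : ZUV), f = c%:~R + (uvar - vvar) ^+ 2 * evalUV g.
Proof.
split=> [/inJ_Jstr/Jstr_form //|[c [g ->]]]; exact/inJ_gen/W0_evalUV.
Qed.

Lemma inJP f : inJ f <-> Jstr f.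
Proof. by split=> [|/Jstr_form/inJ_form]; [exact: inJ_Jstr|]. Qed.

Lemma even_degree_sub (p q : mpoly.mpoly 2 int) : even_degree p -> even_degree q -> even_degree (p - q).
Proof.
move=> ep eq m /mpoly.msuppB_le; rewrite mem_cat => /orP[/ep|/eq] //.
Qed.

Lemma even_supp_evalUV p : even_degree p -> par_supp false (evalUV p).
Proof.
move=> ep; rewrite /evalUV /mpoly.mmap big_seq; elim/big_rec: _.
  by move=> c; rewrite coef0_P0 eqxx.
move=> m y mp py; rewrite -[_ + _]opprK opprD.
have pN q f : par_supp q f -> par_supp q (- f).
  by move=> pf c; rewrite coefN_P0 oppr_eq0; apply: pf.
apply/pN/par_supp_sub => //; apply: pN.
rewrite mulrzl => c; apply: contraTeq => od; rewrite negbK.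
suff /eqP E : coef (mpoly.mmap1 (fun i : 'I_2 => if i == ord0 then uvar else vvar) m) c == 0.
  by rewrite coefMz E mul0rz.
apply: contraT => /(_ : par_supp false _) H; move: od.
rewrite H ?eqxx // /mpoly.mmap1 big_ord_recl big_ord1 /=.
have := par_supp_mul (@par_suppX _ _ (m ord0) par_supp_u)
  (@par_suppX _ _ (m (fintype.lift ord0 ord0)) par_supp_v).
have := ep m mp; rewrite mpoly.mdegE big_ord_recl big_ord1 oddD !andbT.
by case: addb.
Qed.

Lemma ring_uv_expand (R : comNzRingType) (x y : R) i j :
  (x - y) ^+ 2 * (x ^+ i * y ^+ j) =
  x ^+ i.+2 * y ^+ j - x ^+ i.+1 * y ^+ j.+1 -
  (x ^+ i.+1 * y ^+ j.+1 - x ^+ i * y ^+ j.+2).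
Proof. by rewrite !exprS; ring. Qed.

Lemma even_degreeD f g :
  (exists2 p, even_degree p & f = evalUV p) ->
  (exists2 p, even_degree p & g = evalUV p) ->
  (exists2 p, even_degree p & f - g = evalUV p).
Proof.
move=> [p ep ->] [q eq ->]; exists ((p : mpoly.mpoly 2 int) - q).
  exact: even_degree_sub.
by rewrite evalUV_B.
Qed.

Lemma even_uv i j : ~~ odd (i + j) ->
  exists2 p, even_degree p & (uvar - vvar) ^+ 2 * (uvar ^+ i * vvar ^+ j) = evalUV p.
Proof.
move=> ij.
have M a b : ~~ odd (a + b) ->
    exists2 p, even_degree p & uvar ^+ a * vvar ^+ b = evalUV p.
  by move=> ab; have [p [pE /(_ ab) ep]] := evalUV_monom a b; exists p.
have E : exists2 p, even_degree p & uvar ^+ i.+2 * vvar ^+ j - uvar ^+ i.+1 * vvar ^+ j.+1 -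
  (uvar ^+ i.+1 * vvar ^+ j.+1 - uvar ^+ i * vvar ^+ j.+2) = evalUV p.
  by do !apply: even_degreeD; apply: M; rewrite ?addSn ?addnS /= negbK.
by case: E => p ep pE; exists p => //; apply: etrans (ring_uv_expand _ _ _ _) pE.
Qed.

(** Run over weights of even parity, the descent combines only 1 and the products (u - v)^2 u^i v^j
    with i + j even, and therefore builds an even polynomial. *)
Lemma inJplusP f : inJplus f <-> Jstr f /\ par_supp false f.
Proof.
split=> [[/inJ_Jstr Jf [p [ep fE]]]|[Jf ef]].
  by split=> //; rewrite fE; apply: even_supp_evalUV.
split; first exact/inJP.
suff [p ep fE] : exists2 p, even_degree p & f = evalUV p by exists p.
move: f Jf ef; apply: (@Jstr_ind (fun c => odd `|(c.1 + c.2)%R|%N = false)).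
- exact: even_degreeD.
- have [p [pE ep]] := evalUV_monom 0 0; exists p; first exact: ep.
  exact: etrans (esym (mulr1 1)) (esym pE).
move=> a b a2 b0 /= ab.
have [g [gE Jg lg]] := part1_gen `|a - 2|%N `|b|%N.
have [p ep pE] : exists2 p, even_degree p & (uvar - vvar) ^+ 2 * evalUV g = evalUV p.
  have [|p ep pE] := @even_uv `|a - 2|%N `|b|%N; first by move: ab; lia.
  exists p; [exact: ep|exact: etrans (esym gE) pE].
exists ((uvar - vvar) ^+ 2 * evalUV g); split.
- exact: Jg.
- by exists p.
- by move: lg; congr is_lead; congr (_, _); lia.
rewrite pE; exact: even_supp_evalUV.
Qed.

End EvalUV.

(** * Superalgebras and points of SL(2,2) *)

From mathcomp Require Import fingroup perm.

Section SuperAlgebras.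
Variables (k : fieldType) (A : superalg k).
Implicit Types (x y z : A) (b c : bool).

Lemma homD b x y : sa_hom b x -> sa_hom b y -> sa_hom b (x + y).
Proof. by move=> hx hy; rewrite -[x]scale1r; apply: sa_homP. Qed.

Lemma homZ b (t : k) x : sa_hom b x -> sa_hom b (t *: x).
Proof. by move=> hx; rewrite -[_ *: _]addr0; apply: sa_homP => //; apply: sa_hom0. Qed.

Lemma homN b x : sa_hom b x -> sa_hom b (- x).
Proof. by rewrite -scaleN1r; apply: homZ. Qed.

Lemma homB b x y : sa_hom b x -> sa_hom b y -> sa_hom b (x - y).
Proof. by move=> hx hy; apply: homD => //; apply: homN. Qed.

Lemma hom_alg (t : k) : sa_hom false (t%:A : A).
Proof. exact/homZ/sa_hom1. Qed.

Lemma hom_sum (I : Type) (r : seq I) (P : pred I) (F : I -> A) b :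
  (forall i, P i -> sa_hom b (F i)) -> sa_hom b (\sum_(i <- r | P i) F i).
Proof. by move=> H; apply: big_ind => //; [exact: sa_hom0|exact: homD]. Qed.

Lemma homM_even b x y : sa_hom false x -> sa_hom b y -> sa_hom b (x * y).
Proof. by move=> hx hy; rewrite -[b]addFb; apply: sa_homM. Qed.

Lemma homM_evenr b x y : sa_hom b x -> sa_hom false y -> sa_hom b (x * y).
Proof. by move=> hx hy; rewrite -[b]addbF; apply: sa_homM. Qed.

Lemma homX x n : sa_hom false x -> sa_hom false (x ^+ n).
Proof.
move=> hx; elim: n => [|n IHn]; first exact: sa_hom1.
by rewrite exprS; apply: homM_even.
Qed.

Lemma even_comm x y : sa_hom false x -> x * y = y * x.
Proof.
move=> hx; have [y0 [y1 [h0 h1 ->]]] := sa_dec y.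
rewrite mulrDl mulrDr (sa_comm hx h0) (sa_comm hx h1) /= !mul1r //.
Qed.

(** Comparing parities in [x * y = 1] shows that the odd part of [y] is killed by [x], which is
    invertible. *)
Lemma hom_inv x y : sa_hom false x -> x * y = 1 -> sa_hom false y.
Proof.
move=> hx xy; have [y0 [y1 [h0 h1 yE]]] := sa_dec y.
have xy0 : x * y0 = 1 /\ x * y1 = 0.
  have e1 : x * y1 = 1 - x * y0 by rewrite -xy yE mulrDr addrAC subrr add0r.
  have e : x * y1 = 0.
    apply: sa_dir; last by rewrite -[true]addFb; apply: sa_homM.
    by rewrite e1; apply: homB; [exact: sa_hom1|apply: homM_even].
  by split=> //; move: e1; rewrite e => /esym/eqP; rewrite subr_eq0 => /eqP.
have [e0 e1] := xy0.
suff -> : y = y0 by [].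
rewrite yE; suff -> : y1 = 0 by rewrite addr0.
by rewrite -[y1]mul1r -e0 (even_comm _ hx) -mulrA e1 mulr0.
Qed.

Lemma inv_uniq x y z : sa_hom false x -> x * y = 1 -> x * z = 1 -> y = z.
Proof.
move=> hx xy xz; rewrite -[y]mulr1 -xz mulrA -(even_comm _ hx) xy mul1r //.
Qed.

Lemma algE_comm (t : k) x : t%:A * x = x * t%:A.
Proof. by rewrite -scalerAl -scalerAr mul1r mulr1. Qed.

End SuperAlgebras.

Lemma det2E (R : pzRingType) (M : 'M[R]_2) :
  \det M = M 0 0 * M 1 1 - M 0 1 * M 1 0.
Proof.
rewrite /determinant (bigD1 (1%g : 'S_2)) //= (bigD1 (tperm 0 1)) /=; last first.
  by apply/eqP => /permP/(_ 0); rewrite tpermL perm1.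
rewrite [X in _ + (_ + X)]big1 ?addr0 => [|s /andP[s1 st]]; last first.
  have := s1; have s01 : s 0 != s 1 by rewrite (inj_eq perm_inj).
  case: (eqVneq (s 0) 0) => [s0|s0].
    have s11 : s 1 = 1.
      by move: s01; rewrite s0; case: (s 1) => [[|[|]]] //= i _; apply/val_inj.
    case/negP; apply/eqP/permP => -[[|[|]]] // i.
      by rewrite perm1 (_ : Ordinal i = 0) ?s0 //; apply/val_inj.
    by rewrite perm1 (_ : Ordinal i = 1) ?s11 //; apply/val_inj.
  have s0' : s 0 = 1.
    by move: s0; case: (s 0) => [[|[|]]] //= i _; apply/val_inj.
  have s1' : s 1 = 0.
    by move: s01; rewrite s0'; case: (s 1) => [[|[|]]] //= i _; apply/val_inj.
  move=> _; case/negP: st; apply/eqP/permP => -[[|[|]]] // i.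
    by rewrite (_ : Ordinal i = 0) ?s0' ?tpermL //; apply/val_inj.
  by rewrite (_ : Ordinal i = 1) ?s1' ?tpermR //; apply/val_inj.
rewrite !big_ord_recl !big_ord0 odd_perm1 odd_tperm /= !perm1 expr0 expr1 !mulr1 mul1r.
rewrite tpermL mulN1r.
have -> : lift ord0 ord0 = 1 :> 'I_2 by apply/val_inj.
by rewrite tpermR.
Qed.

Lemma adj2E (R : pzRingType) (M : 'M[R]_2) :
  [/\ (\adj M) 0 0 = M 1 1, (\adj M) 1 1 = M 0 0,
      (\adj M) 0 1 = - M 0 1 & (\adj M) 1 0 = - M 1 0].
Proof.
have C i j : cofactor M i j = (-1) ^+ (i + j) * M (i + 1) (j + 1).
  rewrite /cofactor; congr (_ * _).
  have S1 (s : 'S_1) : s = 1%g by apply/permP => x; exact: etrans (ord1 _) (esym (ord1 _)).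
  rewrite /determinant (@big_pred1 _ _ _ _ (1%g : 'S_1)) => [|s]; last first.
    by rewrite /= (S1 s) eqxx.
  rewrite odd_perm1 mul1r big_ord1 perm1 !mxE.
  by congr (M _ _); apply/val_inj; case: (i) (j) => [[|[|]]] //= ? [[|[|]]].
have e01 : 0 + 1 = 1 :> 'I_2 by apply/val_inj.
have e11 : 1 + 1 = 0 :> 'I_2 by apply/val_inj.
rewrite !mxE !C e01 e11 /=.
by split; rewrite ?(addn0, add0n) ?expr0 ?expr1 ?sqrrN ?expr1n ?mul1r ?mulN1r.
Qed.

Lemma ord2_ind (P : 'I_2 -> Prop) : P 0 -> P 1 -> forall i, P i.
Proof.
move=> P0 P1 [[|[|]]] // i; [rewrite (_ : Ordinal i = 0)|rewrite (_ : Ordinal i = 1)] => //;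
  exact/val_inj.
Qed.

Section PurelyEven.
Variable k : fieldType.
(** The field as a superalgebra concentrated in even degree; its points are the ordinary
    [k]-points. *)
Definition khom (b : bool) (x : k^o) : Prop := b -> x = 0.

Lemma khom0 b : khom b 0. Proof. by []. Qed.
Lemma khomP b (c : k) x y : khom b x -> khom b y -> khom b (c *: x + y).
Proof. by move=> hx hy e; rewrite hx // hy // scaler0 addr0. Qed.
Lemma khom_dec x : exists x0 x1, [/\ khom false x0, khom true x1 & x = x0 + x1].
Proof. by exists x, 0; rewrite addr0. Qed.
Lemma khom_dir x : khom false x -> khom true x -> x = 0.
Proof. by move=> _; apply. Qed.
Lemma khom1 : khom false 1. Proof. by []. Qed.
Lemma khomM b c x y : khom b x -> khom c y -> khom (b (+) c) (x * y).
Proof.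
case: b; case: c => //= hx hy _; first by rewrite hx // mul0r.
by rewrite hy // mulr0.
Qed.
Lemma khomC b c x y : khom b x -> khom c y -> y * x = (-1) ^+ (b && c) * (x * y).
Proof.
case: b; case: c => /= hx hy; rewrite ?mul1r; try exact: (mulrC (y : k)).
by rewrite hx // !mul0r !mulr0.
Qed.

Definition kalg : superalg k :=
  @SuperAlg k k^o khom khom0 khomP khom_dec khom_dir khom1 khomM khomC.
End PurelyEven.

(* [k<y, z>] with [y] and [z] of parities [p] and [q], [y ^ 2 = z ^ 2 = 0] and
   [z y = s y z]; coordinates along [1, y, z, y z]. *)
Section TestAlgebra.
Variables (k : fieldType) (p q : bool).
Record quad := Quad { q0 : k; q1 : k; q2 : k; q3 : k }.
Definition quad_code (x : quad) := (q0 x, q1 x, q2 x, q3 x).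
Definition quad_decode (x : k * k * k * k) := Quad x.1.1.1 x.1.1.2 x.1.2 x.2.
Lemma quad_codeK : cancel quad_code quad_decode. Proof. by case. Qed.
HB.instance Definition _ := Equality.copy quad (can_type quad_codeK).
HB.instance Definition _ := Choice.copy quad (can_type quad_codeK).
Let s : k := (-1) ^+ (p && q).

Lemma quad_eq (x y : quad) :
  q0 x = q0 y -> q1 x = q1 y -> q2 x = q2 y -> q3 x = q3 y -> x = y.
Proof. by case: x y => ? ? ? ? [? ? ? ?] /= -> -> -> ->. Qed.

Definition qadd (x y : quad) := Quad (q0 x + q0 y) (q1 x + q1 y) (q2 x + q2 y) (q3 x + q3 y).
Definition qopp (x : quad) := Quad (- q0 x) (- q1 x) (- q2 x) (- q3 x).
Lemma qaddA : associative qadd. Proof. by move=> x y z; apply: quad_eq; apply: addrA. Qed.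
Lemma qaddC : commutative qadd. Proof. by move=> x y; apply: quad_eq; apply: addrC. Qed.
Lemma qadd0 : left_id (Quad 0 0 0 0) qadd.
Proof. by move=> x; apply: quad_eq; apply: add0r. Qed.
Lemma qaddN : left_inverse (Quad 0 0 0 0) qopp qadd.
Proof. by move=> x; apply: quad_eq; apply: addNr. Qed.
HB.instance Definition _ := GRing.isZmodule.Build quad qaddA qaddC qadd0 qaddN.

Definition qscale (t : k) (x : quad) := Quad (t * q0 x) (t * q1 x) (t * q2 x) (t * q3 x).
Lemma qscaleA t u x : qscale t (qscale u x) = qscale (t * u) x.
Proof. by apply: quad_eq; apply: mulrA. Qed.
Lemma qscale1 : left_id 1 qscale. Proof. by move=> x; apply: quad_eq; apply: mul1r. Qed.
Lemma qscaleDr : right_distributive qscale +%R.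
Proof. by move=> t x y; apply: quad_eq; apply: mulrDr. Qed.
Lemma qscaleDl x : {morph qscale^~ x : t u / t + u}.
Proof. by move=> t u; apply: quad_eq; apply: mulrDl. Qed.
HB.instance Definition _ := GRing.Zmodule_isLmodule.Build k quad
  qscaleA qscale1 qscaleDr qscaleDl.

Definition qmul (x y : quad) := Quad (q0 x * q0 y) (q0 x * q1 y + q1 x * q0 y)
  (q0 x * q2 y + q2 x * q0 y)
  (q0 x * q3 y + q3 x * q0 y + q1 x * q2 y + s * (q2 x * q1 y)).
Definition qone := Quad 1 0 0 0.

Lemma qmulA : associative qmul.
Proof. by move=> x y z; apply: quad_eq => /=; ring. Qed.
Lemma qmul1l : left_id qone qmul.
Proof. by move=> x; apply: quad_eq => /=; ring. Qed.
Lemma qmul1r : right_id qone qmul.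
Proof. by move=> x; apply: quad_eq => /=; ring. Qed.
Lemma qmulDl : left_distributive qmul +%R.
Proof. by move=> x y z; apply: quad_eq => /=; ring. Qed.
Lemma qmulDr : right_distributive qmul +%R.
Proof. by move=> x y z; apply: quad_eq => /=; ring. Qed.
Lemma qone_neq0 : qone != 0.
Proof. by apply/eqP => /(congr1 q0) /= /eqP; rewrite oner_eq0. Qed.
HB.instance Definition _ := GRing.Zmodule_isNzRing.Build quad
  qmulA qmul1l qmul1r qmulDl qmulDr qone_neq0.
Lemma qscaleAl (t : k) (x y : quad) : t *: (x * y) = (t *: x) * y.
Proof. by apply: quad_eq => /=; ring. Qed.
HB.instance Definition _ := GRing.Lmodule_isLalgebra.Build k quad qscaleAl.
Lemma qscaleAr (t : k) (x y : quad) : t *: (x * y) = x * (t *: y).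
Proof. by apply: quad_eq => /=; ring. Qed.
HB.instance Definition _ := GRing.Lalgebra_isAlgebra.Build k quad qscaleAr.

Definition qhom (b : bool) (x : quad) : Prop :=
  [/\ b -> q0 x = 0, b != p -> q1 x = 0, b != q -> q2 x = 0 & b != p (+) q -> q3 x = 0].

Lemma qhom0 b : qhom b 0. Proof. by []. Qed.
Lemma qhomP b (c : k) x y : qhom b x -> qhom b y -> qhom b (c *: x + y).
Proof.
move=> [h0 h1 h2 h3] [g0 g1 g2 g3].
by split=> e /=; rewrite ?h0 ?h1 ?h2 ?h3 ?g0 ?g1 ?g2 ?g3 // mulr0 addr0.
Qed.
Lemma qhom_dec x : exists x0 x1, [/\ qhom false x0, qhom true x1 & x = x0 + x1].
Proof.
exists (Quad (q0 x) (if p then 0 else q1 x) (if q then 0 else q2 x)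
  (if p (+) q then 0 else q3 x)).
exists (Quad 0 (if p then q1 x else 0) (if q then q2 x else 0)
  (if p (+) q then q3 x else 0)).
split; last by apply: quad_eq => /=; case: (p) (q) => [] [] /=; rewrite ?addr0 ?add0r.
  by split=> //=; case: (p) (q) => [] [].
by split=> //=; case: (p) (q) => [] [].
Qed.
Lemma qhom_dir x : qhom false x -> qhom true x -> x = 0.
Proof.
move=> [h0 h1 h2 h3] [g0 g1 g2 g3]; apply: quad_eq; first by rewrite g0.
- by case: (p) h1 g1 => /= h1 g1; [apply: h1|apply: g1].
- by case: (q) h2 g2 => /= h2 g2; [apply: h2|apply: g2].
- by case: (p (+) q) h3 g3 => /= h3 g3; [apply: h3|apply: g3].
Qed.
Lemma qhom1 : qhom false 1. Proof. by []. Qed.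
Ltac use_zero := repeat match goal with
  | H : is_true true -> _ = 0 |- _ => rewrite ?(H isT); clear H end.

Lemma qhomM b c x y : qhom b x -> qhom c y -> qhom (b (+) c) (x * y).
Proof.
case: x y => a0 a1 a2 a3 [b0 b1 b2 b3] [/= h0 h1 h2 h3] [/= g0 g1 g2 g3].
split=> /=; move: h0 h1 h2 h3 g0 g1 g2 g3;
case: (b) (c) (p) (q) => [] [] [] [] /= h0 h1 h2 h3 g0 g1 g2 g3 // _;
by use_zero; ring.
Qed.
Lemma qhomC b c x y : qhom b x -> qhom c y -> y * x = (-1) ^+ (b && c) * (x * y).
Proof.
have sgE (e : bool) (z : quad) : (-1) ^+ e * z = ((-1) ^+ e : k) *: z.
  by case: e; rewrite ?expr1 ?expr0 ?mulN1r ?scaleN1r ?mul1r ?scale1r.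
rewrite sgE.
case: x y => a0 a1 a2 a3 [b0 b1 b2 b3] [/= h0 h1 h2 h3] [/= g0 g1 g2 g3].
apply: quad_eq => /=; move: h0 h1 h2 h3 g0 g1 g2 g3; rewrite /s /=;
case: (b) (c) (p) (q) => [] [] [] [] /= h0 h1 h2 h3 g0 g1 g2 g3;
by use_zero; ring.
Qed.

Definition qalg : superalg k :=
  @SuperAlg k quad qhom qhom0 qhomP qhom_dec qhom_dir qhom1 qhomM qhomC.

Definition qy : qalg := Quad 0 1 0 0.
Definition qz : qalg := Quad 0 0 1 0.
Definition qyz : qalg := Quad 0 0 0 1.
End TestAlgebra.

(** * Homogeneous supermatrices, supertrace and superbracket *)

Section Supermatrices.
Variable k : fieldType.
Local Notation M4 := 'M[k]_(2 + 2).
Implicit Types M N : M4.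

Definition homog (p : bool) M := forall i j, par22 i (+) par22 j != p -> M i j = 0.
Definition str M : k := \tr (ulsubmx M) - \tr (drsubmx M).
Definition sbracket (p q : bool) M N : M4 :=
  M *m N - (-1) ^+ (p && q) *: (N *m M).

Definition e0 : 'I_(2 + 2) := lshift 2 0.
Definition e1 : 'I_(2 + 2) := lshift 2 1.
Definition f0 : 'I_(2 + 2) := rshift 2 0.
Definition f1 : 'I_(2 + 2) := rshift 2 1.

Lemma par_e0 : par22 e0 = false. Proof. by []. Qed.
Lemma par_e1 : par22 e1 = false. Proof. by []. Qed.
Lemma par_f0 : par22 f0 = true. Proof. by []. Qed.
Lemma par_f1 : par22 f1 = true. Proof. by []. Qed.
Definition parE := (par_e0, par_e1, par_f0, par_f1).

Lemma sum4 (T : nmodType) (F : 'I_(2 + 2) -> T) :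
  \sum_i F i = F e0 + F e1 + F f0 + F f1.
Proof.
rewrite big_split_ord /= !big_ord_recl !big_ord0 !addr0 !addrA.
by rewrite /e0 /e1 /f0 /f1; congr (F _ + F _ + F _ + F _); apply/val_inj.
Qed.

Lemma ord4_ind (P : 'I_(2 + 2) -> Prop) : P e0 -> P e1 -> P f0 -> P f1 -> forall i, P i.
Proof.
move=> h0 h1 h2 h3 i; case: (split_ordP i) => j ->; move: j; exact: ord2_ind.
Qed.

Lemma sum2 (T : nmodType) (F : 'I_2 -> T) : \sum_i F i = F 0 + F 1.
Proof.
by rewrite !big_ord_recl big_ord0 addr0; congr (F _ + F _); apply/val_inj.
Qed.

Lemma strE M : str M = M e0 e0 + M e1 e1 - (M f0 f0 + M f1 f1).
Proof. by rewrite /str /mxtrace !sum2 !mxE. Qed.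

Lemma homogP p M : homog p M -> 
  (if p then [/\ M e0 e0 = 0, M e0 e1 = 0, M e1 e0 = 0 & M e1 e1 = 0] /\
             [/\ M f0 f0 = 0, M f0 f1 = 0, M f1 f0 = 0 & M f1 f1 = 0]
   else [/\ M e0 f0 = 0, M e0 f1 = 0, M e1 f0 = 0 & M e1 f1 = 0] /\
             [/\ M f0 e0 = 0, M f0 e1 = 0, M f1 e0 = 0 & M f1 e1 = 0]).
Proof. by case: p => H; split; split; apply: H. Qed.

Lemma homogM p q M N : homog p M -> homog q N -> homog (p (+) q) (M *m N).
Proof.
move=> hM hN i j ij; rewrite mxE big1 // => l _.
have [E|/hM->] := eqVneq (par22 i (+) par22 l) p; last by rewrite mul0r.
rewrite hN ?mulr0 //; apply: contra ij => /eqP <-; rewrite -E.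
by case: (par22 i) (par22 l) (par22 j) => [] [] [].
Qed.

Lemma homogZ p (t : k) M : homog p M -> homog p (t *: M).
Proof. by move=> hM i j ij; rewrite mxE hM // mulr0. Qed.

Lemma homogB p M N : homog p M -> homog p N -> homog p (M - N).
Proof. by move=> hM hN i j ij; rewrite !mxE hM // hN // subrr. Qed.

Lemma homog0 p : homog p 0.
Proof. by move=> i j _; rewrite mxE. Qed.

Lemma str_super p q M N : homog p M -> homog q N ->
  str (M *m N) = (-1) ^+ (p && q) * str (N *m M).
Proof.
move=> /homogP hM /homogP hN; rewrite !strE !mxE !sum4.
case: p hM => [] [[h1 h2 h3 h4] [h5 h6 h7 h8]];
case: q hN => [] [[g1 g2 g3 g4] [g5 g6 g7 g8]];
rewrite ?h1 ?h2 ?h3 ?h4 ?h5 ?h6 ?h7 ?h8 ?g1 ?g2 ?g3 ?g4 ?g5 ?g6 ?g7 ?g8 /=; by ring.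
Qed.

Lemma homog_bracket p q M N : homog p M -> homog q N ->
  homog (p (+) q) (sbracket p q M N).
Proof.
by move=> hM hN; apply/homogB/homogZ; [|rewrite addbC]; apply: homogM.
Qed.

Lemma strB M N : str (M - N) = str M - str N.
Proof. by rewrite !strE !mxE; ring. Qed.
Lemma strZ t M : str (t *: M) = t * str M.
Proof. by rewrite !strE !mxE; ring. Qed.

Lemma str_bracket p q M N : homog p M -> homog q N -> str (sbracket p q M N) = 0.
Proof.
move=> hM hN; rewrite /sbracket strB strZ (str_super hM hN); apply/eqP.
by rewrite subr_eq0.
Qed.

End Supermatrices.
Arguments homog {k}.

Lemma schurE (R : pzRingType) (A B C D : 'M[R]_2) x i j :
  (A - B *m (x%:M *m \adj D) *m C) i j =
  A i j - ((B i 0 * (x * D 1 1) - B i 1 * (x * D 1 0)) * C 0 j +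
           (B i 1 * (x * D 0 0) - B i 0 * (x * D 0 1)) * C 1 j).
Proof.
have [] := adj2E D; move: (\adj D) => J j00 j11 j01 j10.
rewrite mul_scalar_mx !mxE sum2 !mxE !sum2 !mxE j00 j11 j01 j10 !mulrN.
by rewrite [- _ + _ in X in _ - (_ + X)]addrC.
Qed.

(** * The action of the Lie superalgebra *)

Section Infinitesimal.
Variables (k : fieldType) (p q : bool).
Local Notation M4 := 'M[k]_(2 + 2).
Local Notation A := (qalg k p q).
Implicit Types M N : M4.

(** The matrix 1 + y M + z M' + y z N. *)
Definition qmx n (M M' N : 'M[k]_n) : 'M[A]_n :=
  \matrix_(i, j) (@Quad k ((i == j)%:R : k) (M i j) (M' i j) (N i j) : A).

(** The series 1 - r + r^2 for the inverse of 1 + r, where r has no constant term and hence r^3 =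
    0. *)
Definition qinv (x : A) : A :=
  @Quad k 1 (- q1 x) (- q2 x) (- q3 x + q1 x * q2 x + (-1) ^+ (p && q) * (q2 x * q1 x)).

Lemma qinvP (x : A) : q0 x = 1 -> x * qinv x = 1.
Proof. by move=> x0; apply: quad_eq => /=; rewrite x0; ring. Qed.

(** The trace conditions make the coefficients of the Berezinian along [y], [z] and [y z] vanish.
    The one on [N] is modelled on the product of 1 + y M and 1 + z M', whose [y z] coefficient is
    [M *m M']. *)
Lemma qmx_point M M' N : homog p M -> homog q M' -> homog (p (+) q) N ->
  str M = 0 -> str M' = 0 -> str N = str (M *m M') ->
  exists g : SL22 A, sl_mx g = qmx M M' N.
Proof.
move=> hM hM' hN sM sM' sN.
have Gev i j : sa_hom (par22 i (+) par22 j) (qmx M M' N i j).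
  rewrite mxE; split=> /= ij; [|exact: hM|exact: hM'|exact: hN].
  by have [E|//] := eqVneq i j; move: ij; rewrite E addbb.
set G := qmx M M' N in Gev *.
have GE i j : G i j = @Quad k ((i == j)%:R : k) (M i j) (M' i j) (N i j) by rewrite mxE.
have dA : \det (ulsubmx G) * qinv (\det (ulsubmx G)) = 1.
  apply: qinvP; rewrite det2E !mxE /=; ring.
have dD : \det (drsubmx G) * qinv (\det (drsubmx G)) = 1.
  apply: qinvP; rewrite det2E !mxE /=; ring.
have ber : \det (ulsubmx G - ursubmx G
              *m ((qinv (\det (drsubmx G)))%:M *m \adj (drsubmx G)) *m dlsubmx G)
            * qinv (\det (drsubmx G)) = 1.
  have E00 : M e0 e0 = M f0 f0 + M f1 f1 - M e1 e1.
    by apply/eqP; rewrite -subr_eq0 -sM strE; apply/eqP; ring.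
  have E00' : M' e0 e0 = M' f0 f0 + M' f1 f1 - M' e1 e1.
    by apply/eqP; rewrite -subr_eq0 -sM' strE; apply/eqP; ring.
  have E00'' : N e0 e0 = N f0 f0 + N f1 f1 - N e1 e1 + str (M *m M').
    by apply/eqP; rewrite -subr_eq0 -sN strE; apply/eqP; ring.
  rewrite det2E (det2E (drsubmx G)) !schurE.
  have HA i j : ulsubmx G i j = G (lshift 2 i) (lshift 2 j) by rewrite !mxE.
  have HB i j : ursubmx G i j = G (lshift 2 i) (rshift 2 j) by rewrite !mxE.
  have HC i j : dlsubmx G i j = G (rshift 2 i) (lshift 2 j) by rewrite !mxE.
  have HD i j : drsubmx G i j = G (rshift 2 i) (rshift 2 j) by rewrite !mxE.
  rewrite !(HA, HB, HC, HD) -!/e0 -!/e1 -!/f0 -!/f1 !GE.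
  move: hM hM' hN => /homogP hM /homogP hM' /homogP hN.
  rewrite strE !mxE !sum4 in E00''.
  apply: quad_eq; rewrite /= ?E00 ?E00' ?E00''; rewrite ?E00 ?E00'.
  - by ring.
  - by ring.
  - by ring.
  move: hM hM'.
case: (p) => [] [[h1 h2 h3 h4] [h5 h6 h7 h8]];
case: (q) => [] [[g1 g2 g3 g4] [g5 g6 g7 g8]];
rewrite ?h1 ?h2 ?h3 ?h4 ?h5 ?h6 ?h7 ?h8 ?g1 ?g2 ?g3 ?g4 ?g5 ?g6 ?g7 ?g8 /=; by ring.
by exists (SL22Point Gev dA dD ber).
Qed.
End Infinitesimal.

Section Derivative.
Variable k : fieldType.
Local Notation M4 := 'M[k]_(2 + 2).
Implicit Types (M N : M4) (e : regexpr k).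

(* The differential at the identity of the function represented by [e]. *)
Fixpoint ev1 e : k :=
  match e with
  | Entry i j => (i == j)%:R
  | InvDetA | InvDetD => 1
  | Const c => c
  | Add e e' => ev1 e + ev1 e'
  | Mul e e' => ev1 e * ev1 e'
  end.

Fixpoint der M e : k :=
  match e with
  | Entry i j => M i j
  | InvDetA => - \tr (ulsubmx M)
  | InvDetD => - \tr (drsubmx M)
  | Const c => 0
  | Add e e' => der M e + der M e'
  | Mul e e' => der M e * ev1 e' + ev1 e * der M e'
  end.

Lemma derP (t : k) M N e : der (t *: M + N) e = t * der M e + der N e.
Proof.
elim: e => [i j|||c|e He e' He'|e He e' He'] /=.
- by rewrite !mxE.
- by rewrite /mxtrace !sum2 !mxE; ring.
- by rewrite /mxtrace !sum2 !mxE; ring.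
- by rewrite mulr0 addr0.
- by rewrite He He'; ring.
- by rewrite He He'; ring.
Qed.

Section Points.
Variables (A : superalg k) (g : SL22 A).

Lemma hom_entry b i j : par22 i (+) par22 j = b -> sa_hom b (sl_mx g i j).
Proof. by move=> <-; apply: sl_even. Qed.

Lemma detA_even : sa_hom false (\det (ulsubmx (sl_mx g))).
Proof.
by rewrite det2E !mxE; apply: homB; apply: homM_even; apply: hom_entry.
Qed.
Lemma detD_even : sa_hom false (\det (drsubmx (sl_mx g))).
Proof.
by rewrite det2E !mxE; apply: homB; apply: homM_even; apply: hom_entry.
Qed.
Lemma invA_uniq x : \det (ulsubmx (sl_mx g)) * x = 1 -> sl_invA g = x.
Proof. exact: inv_uniq detA_even (sl_invAP g). Qed.
Lemma invD_uniq x : \det (drsubmx (sl_mx g)) * x = 1 -> sl_invD g = x.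
Proof. exact: inv_uniq detD_even (sl_invDP g). Qed.

Variables (y : A) (M : M4).
Hypothesis yy : y * y = 0.
Hypothesis gE : sl_mx g = 1%:M + y *: map_mx (in_alg A) M.

Let inf_mul (a b c d : k) :
  (a%:A + b *: y) * (c%:A + d *: y) = (a * c)%:A + (b * c + a * d) *: y.
Proof.
rewrite mulrDl !mulrDr.
have -> : a%:A * c%:A = (a * c)%:A :> A by rewrite -scalerAl mul1r scalerA.
have -> : a%:A * (d *: y) = (a * d) *: y by rewrite -scalerAl mul1r scalerA.
have -> : b *: y * c%:A = (b * c) *: y by rewrite -scalerAl -scalerAr mulr1 scalerA.
have -> : b *: y * (d *: y) = 0 by rewrite -scalerAl -scalerAr yy !scaler0.
by rewrite addr0 -addrA -scalerDl [_ + b * c]addrC.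
Qed.

Let gij i j : g i j = ((i == j)%:R : k)%:A + M i j *: y.
Proof.
rewrite gE !mxE; congr (_ + _); first by rewrite scaler_nat.
by rewrite -scalerAr mulr1.
Qed.

Let det1 (a b c d : k) :
  (1%:A + a *: y) * (1%:A + d *: y) - (0%:A + b *: y) * (0%:A + c *: y) =
  1%:A + (a + d) *: y :> A.
Proof.
by rewrite !inf_mul !(mul0r, mulr0, mulr1, mul1r, addr0) !scale0r addr0 subr0.
Qed.

Let one1 (a : k) : (1%:A + a *: y) * (1%:A + (- a) *: y) = 1 :> A.
Proof. by rewrite inf_mul !mulr1 mul1r subrr scale0r addr0 scale1r. Qed.

(** First order Taylor expansion at the identity. The coefficients lie in [k] and commute with [y],
    so one formula covers even and odd [y]; the inverse determinants come from uniqueness of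
    inverses, 1 - a y being inverse to 1 + a y. *)
Lemma reval_inf e : reval g e = (ev1 e)%:A + der M e *: y.
Proof.
elim: e => [i j|||c|e He e' He'|e He e' He'] /=.
- exact: gij.
- apply: invA_uniq; rewrite det2E !mxE !gij /= !det1 /mxtrace sum2 !mxE scale1r.
  by have := one1 (M e0 e0 + M e1 e1); rewrite scale1r.
- apply: invD_uniq; rewrite det2E !mxE !gij /= !det1 /mxtrace sum2 !mxE scale1r.
  by have := one1 (M f0 f0 + M f1 f1); rewrite scale1r.
- by rewrite scale0r addr0.
- by rewrite He He' !scalerDl addrACA.
- by rewrite He He' inf_mul.
Qed.
End Points.
End Derivative.

Section QuadMatrices.
Variables (k : fieldType) (p q : bool).
Local Notation A := (qalg k p q).

Lemma q0_sum (I : Type) (r : seq I) (F : I -> A) : q0 (\sum_(i <- r) F i) = \sum_(i <- r) q0 (F i).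
Proof. exact: (big_morph (@q0 k : A -> k)). Qed.
Lemma q1_sum (I : Type) (r : seq I) (F : I -> A) : q1 (\sum_(i <- r) F i) = \sum_(i <- r) q1 (F i).
Proof. exact: (big_morph (@q1 k : A -> k)). Qed.
Lemma q2_sum (I : Type) (r : seq I) (F : I -> A) : q2 (\sum_(i <- r) F i) = \sum_(i <- r) q2 (F i).
Proof. exact: (big_morph (@q2 k : A -> k)). Qed.
Lemma q3_sum (I : Type) (r : seq I) (F : I -> A) : q3 (\sum_(i <- r) F i) = \sum_(i <- r) q3 (F i).
Proof. exact: (big_morph (@q3 k : A -> k)). Qed.

Lemma sum_delta n (F : 'I_n -> k) i : \sum_j (i == j)%:R * F j = F i.
Proof.
rewrite (bigD1 i) //= eqxx mul1r big1 ?addr0 // => j ji.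
by rewrite eq_sym (negPf ji) mul0r.
Qed.
Lemma sum_deltar n (F : 'I_n -> k) i : \sum_j F j * (j == i)%:R = F i.
Proof.
by rewrite -[RHS](sum_delta F); apply: eq_bigr => j _; rewrite mulrC eq_sym.
Qed.

Lemma qmxM n (M M' N L L' K : 'M[k]_n) :
  qmx p q M M' N *m qmx p q L L' K =
  qmx p q (M + L) (M' + L') (N + K + M *m L' + (-1) ^+ (p && q) *: (M' *m L)).
Proof.
apply/matrixP => i j; rewrite !mxE; apply: quad_eq.
- rewrite q0_sum; under eq_bigr do rewrite !mxE /=.
  by rewrite sum_delta.
- rewrite q1_sum; under eq_bigr do rewrite !mxE /=.
  by rewrite big_split /= sum_delta sum_deltar addrC.
- rewrite q2_sum; under eq_bigr do rewrite !mxE /=.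
  by rewrite big_split /= sum_delta sum_deltar addrC.
- rewrite q3_sum; under eq_bigr do rewrite !mxE /=.
  by rewrite !big_split /= sum_delta sum_deltar -mulr_sumr [K i j + _]addrC.
Qed.

Lemma qmx_inj3 n (M M' N L L' K : 'M[k]_n) : qmx p q M M' N = qmx p q L L' K -> N = K.
Proof.
move=> E; apply/matrixP => i j.
by have := congr1 (fun G : 'M[A]_n => q3 (G i j)) E; rewrite !mxE.
Qed.
End QuadMatrices.

Section RepMatrices.
Variables (k : fieldType) (n : nat) (R : 'I_n -> 'I_n -> regexpr k).

(** A representation with its parities forgotten: sums and compressions are first built as matrices
    of functions and receive parities afterwards. *)
Record is_repmx : Prop := IsRepmx {
  rmx_scal : forall (A : superalg k) (g : SL22 A) (a : A),
    sl_mx g = a%:M -> evalmx R g = 1%:M;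
  rmx_mul : forall (A : superalg k) (g h gh : SL22 A),
    sl_mx gh = sl_mx g *m sl_mx h -> evalmx R gh = evalmx R g *m evalmx R h }.

Definition dmx (M : 'M[k]_(2 + 2)) : 'M[k]_n := \matrix_(i, j) der M (R i j).

Lemma dmxP t M N : dmx (t *: M + N) = t *: dmx M + dmx N.
Proof. by apply/matrixP => i j; rewrite !mxE derP. Qed.
HB.instance Definition _ := GRing.isLinear.Build k 'M[k]_(2 + 2) 'M[k]_n _ dmx dmxP.

Hypothesis RR : is_repmx.

Lemma ev1_repmx i j : ev1 (R i j) = (i == j)%:R.
Proof.
have [||||||g gE] := @qmx_point k false false 0 0 0; try exact: homog0.
- by rewrite strE !mxE; ring.
- by rewrite strE !mxE; ring.
- by rewrite mul0mx !strE !mxE; ring.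
have g1 : sl_mx g = 1%:M.
  rewrite gE; apply/matrixP => a b; rewrite !mxE; apply: quad_eq => //=; by case: eqP.
have /matrixP/(_ i j) := rmx_scal RR g1.
rewrite !mxE (@reval_inf _ _ g 0 0) ?mulr0 //; last by rewrite g1 scale0r addr0.
rewrite scaler0 addr0 => /(congr1 (@q0 k)) /=; rewrite mulr1 => ->.
by case: eqP.
Qed.

Lemma rho_inf (A : superalg k) (g : SL22 A) (y : A) M : y * y = 0 ->
  sl_mx g = 1%:M + y *: map_mx (in_alg A) M ->
  evalmx R g = 1%:M + y *: map_mx (in_alg A) (dmx M).
Proof.
move=> yy gE; apply/matrixP => i j; rewrite !mxE (reval_inf yy gE) ev1_repmx.
by congr (_ + _); rewrite ?scaler_nat // -scalerAr mulr1.
Qed.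

(** The products of 1 + y M and 1 + z N in the two orders differ by the factor 1 + y z [M, N], the
    sign coming from z y = ± y z. Comparing the [y z] coefficients of the images gives the
    relation. *)
Lemma dmx_bracket p q M N : homog p M -> homog q N -> str M = 0 -> str N = 0 ->
  dmx M *m dmx N - (-1) ^+ (p && q) *: (dmx N *m dmx M) = dmx (sbracket p q M N).
Proof.
move=> hM hN sM sN; set s := (-1) ^+ (p && q).
have s0 : str (0 : 'M[k]_(2 + 2)) = 0 by rewrite strE !mxE; ring.
have [||||||g1 g1E] := @qmx_point k p q M 0 0; rewrite ?mulmx0 //; try exact: homog0.
have [||||||g2 g2E] := @qmx_point k p q 0 N 0; rewrite ?mul0mx //; try exact: homog0.
have [||||||g3 g3E] := @qmx_point k p q 0 0 (sbracket p q M N);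
  rewrite ?mul0mx ?s0 //; try exact: homog0.
- exact: homog_bracket.
- exact: str_bracket.
have [||||||g12 g12E] := @qmx_point k p q M N (M *m N) => //.
- exact: homogM.
have [||||||g21 g21E] := @qmx_point k p q M N (s *: (N *m M)) => //.
- by apply: homogZ; rewrite addbC; apply: homogM.
- by rewrite strZ (str_super hM hN).
have inf (y : qalg k p q) (g : SL22 (qalg k p q)) L :
    y * y = 0 -> sl_mx g = 1%:M + y *: map_mx (in_alg _) L ->
    evalmx R g = 1%:M + y *: map_mx (in_alg _) (dmx L) by exact: rho_inf.
have qE (m : nat) (L L' K : 'M[k]_m) : qmx p q L L' K =
   1%:M + qy k p q *: map_mx (in_alg (qalg k p q)) L
        + qz k p q *: map_mx (in_alg (qalg k p q)) L'
        + qyz k p q *: map_mx (in_alg (qalg k p q)) K.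
  by apply/matrixP => i j; rewrite !mxE; apply: quad_eq => /=; case: eqP => _ /=; ring.
have z0 (m : nat) (y : qalg k p q) : y *: map_mx (in_alg _) (0 : 'M[k]_m) = 0.
  by rewrite map_mx0 scaler0.
have r1 : evalmx R g1 = qmx p q (dmx M) 0 0.
  rewrite qE !z0 !addr0; apply: inf; last by rewrite g1E qE !z0 !addr0.
  by apply: quad_eq => /=; ring.
have r2 : evalmx R g2 = qmx p q 0 (dmx N) 0.
  rewrite qE !z0 !addr0; apply: inf; last by rewrite g2E qE !z0 !addr0.
  by apply: quad_eq => /=; ring.
have r3 : evalmx R g3 = qmx p q 0 0 (dmx (sbracket p q M N)).
  rewrite qE !z0 !addr0; apply: inf; last by rewrite g3E qE !z0 !addr0.
  by apply: quad_eq => /=; ring.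
have m12 : evalmx R g12 = evalmx R g1 *m evalmx R g2.
  apply: rmx_mul => //; rewrite g1E g2E g12E qmxM.
  by rewrite !(addr0, add0r) mulmx0 scaler0 addr0.
have m21 : evalmx R g21 = evalmx R g2 *m evalmx R g1.
  apply: rmx_mul => //; rewrite g1E g2E g21E qmxM.
  by rewrite !(addr0, add0r) mulmx0 add0r.
have m123 : evalmx R g12 = evalmx R g21 *m evalmx R g3.
  apply: rmx_mul => //; rewrite g3E g12E g21E qmxM.
  by rewrite !(addr0, add0r) !mulmx0 scaler0 !addr0 addrC subrK.
have := m123; rewrite m12 m21 r1 r2 r3 !qmxM => /qmx_inj3.
rewrite !(addr0, add0r) !mulmx0 !scaler0 !addr0 add0r => ->.
by first [rewrite addrK | rewrite addrAC subrr add0r].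
Qed.

(** The point 1 + y is a scalar matrix, so it acts trivially: the infinitesimal action factors
    through psl(2,2). *)
Lemma dmx1 : dmx 1%:M = 0.
Proof.
have s0 : str (0 : 'M[k]_(2 + 2)) = 0 by rewrite strE !mxE; ring.
have h1 : homog false (1%:M : 'M[k]_(2 + 2)).
  by move=> i j ij; rewrite mxE; have [E|//] := eqVneq i j; move: ij; rewrite E addbb.
have [||||||g gE] := @qmx_point k false false 1%:M 0 0; rewrite ?mulmx0 //; try exact: homog0.
  by rewrite strE !mxE /=; ring.
have qE (m : nat) (L : 'M[k]_m) : qmx false false L 0 0 =
   1%:M + qy k false false *: map_mx (in_alg (qalg k false false)) L.
  by apply/matrixP => i j; rewrite !mxE; apply: quad_eq => /=; case: eqP => _ /=; ring.
have r1 : evalmx R g = qmx false false (dmx 1%:M) 0 0.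
  rewrite qE; apply: rho_inf; last by rewrite gE qE.
  by apply: quad_eq => /=; ring.
have r2 : evalmx R g = 1%:M.
  apply: (rmx_scal RR (a := Quad 1 1 0 0 : qalg k false false)); rewrite gE.
  by apply/matrixP => i j; rewrite !mxE; case: eqP => _ /=; apply: quad_eq.
apply/matrixP => i j; rewrite mxE.
have := congr1 (fun G : 'M[qalg k false false]_n => q1 (G i j)) r1.
by rewrite r2 !mxE /= => E; rewrite -E; case: (i == j).
Qed.
End RepMatrices.

(** * Polynomial identities tested on scalars, and even points of SL(2,2) *)

Section CharZero.
Variables (k : fieldType) (char0 : [pchar k] =i pred0).

Lemma natk_eq0 n : (n%:R == 0 :> k) = (n == 0)%N.
Proof. by move: n; apply/pcharf0P. Qed.

Lemma natk_inj : injective (fun n : nat => n%:R : k).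
Proof.
move=> m n /eqP; wlog le : m n / (m <= n)%N => [H E|].
  by have [/H->|/ltnW/H E'] := leqP m n => //; rewrite E' // eq_sym.
by rewrite eq_sym -subr_eq0 -natrB // natk_eq0 subn_eq0 => nm; apply/eqP; rewrite eqn_leq le.
Qed.

Lemma intk_eq0 (z : int) : (z%:~R == 0 :> k) = (z == 0).
Proof.
case: z => n; first by rewrite -pmulrn natk_eq0.
by rewrite NegzE mulrNz oppr_eq0 -pmulrn natk_eq0.
Qed.

Lemma intk_inj : injective (fun z : int => z%:~R : k).
Proof. by move=> x y /eqP; rewrite -subr_eq0 -intrB intk_eq0 subr_eq0 => /eqP. Qed.

Lemma poly_eq0_inf (p : {poly k}) : (forall t, t != 0 -> p.[t] = 0) -> p = 0.
Proof.
move=> H; apply/eqP; apply: contraT => p0.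
(* The [size p] distinct nonzero scalars 1, 2, ..., more than the roots of a nonzero [p]. *)
pose rs := [seq (i.+1)%:R : k | i <- iota 0 (size p)].
have : (size rs < size p)%N.
  apply: max_poly_roots => //.
    by apply/allP => t /mapP[i _ ->]; rewrite rootE H // natk_eq0.
  by rewrite map_inj_uniq ?iota_uniq // => i j /natk_inj [].
by rewrite size_map size_iota ltnn.
Qed.
End CharZero.

Section EvenPoints.
Variables (k : fieldType) (A : superalg k).

Lemma par_l (i : 'I_2) : par22 (lshift 2 i) = false.
Proof. by rewrite /par22 leqNgt /= ltn_ord. Qed.
Lemma par_r (i : 'I_2) : par22 (rshift 2 i) = true.
Proof. by rewrite /par22 leq_addr. Qed.

Lemma hom1mx b n (i j : 'I_n) : sa_hom false ((1%:M : 'M[A]_n) i j) /\ sa_hom b ((0 : 'M[A]_n) i j).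
Proof.
split; rewrite mxE; last exact: sa_hom0.
by case: eqP => _; [exact: sa_hom1|exact: sa_hom0].
Qed.

(** With a zero upper right block the Berezinian is det A0 / det D0, so a common inverse [x] of the
    two determinants is exactly the required datum. *)
Lemma point_lower (A0 D0 C : 'M[A]_2) x :
  (forall i j, sa_hom false (A0 i j)) -> (forall i j, sa_hom false (D0 i j)) ->
  (forall i j, sa_hom true (C i j)) -> \det A0 * x = 1 -> \det D0 * x = 1 ->
  exists g : SL22 A, sl_mx g = block_mx A0 0 C D0.
Proof.
move=> hA hD hC dA dD; set G := block_mx A0 0 C D0.
have ev i j : sa_hom (par22 i (+) par22 j) (G i j).
  case: (split_ordP i) => i' ->; case: (split_ordP j) => j' ->.
  - by rewrite block_mxEul !par_l.
  - by rewrite block_mxEur !par_l par_r mxE; apply: sa_hom0.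
  - by rewrite block_mxEdl !par_l par_r.
  - by rewrite block_mxEdr !par_r.
have pA : \det (ulsubmx G) * x = 1 by rewrite block_mxKul.
have pD : \det (drsubmx G) * x = 1 by rewrite block_mxKdr.
have pB : \det (ulsubmx G - ursubmx G *m (x%:M *m \adj (drsubmx G)) *m dlsubmx G) * x = 1.
  by rewrite block_mxKur !mul0mx subr0.
by exists (SL22Point ev pA pD pB).
Qed.

Lemma point_upper (Y : 'M[A]_2) : (forall i j, sa_hom true (Y i j)) ->
  exists g : SL22 A, sl_mx g = block_mx 1%:M Y 0 1%:M.
Proof.
move=> hY; set G := block_mx 1%:M Y 0 1%:M.
have ev i j : sa_hom (par22 i (+) par22 j) (G i j).
  case: (split_ordP i) => i' ->; case: (split_ordP j) => j' ->.
  - by rewrite block_mxEul !par_l; case: (hom1mx true i' j').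
  - by rewrite block_mxEur !par_l par_r.
  - by rewrite block_mxEdl !par_l par_r mxE; apply: sa_hom0.
  - by rewrite block_mxEdr !par_r; case: (hom1mx true i' j').
have d1 : \det (1%:M : 'M[A]_2) * 1 = 1.
  by rewrite det2E !mxE /= !mulr1 mulr0 subr0.
have pA : \det (ulsubmx G) * 1 = 1 by rewrite block_mxKul.
have pD : \det (drsubmx G) * 1 = 1 by rewrite block_mxKdr.
have pB : \det (ulsubmx G - ursubmx G *m (1%:M *m \adj (drsubmx G)) *m dlsubmx G) * 1 = 1.
  by rewrite block_mxKdl mulmx0 subr0.
by exists (SL22Point ev pA pD pB).
Qed.

Lemma point_even (A0 D0 : 'M[A]_2) x :
  (forall i j, sa_hom false (A0 i j)) -> (forall i j, sa_hom false (D0 i j)) ->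
  \det A0 * x = 1 -> \det D0 * x = 1 ->
  exists g : SL22 A, sl_mx g = block_mx A0 0 0 D0.
Proof.
by move=> hA hD; apply: point_lower => // i j; rewrite mxE; apply: sa_hom0.
Qed.

Definition mx2 (a b c d : A) : 'M[A]_2 :=
  \matrix_(i, j) if i == 0 then (if j == 0 then a else b) else (if j == 0 then c else d).

Lemma mx2_eta (G : 'M[A]_2) : G = mx2 (G 0 0) (G 0 1) (G 1 0) (G 1 1).
Proof. by apply/matrixP; apply: ord2_ind; apply: ord2_ind; rewrite !mxE. Qed.

Lemma mx2M a b c d a' b' c' d' : mx2 a b c d *m mx2 a' b' c' d' =
  mx2 (a * a' + b * c') (a * b' + b * d') (c * a' + d * c') (c * b' + d * d').
Proof.
by apply/matrixP; apply: ord2_ind; apply: ord2_ind; rewrite !mxE sum2 !mxE.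
Qed.

Lemma mx2_1 : 1%:M = mx2 1 0 0 1.
Proof. by apply/matrixP; apply: ord2_ind; apply: ord2_ind; rewrite !mxE. Qed.

Lemma det_mx2 a b c d : \det (mx2 a b c d) = a * d - b * c.
Proof. by rewrite det2E !mxE. Qed.

Definition emb (blk : bool) (G : 'M[A]_2) : 'M[A]_(2 + 2) :=
  if blk then block_mx 1%:M 0 0 G else block_mx G 0 0 1%:M.

Lemma embM blk G H : emb blk (G *m H) = emb blk G *m emb blk H.
Proof.
by rewrite /emb; case: blk; rewrite mulmx_block !(mul0mx, mulmx0, mulmx1, mul1mx, addr0, add0r).
Qed.

Lemma emb_point blk a b c d : sa_hom false a -> sa_hom false b ->
  sa_hom false c -> sa_hom false d -> a * d - b * c = 1 ->
  exists g : SL22 A, sl_mx g = emb blk (mx2 a b c d).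
Proof.
move=> ha hb hc hd D1.
have h : forall i j, sa_hom false (mx2 a b c d i j).
  by apply: ord2_ind; apply: ord2_ind; rewrite mxE.
have h1 (i j : 'I_2) : sa_hom false ((1%:M : 'M[A]_2) i j) by case: (hom1mx true i j).
have d1 : \det (1%:M : 'M[A]_2) * 1 = 1.
  by rewrite det2E !mxE /= !mulr1 mulr0 subr0.
by rewrite /emb; case: blk; apply: (@point_even _ _ 1) => //; rewrite det_mx2 mulr1.
Qed.
End EvenPoints.

Lemma taylor1 (k : fieldType) (A : superalg k) (s : k) (y : A) (p : {poly k}) :
  y * y = 0 -> horner_alg (s%:A + y) p = (p.[s])%:A + (p^`()).[s] *: y.
Proof.
move=> yy; elim/poly_ind: p => [|p c IHp].
  by rewrite rmorph0 deriv0 !horner0 !scale0r addr0.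
rewrite rmorphD rmorphM /= horner_algX horner_algC IHp derivD derivM derivX derivC.
rewrite !hornerE; rewrite mulrDl !mulrDr.
have -> : p.[s]%:A * s%:A = (p.[s] * s)%:A :> A by rewrite -scalerAl mul1r scalerA.
have -> : p.[s]%:A * y = p.[s] *: y by rewrite -scalerAl mul1r.
have -> : (p^`()).[s] *: y * s%:A = ((p^`()).[s] * s) *: y.
  by rewrite -scalerAl -scalerAr mulr1 scalerA.
rewrite -scalerAl yy scaler0 addr0 !scalerDl -!addrA; congr (_ + _).
by first [rewrite addrA addrC; congr (_ + _); exact: addrC | rewrite addrA addrC].
Qed.

(** * Subspaces stable under the Lie superalgebra are subrepresentations *)

Section Stability.
Variables (k : fieldType) (char0 : [pchar k] =i pred0).
Variables (n : nat) (R : 'I_n -> 'I_n -> regexpr k) (RR : is_repmx R).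
Variables (C B : 'M[k]_n).

(* With [C = 1 - B] and [B] idempotent, [stable g] says that the image of [B]
   is stable under [g]. *)
Definition stable (A : superalg k) (g : SL22 A) :=
  map_mx (in_alg A) C *m evalmx R g *m map_mx (in_alg A) B = 0.

Hypothesis CB : C + B = 1%:M.
Hypothesis BB : B *m B = B.

Lemma stableE A (g : SL22 A) : stable g ->
  evalmx R g *m map_mx (in_alg A) B =
  map_mx (in_alg A) B *m (evalmx R g *m map_mx (in_alg A) B).
Proof.
rewrite /stable -mulmxA => st; rewrite -[LHS]mul1mx -(map_mx1 (in_alg A)) -CB.
by rewrite map_mxD mulmxDl st add0r.
Qed.

Lemma stable_mul A (g h gh : SL22 A) : sl_mx gh = sl_mx g *m sl_mx h ->
  stable g -> stable h -> stable gh.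
Proof.
move=> E sg sh; rewrite /stable (rmx_mul RR E) -!mulmxA (stableE sh).
rewrite !mulmxA (sg : map_mx (in_alg A) C *m evalmx R g *m map_mx (in_alg A) B = 0).
by rewrite !mul0mx.
Qed.

Lemma CB0 : C *m B = 0.
Proof. by rewrite -[C](addrK B) CB mulmxBl mul1mx BB subrr. Qed.

Lemma stable_inf (A : superalg k) (g : SL22 A) (y : A) M : y * y = 0 ->
  sl_mx g = 1%:M + y *: map_mx (in_alg A) M ->
  C *m dmx R M *m B = 0 -> stable g.
Proof.
move=> yy gE st; rewrite /stable (rho_inf RR yy gE) mulmxDr mulmx1 mulmxDl.
rewrite -map_mxM CB0 map_mx0 add0r.
have -> : map_mx (in_alg A) C *m (y *: map_mx (in_alg A) (dmx R M)) =
          y *: map_mx (in_alg A) (C *m dmx R M).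
  apply/matrixP => i j; rewrite !mxE rmorph_sum mulr_sumr; apply: eq_bigr => l _.
  by rewrite !mxE rmorphM /= mulrA algE_comm -mulrA.
by rewrite -scalemxAl -map_mxM st map_mx0 scaler0.
Qed.

Lemma central_mul (A : superalg k) m (c : A) (D : 'M[k]_(m, n)) (G : 'M[A]_n) :
  map_mx (in_alg A) D *m (c *: G) = c *: (map_mx (in_alg A) D *m G).
Proof.
apply/matrixP => i j; rewrite !mxE mulr_sumr; apply: eq_bigr => l _.
by rewrite !mxE mulrA algE_comm -mulrA.
Qed.

Lemma stable_horner (A : superalg k) (g : SL22 A) (c s : A) (Q : 'M[{poly k}]_n) :
  c *: evalmx R g = map_mx (horner_alg s) Q ->
  map_mx polyC C *m Q *m map_mx polyC B = 0 ->
  c *: (map_mx (in_alg A) C *m evalmx R g *m map_mx (in_alg A) B) = 0.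
Proof.
move=> E Z; rewrite scalemxAl -central_mul E.
have CE m p (D : 'M[k]_(m, p)) :
    map_mx (in_alg A) D = map_mx (horner_alg s) (map_mx polyC D).
  by apply/matrixP => i j; rewrite !mxE; apply: esym (horner_algC _ _).
by rewrite !CE -!map_mxM Z map_mx0.
Qed.

Section Unipotent.
Variables (i j : 'I_(2 + 2)).
Hypothesis ij : i != j.
Hypothesis pij : par22 i = par22 j.

(** The function along 1 + s E_ij as a polynomial in [s]; both block determinants equal 1 there,
    whence the two constant cases. *)
Fixpoint upoly (e : regexpr k) : {poly k} :=
  match e with
  | Entry a b => ((a == b)%:R)%:P + ((a == i) && (b == j))%:R%:P * 'X
  | InvDetA | InvDetD => 1
  | Const c => c%:P
  | Add e e' => upoly e + upoly e'
  | Mul e e' => upoly e * upoly e'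
  end.

Definition umx (A : superalg k) (s : A) : 'M[A]_(2 + 2) := 1%:M + s *: delta_mx i j.

Lemma umx_det (A : superalg k) (s : A) :
  \det (ulsubmx (umx s)) = 1 /\ \det (drsubmx (umx s)) = 1.
Proof.
rewrite !det2E !mxE /= -!/e0 -!/e1 -!/f0 -!/f1.
move: i j ij pij; apply: ord4_ind; apply: ord4_ind => // _ _;
  by rewrite /= !(mulr0, mulr1, addr0, add0r, mul0r, subr0).
Qed.

Lemma umx_point (A : superalg k) (s : A) : sa_hom false s ->
  exists g : SL22 A, sl_mx g = umx s.
Proof.
move=> hs; have [dA dD] := umx_det s.
have hu a b : par22 a (+) par22 b = false -> sa_hom false (umx s a b).
  move=> _; rewrite !mxE; apply: homD; first by case: eqP => _; [exact: sa_hom1|exact: sa_hom0].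
  by case: (_ && _); rewrite ?mulr1 ?mulr0 //; exact: sa_hom0.
have E : umx s = block_mx (ulsubmx (umx s)) 0 0 (drsubmx (umx s)).
  rewrite -[LHS]submxK; congr block_mx; apply/matrixP => a b; rewrite !mxE;
  rewrite ?eq_lrshift ?eq_rlshift add0r;
  have [ea|_] := eqVneq _ i => /=; rewrite ?mulr0 //;
  have [eb|_] := eqVneq _ j => /=; rewrite ?mulr0 //;
  by have := pij; rewrite -ea -eb par_l par_r.
rewrite E; apply: (@point_even _ _ _ _ 1) => [a b|a b||]; rewrite ?mulr1 //.
- by rewrite !mxE; have := hu (lshift 2 a) (lshift 2 b); rewrite !par_l !mxE; apply.
- by rewrite !mxE; have := hu (rshift 2 a) (rshift 2 b); rewrite !par_r !mxE; apply.
Qed.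

Lemma reval_umx (A : superalg k) (g : SL22 A) s e :
  sl_mx g = umx s -> reval g e = horner_alg s (upoly e).
Proof.
move=> gE; have [dA dD] := umx_det s.
elim: e => [a b|||c|e He e' He'|e He e' He'] /=.
- rewrite gE !mxE rmorphD rmorphM /= !horner_algC horner_algX scaler_nat.
  by congr (_ + _); case: (_ && _); rewrite ?scale1r ?scale0r ?mulr1 ?mul1r ?mulr0 ?mul0r.
- by rewrite rmorph1; apply: invA_uniq; rewrite gE dA mulr1.
- by rewrite rmorph1; apply: invD_uniq; rewrite gE dD mulr1.
- by rewrite horner_algC.
- by rewrite rmorphD He He'.
- by rewrite rmorphM He He'.
Qed.

Definition umatrix : 'M[{poly k}]_n := \matrix_(a, b) upoly (R a b).

Lemma rho_umx (A : superalg k) (g : SL22 A) s :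
  sl_mx g = umx s -> evalmx R g = map_mx (horner_alg s) umatrix.
Proof. by move=> gE; apply/matrixP => a b; rewrite !mxE (reval_umx _ gE). Qed.

Lemma upoly_ev1 e : (upoly e).[0] = ev1 e.
Proof.
elim: e => [a b|||c|e He e' He'|e He e' He'] /=; rewrite ?hornerE ?He ?He' //.
Qed.

(** The derivative of the group law: the point at s + y is the product of the points at [s] and at
    [y], and the coefficient of [y] is compared at every scalar [s]. *)
Lemma umatrix_deriv : map_mx (fun p => p^`()) umatrix =
  umatrix *m map_mx polyC (dmx R (delta_mx i j)).
Proof.
apply/matrixP => a b; rewrite [LHS]mxE; apply/eqP; rewrite -subr_eq0; apply/eqP.
apply: (poly_eq0_inf char0) => s _.
pose A := qalg k false false; pose y : A := qy k false false.
have yy : y * y = 0 by apply: quad_eq => /=; ring.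
have ey : sa_hom false y by [].
have [g1 g1E] := umx_point (hom_alg A s); have [g2 g2E] := umx_point ey.
have [g12 g12E] := umx_point (homD (hom_alg A s) ey).
have EE : sl_mx g12 = sl_mx g1 *m sl_mx g2.
  rewrite g1E g2E g12E /umx mulmxDl mul1mx mulmxDr mulmx1.
  rewrite -scalemxAl -[X in _ = _ + (_ + X)]/(_ *: (_ *m _)).
  have -> : delta_mx i j *m (y *: delta_mx i j) = 0 :> 'M[A]_(2 + 2).
    apply/matrixP => u v; rewrite !mxE big1 // => l _; rewrite !mxE.
    have [->|_] := eqVneq l j; last by rewrite andbF mul0r.
    have /negPf -> : j != i by rewrite eq_sym.
    by rewrite /= mulr0 mulr0.
  by rewrite scaler0 addr0 scalerDl -!addrA; congr (_ + _); rewrite addrC.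
have g2E' : sl_mx g2 = 1%:M + y *: map_mx (in_alg A) (delta_mx i j).
  rewrite g2E /umx; congr (_ + _ *: _); apply/matrixP => u v; rewrite !mxE.
  by rewrite rmorph_nat.
have /matrixP/(_ a b) := rmx_mul RR EE; rewrite (rho_inf RR yy g2E').
rewrite !mxE (reval_umx _ g12E) (taylor1 _ _ yy) => /(congr1 (@q1 k)) /=.
rewrite q1_sum hornerD hornerN horner_sum => E; apply/eqP; rewrite subr_eq0; apply/eqP.
apply: etrans (etrans _ E) _.
  by rewrite mulr0 add0r mulr1.
apply: eq_bigr => l _; rewrite !mxE (reval_umx _ g1E) hornerM hornerC.
have := taylor1 s (upoly (R a l)) (mulr0 (0 : A)); rewrite scaler0 !addr0 => ->.
by rewrite /=; case: eqP => _ /=; ring.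
Qed.

Hypothesis st : C *m dmx R (delta_mx i j) *m B = 0.

(** The matrix [Z] solves Z' = Z K with constant K and Z(0) = C B = 0, so its coefficients vanish
    one after the other; characteristic 0 allows the division by m + 1. *)
Lemma umatrix_stable : map_mx polyC C *m umatrix *m map_mx polyC B = 0.
Proof.
set Z := LHS.
have Zd : map_mx (fun p => p^`()) Z = Z *m map_mx polyC (dmx R (delta_mx i j) *m B).
  have dM m p q (D : 'M[k]_(m, p)) (Q : 'M[{poly k}]_(p, q)) :
      map_mx (fun p => p^`()) (map_mx polyC D *m Q) =
      map_mx polyC D *m map_mx (fun p => p^`()) Q.
    apply/matrixP => a b; rewrite !mxE linear_sum; apply: eq_bigr => l _.
    by rewrite /= !mxE derivM derivC mul0r add0r.
  have dMr m p q (D : 'M[k]_(p, q)) (Q : 'M[{poly k}]_(m, p)) :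
      map_mx (fun p => p^`()) (Q *m map_mx polyC D) =
      map_mx (fun p => p^`()) Q *m map_mx polyC D.
    apply/matrixP => a b; rewrite !mxE linear_sum; apply: eq_bigr => l _.
    by rewrite /= !mxE derivM derivC mulr0 addr0.
  rewrite /Z dMr dM umatrix_deriv -!mulmxA -!map_mxM; do 2 congr (_ *m _).
  congr (map_mx _ _).
  by rewrite -[LHS]mul1mx -CB mulmxDl mulmxA st add0r.
have co m : map_mx (fun p : {poly k} => p`_m) Z = 0.
  elim: m => [|m IHm].
    apply/matrixP => a b; rewrite mxE [RHS]mxE -horner_coef0.
    have -> : (Z a b).[0] = (C *m B) a b; last by rewrite CB0 mxE.
    have -> : C *m B = C *m (map_mx (horner_eval 0) umatrix) *m B.
      rewrite (_ : map_mx _ _ = 1%:M) ?mulmx1 //; apply/matrixP => u v.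
      by rewrite !mxE /horner_eval upoly_ev1 (ev1_repmx RR).
    have CE m p (D : 'M[k]_(m, p)) : D = map_mx (horner_eval 0) (map_mx polyC D).
      by apply/matrixP => u v; rewrite !mxE /horner_eval hornerC.
    by rewrite [in RHS](CE _ _ C) [in RHS](CE _ _ B) -!map_mxM [RHS]mxE.
  apply/matrixP => a b; rewrite mxE [RHS]mxE.
  have E : (Z a b)`_m.+1 *+ m.+1 = 0.
    have /matrixP/(_ a b) := Zd.
    rewrite mxE => /(congr1 (fun p : {poly k} => p`_m)); rewrite coef_deriv => ->.
    rewrite mxE coef_sum big1 // => l _; rewrite [map_mx polyC _ _ _]mxE coefMC.
    by have /matrixP/(_ a l) := IHm; rewrite !mxE => ->; rewrite mul0r.
  by move/eqP: E; rewrite -mulr_natr mulf_eq0 natk_eq0 // orbF => /eqP.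
apply/matrixP => a b; rewrite [RHS]mxE; apply/polyP => m.
by have /matrixP/(_ a b) := co m; rewrite !mxE coef0.
Qed.

Lemma stable_umx (A : superalg k) (g : SL22 A) s : sl_mx g = umx s -> stable g.
Proof.
move=> gE; rewrite /stable -[LHS]scale1r.
apply: (@stable_horner _ _ _ s umatrix); last exact: umatrix_stable.
by rewrite scale1r; apply: rho_umx.
Qed.
End Unipotent.
End Stability.

(** * Density arguments in charts with one denominator *)

Section Charts.
Variables (k : fieldType) (P : comNzRingType) (z : P) (constP : {rmorphism k -> P}).
(** [F g ev] means that [g] is the point whose chart coordinates are the values of [ev]; [z] is the
    denominator of the chart. *)
Variable F : forall A : superalg k, SL22 A -> {rmorphism P -> A} -> Prop.
Hypothesis Fz : forall A g ev, @F A g ev -> sa_hom false (ev z).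
Hypothesis Fc : forall A g ev, @F A g ev -> forall c, ev (constP c) = c%:A.
Hypothesis Fentry : forall i j, exists p, forall A g ev, @F A g ev -> ev z * g i j = ev p.
Hypothesis FinvA : exists p, forall A g ev, @F A g ev -> ev z * sl_invA g = ev p.
Hypothesis FinvD : exists p, forall A g ev, @F A g ev -> ev z * sl_invD g = ev p.

(* After multiplication by a power of [z], regular functions become polynomial
   in the coordinates of the chart; no localization is needed. *)
Lemma chart_reval e : exists N0 : nat, forall N, (N0 <= N)%N -> exists p : P,
  forall A g ev, @F A g ev -> ev z ^+ N * reval g e = ev p.
Proof.
have atom (f : forall A, SL22 A -> A) :
    (exists p, forall A g ev, @F A g ev -> ev z * f A g = ev p) ->
    exists N0 : nat, forall N, (N0 <= N)%N -> exists p : P,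
      forall A g ev, @F A g ev -> ev z ^+ N * f A g = ev p.
  move=> [p pE]; exists 1%N => -[//|N] _; exists (z ^+ N * p) => A g ev Fg.
  by rewrite exprSr -mulrA (pE _ _ _ Fg) rmorphM rmorphXn.
elim: e => [i j|||c|e [N1 H1] e' [N2 H2]|e [N1 H1] e' [N2 H2]].
- exact: (atom (fun A g => sl_mx g i j)).
- exact: (atom (fun A g => sl_invA g)).
- exact: (atom (fun A g => sl_invD g)).
- exists 0%N => N _; exists (z ^+ N * constP c) => A g ev Fg.
  by rewrite rmorphM rmorphXn (Fc Fg).
- exists (maxn N1 N2) => N; rewrite geq_max => /andP[/H1 [p pE] /H2 [q qE]].
  by exists (p + q) => A g ev Fg /=; rewrite mulrDr (pE _ _ _ Fg) (qE _ _ _ Fg) rmorphD.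
- exists (N1 + N2)%N => N le.
  have [p pE] := H1 (N - N2)%N ltac:(lia); have [q qE] := H2 N2 (leqnn _).
  exists (p * q) => A g ev Fg /=; rewrite rmorphM -(pE _ _ _ Fg) -(qE _ _ _ Fg).
  have ez := homX N2 (Fz Fg).
  have -> : (N = (N - N2) + N2)%N by lia.
  rewrite exprD addnK -!mulrA; congr (_ * _).
  by rewrite !mulrA (even_comm _ ez).
Qed.

Lemma chart_mx n (R : 'I_n -> 'I_n -> regexpr k) : exists (N : nat) (Q : 'M[P]_n),
  forall A g ev, @F A g ev -> ev z ^+ N *: evalmx R g = map_mx ev Q.
Proof.
have /fin_all_exists [Nf HN] (ij : 'I_n * 'I_n) := chart_reval (R ij.1 ij.2).
pose N := (\sum_ij Nf ij)%N.
have le ij : (Nf ij <= N)%N by rewrite /N (bigD1 ij) //= leq_addr.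
have /fin_all_exists [Qf HQ] (ij : 'I_n * 'I_n) := HN ij N (le ij).
exists N, (\matrix_(i, j) Qf (i, j)) => A g ev Fg.
by apply/matrixP => i j; rewrite !mxE -(HQ (i, j) _ _ _ Fg).
Qed.

(** Stability over the chart is the vanishing of one matrix over [P], and the first hypothesis is
    density of the [k]-points. Stability at these points thus spreads to all points of the chart up
    to a power of the denominator, even where the latter is a zero divisor. *)
Lemma chart_stable n (R : 'I_n -> 'I_n -> regexpr k) (C B : 'M[k]_n) :
  (forall p : P, (forall (g : SL22 (kalg k)) ev, @F (kalg k) g ev -> ev p = 0) -> p = 0) ->
  (forall (g : SL22 (kalg k)) ev, @F (kalg k) g ev -> stable R C B g) ->
  exists N : nat, forall A g ev, @F A g ev ->
  ev z ^+ N *: (map_mx (in_alg A) C *m evalmx R g *m map_mx (in_alg A) B) = 0.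
Proof.
move=> Pz Fs; have [N [Q QE]] := chart_mx R; exists N.
have E A g ev : @F A g ev ->
    ev z ^+ N *: (map_mx (in_alg A) C *m evalmx R g *m map_mx (in_alg A) B) =
    map_mx ev (map_mx constP C *m Q *m map_mx constP B).
  move=> Fg; rewrite scalemxAl -central_mul (QE _ _ _ Fg) !map_mxM.
  by congr (_ *m _ *m _); apply/matrixP => i j; rewrite !mxE (Fc Fg).
suff Z : map_mx constP C *m Q *m map_mx constP B = 0.
  by move=> A g ev Fg; rewrite (E _ _ _ Fg) Z map_mx0.
apply/matrixP => i j; rewrite [RHS]mxE; apply: Pz => g ev Fg.
have := E _ _ _ Fg; rewrite (Fs _ _ Fg) scaler0 => /matrixP/(_ i j).
by rewrite [LHS]mxE [RHS]mxE => <-.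
Qed.
End Charts.

Section PolynomialCharts.
Import mpoly.
Variables (k : fieldType) (char0 : [pchar k] =i pred0).

(** Evaluation of polynomials is multiplicative because even elements are central. *)
Lemma mev_exists (A : superalg k) (v : 'I_3 -> A) : (forall i, sa_hom false (v i)) ->
  exists ev : {rmorphism mpoly 3 k -> A},
    [/\ forall p, ev p = mmap (in_alg A) v p, forall i, ev 'X_i = v i &
        forall c, ev (mpolyC 3 c) = c%:A].
Proof.
move=> hv.
have cv i x : GRing.comm x (v i) by apply/esym/even_comm.
have cc (p : mpoly 3 k) m m' : GRing.comm (in_alg A (mcoeff m p)) (mmap1 v m').
  exact: algE_comm.
have [H1 H2] := commr_mmap_is_multiplicative cv cc.
pose f : mpoly 3 k -> A := mmap (in_alg A) v.
have fB : {morph f : x y / x - y} by move=> x y; apply: (raddfB (mmap _ _)).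
pose ha := GRing.isZmodMorphism.Build _ _ f fB.
pose hm := GRing.isMonoidMorphism.Build _ _ f (conj H2 H1).
pose ev : {rmorphism mpoly 3 k -> A} := HB.pack f ha hm.
exists ev; split=> [//|i|c]; rewrite -[LHS]/(f _) /f.
  by rewrite mmapX mmap1U.
by rewrite mmapC.
Qed.

Lemma digit K a a' x x' : (a < K)%N -> (a' < K)%N -> (a + K * x = a' + K * x')%N ->
  a = a' /\ x = x'.
Proof.
move=> aK aK' E; have E' := congr1 (modn^~ K) E.
move: E'; rewrite /= ![(_ + K * _)%N]addnC ![(K * _)%N]mulnC !modnMDl !modn_small // => aa.
split=> //; move: E; rewrite aa => /addnI /eqP.
by rewrite eqn_pmul2l ?(leq_trans _ aK) // => /eqP.
Qed.

(** Kronecker substitution: with K above the degree, (t, t^K, t^(K^2)) sends distinct monomials of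
    [p] to distinct powers of [t]. Such test points have nonzero coordinates, so the denominator of
    the chart is invertible at them. *)
Lemma mpoly_eq0_inf (p : mpoly 3 k) :
  (forall t : k, t != 0 -> forall a b c : nat,
     mmap (in_alg (kalg k)) (fun i : 'I_3 => (t : kalg k) ^+ nth 0%N [:: a; b; c] i) p = 0) -> p = 0.
Proof.
move=> H; apply/mpolyP => m0; rewrite mcoeff0.
have [//|/eqP m0p] := eqVneq (mcoeff m0 p) 0.
have [K KE] : exists K, K = (msize p).+1 by eexists.
pose kap (m : 'X_{1..3}) := (m 0%R + K * m 1%R + K * K * m (inord 2))%N.
have bnd m : m \in msupp p -> forall i, (m i < K)%N.
  move=> mp i; rewrite KE ltnS; apply: leq_trans (ltnW (msize_mdeg_lt mp)).
  by rewrite mdegE (bigD1 i) //= leq_addr.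
have kinj m m' : m \in msupp p -> m' \in msupp p -> kap m = kap m' -> m = m'.
  move=> /bnd hm /bnd hm'; rewrite /kap => E.
  have := hm 0%R; have := hm 1%R; have := hm (inord 2).
  have := hm' 0%R; have := hm' 1%R; have := hm' (inord 2).
  move=> b5 b4 b3 b2 b1 b0.
  have [E0 /(digit b1 b4) [E1 E2]] : m 0%R = m' 0%R /\
      (m 1%R + K * m (inord 2) = m' 1%R + K * m' (inord 2))%N.
    by apply: (@digit K _ _ _ _ b0 b3); rewrite !mulnDr !mulnA !addnA; exact: E.
  apply/mnmP => -[[|[|[|]]]] // i.
  - by rewrite (_ : Ordinal i = 0%R) //; apply/val_inj.
  - by rewrite (_ : Ordinal i = 1%R) //; apply/val_inj.
  - by rewrite (_ : Ordinal i = inord 2) //; apply/val_inj; rewrite /= inordK.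
have tm (t : k) m : mmap1 (fun i : 'I_3 => (t : kalg k) ^+ nth 0%N [:: 1; K; (K * K)%N]%N i) m = (t : kalg k) ^+ kap m.
  rewrite /mmap1 !big_ord_recl big_ord0 /= mulr1 -!exprM -!exprD /kap.
  have h1 : lift ord0 ord0 = 1%R :> 'I_3 by apply/val_inj.
  have h2 : lift ord0 (lift ord0 ord0) = inord 2 :> 'I_3 by apply/val_inj; rewrite /= inordK.
  by rewrite h1 h2 addnA mul1n.
pose P := \sum_(m <- msupp p) (mcoeff m p) *: ('X^(kap m) : {poly k}).
have P0 : P = 0.
  apply: (poly_eq0_inf char0) => t t0; rewrite -[RHS](H t t0 1 K (K * K)%N).
  rewrite /mmap /P horner_sum; apply: eq_bigr => m _.
  by rewrite hornerZ hornerXn tm /= [_%:A]mulr1.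
have m0s : m0 \in msupp p by rewrite mcoeff_msupp; apply/eqP.
have := congr1 (fun q : {poly k} => q`_(kap m0)) P0; rewrite /P coef_sum coef0.
rewrite (bigD1_seq m0) //= ?msupp_uniq // coefZ coefXn eqxx mulr1.
rewrite big_seq_cond big1 ?addr0 // => m /andP[ms mm].
rewrite coefZ coefXn; case: eqP => [E|_]; last by rewrite mulr0.
by rewrite (kinj _ _ m0s ms E) eqxx in mm.
Qed.
End PolynomialCharts.

Lemma emb_det (k : fieldType) (A : superalg k) blk (a b c d : A) : a * d - b * c = 1 ->
  \det (ulsubmx (emb blk (mx2 a b c d))) = 1 /\ \det (drsubmx (emb blk (mx2 a b c d))) = 1.
Proof.
have d1 : \det (1%:M : 'M[A]_2) = 1 by rewrite det2E !mxE /= !mulr1 mulr0 subr0.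
by move=> D; rewrite /emb; case: blk; rewrite ?block_mxKul ?block_mxKdr det_mx2.
Qed.

Lemma mx2_congr (k : fieldType) (A : superalg k) (a b c d a' b' c' d' : A) :
  a = a' -> b = b' -> c = c' -> d = d' -> mx2 a b c d = mx2 a' b' c' d'.
Proof. by move=> -> -> -> ->. Qed.

(** * From Lie stability to stability under every point *)

Section Density.
Variables (k : closedFieldType) (char0 : [pchar k] =i pred0).
Variables (n : nat) (R : 'I_n -> 'I_n -> regexpr k) (RR : is_repmx R).
Variables (C B : 'M[k]_n).
Hypothesis CB : C + B = 1%:M.
Hypothesis BB : B *m B = B.
Hypothesis dst : forall p M, homog p M -> str M = 0 -> C *m dmx R M *m B = 0.
Local Notation st := (stable R C B).

Let Z (A : superalg k) (g : SL22 A) :=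
  map_mx (in_alg A) C *m evalmx R g *m map_mx (in_alg A) B.

Lemma homog_delta i j : homog (par22 i (+) par22 j) (delta_mx i j : 'M[k]_(2 + 2)).
Proof.
move=> a b ab; rewrite mxE; have [ai|//] := eqVneq a i; have [bj|//] := eqVneq b j.
by move: ab; rewrite ai bj eqxx.
Qed.

Lemma str_delta i j : i != j -> str (delta_mx i j : 'M[k]_(2 + 2)) = 0.
Proof.
move=> ij; have d a : (delta_mx i j : 'M[k]_(2 + 2)) a a = 0.
  by rewrite mxE; have [->|//] := eqVneq a i; rewrite (negPf ij).
by rewrite strE !d; ring.
Qed.

Lemma odd_sq (A : superalg k) (y : A) : sa_hom true y -> y * y = 0.
Proof.
move=> hy; have := sa_comm hy hy; rewrite /= mulN1r => E.
have : (2%:R : k) *: (y * y) = 0 by rewrite scaler_nat mulr2n {1}E addNr.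
move/(congr1 (fun x => (2%:R : k)^-1 *: x)); rewrite scaler0 scalerA mulVf ?scale1r //.
by rewrite natk_eq0.
Qed.

Lemma stable_odd1 (A : superalg k) (g : SL22 A) i j y : sa_hom true y ->
  par22 i (+) par22 j -> sl_mx g = 1%:M + y *: delta_mx i j -> st g.
Proof.
move=> hy pij gE; apply: (stable_inf RR CB BB (odd_sq hy) (M := delta_mx i j)).
  rewrite gE; congr (_ + _ *: _); apply/matrixP => u v; rewrite !mxE.
  by rewrite rmorph_nat.
apply: (dst (@homog_delta i j)); apply: str_delta.
by apply: contraTneq pij => ->; rewrite addbb.
Qed.

Section OddUnipotent.
Variables (A : superalg k) (up : bool).
Definition omx (Y : 'M[A]_2) : 'M[A]_(2 + 2) :=
  if up then block_mx 1%:M Y 0 1%:M else block_mx 1%:M 0 Y 1%:M.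

Lemma omxM Y Y' : omx (Y + Y') = omx Y *m omx Y'.
Proof.
rewrite /omx; case: up; rewrite mulmx_block !(mul0mx, mulmx0, mul1mx, mulmx1, addr0, add0r) //.
by rewrite addrC.
Qed.

Lemma omx_point (Y : 'M[A]_2) : (forall i j, sa_hom true (Y i j)) -> exists g : SL22 A, sl_mx g = omx Y.
Proof.
move=> hY; rewrite /omx; case: up; first exact: point_upper.
have d1 : \det (1%:M : 'M[A]_2) * 1 = 1.
  by rewrite det2E !mxE /= !mulr1 mulr0 subr0.
apply: (@point_lower _ _ _ _ _ 1) => // i j; by case: (hom1mx A true i j).
Qed.

(** [omx] turns sums into products, and [Y] is a sum of four elementary matrices with odd
    coefficients, each a first order point since odd elements square to zero. *)
Lemma stable_odd (g : SL22 A) (Y : 'M[A]_2) : (forall i j, sa_hom true (Y i j)) ->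
  sl_mx g = omx Y -> st g.
Proof.
pose P Y := forall g : SL22 A, sl_mx g = omx Y -> st g.
have PD (Y1 Y2 : 'M[A]_2) : (forall i j, sa_hom true (Y1 i j)) -> (forall i j, sa_hom true (Y2 i j)) ->
    P Y1 -> P Y2 -> P (Y1 + Y2).
  move=> h1 h2 p1 p2 h hE; have [g1 g1E] := omx_point h1; have [g2 g2E] := omx_point h2.
  apply: (stable_mul RR CB (g := g1) (h := g2)); last exact: p2.
    by rewrite hE g1E g2E omxM.
  exact: p1.
have hd y a b : sa_hom true y -> forall i j, sa_hom true ((y *: delta_mx a b : 'M[A]_2) i j).
  by move=> hy i j; rewrite !mxE; case: (_ && _); rewrite ?mulr1 ?mulr0 //; exact: sa_hom0.
have P1 y a b : sa_hom true y -> P (y *: delta_mx a b).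
  move=> hy h hE.
  pose i := if up then lshift 2 a else rshift 2 a.
  pose j := if up then rshift 2 b else lshift 2 b.
  apply: (stable_odd1 (i := i) (j := j) hy); first by rewrite /i /j; case: up; rewrite par_l par_r.
  rewrite hE /omx /i /j; apply/matrixP => u v.
  case: up; case: (split_ordP u) => u' ->; case: (split_ordP v) => v' ->;
  rewrite ?block_mxEul ?block_mxEur ?block_mxEdl ?block_mxEdr !mxE
    ?eq_lshift ?eq_rshift ?eq_lrshift ?eq_rlshift /= ?andbF ?mulr0 ?addr0 ?add0r //.
move=> hY gE; suff : P Y by apply.
have -> : Y = Y 0 0 *: delta_mx 0 0 + Y 0 1 *: delta_mx 0 1 +
              (Y 1 0 *: delta_mx 1 0 + Y 1 1 *: delta_mx 1 1).
  by apply/matrixP; apply: ord2_ind; apply: ord2_ind;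
    rewrite !mxE /= !(mulr0, mulr1, addr0, add0r).
have hD (Y1 Y2 : 'M[A]_2) : (forall i j, sa_hom true (Y1 i j)) -> (forall i j, sa_hom true (Y2 i j)) ->
    forall i j : 'I_2, sa_hom true ((Y1 + Y2 : 'M[A]_2) i j).
  by move=> h1 h2 i j; rewrite mxE; apply: homD.
by apply: (PD); try apply: (hD); try apply: (PD); try apply: (hd); try apply: (P1); exact: hY.
Qed.
End OddUnipotent.

Section EvenBlock.
Variable blk : bool.
Let i0 := if blk then f0 else e0.
Let i1 := if blk then f1 else e1.

Lemma stable_U (A : superalg k) (g : SL22 A) s :
  sl_mx g = emb blk (mx2 1 s 0 1) -> st g.
Proof.
have E (i j : 'I_(2 + 2)) : i != j -> par22 i = par22 j -> C *m dmx R (delta_mx i j) *m B = 0.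
  by move=> ij pij; apply: (dst (@homog_delta i j)); exact: str_delta.
move=> gE; apply: (@stable_umx _ char0 _ _ RR _ _ CB BB i0 i1 _ _ _ _ g s).
- by rewrite /i0 /i1; case: blk.
- by rewrite /i0 /i1; case: blk.
- by apply: E; rewrite /i0 /i1; case: blk.
rewrite gE /emb /umx /i0 /i1; apply/matrixP.
by case: blk; apply: ord4_ind; apply: ord4_ind;
  rewrite ?block_mxEul ?block_mxEur ?block_mxEdl ?block_mxEdr !mxE /=
  !(mulr0, mulr1, addr0, add0r).
Qed.

Lemma stable_L (A : superalg k) (g : SL22 A) s :
  sl_mx g = emb blk (mx2 1 0 s 1) -> st g.
Proof.
have E (i j : 'I_(2 + 2)) : i != j -> par22 i = par22 j -> C *m dmx R (delta_mx i j) *m B = 0.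
  by move=> ij pij; apply: (dst (@homog_delta i j)); exact: str_delta.
move=> gE; apply: (@stable_umx _ char0 _ _ RR _ _ CB BB i1 i0 _ _ _ _ g s).
- by rewrite /i0 /i1; case: blk.
- by rewrite /i0 /i1; case: blk.
- by apply: E; rewrite /i0 /i1; case: blk.
rewrite gE /emb /umx /i0 /i1; apply/matrixP.
by case: blk; apply: ord4_ind; apply: ord4_ind;
  rewrite ?block_mxEul ?block_mxEur ?block_mxEdl ?block_mxEdr !mxE /=
  !(mulr0, mulr1, addr0, add0r).
Qed.

Lemma stable_ULU (A : superalg k) (g : SL22 A) s c t : sa_hom false s ->
  sa_hom false c -> sa_hom false t ->
  sl_mx g = emb blk (mx2 1 s 0 1 *m (mx2 1 0 c 1 *m mx2 1 t 0 1)) -> st g.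
Proof.
move=> hs hc ht gE; have h1 := sa_hom1 A; have h0 := sa_hom0 A false.
have [g1 g1E] := @emb_point _ A blk 1 s 0 1 h1 hs h0 h1 ltac:(by rewrite mulr1 mulr0 subr0).
have [g2 g2E] := @emb_point _ A blk 1 0 c 1 h1 h0 hc h1 ltac:(by rewrite mulr1 mul0r subr0).
have [g3 g3E] := @emb_point _ A blk 1 t 0 1 h1 ht h0 h1 ltac:(by rewrite mulr1 mulr0 subr0).
have [|||||g23] := @emb_point _ A blk (1 * 1 + 0 * 0) (1 * t + 0 * 1) (c * 1 + 1 * 0) (c * t + 1 * 1).
- by rewrite mul0r addr0 mulr1.
- by rewrite mul0r addr0 mul1r.
- by rewrite mulr0 addr0 mulr1.
- by rewrite mulr1; apply: homD => //; apply: homM_even.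
- by rewrite !(mul0r, mulr0, mulr1, mul1r, addr0) (even_comm t hc) addrAC subrr add0r.
rewrite -mx2M => g23E.
have s23 : st g23.
  apply: (stable_mul RR CB (g := g2) (h := g3)); first by rewrite g23E embM g2E g3E.
    exact: stable_L g2E.
  exact: stable_U g3E.
apply: (stable_mul RR CB (g := g1) (h := g23)) => //; last exact: stable_U g1E.
by rewrite gE embM g1E g23E.
Qed.

Lemma stable_k (g : SL22 (kalg k)) (a b c d : k) : c != 0 -> a * d - b * c = 1 ->
  sl_mx g = emb blk (@mx2 k (kalg k) a b c d) -> st g.
Proof.
move=> c0 D gE.
(* Factorization of a matrix of SL(2) with invertible lower left entry: upper, lower, upper
   unipotent. *)
apply: (@stable_ULU (kalg k) g ((a - 1) / c) c ((d - 1) / c)) => //.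
rewrite gE; congr (emb blk _); rewrite !mx2M.
have e1 : a = 1 * (1 * 1 + 0 * 0) + (a - 1) / c * (c * 1 + 1 * 0) :> k by field.
have e2 : b = 1 * (1 * ((d - 1) / c) + 0 * 1) + (a - 1) / c * (c * ((d - 1) / c) + 1 * 1) :> k.
  have -> : b = (a * d - 1) / c by rewrite -D; field.
  by field.
have e3 : c = 0 * (1 * 1 + 0 * 0) + 1 * (c * 1 + 1 * 0) :> k by ring.
have e4 : d = 0 * (1 * ((d - 1) / c) + 0 * 1) + 1 * (c * ((d - 1) / c) + 1 * 1) :> k by field.
exact: (@mx2_congr k (kalg k) _ _ _ _ _ _ _ _ e1 e2 e3 e4).
Qed.

Lemma stable_k_all (g : SL22 (kalg k)) (a b c d : k) : a * d - b * c = 1 ->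
  sl_mx g = emb blk (@mx2 k (kalg k) a b c d) -> st g.
Proof.
move=> D gE; have [c0|cn0] := eqVneq c 0; last exact: (stable_k cn0 D gE).
have d0 : d != 0.
  by apply: contra_eq_neq D => ->; rewrite c0 !mulr0 subr0 eq_sym oner_eq0.
(* When c = 0, adding the second column to the first puts the invertible [d] in the lower left
   corner. *)
have [//|//|//|//||g1 g1E] := @emb_point k (kalg k) blk (a + b) b d d.
  by rewrite -[RHS]D c0; ring.
have [//|//|//|//||g2 g2E] := @emb_point k (kalg k) blk 1 0 (-1) 1; first by ring.
apply: (stable_mul RR CB (g := g1) (h := g2)); last exact: stable_L g2E.
  rewrite gE g1E g2E -embM mx2M; congr (emb blk _).
  have e1 : a = (a + b) * 1 + b * -1 :> k by ring.
  have e2 : b = (a + b) * 0 + b * 1 :> k by ring.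
  have e3 : c = d * 1 + d * -1 :> k by rewrite c0; ring.
  have e4 : d = d * 0 + d * 1 :> k by ring.
  exact: (@mx2_congr k (kalg k) _ _ _ _ _ _ _ _ e1 e2 e3 e4).
by apply: (stable_k d0 _ g1E); rewrite -[RHS]D c0; ring.
Qed.

Section Chart.
Import mpoly.
(** The chart of SL(2) with coordinates c, a, d and denominator c; the remaining entry satisfies c b
    = a d - 1. *)
Let Fc (A : superalg k) (g : SL22 A) (ev : {rmorphism mpoly 3 k -> A}) : Prop :=
  exists a b c d : A, [/\ sa_hom false a, sa_hom false b, sa_hom false c & sa_hom false d] /\
    [/\ a * d - b * c = 1, sl_mx g = emb blk (mx2 a b c d),
        [/\ ev 'X_0%R = c, ev 'X_1%R = a & ev 'X_(inord 2) = d] & forall t, ev (mpolyC 3 t) = t%:A].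

Lemma stable_chart : exists N : nat, forall (A : superalg k) (g : SL22 A) a b c d,
  [/\ sa_hom false a, sa_hom false b, sa_hom false c & sa_hom false d] ->
  a * d - b * c = 1 -> sl_mx g = emb blk (mx2 a b c d) -> c ^+ N *: Z g = 0.
Proof.
have [|||||||N HN] := @chart_stable k (mpoly 3 k) 'X_0%R (@mpolyC 3 k : {rmorphism k -> mpoly 3 k}) Fc _ _ _ _ _ n R C B.
- by move=> A g ev [a [b [c [d [[_ _ hc _] [_ _ [-> _ _] _]]]]]].
- by move=> A g ev [a [b [c [d [_ [_ _ _ E]]]]]]; exact: E.
{ move=> i j.
  have cb (A : superalg k) (a b c d : A) : sa_hom false b -> sa_hom false c -> a * d - b * c = 1 -> c * b = a * d - 1.
    by move=> hb hc <-; rewrite (even_comm _ hc) opprB addrCA subrr addr0.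
  have Q (q : mpoly 3 k) : (forall A g ev, @Fc A g ev -> g i j = ev q) ->
      exists p, forall A g ev, @Fc A g ev -> ev 'X_0%R * g i j = ev p.
    by move=> H; exists ('X_0%R * q) => A g ev Fg; rewrite rmorphM (H _ _ _ Fg).
  case: (split_ordP i) => i' Ei; case: (split_ordP j) => j' Ej; case: (boolP blk) => hb.
  all: try (apply: (Q ((i == j)%:R : mpoly 3 k)) => A g ev [a [b [c [d [_ [_ gE _ _]]]]]];
    rewrite rmorph_nat gE /emb ?hb ?(negPf hb) Ei Ej
      ?block_mxEul ?block_mxEur ?block_mxEdl ?block_mxEdr !mxE
      ?eq_lshift ?eq_rshift ?eq_lrshift ?eq_rlshift; by []).
  all: elim/ord2_ind: i' Ei => Ei; elim/ord2_ind: j' Ej => Ej; subst i j.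
  all: try (apply: (Q 'X_1%R) => A g ev [a [b [c [d [_ [_ gE [_ E _] _]]]]]];
    rewrite E gE /emb ?hb ?(negPf hb) ?block_mxEul ?block_mxEdr !mxE; by []).
  all: try (apply: (Q 'X_0%R) => A g ev [a [b [c [d [_ [_ gE [E _ _] _]]]]]];
    rewrite E gE /emb ?hb ?(negPf hb) ?block_mxEul ?block_mxEdr !mxE; by []).
  all: try (apply: (Q 'X_(inord 2)) => A g ev [a [b [c [d [_ [_ gE [_ _ E] _]]]]]];
    rewrite E gE /emb ?hb ?(negPf hb) ?block_mxEul ?block_mxEdr !mxE; by []).
  all: exists ('X_1%R * 'X_(inord 2) - 1) => A g ev [a [b [c [d [[_ hb' hc _] [D gE [E0 E1 E2] _]]]]]];
    by rewrite rmorphB rmorphM rmorph1 E0 E1 E2 -(cb _ _ _ _ _ hb' hc D) gE /emb ?hb ?(negPf hb)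
      ?block_mxEul ?block_mxEdr !mxE. }
- exists 'X_0%R => A g ev [a [b [c [d [_ [D gE _ _]]]]]].
  by rewrite (@invA_uniq _ _ g 1) ?mulr1 // gE (proj1 (emb_det _ D)).
- exists 'X_0%R => A g ev [a [b [c [d [_ [D gE _ _]]]]]].
  by rewrite (@invD_uniq _ _ g 1) ?mulr1 // gE (proj2 (emb_det _ D)).
- move=> q Hq; apply: (mpoly_eq0_inf char0) => t t0 u v w.
  have [//|ev [evE evX evC]] := @mev_exists k (kalg k) (fun i : 'I_3 => (t : kalg k) ^+ nth 0%N [:: u; v; w] i).
  pose c : k := t ^+ u; pose a : k := t ^+ v; pose d : k := t ^+ w.
  have c0 : c != 0 by rewrite expf_neq0.
  pose b : k := (a * d - 1) / c.
  have D : a * d - b * c = 1 by rewrite /b; field.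
  have [//|//|//|//||g gE] := @emb_point k (kalg k) blk a b c d; first exact: D.
  rewrite -evE; apply: (Hq g); exists a, b, c, d; split=> //; split=> //.
  by split; rewrite evX //= inordK.
- by move=> g ev [a [b [c [d [_ [D gE _ _]]]]]]; apply: (stable_k_all D gE).
exists N => A g a b c d [ha hb hc hd] D gE.
have [|ev [_ evX evC]] := @mev_exists k A (fun i : 'I_3 => nth d [:: c; a] i).
  by move=> i; case: (i : nat) => [|[|m]] //=; case: m.
have := HN A g ev; rewrite (evX 0%R); apply; exists a, b, c, d; split=> //; split=> //.
by split; rewrite evX //= inordK.
Qed.
End Chart.

Lemma weyl_point (A : superalg k) : exists w : SL22 A,
  sl_mx w = emb blk (mx2 0 (-1) 1 0) /\ st w.
Proof.
have h1 := sa_hom1 A; have h0 := sa_hom0 A false; have hN := homN h1.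
have [|w wE] := @emb_point _ A blk 0 (-1) 1 0 h0 hN h1 h0; first by rewrite mul0r mulr1 sub0r opprK.
exists w; split=> //; apply: (stable_ULU (s := -1) (c := 1) (t := -1)) => //.
rewrite wE !mx2M; congr (emb blk _).
by apply: mx2_congr; rewrite !(mul0r, mulr0, mulr1, mul1r, addr0, add0r, addrN, addNr).
Qed.

(** As 1 = a d - b c, the monomial c^i d^j is a combination of c^i d^(j+1) and c^(i+1) d^j. Once i +
    j reaches 2 N, one exponent is at least N and the monomial kills [z]; descending from there
    reaches 1. *)
Lemma unimodular_annihilate (A : superalg k) m (z : 'M[A]_m) (a b c d : A) N :
  sa_hom false c -> sa_hom false d ->
  a * d - b * c = 1 -> c ^+ N *: z = 0 -> d ^+ N *: z = 0 -> z = 0.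
Proof.
move=> hc hd D cz dz.
suff H n' : forall i j, (2 * N <= i + j + n')%N -> (c ^+ i * d ^+ j) *: z = 0.
  by have := H (2 * N)%N 0%N 0%N (leqnn _); rewrite !expr0 mul1r scale1r.
elim: n' => [|n' IHn] i j le.
  have [Ni|iN] := leqP N i.
    by rewrite (even_comm _ (homX i hc)) -(subnK Ni) exprD mulrA -scalerA cz scaler0.
  have Nj : (N <= j)%N by lia.
  by rewrite -(subnK Nj) exprD mulrA -scalerA dz scaler0.
have -> : c ^+ i * d ^+ j = a * (c ^+ i * d ^+ j.+1) - b * (c ^+ i.+1 * d ^+ j).
  rewrite -[LHS]mul1r -D mulrBl; congr (_ - _); rewrite -!mulrA; congr (_ * _).
    by rewrite exprS !mulrA; congr (_ * _); exact: even_comm.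
  by rewrite exprS !mulrA.
by rewrite scalerBl -[(a * _) *: _]scalerA -[(b * _) *: _]scalerA !IHn ?scaler0 ?subr0 //; lia.
Qed.

(** The chart gives c^N Z g = 0. Applied to the product of [g] and the inverse of the Weyl element,
    whose lower left entry is - d, it gives d^N Z g = 0 as well, the Weyl element being itself
    stable. *)
Lemma stable_SL2 (A : superalg k) (g : SL22 A) a b c d :
  [/\ sa_hom false a, sa_hom false b, sa_hom false c & sa_hom false d] ->
  a * d - b * c = 1 -> sl_mx g = emb blk (mx2 a b c d) -> st g.
Proof.
move=> [ha hb hc hd] D gE; have [N HN] := stable_chart.
have cz : c ^+ N *: Z g = 0 by exact: (HN _ _ a b c d).
apply: (unimodular_annihilate hc hd D cz).
have [w [wE sw]] := weyl_point A.
have D' : - b * c - a * - d = 1 by rewrite mulrN opprK mulNr addrC.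
have [gw gwE] := @emb_point _ A blk (- b) a (- d) c (homN hb) ha (homN hd) hc D'.
have E : sl_mx g = sl_mx gw *m sl_mx w.
  rewrite gE gwE wE -embM mx2M; congr (emb blk _).
  by apply: mx2_congr; rewrite !(mulr0, mulr1, mulrN1, mul0r, addr0, add0r, opprK).
have z : (- d) ^+ N *: Z gw = 0.
  by apply: (HN _ _ (- b) a (- d) c) => //; split=> //; apply: homN.
have -> : Z g = Z gw *m (evalmx R w *m map_mx (in_alg A) B).
  by rewrite /Z (rmx_mul RR E) -!mulmxA; congr (_ *m (_ *m _)); exact: (stableE CB sw).
have {}z : d ^+ N *: Z gw = 0.
  move: z; rewrite exprNn -scalerA; case: (N) => [|m]; first by rewrite !expr0 scale1r.
  by rewrite -signr_odd; case: (odd _); rewrite ?expr1 ?expr0 ?scaleN1r ?scale1r // => /eqP; rewrite oppr_eq0 => /eqP.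
by rewrite -[LHS]/(_ *: (_ *m _)) scalemxAl z mul0mx.
Qed.
End EvenBlock.

Lemma stable_scalar (A : superalg k) (g : SL22 A) a : sl_mx g = a%:M -> st g.
Proof.
by move=> gE; rewrite /stable (rmx_scal RR gE) mulmx1 -map_mxM (CB0 CB BB) map_mx0.
Qed.

(** Both blocks have determinant [d], so the Berezinian is 1. These points supply the common
    determinant of the blocks of an even point, which SL(2) x SL(2) misses. *)
Definition dtorus (A : superalg k) (d : A) : 'M[A]_(2 + 2) :=
  block_mx (mx2 d 0 0 1) 0 0 (mx2 d 0 0 1).

Lemma dtorus_point (A : superalg k) (d e : A) : sa_hom false d -> d * e = 1 ->
  exists g : SL22 A, sl_mx g = dtorus d.
Proof.
move=> hd de; have h i j : sa_hom false (mx2 d 0 0 1 i j).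
  by move: i j; apply: ord2_ind; apply: ord2_ind; rewrite mxE //=; try exact: sa_hom0; exact: sa_hom1.
by apply: (@point_even _ _ _ _ e) => //; rewrite det_mx2 mulr1 mulr0 subr0.
Qed.

Lemma sqrt_exists (t : k) : exists s, s * s = t.
Proof.
have [s sE] := @solve_monicpoly k 2 (fun i => if i == 0%N then t else 0) isT.
by exists s; rewrite -expr2 sE !big_ord_recl big_ord0 /= mul0r !addr0 mulr1.
Qed.

(** With t = s^2 one has diag(t, 1) = s diag(s, s^-1) in each block: a scalar matrix, which acts
    trivially, times a point of SL(2) x SL(2). *)
Lemma stable_dtorus_k (g : SL22 (kalg k)) (t : k) : t != 0 ->
  sl_mx g = @dtorus (kalg k) t -> st g.
Proof.
move=> t0 gE; have [s sE] := sqrt_exists t.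
have s0 : s != 0 by apply: contra_neq t0 => s0; rewrite -sE s0 mul0r.
have D : s * s^-1 - 0 * 0 = 1 by rewrite mul0r subr0 mulfV.
have [//|//|//|//||g1 g1E] := @emb_point k (kalg k) false s 0 0 s^-1; first exact: D.
have [//|//|//|//||g2 g2E] := @emb_point k (kalg k) true s 0 0 s^-1; first exact: D.
have ss : s ^+ 2 * s ^- 2 = 1 by rewrite mulfV // expf_neq0.
have [i j|i j|||g0 g0E] := @point_even k (kalg k) s%:M s%:M (s ^- 2) => //.
- by rewrite det2E !mxE /= mulr0 subr0 -expr2.
- by rewrite det2E !mxE /= mulr0 subr0 -expr2.
have [//|//|||g12 g12E] := @point_even k (kalg k) (mx2 (s : kalg k) 0 0 s^-1) (mx2 (s : kalg k) 0 0 s^-1) 1.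
- by rewrite mulr1 det_mx2; exact: D.
- by rewrite mulr1 det_mx2; exact: D.
have s12 : st g12.
  apply: (stable_mul RR CB (g := g1) (h := g2)).
  - by rewrite g12E g1E g2E /emb mulmx_block !(mul0mx, mulmx0, mul1mx, mulmx1, addr0, add0r).
  - exact: (@stable_SL2 false (kalg k) g1 s 0 0 s^-1).
  - exact: (@stable_SL2 true (kalg k) g2 s 0 0 s^-1).
apply: (stable_mul RR CB (g := g0) (h := g12)) => //.
  rewrite gE g0E g12E /dtorus mulmx_block !(mul0mx, mulmx0, addr0, add0r) !mul_scalar_mx.
  have E : mx2 (t : kalg k) 0 0 1 = (s : kalg k) *: mx2 (s : kalg k) 0 0 s^-1.
    by apply/matrixP; apply: ord2_ind; apply: ord2_ind; rewrite !mxE /= ?mulr0 // ?sE // mulfV.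
  by rewrite E.
apply: (@stable_scalar _ g0 s); rewrite g0E; exact: esym (scalar_mx_block _ _ _).
Qed.

(** Density again, with the single coordinate d; here the denominator is invertible and its power
    can be cancelled. *)
Lemma stable_dtorus (A : superalg k) (g : SL22 A) d e : sa_hom false d -> d * e = 1 ->
  sl_mx g = dtorus d -> st g.
Proof.
pose F (A : superalg k) (g : SL22 A) (ev : {rmorphism {poly k} -> A}) : Prop :=
  [/\ sl_mx g = dtorus (ev 'X), sa_hom false (ev 'X), exists e, ev 'X * e = 1 & forall c, ev c%:P = c%:A].
have detE (A' : superalg k) (x : A') : \det (mx2 x 0 0 1) = x by rewrite det_mx2 mulr1 mulr0 subr0.
move=> hd de gE.
have [||||||| N HN] := @chart_stable k {poly k} 'X (@polyC k) F _ _ _ _ _ n R C B.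
- by move=> ? ? ? [].
- by move=> ? ? ? [].
- have ent (i j : 'I_(2 + 2)) : exists q : {poly k}, forall (A : superalg k) (g : SL22 A) ev, F A g ev -> g i j = ev q.
    case: (split_ordP i) => i' ->; case: (split_ordP j) => j' ->.
    + elim/ord2_ind: i'; elim/ord2_ind: j'; [exists 'X|exists 0|exists 0|exists 1];
        by move=> A' g' ev [-> _ _ _]; rewrite /dtorus block_mxEul !mxE /= ?rmorph0 ?rmorph1.
    + by exists 0 => A' g' ev [-> _ _ _]; rewrite /dtorus block_mxEur !mxE rmorph0.
    + by exists 0 => A' g' ev [-> _ _ _]; rewrite /dtorus block_mxEdl !mxE rmorph0.
    + elim/ord2_ind: i'; elim/ord2_ind: j'; [exists 'X|exists 0|exists 0|exists 1];
        by move=> A' g' ev [-> _ _ _]; rewrite /dtorus block_mxEdr !mxE /= ?rmorph0 ?rmorph1.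
  by move=> i j; have [q qE] := ent i j; exists ('X * q) => A' g' ev Fg; rewrite rmorphM (qE _ _ _ Fg).
- exists 1 => A' g' ev [g'E _ [e' e'E] _]; rewrite (@invA_uniq _ _ g' e') ?rmorph1 //.
  by rewrite g'E block_mxKul detE.
- exists 1 => A' g' ev [g'E _ [e' e'E] _]; rewrite (@invD_uniq _ _ g' e') ?rmorph1 //.
  by rewrite g'E block_mxKdr detE.
- move=> q Hq; apply: (poly_eq0_inf char0) => t t0.
  have [//||g' g'E] := @dtorus_point (kalg k) t t^-1; first exact: mulfV.
  have hE (q' : {poly k}) : horner_alg (t : kalg k) q' = q'.[t].
    elim/poly_ind: q' => [|p c IHp]; first by rewrite rmorph0 horner0.
    by rewrite rmorphD rmorphM /= horner_algX horner_algC IHp !hornerE /= [_%:A]mulr1.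
  have := Hq g' (horner_alg (t : kalg k)); rewrite /= hE; apply.
  split=> //; first by rewrite /= horner_algX.
    by exists t^-1; rewrite /= horner_algX; exact: mulfV.
  by move=> c; rewrite /= horner_algC.
- move=> g' ev [g'E _ [e' e'E] _]; apply: (@stable_dtorus_k g' (ev 'X)) => //.
  by apply: contra_eq_neq e'E => ->; rewrite mul0r eq_sym oner_eq0.
have := HN A g (horner_alg d); rewrite /= horner_algX => dN.
have {}dN : d ^+ N *: Z g = 0.
  apply: dN; split=> //=; rewrite ?horner_algX //; first by exists e.
  by move=> c; rewrite horner_algC.
have dNe : e ^+ N * d ^+ N = 1.
  rewrite -exprMn_comm; first by rewrite -(even_comm _ hd) de expr1n.
  by rewrite /GRing.comm (even_comm _ hd).
by rewrite /stable -/(Z g) -[Z g]scale1r -dNe -scalerA dN scaler0.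
Qed.

Lemma adj_inv (A : superalg k) (D : 'M[A]_2) x : (forall i j, sa_hom false (D i j)) ->
  sa_hom false x -> \det D * x = 1 ->
  D *m (x%:M *m \adj D) = 1%:M /\ (x%:M *m \adj D) *m D = 1%:M.
Proof.
move=> hD hx; rewrite det2E => Dx; have [j00 j11 j01 j10] := adj2E D.
have xD : x * (D 0 0 * D 1 1 - D 0 1 * D 1 0) = 1 by rewrite (even_comm _ hx).
have cm i j y : D i j * y = y * D i j by exact: even_comm.
have mE i j : (x%:M *m \adj D) i j = x * \adj D i j by rewrite mul_scalar_mx mxE.
split; apply/matrixP.
  apply: ord2_ind; apply: ord2_ind; rewrite [LHS]mxE sum2 !mE [RHS]mxE /= ?j00 ?j01 ?j10 ?j11.
  - rewrite ![D _ _ * (x * _)]cm -!mulrA -mulrDr -[RHS]xD mulNr (cm 1 1) (cm 1 0) //.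
  - rewrite ![D _ _ * (x * _)]cm -!mulrA -mulrDr mulNr (cm 0 1) addNr mulr0 //.
  - rewrite ![D _ _ * (x * _)]cm -!mulrA -mulrDr mulNr (cm 1 0) addrN mulr0 //.
  - rewrite ![D _ _ * (x * _)]cm -!mulrA -mulrDr mulNr addrC -[RHS]xD //.
apply: ord2_ind; apply: ord2_ind; rewrite [LHS]mxE sum2 !mE [RHS]mxE /= ?j00 ?j01 ?j10 ?j11.
- by rewrite -!mulrA -mulrDr mulNr (cm 1 1) -[RHS]xD.
- by rewrite -!mulrA -mulrDr mulNr (cm 1 1) addrN mulr0.
- by rewrite -!mulrA -mulrDr mulNr (cm 1 0) addNr mulr0.
- by rewrite -!mulrA -mulrDr mulNr (cm 1 0) addrC -[RHS]xD.
Qed.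

(** With the Schur complement A1 = A - B D^-1 C, the point is an odd upper unipotent times diag(A1,
    D) times an odd lower unipotent. The Berezinian condition gives det A1 = det D, so diag(A1, D)
    is [dtorus (det D)] times a point of SL(2) x SL(2). *)
Lemma stable_all (A : superalg k) (g : SL22 A) : st g.
Proof.
set A0 := ulsubmx g; set B0 := ursubmx g; set C0 := dlsubmx g; set D := drsubmx g.
set x := sl_invD g.
have hb b i j : par22 i (+) par22 j = b -> sa_hom b (g i j) by exact: hom_entry.
have hA0 i j : sa_hom false (A0 i j) by rewrite !mxE; apply: hb; rewrite !par_l.
have hB0 i j : sa_hom true (B0 i j) by rewrite !mxE; apply: hb; rewrite par_l par_r.
have hC0 i j : sa_hom true (C0 i j) by rewrite !mxE; apply: hb; rewrite par_l par_r.
have hD i j : sa_hom false (D i j) by rewrite !mxE; apply: hb; rewrite !par_r.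
have Dx : \det D * x = 1 := sl_invDP g.
have hdD : sa_hom false (\det D) := detD_even g.
have hx : sa_hom false x := hom_inv hdD Dx.
have xD : x * \det D = 1 by rewrite (even_comm _ hx).
set E := x%:M *m \adj D.
have [DE ED] : D *m E = 1%:M /\ E *m D = 1%:M := adj_inv hD hx Dx.
have hE i j : sa_hom false (E i j).
  have [j00 j11 j01 j10] := adj2E D.
  rewrite /E mul_scalar_mx mxE; apply: homM_even => //; move: i j.
  by apply: ord2_ind; apply: ord2_ind; rewrite ?j00 ?j11 ?j01 ?j10 //; apply: homN.
have hM b c (M M' : 'M[A]_2) : (forall i j, sa_hom b (M i j)) ->
    (forall i j, sa_hom c (M' i j)) -> forall i j, sa_hom (b (+) c) ((M *m M') i j).
  by move=> h h' i j; rewrite mxE; apply: hom_sum => l _; apply: sa_homM.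
set A1 := A0 - B0 *m E *m C0.
have hA1 i j : sa_hom false (A1 i j).
  by rewrite /A1 mxE [X in _ + X]mxE; apply: homB => //; apply: (hM true true) => //; apply: (hM true false).
have A1x : \det A1 * x = 1 := sl_berP g.
have [gY gYE] := @omx_point A true (B0 *m E) (hM true false _ _ hB0 hE).
have [gX gXE] := @omx_point A false (E *m C0) (hM false true _ _ hE hC0).
have [gm gmE] := point_even hA1 hD A1x Dx.
have [gd gdE] := dtorus_point hdD Dx.
(* Dividing its first row by the determinant brings a block into SL(2). *)
have U1 (M : 'M[A]_2) : (forall i j, sa_hom false (M i j)) -> \det M * x = 1 ->
    [/\ sa_hom false (x * M 0 0), sa_hom false (x * M 0 1), sa_hom false (M 1 0) & sa_hom false (M 1 1)] /\
    (x * M 0 0) * M 1 1 - (x * M 0 1) * M 1 0 = 1.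
  move=> h; rewrite det2E -(even_comm _ hx) => Mx; split.
    by split=> //; apply: homM_even.
  by rewrite -!mulrA -mulrBr.
have U2 (M : 'M[A]_2) : M = mx2 (\det D) 0 0 1 *m mx2 (x * M 0 0) (x * M 0 1) (M 1 0) (M 1 1).
  rewrite {1}[M]mx2_eta mx2M.
  by apply: mx2_congr; rewrite !(mul0r, addr0, add0r, mul1r) // mulrA Dx mul1r.
have [[ha1 hb1 hc1 hd1] D1] := U1 _ hA1 A1x; have [[ha2 hb2 hc2 hd2] D2] := U1 _ hD Dx.
have [g1 g1E] := @emb_point _ A false _ _ _ _ ha1 hb1 hc1 hd1 D1.
have [g2 g2E] := @emb_point _ A true _ _ _ _ ha2 hb2 hc2 hd2 D2.
have s1 : st g1 by apply: (stable_SL2 _ D1 g1E).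
have s2 : st g2 by apply: (stable_SL2 _ D2 g2E).
set M1 := mx2 _ _ _ _ in g1E; set M2 := mx2 _ _ _ _ in g2E.
have [||||g12 g12E] := @point_even _ A M1 M2 1.
- by apply: ord2_ind; apply: ord2_ind; rewrite mxE.
- by apply: ord2_ind; apply: ord2_ind; rewrite mxE.
- by rewrite mulr1 det_mx2.
- by rewrite mulr1 det_mx2.
have s12 : st g12.
  apply: (stable_mul RR CB (g := g1) (h := g2)) => //.
  by rewrite g12E g1E g2E /emb mulmx_block !(mul0mx, mulmx0, mul1mx, mulmx1, addr0, add0r).
have sm : st gm.
  apply: (stable_mul RR CB (g := gd) (h := g12)) => //; last exact: (stable_dtorus hdD Dx gdE).
  rewrite gmE gdE g12E /dtorus mulmx_block !(mul0mx, mulmx0, addr0, add0r).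
  by rewrite /M1 /M2 -!U2.
have [gmX gmXE] := point_lower hA1 hD hC0 A1x Dx.
have smX : st gmX.
  apply: (stable_mul RR CB (g := gm) (h := gX)) => //.
    rewrite gmXE gmE gXE /omx mulmx_block !(mul0mx, mulmx0, mulmx1, addr0, add0r).
    by rewrite mulmxA DE mul1mx.
  exact: (stable_odd (hM false true _ _ hE hC0) gXE).
apply: (stable_mul RR CB (g := gY) (h := gmX)) => //.
  rewrite -[LHS]submxK gYE gmXE /omx mulmx_block !(mul0mx, mulmx0, mul1mx, addr0, add0r).
  by rewrite subrK -mulmxA ED mulmx1.
exact: (stable_odd (hM true false _ _ hB0 hE) gYE).
Qed.
End Density.

(** * Direct sums, and morphisms from Lie equivariance *)

Section BlockSum.
Variables (k : fieldType) (n m : nat).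
Variables (R : 'I_n -> 'I_n -> regexpr k) (R' : 'I_m -> 'I_m -> regexpr k).

Definition sum_mx (x y : 'I_(n + m)) : regexpr k :=
  match split x, split y with
  | inl i, inl j => R i j
  | inr p, inr q => R' p q
  | _, _ => Const 0
  end.

Lemma split_l (i : 'I_n) : split (lshift m i) = inl i.
Proof. exact: (unsplitK (inl i)). Qed.
Lemma split_r (p : 'I_m) : split (rshift n p) = inr p.
Proof. exact: (unsplitK (inr p)). Qed.

Lemma sum_mxE (A : superalg k) (g : SL22 A) :
  evalmx sum_mx g = block_mx (evalmx R g) 0 0 (evalmx R' g).
Proof.
apply/matrixP => x y; case: (split_ordP x) => i ->; case: (split_ordP y) => j ->.
all: rewrite ?block_mxEul ?block_mxEur ?block_mxEdl ?block_mxEdr !mxE /sum_mx.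
all: by rewrite ?split_l ?split_r //= scale0r.
Qed.

Lemma dmx_sum M : dmx sum_mx M = block_mx (dmx R M) 0 0 (dmx R' M).
Proof.
apply/matrixP => x y; case: (split_ordP x) => i ->; case: (split_ordP y) => j ->.
all: rewrite ?block_mxEul ?block_mxEur ?block_mxEdl ?block_mxEdr !mxE /sum_mx.
all: by rewrite ?split_l ?split_r.
Qed.

Lemma sum_repmx : is_repmx R -> is_repmx R' -> is_repmx sum_mx.
Proof.
move=> RR RR'; split=> [A g a gE|A g h gh E]; rewrite !sum_mxE.
  by rewrite (rmx_scal RR gE) (rmx_scal RR' gE); exact: esym (scalar_mx_block _ _ _).
rewrite (rmx_mul RR E) (rmx_mul RR' E) mulmx_block.
by rewrite !(mul0mx, mulmx0, addr0, add0r).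
Qed.
End BlockSum.

Lemma rep_repmx (k : fieldType) (V : rep k) : is_repmx (rep_mx V).
Proof. split; [exact: rep_scal|exact: rep_mul]. Qed.

(* The graph of [f] is stable under the Lie superalgebra, hence under the group. *)
Lemma is_mor_lie (k : closedFieldType) (char0 : [pchar k] =i pred0) (V W : rep k)
    (f : 'M[k]_(rep_dim W, rep_dim V)) :
  (forall i j, f i j != 0 -> rep_par W i = rep_par V j) ->
  (forall p M, homog p M -> str M = 0 -> f *m dmx (rep_mx V) M = dmx (rep_mx W) M *m f) ->
  is_mor f.
Proof.
move=> pf cf; split=> // A g.
pose B : 'M[k]_(rep_dim V + rep_dim W) := block_mx 1%:M 0 f 0.
have BB : B *m B = B.
  by rewrite /B mulmx_block !(mul0mx, mulmx0, mulmx1, mul1mx, addr0, add0r).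
have CB : (1%:M - B) + B = 1%:M by rewrite subrK.
have RR := sum_repmx (rep_repmx V) (rep_repmx W).
have dst p M : homog p M -> str M = 0 ->
    (1%:M - B) *m dmx (sum_mx (rep_mx V) (rep_mx W)) M *m B = 0.
  move=> hM sM; rewrite dmx_sum -mulmxA mulmxBl mul1mx /B.
  rewrite !mulmx_block !(mul0mx, mulmx0, mulmx1, mul1mx, addr0, add0r).
  by rewrite (cf _ _ hM sM) subrr.
have := stableE CB (stable_all char0 RR CB BB dst g).
rewrite sum_mxE /B map_block_mx !map_mx0 map_mx1.
rewrite !mulmx_block !(mul0mx, mulmx0, mulmx1, mul1mx, addr0, add0r).
by case/eq_block_mx => _ _ <-.
Qed.

Definition wval (k : fieldType) (p q : k) (i : 'I_(2 + 2)) : k :=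
  if i == e0 then p else if i == e1 then - p else if i == f0 then q else - q.

Lemma hdiagE (k : fieldType) (p q : k) i j : hdiag p q i j = wval p q i *+ (i == j).
Proof.
rewrite /hdiag; move: i j; apply: ord4_ind; apply: ord4_ind;
  rewrite ?block_mxEul ?block_mxEur ?block_mxEdl ?block_mxEdr !mxE /wval /= ?expr0 ?expr1;
  by rewrite ?mul1r ?mulN1r.
Qed.

(** * Weights *)

Section Torus.
Variables (k : fieldType) (char0 : [pchar k] =i pred0).
Variables (n : nat) (R : 'I_n -> 'I_n -> regexpr k) (RR : is_repmx R).
Variable blk : bool.

Definition hb : 'M[k]_(2 + 2) := hdiag (~~ blk)%:R blk%:R.
Definition torus (A : superalg k) (a e : A) : 'M[A]_(2 + 2) := emb blk (mx2 a 0 0 e).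

Lemma torus_point (A : superalg k) (a e : A) : sa_hom false a -> a * e = 1 ->
  exists g : SL22 A, sl_mx g = torus a e.
Proof.
move=> ha ae; have he := hom_inv ha ae; have h0 := sa_hom0 A false.
by apply: emb_point => //; rewrite mul0r subr0.
Qed.

Lemma torusM (A : superalg k) (a e a' e' : A) :
  torus (a * a') (e * e') = torus a e *m torus a' e'.
Proof.
by rewrite /torus -embM mx2M; congr emb; apply: mx2_congr;
  rewrite !(mulr0, mul0r, addr0, add0r).
Qed.

Lemma torus_inf (A : superalg k) (y : A) :
  torus (1 + y) (1 - y) = 1%:M + y *: map_mx (in_alg A) hb.
Proof.
apply/matrixP => i j; rewrite [RHS]mxE [X in _ = X + _]mxE [X in _ = _ + X]mxE.
rewrite [map_mx _ _ i j]mxE /hb hdiagE /torus /emb; move: i j.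
by case: blk; apply: ord4_ind; apply: ord4_ind;
  rewrite ?block_mxEul ?block_mxEur ?block_mxEdl ?block_mxEdr !mxE /wval /=
  ?oppr0 ?scaleN1r ?scaler0 ?scale1r ?scale0r ?oppr0 ?scale0r ?mulrN1 ?mulr1 ?mulr0 ?addr0 ?add0r.
Qed.

Lemma torus_chart : exists (N : nat) (Q : 'M[{poly k}]_n),
  forall (A : superalg k) (g : SL22 A) a e, sa_hom false a -> a * e = 1 ->
    sl_mx g = torus a e -> a ^+ N *: evalmx R g = map_mx (horner_alg a) Q.
Proof.
pose F (A : superalg k) (g : SL22 A) (ev : {rmorphism {poly k} -> A}) : Prop :=
  [/\ sa_hom false (ev 'X), exists2 e, ev 'X * e = 1 & sl_mx g = torus (ev 'X) e &
      forall c, ev c%:P = c%:A].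
have ent i j : exists q : {poly k}, forall (A : superalg k) (g : SL22 A) ev,
    F A g ev -> ev 'X * g i j = ev q.
  have Fz (A : superalg k) (g : SL22 A) ev : F A g ev -> 
      [/\ ev 'X * ev 'X = ev ('X * 'X), ev 'X * 1 = ev 'X & ev 'X * 0 = ev 0].
    by rewrite rmorphM mulr1 mulr0 rmorph0.
  case: (split_ordP i) => i' ->; case: (split_ordP j) => j' ->; rewrite /F /torus /emb.
  - elim/ord2_ind: i'; elim/ord2_ind: j'; case: blk;
      [exists 'X|exists ('X * 'X)|exists 0|exists 0|exists 0|exists 0|exists 'X|exists 1];
      by move=> A g ev [_ [e ee ->] _]; rewrite block_mxEul !mxE /= ?mulr1 ?mulr0 ?rmorph0 ?rmorphM ?rmorph1.
  - by exists 0; move=> A g ev [_ [e ee ->] _]; case: blk; rewrite block_mxEur mxE mulr0 rmorph0.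
  - by exists 0; move=> A g ev [_ [e ee ->] _]; case: blk; rewrite block_mxEdl mxE mulr0 rmorph0.
  - elim/ord2_ind: i'; elim/ord2_ind: j'; case: blk;
      [exists ('X * 'X)|exists 'X|exists 0|exists 0|exists 0|exists 0|exists 1|exists 'X];
      by move=> A g ev [_ [e ee ->] _]; rewrite block_mxEdr !mxE /= ?mulr1 ?mulr0 ?rmorph0 ?rmorphM ?rmorph1.
have [||||| N [Q QE]] := @chart_mx k {poly k} 'X (@polyC k) F _ _ _ _ _ n R.
- by move=> A g ev [].
- by move=> A g ev [].
- exact: ent.
- exists 'X => A g ev [_ [e ee gE] _]; rewrite (@invA_uniq _ _ g 1) ?mulr1 // gE.
  by case: (@emb_det _ A blk (ev 'X) 0 0 e) => //; rewrite mul0r subr0.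
- exists 'X => A g ev [_ [e ee gE] _]; rewrite (@invD_uniq _ _ g 1) ?mulr1 // gE.
  by case: (@emb_det _ A blk (ev 'X) 0 0 e) => //; rewrite mul0r subr0.
exists N, Q => A g a e ha ae gE; have := QE A g (horner_alg a); rewrite /= horner_algX; apply.
by split=> [||c]; rewrite /= ?horner_algX ?horner_algC //; exists e.
Qed.

(** The group law at s (1 + y) gives a Q'(a) = Q(a) (N + H), where H is the action of [hb].
    Coefficient by coefficient, this says that the rows of the coefficient of degree c are
    eigenvectors of H for c - N. *)
Lemma torus_deriv : exists (N : nat) (Q : 'M[{poly k}]_n),
  [/\ forall (g : SL22 (kalg k)) (a : k), a != 0 -> sl_mx g = @torus (kalg k) a a^-1 ->
        forall i j, a ^+ N * evalmx R g i j = (Q i j).[a],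
      forall i j, (Q i j).[1] = (i == j)%:R &
      forall c, c%:R *: map_mx (coefp c) Q =
                map_mx (coefp c) Q *m (N%:R%:M + dmx R hb)].
Proof.
have [N [Q QE]] := torus_chart; exists N, Q.
have hE (t : k) (q : {poly k}) : horner_alg (t : kalg k) q = q.[t].
  elim/poly_ind: q => [|p c IHp]; first by rewrite rmorph0 horner0.
  by rewrite rmorphD rmorphM /= horner_algX horner_algC IHp !hornerE /= [_%:A]mulr1.
have kev (x : kalg k) : sa_hom false x by [].
have kE (g : SL22 (kalg k)) (a : k) : a != 0 -> sl_mx g = @torus (kalg k) a a^-1 ->
    forall i j, a ^+ N * evalmx R g i j = (Q i j).[a].
  move=> a0 gE i j; have aa : a * a^-1 = 1 by rewrite mulfV.
  have /matrixP/(_ i j) := QE (kalg k) g a a^-1 (kev a) aa gE.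
  by rewrite [LHS]mxE [RHS]mxE hE.
split=> // [i j|c].
  have [//||g gE] := @torus_point (kalg k) 1 1; first by rewrite mulr1.
  have <- := kE g 1 (oner_neq0 _); last by rewrite invr1.
  rewrite expr1n mul1r (rmx_scal RR (a := 1)) ?mxE //.
  rewrite gE /torus -mx2_1 /emb; case: (blk); exact: esym (scalar_mx_block _ _ _).
suff D i j : 'X * (Q i j)^`() = \sum_l Q i l * ((N%:R%:M + dmx R hb) l j)%:P.
  apply/matrixP => i j; rewrite 3!mxE; have := congr1 (coefp c) (D i j).
  rewrite /= coefXM coef_deriv coef_sum; case: c => [|c] /= E.
    by rewrite mul0r; apply: (etrans E); apply: eq_bigr => l _; rewrite coefMC !mxE.
  by rewrite mulr_natl; apply: (etrans E); apply: eq_bigr => l _; rewrite coefMC !mxE.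
apply/eqP; rewrite -subr_eq0; apply/eqP/(poly_eq0_inf char0) => s s0.
rewrite hornerD hornerN; apply/eqP; rewrite subr_eq0; apply/eqP.
pose A := qalg k false false; pose y : A := qy k false false.
have yy : y * y = 0 by apply: quad_eq => /=; ring.
have ey : sa_hom false y by [].
have h1 : sa_hom false (1 + y) by [].
have e1 : (1 + y) * (1 - y) = 1.
  by rewrite mulrDl mul1r mulrBr mulr1 yy subr0 addrNK.
have hs : sa_hom false (s%:A : A) by exact: hom_alg.
have es : s%:A * s^-1%:A = 1 :> A by rewrite -scalerAl mul1r scalerA mulfV // scale1r.
have hs1 : sa_hom false (s%:A * (1 + y)) by exact: homM_even.
have es1 : (s%:A * (1 + y)) * (s^-1%:A * (1 - y)) = 1.
  by rewrite -mulrA [(1 + y) * _]mulrA -(algE_comm _ (1 + y)) -mulrA e1 mulr1.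
have [gs gsE] := torus_point hs es; have [g1 g1E] := torus_point h1 e1.
have [g12 g12E] := torus_point hs1 es1.
have E : sl_mx g12 = sl_mx gs *m sl_mx g1 by rewrite g12E gsE g1E torusM.
have /matrixP/(_ i j) := QE A g12 _ _ hs1 es1 g12E.
rewrite [LHS]mxE (rmx_mul RR E) (rho_inf RR yy (etrans g1E (torus_inf y))) [RHS]mxE.
have -> : s%:A * (1 + y) = s%:A + s *: y by rewrite mulrDr mulr1 -scalerAl mul1r.
rewrite taylor1; last by rewrite -scalerAl -scalerAr yy !scaler0.
have -> : (s%:A + s *: y) ^+ N = (1 + N%:R *: y) * s%:A ^+ N.
  have -> : s%:A + s *: y = (1 + y) * s%:A.
    by rewrite -algE_comm mulrDr mulr1 -scalerAl mul1r.
  rewrite exprMn_comm; last by rewrite /GRing.comm algE_comm.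
  congr (_ * _); elim: (N) => [|m IHm]; first by rewrite scale0r addr0.
  by rewrite exprSr IHm; apply: quad_eq => /=; rewrite -?natr1; ring.
rewrite -mulrA mxE mulr_sumr => /(congr1 (@q1 k)) /= Eq.
have {}Eq : s * (Q i j)^`().[s] = q1 ((1 + N%:R *: y) *
    \sum_l s%:A ^+ N * (evalmx R gs i l * (1%:M + y *: map_mx (in_alg A) (dmx R hb)) l j)).
  by rewrite [RHS]Eq; ring.
rewrite hornerM hornerX {}Eq horner_sum mulr_sumr q1_sum; apply: eq_bigr => l _.
have /matrixP/(_ i l) := QE A gs _ _ hs es gsE; rewrite [LHS]mxE [RHS]mxE => El.
rewrite (mulrA (s%:A ^+ N)) El -[s%:A]addr0.
rewrite (taylor1 s (Q i l) (mulr0 (0 : A))) scaler0 addr0 hornerM hornerC !mxE /=.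
by case: eqP => _ /=; ring.
Qed.
End Torus.

(** The rows of [F c] lie in the eigenspace of [x c]; as these matrices add up to 1, the eigenspaces
    fill the whole space. *)
Lemma resolution_diagonalizable (k : fieldType) n (H : 'M[k]_n) (F : nat -> 'M[k]_n)
    (x : nat -> k) K : injective x ->
  (forall c, F c *m H = x c *: F c) -> \sum_(c < K) F c = 1%:M -> diagonalizable H.
Proof.
move=> xI FH F1; apply/diagonalizablePeigen; exists [seq x c | c <- iota 0 K].
  by rewrite map_inj_uniq ?iota_uniq.
apply/eqmxP; rewrite submx1 -F1 summx_sub // => c _.
rewrite (submx_trans (_ : (F c <= eigenspace H (x c))%MS)) //; first exact/eigenspaceP.
rewrite big_map; have cs : (c : nat) \in iota 0 K by rewrite mem_iota add0n ltn_ord.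
by rewrite (big_rem _ cs) /= addsmxSl.
Qed.

Section Weights.
Variables (k : fieldType) (char0 : [pchar k] =i pred0).
Variables (n : nat) (R : 'I_n -> 'I_n -> regexpr k) (RR : is_repmx R).

Lemma poly_bound (Q : 'M[{poly k}]_n) : exists K, forall i j, (size (Q i j) <= K)%N.
Proof.
exists (\sum_ij size (Q ij.1 ij.2))%N => i j.
by rewrite (bigD1 (i, j)) //= leq_addr.
Qed.

Lemma dmx_hb_diagonalizable blk : diagonalizable (dmx R (hb k blk)).
Proof.
have [N [Q [_ Q1 QH]]] := torus_deriv char0 RR blk; have [K HK] := poly_bound Q.
apply: (@resolution_diagonalizable _ _ _ (fun c => map_mx (coefp c) Q)
  (fun c => c%:R - N%:R) K) => [c c' /addIr /(natk_inj char0) //|c|].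
  by rewrite scalerBl QH mulmxDr mul_mx_scalar addrAC subrr add0r.
apply/matrixP => i j; rewrite summxE mxE -Q1 (horner_coef_wide _ (HK i j)).
by apply: eq_bigr => c _; rewrite mxE /= expr1n mulr1.
Qed.

(** In column j only the degree c with c = N + d_j survives, so the entries of [Q] are monomials.
    This makes the weight c - N an integer and integrates it to the torus character a^(c - N). *)
Lemma dmx_hb_weights blk d : dmx R (hb k blk) = diag_mx d ->
  exists z : 'I_n -> int, (forall i, d 0 i = (z i)%:~R) /\
    forall (g : SL22 (kalg k)) (a : k), a != 0 -> sl_mx g = @torus _ blk (kalg k) a a^-1 ->
    forall i j, evalmx R g i j = (a ^ z i) *+ (i == j).
Proof.
move=> dE; have [N [Q [Qa Q1 QH]]] := torus_deriv char0 RR blk; have [K HK] := poly_bound Q.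
have QE c i j : c%:R * (Q i j)`_c = (Q i j)`_c * (N%:R + d 0 j).
  have /matrixP/(_ i j) := QH c; rewrite dE mulmxDr mul_mx_scalar mul_mx_diag !mxE /= => ->.
  by rewrite mulrC -mulrDr.
have Qc j : exists c : nat, c%:R = N%:R + d 0 j.
  suff /existsP[c Qn0] : [exists c : 'I_K, (Q j j)`_c != 0].
    by exists c; apply: (mulIf Qn0); rewrite QE mulrC.
  apply: contraT; rewrite negb_exists => /forallP Q0.
  have := Q1 j j; rewrite (horner_coef_wide _ (HK j j)) eqxx big1 => [/eqP|c _].
    by rewrite eq_sym oner_eq0.
  by have /negPn/eqP -> := Q0 c; rewrite mul0r.
have /fin_all_exists [c cE] := Qc.
exists (fun j => (c j)%:Z - N%:Z); split=> [j|g a a0 gE i j].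
  by rewrite intrD mulrNz -!pmulrn cE addrAC subrr add0r.
have Qcc m : m != c j -> (Q i j)`_m = 0.
  move=> mc; have /eqP := QE m i j; rewrite -cE mulrC -subr_eq0 -mulrBr mulf_eq0.
  by case/orP => [/eqP//|]; rewrite subr_eq0 => /eqP /(natk_inj char0) E; rewrite E eqxx in mc.
have [q QX] : exists q, Q i j = q *: 'X^(c j).
  exists (Q i j)`_(c j); apply/polyP => m; rewrite coefZ coefXn; have [->|mc] := eqVneq m (c j); first by rewrite mulr1.
  by rewrite mulr0 Qcc.
have aN : a ^+ N != 0 by rewrite expf_neq0.
apply: (mulfI aN); rewrite (Qa g a a0 gE) QX hornerZ hornerXn.
have := Q1 i j; rewrite QX hornerZ hornerXn expr1n mulr1 => ->.
have [<-|ij] := eqVneq i j; last by rewrite !mulr0n mul0r mulr0.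
by rewrite !mulr1n mul1r !exprnP -expfzDr // addrCA subrr addr0.
Qed.
End Weights.

(* For [Pi] the idempotent projection on a subspace, stability of its image
   ([b = false]) or of its kernel ([b = true]). *)
Definition absorb (T : pzRingType) n (b : bool) (Pi X : 'M[T]_n) :=
  if b then Pi *m X = Pi *m X *m Pi else X *m Pi = Pi *m X *m Pi.

(** The projector [Q *m P] may be inserted between [X] and [Y]: after [X] when the kernel is stable,
    before [Y] when the image is. *)
Lemma absorb_mul (T : pzRingType) n m b (P : 'M[T]_(m, n)) (Q : 'M[T]_(n, m)) X Y :
  P *m Q = 1%:M -> absorb b (Q *m P) X -> absorb b (Q *m P) Y ->
  P *m (X *m Y) *m Q = (P *m X *m Q) *m (P *m Y *m Q).
Proof.
move=> PQ; case: b => /= hX hY.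
  have -> : P *m (X *m Y) = P *m (Q *m P *m X) *m Y by rewrite !mulmxA PQ mul1mx.
  by rewrite hX !mulmxA PQ mul1mx.
have -> : P *m (X *m Y) *m Q = P *m X *m (Y *m (Q *m P)) *m Q.
  by rewrite -!mulmxA PQ mulmx1.
by rewrite hY -!mulmxA PQ mulmx1 !mulmxA.
Qed.

(** * Compression to subrepresentations and quotients, in homogeneous weight bases *)

Section Conjugation.
Variables (k : fieldType) (m n : nat).
Variables (P : 'M[k]_(m, n)) (Q : 'M[k]_(n, m)) (R : 'I_n -> 'I_n -> regexpr k).

Definition rsum (s : seq (regexpr k)) : regexpr k := foldr (@Add k) (Const 0) s.

Lemma rsumE (A : superalg k) (g : SL22 A) I (r : seq I) F :
  reval g (rsum [seq F i | i <- r]) = \sum_(i <- r) reval g (F i).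
Proof. by elim: r => [|i r IHr]; rewrite ?big_nil ?big_cons /= ?scale0r ?IHr. Qed.

Lemma der_rsum M I (r : seq I) F :
  der M (rsum [seq F i | i <- r]) = \sum_(i <- r) der M (F i).
Proof. by elim: r => [|i r IHr]; rewrite ?big_nil ?big_cons /= ?IHr. Qed.

Definition rconj (i j : 'I_m) : regexpr k :=
  rsum [seq rsum [seq Mul (Const (P i a)) (Mul (R a b) (Const (Q b j)))
    | b <- enum 'I_n] | a <- enum 'I_n].

Lemma rconjE (A : superalg k) (g : SL22 A) :
  evalmx rconj g = map_mx (in_alg A) P *m evalmx R g *m map_mx (in_alg A) Q.
Proof.
apply/matrixP => i j; rewrite -mulmxA !mxE rsumE big_enum; apply: eq_bigr => a _.
rewrite rsumE big_enum !mxE mulr_sumr; apply: eq_bigr => b _.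
by rewrite !mxE.
Qed.

Lemma dmx_conj M : dmx rconj M = P *m dmx R M *m Q.
Proof.
apply/matrixP => i j; rewrite -mulmxA !mxE der_rsum big_enum; apply: eq_bigr => a _.
rewrite der_rsum big_enum !mxE mulr_sumr; apply: eq_bigr => b _.
by rewrite !mxE /= mul0r add0r mulr0 addr0.
Qed.

Lemma conj_repmx b : is_repmx R -> P *m Q = 1%:M ->
  (forall (A : superalg k) (g : SL22 A), 
     absorb b (map_mx (in_alg A) (Q *m P)) (evalmx R g)) -> is_repmx rconj.
Proof.
move=> RR PQ ab; have PQA (A : superalg k) : map_mx (in_alg A) P *m map_mx (in_alg A) Q = 1%:M.
  by rewrite -map_mxM PQ map_mx1.
split=> [A g a gE|A g h gh E]; rewrite !rconjE; first by rewrite (rmx_scal RR gE) mulmx1 PQA.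
rewrite (rmx_mul RR E); apply: (absorb_mul (b := b)); first exact: PQA.
  by rewrite -map_mxM; exact: ab.
by rewrite -map_mxM; exact: ab.
Qed.
End Conjugation.

Definition wcomp (b : bool) (x : P0) : int := if b then x.2 else x.1.

Definition weighted (k : fieldType) (V : rep k) (w : 'I_(rep_dim V) -> P0) :=
  forall b, dmx (rep_mx V) (hb k b) = diag_mx (\row_i (wcomp b (w i))%:~R).
Arguments weighted {k} V w.

Lemma homog_hdiag (k : fieldType) (p q : k) : homog false (hdiag p q).
Proof.
by move=> i j ij; rewrite hdiagE; have [E|//] := eqVneq i j; move: ij; rewrite E addbb.
Qed.

Lemma str_hdiag (k : fieldType) (p q : k) : str (hdiag p q) = 0.
Proof. by rewrite strE !hdiagE /wval /= !mulr1n; ring. Qed.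

Lemma bracket_hdiag (k : fieldType) (p q : k) b (M : 'M[k]_(2 + 2)) :
  sbracket false b (hdiag p q) M = \matrix_(i, j) ((wval p q i - wval p q j) * M i j).
Proof.
have E : hdiag p q = diag_mx (\row_i wval p q i).
  by apply/matrixP => i j; rewrite hdiagE !mxE.
rewrite /sbracket E mul_diag_mx mul_mx_diag; apply/matrixP => i j; rewrite !mxE /=.
by ring.
Qed.

Lemma dmx_hb_comm (k : fieldType) n (R : 'I_n -> 'I_n -> regexpr k) (RR : is_repmx R) b c :
  dmx R (hb k b) *m dmx R (hb k c) = dmx R (hb k c) *m dmx R (hb k b).
Proof.
have := dmx_bracket RR (@homog_hdiag k (~~ b)%:R b%:R) (@homog_hdiag k (~~ c)%:R c%:R)
  (str_hdiag _ _) (str_hdiag _ _).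
rewrite bracket_hdiag expr0 scale1r => E.
apply/eqP; rewrite -subr_eq0 E; apply/eqP.
rewrite (_ : (\matrix_(i, j) _) = 0) ?linear0 //; apply/matrixP => i j; rewrite [LHS]mxE [RHS]mxE hdiagE.
by have [->|_] := eqVneq i j; rewrite ?subrr ?mul0r ?mulr0.
Qed.

(** The parity condition on a representation is applied to 1 + y M with [y] of parity [p], and the
    coefficient of [y] is read off. *)
Lemma dmx_par (k : fieldType) (V : rep k) p M : homog p M -> str M = 0 ->
  forall i j, dmx (rep_mx V) M i j != 0 -> rep_par V i (+) rep_par V j = p.
Proof.
move=> hM sM i j; apply: contra_neq_eq => pij.
have s0 : str (0 : 'M[k]_(2 + 2)) = 0 by rewrite strE !mxE; ring.
have [||||||g gE] := @qmx_point k p false M 0 0; rewrite ?mulmx0 //; try exact: homog0.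
have gE' : sl_mx g = 1%:M + qy k p false *: map_mx (in_alg _) M.
  by rewrite gE; apply/matrixP => a c; rewrite !mxE; apply: quad_eq => /=; case: eqP => _ /=; ring.
have yy : qy k p false * qy k p false = 0 by apply: quad_eq => /=; ring.
have := rep_even g i j; rewrite (reval_inf yy gE') => -[_ + _ _] => /(_ pij) /=.
by rewrite mxE => <-; ring.
Qed.

Lemma idempotent_factor (k : fieldType) n (Pi : 'M[k]_n) : Pi *m Pi = Pi ->
  exists r (P : 'M[k]_(r, n)) (Q : 'M[k]_(n, r)), P *m Q = 1%:M /\ Q *m P = Pi.
Proof.
have /row_freeP [B] : row_free (row_base Pi) := row_base_free Pi.
have /row_fullP [L] : row_full (col_base Pi) := col_base_full Pi.
have : col_base Pi *m row_base Pi = Pi := mulmx_base Pi.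
move: (row_base Pi) (col_base Pi) B L; move: (\rank Pi) => r P Q B L QP LQ PB PP.
exists r, P, Q; split=> //; have := congr1 (fun X => L *m X *m B) PP; rewrite -QP.
by rewrite !mulmxA LQ !mul1mx -!mulmxA PB mulmx1.
Qed.

Lemma codiagonalizable3 (k : fieldType) n (A B C : 'M[k]_n) :
  diagonalizable A -> diagonalizable B -> diagonalizable C ->
  A *m B = B *m A -> A *m C = C *m A -> B *m C = C *m B ->
  exists G a b c, [/\ G \in unitmx, G *m A *m invmx G = diag_mx a,
    G *m B *m invmx G = diag_mx b & G *m C *m invmx G = diag_mx c].
Proof.
move=> dA dB dC AB AC BC.
have [|G Gu] := (codiagonalizableP [:: A; B; C]).1.
  split=> X; last by rewrite !inE => /or3P[] /eqP->.
  by move=> Y; rewrite !inE => /or3P[] /eqP-> /or3P[] /eqP->.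
move=> /and4P[hA hB hC _].
have /diag_mxP[a] : is_diag_mx (conjmx G A) := hA.
have /diag_mxP[b] : is_diag_mx (conjmx G B) := hB.
have /diag_mxP[c] : is_diag_mx (conjmx G C) := hC.
rewrite !conjumx // => cE bE aE.
by exists G, a, b, c.
Qed.

Section Compress.
Variables (k : closedFieldType) (char0 : [pchar k] =i pred0) (V : rep k).
Local Notation n := (rep_dim V).
Local Notation S := (par_mx V).

Lemma par_mx_sq (W : rep k) : par_mx W *m par_mx W = 1%:M.
Proof.
apply/matrixP => i j; rewrite mul_diag_mx !mxE; have [->|_] := eqVneq i j.
  by rewrite mulr1n -signr_addb addbb.
by rewrite mulr0n mulr0.
Qed.

Lemma par_mx_comm (W : rep k) M : homog false M -> str M = 0 ->
  par_mx W *m dmx (rep_mx W) M = dmx (rep_mx W) M *m par_mx W.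
Proof.
move=> hM sM; have := @dmx_par _ W false M hM sM; move: (dmx _ M) => D pD.
apply/matrixP => i j; rewrite mul_mx_diag mul_diag_mx !mxE.
have [->|/pD] := eqVneq (D i j) 0; first by rewrite mulr0 mul0r.
by move/negbT; rewrite negb_add => /eqP ->; rewrite mulrC.
Qed.

Lemma sgn_inj (s t : bool) : (-1) ^+ s = (-1) ^+ t :> k -> s = t.
Proof.
have N1 : (1 == -1 :> k) = false.
  by apply/negP => /eqP E; have := natk_eq0 char0 2; rewrite mulr2n {2}E subrr eqxx.
by case: s; case: t => //= /eqP; rewrite ?[-1 == _]eq_sym ?expr0 ?expr1 N1.
Qed.

(** Factoring [Pi] gives a representation on its image, a subrepresentation or a quotient according
    to [b]. There the parity involution and the two torus generators act by commuting diagonalizable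
    matrices; a common eigenbasis is homogeneous and weighted, with parities read from the
    eigenvalues of the involution. *)
Lemma compress Pi b : Pi *m Pi = Pi -> S *m Pi = Pi *m S ->
  (forall p M, homog p M -> str M = 0 -> absorb b Pi (dmx (rep_mx V) M)) ->
  exists (U : rep k) (P : 'M[k]_(rep_dim U, n)) (Q : 'M[k]_(n, rep_dim U)) (w : 'I_(rep_dim U) -> P0),
  [/\ P *m Q = 1%:M, Q *m P = Pi,
      forall (A : superalg k) (g : SL22 A),
        act U g = map_mx (in_alg A) P *m act V g *m map_mx (in_alg A) Q,
      (forall i a, P i a != 0 -> rep_par U i = rep_par V a) /\
      (forall a i, Q a i != 0 -> rep_par V a = rep_par U i) & weighted U w].
Proof.
move=> PP SP st; have RR := rep_repmx V.
have ab (A : superalg k) (g : SL22 A) : absorb b (map_mx (in_alg A) Pi) (act V g).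
  case: b st => /= st.
    have CB : Pi + (1%:M - Pi) = 1%:M by rewrite addrCA subrr addr0.
    have BB : (1%:M - Pi) *m (1%:M - Pi) = 1%:M - Pi.
      by rewrite mulmxBr mulmx1 mulmxBl mul1mx PP subrr subr0.
    have := stable_all char0 RR CB BB; rewrite /stable => H.
    have {}H := H _ A g; apply/eqP; rewrite -subr_eq0; apply/eqP.
    rewrite -[X in X - _]mulmx1 -(map_mx1 (in_alg A)) -mulmxBr -map_mxB; apply: H => p M hM sM.
    by rewrite mulmxBr mulmx1 -(st p M hM sM) subrr.
  have CB : (1%:M - Pi) + Pi = 1%:M by rewrite subrK.
  have := stable_all char0 RR CB PP; rewrite /stable => H.
  have {}H := H _ A g; apply/eqP; rewrite -subr_eq0; apply/eqP.
  rewrite -[X in X - _]mul1mx -(map_mx1 (in_alg A)) mulmxA -!mulmxBl -map_mxB; apply: H => p M hM sM.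
  by rewrite -mulmxA mulmxBl mul1mx mulmxA -(st p M hM sM) subrr.
have [r [P0 [Q0 [PQ0 QP0]]]] := idempotent_factor PP.
have PiQ : Pi *m Q0 = Q0 by rewrite -QP0 -mulmxA PQ0 mulmx1.
have PPi : P0 *m Pi = P0 by rewrite -QP0 mulmxA PQ0 mul1mx.
have RR0 : is_repmx (rconj P0 Q0 (rep_mx V)) by apply: (conj_repmx RR PQ0 (b := b)); rewrite QP0.
pose H c := dmx (rconj P0 Q0 (rep_mx V)) (hb k c); pose S0 := P0 *m S *m Q0.
have SS0 : S0 *m S0 = 1%:M.
  rewrite /S0 -!mulmxA (mulmxA Q0) QP0 !mulmxA -[P0 *m S *m Pi]mulmxA SP mulmxA PPi.
  by rewrite -[P0 *m S *m S]mulmxA par_mx_sq mulmx1.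
have SH c : S0 *m H c = H c *m S0.
  rewrite /S0 /H dmx_conj -!mulmxA !(mulmxA Q0) QP0.
  rewrite (mulmxA S Pi) SP -(mulmxA Pi S) (mulmxA P0 Pi) PPi.
  rewrite (mulmxA Pi S) -SP -(mulmxA S Pi) PiQ (mulmxA S) par_mx_comm -?mulmxA //.
    exact: homog_hdiag.
  exact: str_hdiag.
have dS : diagonalizable S0.
  have h2 : (2%:R : k) != 0 by rewrite natk_eq0.
  (* The spectral projectors of an involution; 1 - 2 c takes the values 1 and -1 at c = 0 and c =
     1. *)
  apply: (@resolution_diagonalizable _ _ _ (fun c => if c == 0%N then 2^-1 *: (1%:M + S0)
      else if c == 1%N then 2^-1 *: (1%:M - S0) else 0) (fun c => 1 - (2 * c)%:R) 2).
  - by move=> c c' /addrI /oppr_inj /(natk_inj char0); lia.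
  - case=> [|[|c]] /=; last by rewrite mul0mx scaler0.
      by rewrite muln0 subr0 scale1r -scalemxAl mulmxDl mul1mx SS0 addrC.
    rewrite muln1 (_ : 1 - 2%:R = -1) ?scaleN1r; last by rewrite mulr2n opprD addrA subrr sub0r.
    by rewrite -scalemxAl mulmxBl mul1mx SS0 -scalerN opprB.
  rewrite !big_ord_recl big_ord0 /= addr0 -scalerDr addrACA subrr addr0.
  by rewrite -mulr2n -scaler_nat scalerA mulVf // scale1r.
have [|||G [ds [d0 [d1 [Gu dsE d0E d1E]]]]] := codiagonalizable3 dS (dmx_hb_diagonalizable char0 RR0 false)
  (dmx_hb_diagonalizable char0 RR0 true); [exact: SH|exact: SH|exact: dmx_hb_comm|].
have [P PE] : exists P, P = G *m P0 by exists (G *m P0).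
have [Q QE] : exists Q, Q = Q0 *m invmx G by exists (Q0 *m invmx G).
have PQ : P *m Q = 1%:M by rewrite PE QE -mulmxA (mulmxA P0) PQ0 mul1mx mulmxV.
have QP : Q *m P = Pi by rewrite PE QE -mulmxA (mulmxA _ G) mulVmx // mul1mx.
have PSQ : P *m S *m Q = diag_mx ds by rewrite -dsE PE QE /S0 !mulmxA.
have dsq i : ds 0 i * ds 0 i = 1.
  have : (P *m S *m Q) *m (P *m S *m Q) = 1%:M.
    have PPi' : P *m Pi = P by rewrite -QP mulmxA PQ mul1mx.
    rewrite -!mulmxA (mulmxA Q) QP (mulmxA S Pi) SP -(mulmxA Pi S) (mulmxA P Pi) PPi'.
    by rewrite (mulmxA S S) par_mx_sq mul1mx.
  by rewrite PSQ => /matrixP/(_ i i); rewrite mul_diag_mx !mxE eqxx !mulr1n.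
pose par i := ds 0 i == -1.
have dsP i : ds 0 i = (-1) ^+ par i.
  rewrite /par; case: eqP => [//|/eqP dN]; rewrite expr0; apply/eqP.
  have : (ds 0 i - 1) * (ds 0 i + 1) == 0 by rewrite -subr_sqr expr1n expr2 dsq subrr.
  by rewrite mulf_eq0 subr_eq0 addr_eq0 (negPf dN) orbF.
have parP i a : P i a != 0 -> par i = rep_par V a.
  move=> Pn0; apply: sgn_inj; rewrite -dsP; apply: (mulIf Pn0).
  have : diag_mx ds *m P = P *m S by rewrite -PSQ -mulmxA QP -mulmxA SP mulmxA -QP mulmxA PQ mul1mx.
  by move=> /matrixP/(_ i a); rewrite mul_diag_mx mul_mx_diag !mxE mulrC => ->; rewrite mulrC.
have parQ a i : Q a i != 0 -> rep_par V a = par i.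
  move=> Qn0; apply: sgn_inj; rewrite -dsP; apply: (mulfI Qn0).
  have : Q *m diag_mx ds = S *m Q by rewrite -PSQ !mulmxA QP -SP -!mulmxA -QP -!mulmxA PQ mulmx1.
  by move=> /matrixP/(_ a i); rewrite mul_diag_mx mul_mx_diag !mxE => ->; rewrite mulrC.
have ab' (A : superalg k) (g : SL22 A) : absorb b (map_mx (in_alg A) (Q *m P)) (evalmx (rep_mx V) g).
  by rewrite QP; exact: ab.
have RU := conj_repmx RR PQ ab'.
have Uev (A : superalg k) (g : SL22 A) i j : sa_hom (par i (+) par j) (reval g (rconj P Q (rep_mx V) i j)).
  rewrite rsumE; apply: hom_sum => a _; rewrite rsumE; apply: hom_sum => c _ /=.
  have [->|/parP ->] := eqVneq (P i a) 0; first by rewrite scale0r mul0r; apply: sa_hom0.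
  have [->|/parQ <-] := eqVneq (Q c j) 0; first by rewrite scale0r !mulr0; apply: sa_hom0.
  apply: homM_even; first exact: hom_alg.
  by apply: homM_evenr; [exact: rep_even|exact: hom_alg].
pose U := Rep Uev (rmx_scal RU) (rmx_mul RU).
have DU c : dmx (rconj P Q (rep_mx V)) (hb k c) = diag_mx (if c then d1 else d0).
  rewrite dmx_conj; have E : P *m dmx (rep_mx V) (hb k c) *m Q = G *m H c *m invmx G.
    by rewrite /H dmx_conj PE QE !mulmxA.
  by rewrite E; case: c {E}; rewrite ?d0E ?d1E.
have [z0 [z0E _]] := dmx_hb_weights char0 RU (DU false).
have [z1 [z1E _]] := dmx_hb_weights char0 RU (DU true).
exists U, P, Q, (fun i => (z0 i, z1 i)); split=> //; first by move=> A g; exact: rconjE.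
move=> c; rewrite [LHS]DU; congr diag_mx; apply/rowP => i; rewrite mxE.
by case: c; rewrite ?z0E ?z1E.
Qed.
End Compress.

Section QuadParts.
Variables (k : fieldType) (p q : bool).
Local Notation A := (qalg k p q).

Lemma q0mxM m n r (X : 'M[A]_(m, n)) (Y : 'M[A]_(n, r)) :
  map_mx (@q0 k) (X *m Y) = map_mx (@q0 k) X *m map_mx (@q0 k) Y.
Proof.
apply/matrixP => i j; rewrite !mxE q0_sum; apply: eq_bigr => l _.
by rewrite !mxE.
Qed.

Lemma q1mxM m n r (X : 'M[A]_(m, n)) (Y : 'M[A]_(n, r)) :
  map_mx (@q1 k) (X *m Y) =
  map_mx (@q0 k) X *m map_mx (@q1 k) Y + map_mx (@q1 k) X *m map_mx (@q0 k) Y.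
Proof.
apply/matrixP => i j; rewrite !mxE q1_sum -big_split; apply: eq_bigr => l _.
by rewrite !mxE.
Qed.

Lemma q0mx_alg m n (X : 'M[k]_(m, n)) : map_mx (@q0 k) (map_mx (in_alg A) X) = X.
Proof. by apply/matrixP => i j; rewrite !mxE /= mulr1. Qed.

Lemma q1mx_alg m n (X : 'M[k]_(m, n)) : map_mx (@q1 k) (map_mx (in_alg A) X) = 0.
Proof. by apply/matrixP => i j; rewrite !mxE /= mulr0. Qed.

Lemma q1mx_inf n (X : 'M[k]_n) :
  map_mx (@q1 k) (1%:M + qy k p q *: map_mx (in_alg A) X) = X.
Proof. by apply/matrixP => i j; rewrite !mxE /=; case: eqP => _ /=; ring. Qed.

Lemma q0mx_inf n (X : 'M[k]_n) :
  map_mx (@q0 k) (1%:M + qy k p q *: map_mx (in_alg A) X) = 1%:M.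
Proof. by apply/matrixP => i j; rewrite !mxE /=; case: eqP => _ /=; ring. Qed.

Lemma q0mx1 n : map_mx (@q0 k) (1%:M : 'M[A]_n) = 1%:M.
Proof. by apply/matrixP => i j; rewrite !mxE; case: eqP. Qed.
End QuadParts.

Lemma inf_point (k : fieldType) p (M : 'M[k]_(2 + 2)) : homog p M -> str M = 0 ->
  exists g : SL22 (qalg k p false),
    sl_mx g = 1%:M + qy k p false *: map_mx (in_alg _) M /\
    forall n (R : 'I_n -> 'I_n -> regexpr k), is_repmx R ->
      evalmx R g = 1%:M + qy k p false *: map_mx (in_alg _) (dmx R M).
Proof.
move=> hM sM; have s0 : str (0 : 'M[k]_(2 + 2)) = 0 by rewrite strE !mxE; ring.
have [||||||g gE] := @qmx_point k p false M 0 0; rewrite ?mulmx0 //; try exact: homog0.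
have gE' : sl_mx g = 1%:M + qy k p false *: map_mx (in_alg _) M.
  by rewrite gE; apply/matrixP => a c; rewrite !mxE; apply: quad_eq => /=; case: eqP => _ /=; ring.
have yy : qy k p false * qy k p false = 0 by apply: quad_eq => /=; ring.
by exists g; split=> // n R RR; exact: rho_inf.
Qed.

Lemma mor_lie (k : fieldType) (V W : rep k) f p M : @is_mor k V W f -> homog p M -> str M = 0 ->
  f *m dmx (rep_mx V) M = dmx (rep_mx W) M *m f.
Proof.
move=> [_ mf] hM sM; have [g [_ gE]] := inf_point hM sM.
have := congr1 (map_mx (@q1 k)) (mf _ g); rewrite /act !gE; try exact: rep_repmx.
by rewrite !q1mxM !q1mx_inf !q0mx_inf !q0mx_alg !q1mx_alg mul0mx mulmx0 addr0 add0r.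
Qed.

(** * Separating weights by traces *)

Section CommutingPolynomials.
Variable k : fieldType.

(** Products of shifts of two matrices by integers: enough polynomials to isolate one joint integral
    eigenvalue of a commuting pair. *)
Definition hpoly n (X Y : 'M[k]_n) (l1 l2 : seq int) : 'M[k]_n :=
  foldr (fun t Z => (X - t%:~R%:M) *m Z)
    (foldr (fun t Z => (Y - t%:~R%:M) *m Z) 1%:M l2) l1.

Lemma hpoly_conj m n (X Y : 'M[k]_n) (X' Y' : 'M[k]_m) (f : 'M[k]_(m, n)) l1 l2 :
  f *m X = X' *m f -> f *m Y = Y' *m f -> f *m hpoly X Y l1 l2 = hpoly X' Y' l1 l2 *m f.
Proof.
have step (Z : 'M[k]_n) (Z' : 'M[k]_m) z z' (t : int) : f *m Z = Z' *m f -> f *m z = z' *m f ->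
    f *m ((Z - t%:~R%:M) *m z) = ((Z' - t%:~R%:M) *m z') *m f.
  move=> fZ fz; rewrite mulmxA mulmxBr fZ mul_mx_scalar -mul_scalar_mx -mulmxBl.
  by rewrite -!mulmxA fz.
move=> fX fY; rewrite /hpoly; elim: l1 => [|t l1 IH] /=; last exact: step.
by elim: l2 => [|t l2 IH] /=; [rewrite mul1mx mulmx1|exact: step].
Qed.

Definition evw (l1 l2 : seq int) (b : P0) : k :=
  (\prod_(t <- l1) (b.1 - t)%:~R) * \prod_(t <- l2) (b.2 - t)%:~R.
Definition evc l1 l2 (f : ZP0) : k := linext (evw l1 l2) f.

Lemma hpoly_diag n (w : 'I_n -> P0) l1 l2 :
  hpoly (diag_mx (\row_i (w i).1%:~R)) (diag_mx (\row_i (w i).2%:~R)) l1 l2 =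
  diag_mx (\row_i evw l1 l2 (w i)).
Proof.
have sub (x : 'I_n -> int) (t : int) :
    diag_mx (\row_i (x i)%:~R) - t%:~R%:M = diag_mx (\row_i (x i - t)%:~R : 'rV[k]_n).
  apply/matrixP => i j; rewrite !mxE intrB; case: eqP => [->|_]; by rewrite ?mulr1n ?mulr0n ?subr0.
rewrite /hpoly /evw; elim: l1 => [|t l1 IH] /=.
  elim: l2 => [|t l2 IH] /=.
    apply/matrixP => i j; rewrite !mxE !big_nil mulr1 //.
  rewrite IH sub mulmx_diag; congr diag_mx; apply/rowP => i; rewrite !mxE.
  by rewrite !big_nil !mul1r big_cons.
rewrite IH sub mulmx_diag; congr diag_mx; apply/rowP => i; rewrite !mxE.
by rewrite big_cons mulrA.
Qed.

Hypothesis char0 : [pchar k] =i pred0.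

(** Interpolation: when [l1] and [l2] list the coordinates in the support that differ from those of
    [b0], only the term at [b0] is left, with a factor that is nonzero in characteristic 0. *)
Lemma evc_sep f f' : (forall l1 l2, evc l1 l2 f = evc l1 l2 f') -> f = f'.
Proof.
move=> E; suff H g : (forall l1 l2, evc l1 l2 g = 0) -> forall b, coef g b = 0.
  apply: ZP0P => b; apply/eqP; rewrite -subr_eq0 -coefB_P0; apply/eqP; apply: H => l1 l2.
  by rewrite /evc raddfB /= -!/(evc _ _ _) E subrr.
move=> Z b0; pose l1 := [seq b.1 | b <- msupp g & b.1 != b0.1].
pose l2 := [seq b.2 | b <- msupp g & b.2 != b0.2].
have := Z l1 l2; rewrite /evc (@lift_only _ _ _ _ b0) => [|b nb gb]; last first.
  have bs : b \in msupp g by rewrite -mcoeff_neq0.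
  have P0' l (x : int) : x \in l -> \prod_(t <- l) (x - t)%:~R = 0 :> k.
    by move=> xl; rewrite (big_rem _ xl) /= subrr mul0r.
  rewrite /evw; have [e1|n1] := eqVneq b.1 b0.1.
    rewrite (P0' l2) ?mulr0 //; apply/mapP; exists b => //; rewrite mem_filter bs andbT.
    by apply: contra nb => /eqP e2; rewrite [b]surjective_pairing [b0]surjective_pairing e1 e2.
  by rewrite (P0' l1) ?mul0r //; apply/mapP; exists b => //; rewrite mem_filter bs n1.
rewrite -mulrzr => /eqP; rewrite mulf_eq0 => /orP[|]; last by rewrite intk_eq0 // => /eqP.
have Pn l (x : int) : x \notin l -> \prod_(t <- l) (x - t)%:~R != 0 :> k.
  move=> xl; rewrite prodf_seq_neq0; apply/allP => t tl /=.
  by rewrite intk_eq0 // subr_eq0; apply: contraNneq xl => ->.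
have n1 : b0.1 \notin l1 by apply/mapP => -[b]; rewrite mem_filter => /andP[/eqP + _] E'; apply.
have n2 : b0.2 \notin l2 by apply/mapP => -[b]; rewrite mem_filter => /andP[/eqP + _] E'; apply.
by rewrite mulf_eq0 (negPf (Pn _ _ n1)) (negPf (Pn _ _ n2)).
Qed.

Definition wsum n (par : 'I_n -> bool) (w : 'I_n -> P0) : ZP0 :=
  \sum_i expw (w i) *~ (-1) ^+ par i.

Lemma trace_wsum n (par : 'I_n -> bool) (w : 'I_n -> P0) l1 l2 :
  \tr (diag_mx (\row_i (-1) ^+ par i) *m
       hpoly (diag_mx (\row_i (w i).1%:~R)) (diag_mx (\row_i (w i).2%:~R)) l1 l2) =
  evc l1 l2 (wsum par w).
Proof.
rewrite hpoly_diag mulmx_diag mxtrace_diag /evc /wsum raddf_sum; apply: eq_bigr => i _.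
have E : linext (evw l1 l2) (expw (w i) *~ (-1) ^+ par i) = evw l1 l2 (w i) *~ (-1) ^+ par i.
  by rewrite raddfMz /= liftU.
by rewrite [RHS]E !mxE; case: (par i); rewrite ?expr1 ?expr0 ?mulN1r ?mul1r ?mulrNz.
Qed.
End CommutingPolynomials.

Lemma wsum_coef n (par : 'I_n -> bool) (w : 'I_n -> P0) b :
  coef (wsum par w) b = (#|[pred i | (w i == b) && ~~ par i]|)%:Z
                      - (#|[pred i | (w i == b) && par i]|)%:Z.
Proof.
have cardE (P : pred 'I_n) : (#|P|)%:Z = \sum_i (P i)%:Z.
  rewrite -sum1_card big_mkcond /= (big_morph Posz PoszD (erefl _)).
  by apply: eq_bigr => i _; rewrite unfold_in; case: (P i).
rewrite /wsum coef_sum_P0 !cardE -sumrB; apply: eq_bigr => i _.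
by rewrite coefMz coef_expw /=; case: (w i == b); case: (par i).
Qed.

Lemma ring_sum_mul (R : comNzRingType) n m (x : 'I_n -> R) (y : 'I_m -> R) s t :
  (\sum_i x i *~ s i) * (\sum_p y p *~ t p) = \sum_i \sum_p (x i * y p) *~ (s i * t p).
Proof.
rewrite big_distrlr; apply: eq_bigr => i _; apply: eq_bigr => p _.
by rewrite /= mulrzAl mulrzAr -mulrzA [t p * s i]mulrC.
Qed.

(** * Supercharacters *)

Section ShortExact.
Variables (k : fieldType) (V1 V V2 : rep k).
Variables (f : 'M[k]_(rep_dim V, rep_dim V1)) (g : 'M[k]_(rep_dim V2, rep_dim V)).
Hypothesis ex : @short_exact k V1 V V2 f g.

Lemma short_exact_split : exists r s, [/\ g *m s = 1%:M, r *m f = 1%:M & f *m r + s *m g = 1%:M].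
Proof.
case: ex => mf mg fI gS fg.
have [s gs] : exists s, 1%:M = g *m s.
  by apply: mx_factor => j; have [v gv] := gS (col j 1%:M); exists v.
have [r fr] : exists r, 1%:M - s *m g = f *m r.
  apply: mx_factor => j; apply/fg.
  by rewrite colE mulmxA mulmxBr mulmx1 mulmxA -gs mul1mx subrr mul0mx.
exists r, s; split=> //; last by rewrite -fr subrK.
apply/subr0_eq/matrixP => i j; rewrite [RHS]mxE.
have : f *m ((r *m f - 1%:M) *m (delta_mx j 0 : 'cV_(rep_dim V1))) = 0.
  have gfd : g *m (f *m (delta_mx j 0 : 'cV_(rep_dim V1))) = 0 by apply/fg; exists (delta_mx j 0).
  rewrite mulmxBl mul1mx mulmxBr !mulmxA -fr mulmxBl mul1mx mulmxBl.
  by rewrite -(mulmxA s) -(mulmxA s) -(mulmxA g) gfd mulmx0 subr0 subrr.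
by move=> /fI; rewrite -colE => /matrixP/(_ i 0); rewrite !mxE.
Qed.

Lemma trace_exact X1 X X2 : f *m X1 = X *m f -> g *m X = X2 *m g ->
  \tr X = \tr X1 + \tr X2.
Proof.
move=> fX gX; have [r [s [gs rf eq1]]] := short_exact_split.
rewrite -[X]mulmx1 -eq1 mulmxDr mxtraceD; congr (_ + _).
  by rewrite mulmxA -fX -mulmxA mxtrace_mulC -mulmxA rf mulmx1.
by rewrite mulmxA mxtrace_mulC mulmxA gX -mulmxA gs mulmx1.
Qed.
End ShortExact.

Section Characters.
Variables (k : closedFieldType) (char0 : [pchar k] =i pred0).
Implicit Types U V W : rep k.

Definition dh V c := dmx (rep_mx V) (hb k c).
Definition trp V l1 l2 : k := \tr (par_mx V *m hpoly (dh V false) (dh V true) l1 l2).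
(** The supercharacter as a system of supertraces. In this form it is visibly invariant under
    isomorphism and additive on short exact sequences, whatever the bases; [evc_sep] makes it
    unique. *)
Definition is_ch V f := forall l1 l2, trp V l1 l2 = evc k l1 l2 f.

(** Compression by the identity projector is a mere change of basis. *)
Lemma weighted_iso V : exists U (w : 'I_(rep_dim U) -> P0), weighted U w /\ iso_rep V U.
Proof.
have [|||U [P [Q [w [PQ QP UE [parP parQ] wU]]]]] := @compress k char0 V 1%:M false.
- by rewrite mulmx1.
- by rewrite mulmx1 mul1mx.
- by move=> p M _ _; rewrite /absorb mul1mx.
exists U, w; split=> //.
have PQA (A : superalg k) : map_mx (in_alg A) P *m map_mx (in_alg A) Q = 1%:M by rewrite -map_mxM PQ map_mx1.
have QPA (A : superalg k) : map_mx (in_alg A) Q *m map_mx (in_alg A) P = 1%:M by rewrite -map_mxM QP map_mx1.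
exists P, Q; split=> //; split=> // A g; rewrite UE.
  by rewrite -[RHS]mulmxA QPA mulmx1.
by rewrite !mulmxA QPA mul1mx.
Qed.

Lemma is_ch_weighted U w : weighted U w -> is_ch U (wsum (rep_par U) w).
Proof. by move=> wU l1 l2; rewrite /trp /dh (wU false) (wU true); exact: trace_wsum. Qed.

Lemma mor_dh V W f c : @is_mor k V W f -> f *m dh V c = dh W c *m f.
Proof. by move=> mf; apply: (mor_lie mf (homog_hdiag _ _) (str_hdiag _ _)). Qed.

Lemma mor_trp V W f l1 l2 : @is_mor k V W f ->
  f *m (par_mx V *m hpoly (dh V false) (dh V true) l1 l2) =
  (par_mx W *m hpoly (dh W false) (dh W true) l1 l2) *m f.
Proof.
move=> mf; rewrite mulmxA (par_mx_mor mf) -!mulmxA; congr (_ *m _).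
by apply: hpoly_conj; exact: mor_dh.
Qed.

Lemma is_ch_exact V1 V V2 f g h1 h2 : @short_exact k V1 V V2 f g ->
  is_ch V1 h1 -> is_ch V2 h2 -> is_ch V (h1 + h2).
Proof.
move=> ex c1 c2 l1 l2; have [mf mg _ _ _] := ex.
rewrite /trp (trace_exact ex (mor_trp l1 l2 mf) (mor_trp l1 l2 mg)) -!/(trp _ _ _) c1 c2.
by rewrite /evc raddfD.
Qed.

Lemma is_ch_iso V W h : iso_rep V W -> is_ch V h -> is_ch W h.
Proof.
move=> [f [g [mf mg fg gf]]] cV l1 l2; rewrite -cV /trp -[X in \tr X = _]mulmx1 -fg.
by rewrite mulmxA -(mor_trp _ _ mf) -mulmxA mxtrace_mulC -(mulmxA _ g f) gf mulmx1.
Qed.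

Lemma is_ch_exists V : exists f, is_ch V f.
Proof.
have [U [w [wU iV]]] := weighted_iso V; exists (wsum (rep_par U) w).
exact: is_ch_iso (iso_sym iV) (is_ch_weighted wU).
Qed.

Definition ch V : ZP0 := sval (cid (is_ch_exists V)).

Lemma chP V : is_ch V (ch V). Proof. exact: svalP (cid _). Qed.

Lemma ch_uniq V f : is_ch V f -> ch V = f.
Proof. by move=> cf; apply: (evc_sep char0) => l1 l2; rewrite -chP cf. Qed.

Lemma ch_iso V W : iso_rep V W -> ch V = ch W.
Proof. by move=> i; apply/esym/ch_uniq/(is_ch_iso i)/chP. Qed.

Lemma ch_weighted U w : weighted U w -> ch U = wsum (rep_par U) w.
Proof. by move=> wU; exact/ch_uniq/is_ch_weighted. Qed.

Lemma ch_exact V1 V V2 f g : @short_exact k V1 V V2 f g -> ch V = ch V1 + ch V2.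
Proof. by move=> ex; apply/ch_uniq/(is_ch_exact ex); exact: chP. Qed.

Lemma par_mx_parity V : par_mx (parity_change V) = - par_mx V.
Proof.
by apply/matrixP => i j; rewrite !mxE /= signrN mulNrn.
Qed.

Lemma ch_parity V : ch (parity_change V) = - ch V.
Proof.
apply/ch_uniq => l1 l2; have E : evc k l1 l2 (- ch V) = - evc k l1 l2 (ch V) by exact: raddfN.
rewrite E -chP /trp par_mx_parity mulNmx; exact: (raddfN (@mxtrace _ _)).
Qed.

Lemma weighted1 : weighted (rep1 k) (fun=> 0).
Proof. by move=> c; apply/matrixP => i j; rewrite !mxE /=; case: c; rewrite ?mulr0z mul0rn. Qed.

Lemma ch1 : ch (rep1 k) = 1.
Proof. by rewrite (ch_weighted weighted1) /wsum big_ord1. Qed.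

Lemma der_tensor V W M i p j q :
  der M (@tensor_mx k V W (mxtens_index (i, p)) (mxtens_index (j, q))) =
  (-1) ^+ ((rep_par V i (+) rep_par V j) && rep_par W p)
  * (der M (rep_mx V i j) * ev1 (rep_mx W p q) + ev1 (rep_mx V i j) * der M (rep_mx W p q)).
Proof. by rewrite /tensor_mx !mxtens_indexK /= mul0r add0r. Qed.

Definition wtensor V W (v : 'I_(rep_dim V) -> P0) (w : 'I_(rep_dim W) -> P0)
    (x : 'I_(rep_dim (tensor V W))) : P0 :=
  v (mxtens_unindex x).1 + w (mxtens_unindex x).2.

Lemma weighted_tensor V W v w : weighted V v -> weighted W w ->
  weighted (tensor V W) (@wtensor V W v w).
Proof.
move=> hv hw c; apply/matrixP => x y; case: (mxtens_indexP x) => i p; case: (mxtens_indexP y) => j q.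
rewrite [LHS]mxE [RHS]mxE mxE der_tensor !(ev1_repmx (rep_repmx _)) /wtensor !mxtens_indexK [fst _]/= [snd _]/=.
have /matrixP/(_ i j) := hv c; have /matrixP/(_ p q) := hw c; rewrite !mxE => -> ->.
rewrite (can_eq (@mxtens_indexK _ _)) xpair_eqE.
have wD a b : wcomp c (a + b) = wcomp c a + wcomp c b by case: c.
have [->|_] := eqVneq i j; last by rewrite !mulr0n !(mul0r, mulr0, addr0).
rewrite addbb mul1r wD intrD; case: (p == q); rewrite ?mulr1n ?mulr0n ?mulr1 ?mul1r //.
by rewrite !mulr0 addr0.
Qed.

Lemma ch_tensor V W : ch (tensor V W) = ch V * ch W.
Proof.
have [V' [v [hv iV]]] := weighted_iso V; have [W' [w [hw iW]]] := weighted_iso W.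
rewrite (ch_iso (iso_tensor iV iW)) (ch_iso iV) (ch_iso iW).
rewrite (ch_weighted (weighted_tensor hv hw)) (ch_weighted hv) (ch_weighted hw).
apply: etrans (esym (ring_sum_mul _ _ _ _)); rewrite /wsum sum_tens.
apply: eq_bigr => i _; apply: eq_bigr => p _.
apply: (congr2 (fun (x : ZP0) (z : int) => x *~ z)).
  have E : @wtensor V' W' v w (mxtens_index (i, p)) = v i + w p by rewrite /wtensor mxtens_indexK.
  exact: etrans (congr1 expw E) (esym (mrXM _ _ _)).
by rewrite par_tensor signr_addb.
Qed.
End Characters.

(** * Weyl symmetry, parity and string sums of supercharacters *)

Definition wt (i : 'I_(2 + 2)) : P0 :=
  if i == e0 then (1, 0) else if i == e1 then (-1, 0) else if i == f0 then (0, 1) else (0, -1).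

Lemma wval_wt (k : fieldType) c i : wval (~~ c)%:R c%:R i = (wcomp c (wt i))%:~R :> k.
Proof.
by case: c; move: i; apply: ord4_ind; rewrite /wval /wt /= ?mulrN1z ?oppr0.
Qed.

Lemma P0_eq (a b : P0) : a.1 = b.1 :> int -> a.2 = b.2 :> int -> a = b.
Proof. by case: a b => ? ? [? ?] /= -> ->. Qed.

Section WeightedReps.
Variables (k : closedFieldType) (char0 : [pchar k] =i pred0).
Variables (V : rep k) (w : 'I_(rep_dim V) -> P0) (wV : weighted V w).

(** E_ij is an eigenvector of weight [wt i] minus [wt j] for the torus generators. The conclusion is
    written additively because [P0] is only equipped with its monoid structure. *)
Lemma dmx_shift i j a b : i != j -> dmx (rep_mx V) (delta_mx i j) a b != 0 ->
  w a + wt j = w b + wt i.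
Proof.
move=> ij Dab.
have E c : wcomp c (w a) - wcomp c (w b) = wcomp c (wt i) - wcomp c (wt j).
  apply: (intk_inj char0); rewrite !intrB -!(wval_wt k c).
  have := dmx_bracket (rep_repmx V) (@homog_hdiag k (~~ c)%:R c%:R) (@homog_delta k i j)
    (str_hdiag _ _) (str_delta k ij).
  rewrite bracket_hdiag expr0 scale1r.
  have -> : (\matrix_(u, v) ((wval (~~ c)%:R c%:R u - wval (~~ c)%:R c%:R v) * delta_mx i j u v)) =
      (wval (~~ c)%:R c%:R i - wval (~~ c)%:R c%:R j) *: (delta_mx i j : 'M[k]_(2 + 2)).
    apply/matrixP => u v; rewrite !mxE; have [->|_] := eqVneq u i => /=; last by rewrite !mulr0.
    by have [->|_] := eqVneq v j => /=; rewrite ?mulr0.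
  have L t : dmx (rep_mx V) (t *: delta_mx i j) = t *: dmx (rep_mx V) (delta_mx i j) by exact: linearZ.
  rewrite L -/(hb k c) (wV c); move: (dmx _ (delta_mx i j)) Dab {L} => D Dab.
  rewrite mul_diag_mx mul_mx_diag => /matrixP/(_ a b); rewrite !mxE [D a b * _]mulrC -mulrBl.
  exact: (mulIf Dab).
have E0 : (w a).1 - (w b).1 = (wt i).1 - (wt j).1 :> int := E false.
have E1 : (w a).2 - (w b).2 = (wt i).2 - (wt j).2 :> int := E true.
apply: P0_eq.
  change ((w a).1 + (wt j).1 = (w b).1 + (wt i).1 :> int); lia.
by change ((w a).2 + (wt j).2 = (w b).2 + (wt i).2 :> int); lia.
Qed.

(** The scalar matrix -1 is the product of the two tori at -1, which multiplies a vector of weight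
    (a, b) by (-1)^(a + b), and it acts trivially. *)
Lemma ch_even : par_supp false (ch char0 V).
Proof.
have sgz (z : int) : (-1 : k) ^ z = (-1) ^+ odd `|z|.
  rewrite signr_odd; case: z => n //.
  by rewrite -[LHS]/((-1) ^- n.+1) -exprVn invrN1.
have tor c : exists g : SL22 (kalg k), sl_mx g = @torus _ c (kalg k) (-1) (-1) /\
    evalmx (rep_mx V) g = diag_mx (\row_i (-1) ^+ odd `|wcomp c (w i)|).
  have N1 : (-1 : kalg k) * (-1) = 1 by rewrite mulrNN mulr1.
  have [//|g gE] := @torus_point _ c (kalg k) (-1) (-1) _ N1; exists g; split=> //.
  have [z [zE H]] := dmx_hb_weights char0 (rep_repmx V) (wV c).
  have a0 : (-1 : k) != 0 by rewrite oppr_eq0 oner_neq0.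
  apply/matrixP => i j; rewrite (H g (-1) a0) ?gE ?invrN1 // !mxE sgz.
  have -> : z i = wcomp c (w i) by apply: (intk_inj char0); rewrite -zE mxE.
  by case: eqP => [->|].
have [g0 [g0E R0]] := tor false; have [g1 [g1E R1]] := tor true.
have d1 : \det ((-1)%:M : 'M[kalg k]_2) * 1 = 1 by rewrite det2E !mxE /=; ring.
have [//|//|g gE] := @point_even k (kalg k) (-1)%:M (-1)%:M 1 _ _ d1 d1.
have gS : sl_mx g = (-1)%:M by rewrite gE; exact: esym (scalar_mx_block _ _ _).
have E : sl_mx g = sl_mx g0 *m sl_mx g1.
  have m1 : mx2 (-1 : kalg k) 0 0 (-1) = (-1)%:M.
    by apply/matrixP; apply: ord2_ind; apply: ord2_ind; rewrite !mxE.
  by rewrite gE g0E g1E /torus /emb m1 mulmx_block !(mul0mx, mulmx0, mul1mx, mulmx1, addr0, add0r).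
have := rmx_mul (rep_repmx V) E; rewrite (rmx_scal (rep_repmx V) gS) R0 R1 mulmx_diag => D.
have ev i : odd `|((w i).1 + (w i).2)%R| = false.
  have /matrixP/(_ i i) := D; rewrite !mxE eqxx !mulr1n -signr_addb -odd_absD.
  by case: (odd _) => // /(sgn_inj char0 (s := false) (t := true)).
move=> b; rewrite (ch_weighted char0 wV) => bn.
suff [i <-] : exists i, w i = b by exact: ev.
case: (pickP [pred i | w i == b]) => [i /eqP <-|none]; first by exists i.
case/eqP: bn; rewrite wsum_coef !eq_card0 // => i; rewrite !inE; have := none i; by rewrite /= => ->.
Qed.

(** The Weyl element of one block conjugates the torus generator of that block to its opposite and
    commutes with the other one. These relations between points pass to the generators through the
    coefficient of [y], and conjugation by the even matrix [G] preserves supertraces. *)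
Lemma ch_weyl blk (s : P0 -> P0) : (forall b c, wcomp c (s b) = if c == blk then - wcomp c b else wcomp c b) ->
  ch char0 V = wsum (rep_par V) (s \o w).
Proof.
move=> sE; pose A := qalg k false false; pose y : A := qy k false false.
have yy : y * y = 0 by apply: quad_eq => /=; ring.
have h0 : sa_hom false (0 : A) := sa_hom0 A false.
have h1 : sa_hom false (1 : A) := sa_hom1 A.
have hN : sa_hom false (-1 : A) := homN h1.
have hy : sa_hom false y by [].
have e1 : (1 + y) * (1 - y) = 1 by rewrite mulrDl mul1r mulrBr mulr1 yy subr0 addrNK.
have e2 : (1 - y) * (1 + y) = 1 by rewrite mulrBl mul1r mulrDr mulr1 yy addr0 addrK.
have [|x xE] := @emb_point _ A blk 0 (-1) 1 0 h0 hN h1 h0; first by rewrite mul0r mulr1 sub0r opprK.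
have [|x' x'E] := @emb_point _ A blk 0 1 (-1) 0 h0 h1 hN h0; first by rewrite mul0r mul1r sub0r opprK.
have RR := rep_repmx V.
pose G := map_mx (@q0 k) (evalmx (rep_mx V) x); pose G' := map_mx (@q0 k) (evalmx (rep_mx V) x').
have xx' : 1%:M = sl_mx x *m sl_mx x'.
  rewrite xE x'E -embM mx2M !(mul0r, mulr0, mulr1, addr0, add0r, mulrN1, opprK).
  by rewrite -mx2_1 /emb; case: (blk); exact: (scalar_mx_block _ _ _).
have one_pt : exists g : SL22 A, sl_mx g = 1%:M.
  have [||g [gE _]] := @inf_point k false 0; [exact: homog0|by rewrite strE !mxE; ring|].
  by exists g; rewrite gE map_mx0 scaler0 addr0.
have [i1 i1E] := one_pt.
have GG' : G *m G' = 1%:M.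
  have := rmx_mul RR (etrans i1E xx'); rewrite (rmx_scal RR (a := 1) i1E) => /(congr1 (map_mx (@q0 k))).
  by rewrite q0mxM q0mx1.
have GS : G *m par_mx V = par_mx V *m G.
  apply/matrixP => i j; rewrite mul_mx_diag mul_diag_mx !mxE.
  have [E|/negP N] := boolP (rep_par V i == rep_par V j); first by rewrite (eqP E) mulrC.
  have [+ _ _ _] : sa_hom _ _ := rep_even x i j.
  have -> : rep_par V i (+) rep_par V j by rewrite -negb_eqb; apply/negP.
  by move=> /(_ isT) ->; rewrite mul0r mulr0.
have infT c (t : A) (g : SL22 A) : t * t = 0 -> sl_mx g = torus c (1 + t) (1 - t) ->
    evalmx (rep_mx V) g = 1%:M + t *: map_mx (in_alg A) (dh V c).
  by move=> tt gE; apply: (rho_inf RR tt); rewrite gE torus_inf.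
have Gh c : G *m dh V c = (if c == blk then - dh V c else dh V c) *m G.
  have [|g gE] := @torus_point k c A (1 + y) (1 - y) _ e1; first by [].
  have Rg := infT c y g yy gE.
  have q0g : map_mx (@q0 k) (evalmx (rep_mx V) g) = 1%:M by rewrite Rg q0mx_inf.
  have q1g : map_mx (@q1 k) (evalmx (rep_mx V) g) = dh V c by rewrite Rg q1mx_inf.
  case: eqP => [cb|/eqP cb].
    have [|g' g'E] := @torus_point k c A (1 - y) (1 + y) _ e2; first by [].
    have yy' : - y * - y = 0 by rewrite mulrNN.
    have Rg' : evalmx (rep_mx V) g' = 1%:M + - y *: map_mx (in_alg A) (dh V c).
      by apply: infT; rewrite // opprK.
    have [//|//|//||xg xgE] := @emb_point _ A blk 0 (- (1 - y)) (1 + y) 0 h0.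
      by rewrite mul0r sub0r mulNr opprK.
    have E1 : sl_mx xg = sl_mx x *m sl_mx g.
      rewrite xgE xE gE /torus cb -embM mx2M; congr emb.
      by apply: mx2_congr; rewrite !(mul0r, mulr0, mul1r, mulN1r, addr0, add0r).
    have E2 : sl_mx xg = sl_mx g' *m sl_mx x.
      rewrite xgE xE g'E /torus cb -embM mx2M; congr emb.
      by apply: mx2_congr; rewrite !(mul0r, mulr0, mulr1, mulrN1, addr0, add0r).
    have q0g' : map_mx (@q0 k) (evalmx (rep_mx V) g') = 1%:M.
      by rewrite Rg'; apply/matrixP => i j; rewrite !mxE /=; case: eqP => _ /=; ring.
    have q1g' : map_mx (@q1 k) (evalmx (rep_mx V) g') = - dh V c.
      by rewrite Rg'; apply/matrixP => i j; rewrite !mxE /=; case: eqP => _ /=; ring.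
    have := rmx_mul RR E1; rewrite (rmx_mul RR E2) => /(congr1 (map_mx (@q1 k))).
    by rewrite !q1mxM q0g q1g q0g' q1g' -/G mulmx1 mul1mx addrC => /addIr.
  have d10 : \det (1%:M : 'M[A]_2) * 1 = 1 by rewrite det2E !mxE /= !mulr1 mulr0 subr0.
  pose T := mx2 (1 + y) 0 0 (1 - y); pose X := mx2 0 (-1) 1 (0 : A).
  have hT i j : sa_hom false (T i j).
    by move: i j; apply: ord2_ind; apply: ord2_ind; rewrite mxE.
  have hX i j : sa_hom false (X i j).
    by move: i j; apply: ord2_ind; apply: ord2_ind; rewrite mxE.
  have dT : \det T * 1 = 1 by rewrite mulr1 det_mx2 mulr0 subr0.
  have dX : \det X * 1 = 1 by rewrite mulr1 det_mx2 mul0r mulr1 sub0r opprK.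
  have [xg xgE] : exists xg : SL22 A, sl_mx xg = if blk then block_mx T 0 0 X else block_mx X 0 0 T.
    by case: (blk); [exact: (point_even hT hX dT dX)|exact: (point_even hX hT dX dT)].
  have cE : c = ~~ blk by case: (c) (blk) cb => [] [].
  have E1 : sl_mx xg = sl_mx x *m sl_mx g.
    rewrite xgE xE gE /torus cE /emb; case: (blk);
      by rewrite mulmx_block !(mul0mx, mulmx0, mul1mx, mulmx1, addr0, add0r).
  have E2 : sl_mx xg = sl_mx g *m sl_mx x.
    rewrite xgE xE gE /torus cE /emb; case: (blk);
      by rewrite mulmx_block !(mul0mx, mulmx0, mul1mx, mulmx1, addr0, add0r).
  have := rmx_mul RR E1; rewrite (rmx_mul RR E2) => /(congr1 (map_mx (@q1 k))).
  by rewrite !q1mxM q0g q1g -/G mulmx1 mul1mx addrC => /addIr.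
apply: ch_uniq => l1 l2; rewrite -trace_wsum.
set Y := _ *m hpoly _ _ l1 l2; have GY : G *m (par_mx V *m hpoly (dh V false) (dh V true) l1 l2) = Y *m G.
  rewrite mulmxA GS /Y -!mulmxA; congr (_ *m _); apply: hpoly_conj; rewrite Gh; congr (_ *m _);
  rewrite /dh wV; case: eqP => cb; apply/matrixP => i j; rewrite !mxE /=.
  - by have := sE (w i) false; rewrite /wcomp cb eqxx => ->; rewrite mulrNz mulNrn.
  - by have := sE (w i) false; rewrite /wcomp; move/eqP/negPf: cb => -> ->.
  - by have := sE (w i) true; rewrite /wcomp cb eqxx => ->; rewrite mulrNz mulNrn.
  - by have := sE (w i) true; rewrite /wcomp; move/eqP/negPf: cb => -> ->.
rewrite /trp -[X in \tr X = _]mulmx1 -(mulmx1C GG') mxtrace_mulC -mulmxA.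
by rewrite GY mxtrace_mulC -mulmxA GG' mulmx1.
Qed.

Lemma ch_W0 : W0_invariant (ch char0 V).
Proof.
have E c d (s : P0 -> P0) : ch char0 V = wsum (rep_par V) (s \o w) ->
    (forall i, (s (w i) == c) = (w i == d)) -> coef (ch char0 V) c = coef (ch char0 V) d.
  move=> sE H.
  have K : coef (wsum (rep_par V) (s \o w)) c = coef (wsum (rep_par V) w) d.
    apply: etrans (wsum_coef (rep_par V) (s \o w) c) _.
    apply: etrans _ (esym (wsum_coef (rep_par V) w d)).
    by apply: (congr2 (fun m n : nat => m%:Z - n%:Z)); apply: eq_card => i; rewrite !inE /= H.
  exact: etrans (congr1 (coef^~ c) sE) (etrans K (esym (congr1 (coef^~ d) (ch_weighted char0 wV)))).
move=> a b; split.
  apply: (E _ _ _ (@ch_weyl false (fun c => (- c.1, c.2)) _)) => [c [|] //|i].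
  by case: (w i) => x y /=; rewrite !xpair_eqE eqr_opp.
apply: (E _ _ _ (@ch_weyl true (fun c => (c.1, - c.2)) _)) => [c [|] //|i].
by case: (w i) => x y /=; rewrite !xpair_eqE eqr_opp.
Qed.
End WeightedReps.

Lemma hdiag_diag (k : fieldType) (p q : k) : hdiag p q = diag_mx (\row_i wval p q i).
Proof. by apply/matrixP => i j; rewrite hdiagE !mxE. Qed.

(** * Vanishing of string sums *)

Section SuperTrace.
Variables (k : fieldType) (n : nat).
Implicit Types S P C H X Z Y W : 'M[k]_n.

Lemma supercyclic S P Y W : S *m Y = - (Y *m S) -> P *m Y = Y *m P ->
  \tr (S *m P *m (Y *m W)) = - \tr (S *m P *m (W *m Y)).
Proof.
move=> SY PY; have -> : \tr (S *m P *m (W *m Y)) = \tr (Y *m S *m P *m W).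
  by rewrite mulmxA mxtrace_mulC !mulmxA.
by rewrite -[Y *m S]opprK -SY !mulNmx raddfN opprK -[S *m Y *m P]mulmxA -PY !mulmxA.
Qed.

(** Multiplied by s, the supertrace of P is that of P (X Z + Z X), which is 0 by cyclicity for odd
    X. For P H the same computation with [H, X] = X leaves minus the supertrace of P Z X. The second
    pair disposes of it: X' commutes with Z X, so the supertrace of P (X' Z' + Z' X') Z X is 0. Two
    pairs are available because the odd root has multiplicity two. *)
Lemma supertrace_vanish S P H X Z X' Z' C (s : k) :
  S *m X = - (X *m S) -> S *m X' = - (X' *m S) ->
  P *m X = X *m P -> P *m X' = X' *m P ->
  X *m Z + Z *m X = C -> X' *m Z' + Z' *m X' = - C -> P *m C = s *: P ->
  H *m X - X *m H = X -> X *m X' = - (X' *m X) -> Z *m X' = - (X' *m Z) -> s != 0 ->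
  \tr (S *m P) = 0 /\ \tr (S *m P *m H) = 0.
Proof.
move=> SX SX' PX PX' XZ XZ' PC HX XX' ZX' s0.
have C0 W : \tr (S *m P *m (C *m W)) = s * \tr (S *m P *m W).
  by rewrite -!mulmxA (mulmxA P C) PC -scalemxAl -scalemxAr mxtraceZ.
split; apply: (mulfI s0); rewrite mulr0.
  by rewrite -[S *m P]mulmx1 -C0 mulmx1 -XZ mulmxDr mxtraceD (supercyclic _ SX PX) addNr.
have E1 : s * \tr (S *m P *m H) = - \tr (S *m P *m (Z *m X)).
  have XH : X *m H = H *m X - X.
    by have /eqP := HX; rewrite subr_eq => /eqP ->; rewrite addrAC subrr add0r.
  rewrite -C0 -XZ mulmxDl mulmxDr mxtraceD -!mulmxA !(mulmxA S P) (supercyclic _ SX PX) XH.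
  have -> : S *m P *m (Z *m (H *m X - X)) = S *m P *m (Z *m H *m X) - S *m P *m (Z *m X).
    by rewrite !mulmxBr !mulmxA.
  by rewrite [X in _ + X]raddfB /= addrA addNr sub0r.
have E2 : s * \tr (S *m P *m (Z *m X)) = 0.
  suff : \tr (S *m P *m (- C *m (Z *m X))) = 0.
    by rewrite mulNmx mulmxN raddfN /= C0 => /eqP; rewrite oppr_eq0 => /eqP.
  rewrite -XZ' mulmxDl mulmxDr mxtraceD -!mulmxA !(mulmxA S P) (supercyclic _ SX' PX').
  have -> : X' *m (Z *m X) = Z *m X *m X'.
    by rewrite -[RHS]mulmxA XX' mulmxN (mulmxA Z X' X) ZX' mulNmx opprK mulmxA.
  by rewrite !mulmxA addNr.
by rewrite E1; move/eqP: E2; rewrite mulf_eq0 (negPf s0) => /eqP ->; rewrite oppr0.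
Qed.
End SuperTrace.

Section Units.
Variables (k : closedFieldType) (char0 : [pchar k] =i pred0) (V : rep k).
Definition unit_op i j := dmx (rep_mx V) (delta_mx i j).

Lemma unit_bracket i j p q : i != j -> p != q ->
  unit_op i j *m unit_op p q
    - (-1) ^+ ((par22 i (+) par22 j) && (par22 p (+) par22 q)) *: (unit_op p q *m unit_op i j) =
  dmx (rep_mx V) (delta_mx i q *+ (j == p)
    - (-1) ^+ ((par22 i (+) par22 j) && (par22 p (+) par22 q)) *: (delta_mx p j *+ (q == i))).
Proof.
move=> ij pq.
rewrite (dmx_bracket (rep_repmx V) (@homog_delta k i j) (@homog_delta k p q) (str_delta k ij) (str_delta k pq)).
by rewrite /sbracket !mul_delta_mx_cond.
Qed.

Lemma unit_anti i j : par22 i (+) par22 j -> par_mx V *m unit_op i j = - (unit_op i j *m par_mx V).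
Proof.
move=> pij; have ij : i != j by apply: contraTneq pij => ->; rewrite addbb.
have := @dmx_par k V _ _ (@homog_delta k i j) (str_delta k ij); rewrite -/(unit_op i j) pij.
move: (unit_op i j) => D pD; apply/matrixP => a b; rewrite mul_diag_mx [RHS]mxE mul_mx_diag !mxE.
have [->|/pD] := eqVneq (D a b) 0; first by rewrite mulr0 mul0r oppr0.
by move/addbP => <-; rewrite signrN mulrN opprK mulrC.
Qed.

(** The matrices E_e0e0 + E_f0f0 and E_e1e1 + E_f1f1 are half of 1 plus or minus the sum of the two
    torus generators, and 1 acts by zero. On weight (a, b) the anticommutators are thus (a + b) / 2
    and its opposite. *)
Lemma unit_cartan : unit_op e0 f0 *m unit_op f0 e0 + unit_op f0 e0 *m unit_op e0 f0 =
    2^-1 *: (dh V false + dh V true) /\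
  unit_op f1 e1 *m unit_op e1 f1 + unit_op e1 f1 *m unit_op f1 e1 =
    - (2^-1 *: (dh V false + dh V true)).
Proof.
have h2 : (2%:R : k) != 0 by rewrite natk_eq0.
have E1 := @unit_bracket e0 f0 f0 e0 isT isT; have E2 := @unit_bracket f1 e1 e1 f1 isT isT.
rewrite !eqxx !parE /= expr1 !scaleN1r !opprK in E1 E2; rewrite E1 E2.
have d1 := dmx1 (rep_repmx V).
have m1 : delta_mx e0 e0 + delta_mx f0 f0 = 2^-1 *: (hb k false + hb k true + 1%:M).
  rewrite /hb !hdiag_diag; apply/matrixP => i j; rewrite !mxE; move: i j.
  by apply: ord4_ind; apply: ord4_ind; rewrite /wval /=; field.
have m2 : delta_mx f1 f1 + delta_mx e1 e1 = 2^-1 *: (- (hb k false + hb k true) + 1%:M).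
  rewrite /hb !hdiag_diag; apply/matrixP => i j; rewrite !mxE; move: i j.
  by apply: ord4_ind; apply: ord4_ind; rewrite /wval /=; field.
have L x y z t : dmx (rep_mx V) (t *: (x + y + z)) =
    t *: (dmx (rep_mx V) x + dmx (rep_mx V) y + dmx (rep_mx V) z) by rewrite linearZ /= !linearD.
have N x : dmx (rep_mx V) (- x) = - dmx (rep_mx V) x by rewrite linearN.
by rewrite !mulr1n m1 m2 opprD !L !N d1 !addr0 -opprD scalerN.
Qed.

Variables (w : 'I_(rep_dim V) -> P0) (wV : weighted V w).

Lemma lift_wsum (T : zmodType) (F : P0 -> T) n (par : 'I_n -> bool) (u : 'I_n -> P0) :
  linext F (wsum par u) = \sum_i F (u i) *~ (-1) ^+ par i.
Proof.
rewrite /wsum raddf_sum; apply: eq_bigr => i _.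
have E : linext F (expw (u i) *~ (-1) ^+ par i) = F (u i) *~ (-1) ^+ par i.
  by rewrite raddfMz /= liftU.
exact: E.
Qed.

Lemma ch_strST s : s != 0 -> strS s (ch char0 V) = 0 /\ strT s (ch char0 V) = 0.
Proof.
move=> s0; have h2 : (2%:R : k) != 0 by rewrite natk_eq0.
pose P : 'M[k]_(rep_dim V) := diag_mx (\row_i ((w i).1 + (w i).2 == s)%:R).
have Pc i j : i != j -> (wt i).1 + (wt i).2 = (wt j).1 + (wt j).2 :> int ->
    P *m unit_op i j = unit_op i j *m P.
  move=> ij wij; have := @dmx_shift k char0 V w wV i j _ _ ij; rewrite -/(unit_op i j).
  move: (unit_op i j) => D sD; apply/matrixP => a b; rewrite mul_diag_mx mul_mx_diag !mxE.
  have [->|/sD E] := eqVneq (D a b) 0; first by rewrite mulr0 mul0r.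
  have E1 : (w a).1 + (wt j).1 = (w b).1 + (wt i).1 :> int := congr1 fst E.
  have E2 : (w a).2 + (wt j).2 = (w b).2 + (wt i).2 :> int := congr1 snd E.
  have -> : (w a).1 + (w a).2 = (w b).1 + (w b).2 :> int by move: wij E1 E2; lia.
  by rewrite mulrC.
have HX : dh V false *m unit_op e0 f0 - unit_op e0 f0 *m dh V false = unit_op e0 f0.
  have := @dmx_shift k char0 V w wV e0 f0 _ _ isT; rewrite -/(unit_op e0 f0) /dh (wV false).
  move: (unit_op e0 f0) => D sD; apply/matrixP => a b; rewrite mul_diag_mx mul_mx_diag !mxE /=.
  have [->|/sD E] := eqVneq (D a b) 0; first by rewrite mulr0 mul0r subr0.
  have E1 : (w a).1 + 0 = (w b).1 + 1 :> int := congr1 fst E.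
  by rewrite addr0 in E1; rewrite E1 intrD; ring.
have PC : P *m (2^-1 *: (dh V false + dh V true)) = (2^-1 * s%:~R) *: P.
  rewrite /dh !wV /P; apply/matrixP => a b; rewrite mul_diag_mx !mxE /=.
  have [->|_] := eqVneq a b; last by rewrite !mulr0n !(addr0, mulr0).
  have [<-|_] := eqVneq; last by rewrite mulr0n !(mul0r, mulr0, mul0rn).
  by rewrite !mulr1n intrD; ring.
have [XZ XZ'] := unit_cartan.
have XX' : unit_op e0 f0 *m unit_op f1 e1 = - (unit_op f1 e1 *m unit_op e0 f0).
  have := @unit_bracket e0 f0 f1 e1 isT isT; rewrite !parE /= expr1 !scaleN1r !opprK !mulr0n addr0 linear0.
  by move/eqP; rewrite addr_eq0 => /eqP.
have ZX' : unit_op f0 e0 *m unit_op f1 e1 = - (unit_op f1 e1 *m unit_op f0 e0).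
  have := @unit_bracket f0 e0 f1 e1 isT isT; rewrite !parE /= expr1 !scaleN1r !opprK !mulr0n addr0 linear0.
  by move/eqP; rewrite addr_eq0 => /eqP.
have s0' : 2^-1 * s%:~R != 0 :> k by rewrite mulf_neq0 ?invr_eq0 // intk_eq0.
have [T0 T1] := supertrace_vanish (unit_anti (isT : par22 e0 (+) par22 f0))
  (unit_anti (isT : par22 f1 (+) par22 e1)) (Pc e0 f0 isT erefl) (Pc f1 e1 isT erefl)
  XZ XZ' PC HX XX' ZX' s0'.
rewrite (ch_weighted char0 wV) /strS /strT !lift_wsum; split; apply: (intk_inj char0).
  rewrite -[RHS]T0 /P mulmx_diag mxtrace_diag raddf_sum; apply: eq_bigr => i _ /=.
  by rewrite mxE !mxE mulrzz rmorphM /= rmorph_sign mulrC; case: eqP.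
rewrite -[RHS]T1 /dh wV /P !mulmx_diag mxtrace_diag raddf_sum; apply: eq_bigr => i _ /=.
by rewrite !mxE mulrzz !rmorphM /= rmorph_sign; case: eqP => _ /=; ring.
Qed.
End Units.

(** * Agreement with the dimensions of weight spaces *)

Section Supercharacter.
Variables (k : closedFieldType) (char0 : [pchar k] =i pred0).

Lemma dim_of_eq n (S : 'cV[k]_n -> Prop) d0 :
  (exists M : 'M[k]_(n, d0), \rank M = d0 /\ forall j, S (col j M)) ->
  (forall d (M : 'M[k]_(n, d)), \rank M = d -> (forall j, S (col j M)) -> (d <= d0)%N) ->
  dim_of S = d0.
Proof.
move=> [M [rM SM]] H; have d0n : (d0 < n.+1)%N by rewrite ltnS -rM rank_leq_row.
apply/eqP; rewrite eqn_leq; apply/andP; split.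
  by apply/bigmax_leqP => d /asboolP[N [rN SN]]; apply: (H _ N).
rewrite /dim_of (bigD1 (Ordinal d0n)) ?leq_maxl //=.
by apply/asboolP; exists M.
Qed.

Lemma weight_vecP V b (v : 'cV[k]_(rep_dim V)) :
  weight_vec b v <-> forall c, dh V c *m v = (wcomp c b)%:~R *: v.
Proof.
have wev (c : bool) : weight_eval b (~~ c)%:R c%:R = (wcomp c b)%:~R :> k.
  by rewrite /weight_eval; case: c; rewrite /= ?mulr1 ?mulr0 ?addr0 ?add0r.
split=> [wv c|H A e p q g he ee gE].
  have [g [gE RE]] := @inf_point k false (hb k c) (homog_hdiag _ _) (str_hdiag _ _).
  have yy : qy k false false * qy k false false = 0 by apply: quad_eq => /=; ring.
  have := wv _ (qy k false false) _ _ g (_ : sa_hom false _) yy gE => /(_ ltac:(by [])).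
  rewrite /act (RE _ _ (rep_repmx V)) => /(congr1 (map_mx (@q1 k))).
  rewrite q1mxM q1mx_inf q0mx_inf q0mx_alg q1mx_alg mulmx0 add0r => ->.
  by rewrite wev; apply/matrixP => i j; rewrite !mxE /=; ring.
have hE : hdiag p q = p *: hb k false + q *: hb k true.
  rewrite /hb !hdiag_diag; apply/matrixP => i j; rewrite !mxE; move: i j.
  by apply: ord4_ind; apply: ord4_ind; rewrite /wval /= ?mulr0n ?mulr1n; ring.
have D : dmx (rep_mx V) (hdiag p q) *m v = weight_eval b p q *: v.
  have -> : dmx (rep_mx V) (hdiag p q) = p *: dh V false + q *: dh V true.
    by rewrite hE linearD /= linearZ /= linearZ.
  rewrite mulmxDl -!scalemxAl !H /weight_eval /wcomp !scalerA -scalerDl.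
  by congr (_ *: _); ring.
rewrite /act (rho_inf (rep_repmx V) ee gE) mulmxDl mul1mx -scalemxAl -map_mxM D.
apply/matrixP => i j; rewrite !mxE rmorphM /= mulrA -[X in X + _]mul1r -mulrDl //.
Qed.

Lemma parity_vecP V s (v : 'cV[k]_(rep_dim V)) :
  parity_vec s v <-> par_mx V *m v = (-1) ^+ s *: v.
Proof.
split=> [H|/matrixP H i vi].
  apply/matrixP => i j; rewrite ord1 mul_diag_mx !mxE.
  by have [->|/H ->] := eqVneq (v i 0) 0; rewrite ?mulr0.
have := H i 0; rewrite mul_diag_mx !mxE => /(mulIf vi); exact: (sgn_inj char0).
Qed.

Lemma ch_supercharacter V : is_supercharacter V (ch char0 V).
Proof.
move=> b; have [U [w [wU [P [Q [mP mQ PQ QP]]]]]] := weighted_iso char0 V.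
have -> : ch char0 V = wsum (rep_par U) w.
  by rewrite -(ch_weighted char0 wU); apply: ch_iso; exists P, Q.
rewrite wsum_coef; suff D s : weight_dim V b s = #|[pred i | (w i == b) && (rep_par U i == s)]|.
  rewrite !D; congr (Posz _ - Posz _); apply: eq_card => i; rewrite !inE; congr (_ && _);
  by case: (rep_par U i).
set I := [pred i | _].
have SV v : (weight_vec b v /\ parity_vec s v) <-> 
    (weight_vec b (P *m v) /\ parity_vec s (P *m v)).
  rewrite !weight_vecP !parity_vecP.
  have inj (x y : 'cV[k]_(rep_dim V)) : P *m x = P *m y -> x = y.
    by move=> /(congr1 (mulmx Q)); rewrite !mulmxA QP !mul1mx.
  split=> -[h1 h2]; split=> [c|].
  - by rewrite mulmxA -(mor_dh c mP) -mulmxA h1 scalemxAr.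
  - by rewrite mulmxA -(par_mx_mor mP) -mulmxA h2 scalemxAr.
  - by apply: inj; rewrite mulmxA (mor_dh c mP) -mulmxA h1 scalemxAr.
  - by apply: inj; rewrite mulmxA (par_mx_mor mP) -mulmxA h2 scalemxAr.
have SU u : (weight_vec b u /\ parity_vec s u) <-> forall i, u i 0 != 0 -> I i.
  rewrite weight_vecP; split=> [[h1 h2] i ui|H].
    rewrite /I /= (h2 _ ui) eqxx andbT; apply/eqP/P0_eq; apply: (intk_inj char0).
      have /matrixP/(_ i 0) := h1 false; rewrite /dh wU mul_diag_mx !mxE; exact: mulIf.
    have /matrixP/(_ i 0) := h1 true; rewrite /dh wU mul_diag_mx !mxE; exact: mulIf.
  split=> [c|i /H /andP[_ /eqP]//].
  apply/matrixP => i j; rewrite ord1 /dh wU mul_diag_mx !mxE.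
  by have [->|/H /andP[/eqP -> _]] := eqVneq (u i 0) 0; rewrite ?mulr0.
(* In a weight basis, the coordinate vectors indexed by [I] realize the dimension; conversely,
   columns lying in the weight space are supported on [I], so their rank is at most the size of
   [I]. *)
pose M0 : 'M[k]_(rep_dim U, #|I|) := \matrix_(i, j) (i == enum_val j)%:R.
have MM : M0^T *m M0 = 1%:M.
  apply/matrixP => i j; rewrite !mxE (bigD1 (enum_val j)) //= !mxE eqxx mulr1 big1 ?addr0.
    by rewrite (inj_eq enum_val_inj) eq_sym.
  by move=> l lj; rewrite !mxE (negPf lj) mulr0.
apply: dim_of_eq => [|d M rM SM].
  exists (Q *m M0); split.
    apply/eqP; rewrite eqn_leq rank_leq_col /=.
    have : (\rank (1%:M : 'M[k]_(#|I|)) <= \rank (Q *m M0))%N.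
      by rewrite -MM -[M0 in X in (X <= _)%N]mul1mx -PQ !mulmxA -mulmxA; apply: mxrankM_maxr.
    by rewrite mxrank1.
  move=> j; apply/SV; apply/SU => i; rewrite colE !mulmxA PQ mul1mx -colE !mxE.
  by have [-> _|_] := eqVneq i (enum_val j); [exact: (enum_valP j)|rewrite eqxx].
have PMI i j : (P *m M) i j != 0 -> I i.
  by have /SV/SU/(_ i) := SM j; rewrite colE mulmxA -colE mxE.
have E : P *m M = M0 *m (M0^T *m (P *m M)).
  move: (P *m M) PMI => PM PMI; apply/matrixP => i j; rewrite mulmxA.
  have MMi l : (M0 *m M0^T) i l = (i == l)%:R * (I i)%:R.
    rewrite !mxE; have [Ii|nIi] := boolP (I i).
      rewrite (bigD1 (enum_rank_in Ii i)) //= !mxE enum_rankK_in // eqxx mul1r big1 ?addr0.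
        by rewrite mulr1 eq_sym.
      move=> u ui; rewrite !mxE [i == _](_ : _ = false) ?mul0r //; apply: contraNF ui => /eqP iu.
      by rewrite -(enum_valK_in Ii u) -iu.
    rewrite mulr0 big1 // => u _; rewrite !mxE [i == _](_ : _ = false) ?mul0r //.
    by apply: contraNF nIi => /eqP iu; have := enum_valP u; rewrite -iu.
  rewrite [RHS]mxE (bigD1 i) //= MMi eqxx mul1r big1 ?addr0.
    by have [->|/PMI ->] := eqVneq (PM i j) 0; rewrite ?mulr0 ?mul1r.
  by move=> l li; rewrite MMi eq_sym (negPf li) !mul0r.
have : (\rank (P *m M) <= #|I|)%N.
  by rewrite E; apply: leq_trans (mxrankM_maxl _ _) (rank_leq_col _).
have : (\rank M <= \rank (P *m M))%N.
  by rewrite -{1}[M]mul1mx -QP -mulmxA; apply: mxrankM_maxr.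
by rewrite rM; apply: leq_trans.
Qed.
End Supercharacter.

Lemma sub_add_opp (T : zmodType) (a b c : T) : a - (b + c) = - (b - a + c).
Proof. by rewrite !opprD opprK [- b + a]addrC -addrA. Qed.

(** * The supercharacter map *)

Section GrothendieckRing.
Local Notation repr := generic_quotient.repr.
Variables (k : closedFieldType) (char0 : [pchar k] =i pred0).
Local Open Scope quotient_scope.
Local Notation G := (groth k).

Lemma groth_eq (x y : free_rep k) : relation (x - y) -> \pi_G x = \pi_G y.
Proof.
move=> r; apply/eqP; rewrite -Quotient.idealrBE; exact/asboolP.
Qed.

Lemma groth_rel (x y : free_rep k) : \pi_G x = \pi_G y -> relation (x - y).
Proof.
by move=> /eqP; rewrite -Quotient.idealrBE => /asboolP.
Qed.

Lemma groth_iso (V W : rep k) : iso_rep V W -> groth_cls V = groth_cls W.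
Proof. by move=> i; rewrite /groth_cls /free_cls; congr (\pi_G (mrX _ _)); apply/clsP. Qed.

Lemma groth_exact (V1 V V2 : rep k) f g : @short_exact k V1 V V2 f g ->
  groth_cls V = groth_cls V1 + groth_cls V2.
Proof.
move=> ex; rewrite /groth_cls -rmorphD; apply: groth_eq.
rewrite sub_add_opp; apply: rel_opp; exact: rel_exact ex.
Qed.

Lemma groth_parity (V : rep k) : groth_cls (parity_change V) = - groth_cls V.
Proof.
rewrite /groth_cls -rmorphN; apply: groth_eq; rewrite opprK addrC; exact: rel_parity.
Qed.

Lemma groth_ind (Q : G -> Prop) : Q 0 -> (forall x y, Q x -> Q y -> Q (x - y)) ->
  (forall V, Q (groth_cls V)) -> forall x, Q x.
Proof.
move=> Q0 QB QV x; rewrite -[x]reprK (free_repE (repr x)) rmorph_sum.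
have QN y : Q y -> Q (- y) by rewrite -sub0r; apply: QB.
have QD y z : Q y -> Q z -> Q (y + z) by move=> hy hz; rewrite -[z]opprK; apply/QB/QN.
apply: big_ind => // a _; rewrite rmorphMz.
have Qn y n : Q y -> Q (y *+ n).
  by move=> hy; elim: n => [|n IH]; rewrite ?mulr0n // mulrS; apply: QD.
have Qa : Q (\pi_G (free_cls (repr a))) := QV (repr a).
case: (mcoeff _ _) => n; first by rewrite -pmulrn; apply: Qn.
by rewrite NegzE mulrNz -pmulrn; apply/QN/Qn.
Qed.

Definition ch_free (x : free_rep k) : ZP0 := 
  linext (fun a : isoclass k => ch char0 (repr a)) (x : {malg int[isoclass k]}).

Lemma ch_free_cls V : ch_free (free_cls V) = ch char0 V.
Proof.
apply: etrans (liftU _ _ _) _; rewrite mulr1z; exact/ch_iso/repr_cls.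
Qed.

Lemma ch_freeM x y : ch_free (x * y) = ch_free x * ch_free y.
Proof.
apply: lift_mul => a b; apply: etrans (ch_iso char0 (repr_cls _)) _.
exact: ch_tensor.
Qed.

Lemma ch_freeB x y : ch_free (x - y) = ch_free x - ch_free y.
Proof. exact: raddfB. Qed.

Lemma ch_free_rel x : relation x -> ch_free x = 0.
Proof.
elim=> [V1 V V2 f g ex|V||y z _ hy _ hz].
- have E : ch_free (free_cls V1 - free_cls V + free_cls V2) =
     ch_free (free_cls V1) - ch_free (free_cls V) + ch_free (free_cls V2).
    exact: etrans (raddfD _ _ _) (congr1 (+%R^~ _) (raddfB _ _ _)).
  apply: etrans E _; rewrite !ch_free_cls (ch_exact char0 ex).
  by move: (ch char0 V1) (ch char0 V2) => a b; rewrite opprD addrA subrr sub0r addNr.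
- have E : ch_free (free_cls V + free_cls (parity_change V)) =
     ch_free (free_cls V) + ch_free (free_cls (parity_change V)) by exact: raddfD.
  by rewrite E !ch_free_cls ch_parity; exact: subrr.
- exact: raddf0.
- by rewrite ch_freeB hy hz subr0.
Qed.

Definition sch_fun (x : G) : ZP0 := ch_free (repr x).

Lemma sch_pi x : sch_fun (\pi_G x) = ch_free x.
Proof.
have r : relation (repr (\pi_G x) - x) by apply: groth_rel; rewrite reprK.
have := ch_free_rel r; rewrite ch_freeB => /eqP; rewrite subr_eq0 => /eqP; exact.
Qed.

Lemma sch_funB : {morph sch_fun : x y / x - y}.
Proof.
move=> x y; rewrite -[x]reprK -[y]reprK -rmorphB !sch_pi; exact: ch_freeB.
Qed.

Lemma sch_funM : {morph sch_fun : x y / x * y}.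
Proof.
move=> x y; rewrite -[x]reprK -[y]reprK -rmorphM !sch_pi; exact: ch_freeM.
Qed.

Lemma sch_fun_cls V : sch_fun (groth_cls V) = ch char0 V.
Proof. by rewrite sch_pi ch_free_cls. Qed.

Lemma sch_fun1 : sch_fun 1 = 1.
Proof.
have <- : \pi_G (1 : free_rep k) = 1 by exact: rmorph1.
exact: etrans (sch_pi 1) (etrans (ch_free_cls (rep1 k)) (ch1 char0)).
Qed.

Lemma sch_exists : exists sch : {rmorphism G -> ZP0}, forall x, sch x = sch_fun x.
Proof.
pose ha := GRing.isZmodMorphism.Build _ _ sch_fun sch_funB.
pose hm := GRing.isMonoidMorphism.Build _ _ sch_fun (conj sch_fun1 sch_funM).
pose sch : {rmorphism G -> ZP0} := HB.pack sch_fun ha hm.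
by exists sch.
Qed.

Lemma ch_Jstr V : Jstr (ch char0 V) /\ par_supp false (ch char0 V).
Proof.
have [U [w [wU iV]]] := weighted_iso char0 V; rewrite (ch_iso char0 iV).
split; last exact: ch_even wU.
by split=> [|s s0]; [exact: ch_W0 wU|exact: ch_strST wU s s0].
Qed.

Lemma sch_fun_Jstr x : Jstr (sch_fun x) /\ par_supp false (sch_fun x).
Proof.
elim/groth_ind: x => [|x y [Jx px] [Jy py]|V].
- have -> : sch_fun 0 = sch_fun (1 - 1) by rewrite subrr.
  rewrite sch_funB sch_fun1 -(ch1 char0); have [J p] := ch_Jstr (rep1 k).
  by split; [exact: Jstr_sub|exact: par_supp_sub].
- by rewrite sch_funB; split; [exact: Jstr_sub|exact: par_supp_sub].
- by rewrite sch_fun_cls; exact: ch_Jstr.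
Qed.
End GrothendieckRing.

Notation hgt := (height (2, 1)).

Section LieSplit.
Variables (k : closedFieldType) (char0 : [pchar k] =i pred0).

Lemma lie_split (M : 'M[k]_(2 + 2)) : str M = 0 -> exists a b c : k,
  M = (\sum_i \sum_j (M i j *+ (i != j)) *: delta_mx i j) + (a *: hb k false + b *: hb k true + c *: 1%:M).
Proof.
have h2 : (2%:R : k) != 0 by rewrite natk_eq0.
rewrite strE => sM; have M11 : M f1 f1 = M e0 e0 + M e1 e1 - M f0 f0.
  by apply/eqP; rewrite -subr_eq0 -oppr_eq0 -sM; apply/eqP; ring.
exists ((M e0 e0 - M e1 e1) / 2), ((M f0 f0 - M f1 f1) / 2), ((M e0 e0 + M e1 e1) / 2).
have -> : \sum_i \sum_j (M i j *+ (i != j)) *: delta_mx i j = \matrix_(i, j) (M i j *+ (i != j)).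
  by rewrite [RHS]matrix_sum_delta; apply: eq_bigr => i _; apply: eq_bigr => j _; rewrite mxE.
rewrite /hb !hdiag_diag; apply/matrixP; apply: ord4_ind; apply: ord4_ind;
  rewrite !mxE /wval /= ?M11; by field.
Qed.

Lemma dmx_sum_units (V : rep k) (F : 'I_(2 + 2) -> 'I_(2 + 2) -> k) :
  dmx (rep_mx V) (\sum_i \sum_j F i j *: delta_mx i j) = \sum_i \sum_j F i j *: unit_op V i j.
Proof.
rewrite linear_sum; apply: eq_bigr => i _; rewrite linear_sum; apply: eq_bigr => j _.
exact: linearZ.
Qed.
End LieSplit.

(** * Highest weights and injectivity *)

Section HighestWeight.
Variables (k : closedFieldType) (char0 : [pchar k] =i pred0) (V : rep k).
Local Notation cV := 'cV[k]_(rep_dim V).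

(** The span of what the lower triangular operators make out of [v], for the order e0 > f0 > f1 > e1
    given by the height. *)
Inductive low (v : cV) : cV -> Prop :=
| low_gen : low v v
| low_lin (c : k) x y of low v x & low v y : low v (c *: x + y)
| low_op i j x of hgt (wt i) < hgt (wt j) & low v x : low v (unit_op V i j *m x).

Record hwv (v : cV) (b : P0) (s : bool) : Prop := Hwv {
  hw_raise : forall i j, hgt (wt j) < hgt (wt i) -> unit_op V i j *m v = 0;
  hw_weight : forall c, dh V c *m v = (wcomp c b)%:~R *: v;
  hw_par : par_mx V *m v = (-1) ^+ s *: v }.

Lemma low0 v : low v 0.
Proof.
have -> : 0 = -1 *: v + v :> cV by rewrite scaleN1r addNr.
by apply: low_lin; exact: low_gen.
Qed.

Lemma lowZ v c x : low v x -> low v (c *: x).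
Proof. by move=> lx; rewrite -[_ *: x]addr0; apply: low_lin => //; exact: low0. Qed.

Lemma lowD v x y : low v x -> low v y -> low v (x + y).
Proof. by move=> lx ly; rewrite -[x]scale1r; apply: low_lin. Qed.

Lemma hgt_neq i j : i != j -> (hgt (wt i) < hgt (wt j)) || (hgt (wt j) < hgt (wt i)).
Proof. by move: i j; apply: ord4_ind; apply: ord4_ind. Qed.

(** Induction on membership, for all [M] at once: [M] passes a lowering operator up to sign and a
    bracket, and the hypothesis covers both terms. On [v] itself, [M] splits into raising, lowering
    and torus parts and a multiple of 1, which acts by zero. *)
Lemma low_lie v b s x p M : hwv v b s -> low v x -> homog p M -> str M = 0 ->
  low v (dmx (rep_mx V) M *m x).
Proof.
move=> hv lx; elim: lx p M => {x} [|c x y _ IHx _ IHy|i j x ij lx IH] p M hM sM.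
- have [a [d [c ->]]] := lie_split char0 sM.
  have L (X Y : 'M[k]_(2 + 2)) : dmx (rep_mx V) (X + Y) = dmx (rep_mx V) X + dmx (rep_mx V) Y by exact: linearD.
  have Z t (X : 'M[k]_(2 + 2)) : dmx (rep_mx V) (t *: X) = t *: dmx (rep_mx V) X by exact: linearZ.
  rewrite !L !Z (dmx1 (rep_repmx V)) scaler0 addr0 !mulmxDl -!scalemxAl -!/(dh V _) !(hw_weight hv).
  apply: lowD; last by apply: lowD; apply/lowZ/lowZ/low_gen.
  rewrite dmx_sum_units mulmx_suml; apply: big_ind => [|? ?|u _]; [exact: low0|exact: lowD|].
  rewrite mulmx_suml; apply: big_ind => [|? ?|t _]; [exact: low0|exact: lowD|].
  rewrite -scalemxAl; have [ut|ut] := eqVneq u t; first by rewrite mulr0n scale0r; exact: low0.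
  apply: lowZ; case/orP: (hgt_neq ut) => ht; first by apply: low_op => //; exact: low_gen.
  by rewrite (hw_raise hv ht); exact: low0.
- by rewrite mulmxDr -scalemxAr; apply: low_lin; [exact: IHx hM sM|exact: IHy hM sM].
have ij' : i != j by apply: contraTneq ij => ->; rewrite ltxx.
have := dmx_bracket (rep_repmx V) hM (@homog_delta k i j) sM (str_delta k ij').
move/eqP; rewrite subr_eq addrC => /eqP; rewrite -/(unit_op V i j) => E.
rewrite mulmxA E mulmxDl; apply: lowD; last first.
  by apply: IH; [apply: homog_bracket hM _; exact: homog_delta|apply: str_bracket hM _; exact: homog_delta].
rewrite -scalemxAl -mulmxA; apply/lowZ/low_op => //; exact: IH hM sM.
Qed.

Lemma unit_par i j : i != j -> par_mx V *m unit_op V i j =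
  (-1) ^+ (par22 i (+) par22 j) *: (unit_op V i j *m par_mx V).
Proof.
move=> ij; case: (boolP (par22 i (+) par22 j)) => pij.
  by rewrite expr1 scaleN1r; exact: unit_anti.
rewrite expr0 scale1r; apply: par_mx_comm; last exact: str_delta.
by have := @homog_delta k i j; rewrite (negPf pij).
Qed.

Lemma low_par v b s x : hwv v b s -> low v x -> low v (par_mx V *m x).
Proof.
move=> hv; elim=> {x} [|c x y _ IHx _ IHy|i j x ij lx IH].
- by rewrite (hw_par hv); apply/lowZ/low_gen.
- by rewrite mulmxDr -scalemxAr; apply: low_lin.
have ij' : i != j by apply: contraTneq ij => ->; rewrite ltxx.
by rewrite mulmxA (unit_par ij') -scalemxAl -mulmxA; apply/lowZ/low_op.
Qed.

Variables (w : 'I_(rep_dim V) -> P0) (wV : weighted V w).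

Lemma weight_entry (v : cV) b i : (forall c, dh V c *m v = (wcomp c b)%:~R *: v) -> v i 0 != 0 -> w i = b.
Proof.
move=> hv vi; apply: P0_eq; apply: (intk_inj char0).
  have /matrixP/(_ i 0) := hv false; rewrite /dh wV mul_diag_mx !mxE; exact: mulIf.
have /matrixP/(_ i 0) := hv true; rewrite /dh wV mul_diag_mx !mxE; exact: mulIf.
Qed.

Lemma unit_hgt i j a c : i != j -> unit_op V i j a c != 0 ->
  hgt (w a) = hgt (w c) + (hgt (wt i) - hgt (wt j)).
Proof.
move=> ij /(dmx_shift char0 wV ij) E.
have E1 : (w a).1 + (wt j).1 = (w c).1 + (wt i).1 :> int := congr1 fst E.
have E2 : (w a).2 + (wt j).2 = (w c).2 + (wt i).2 :> int := congr1 snd E.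
have H (x1 x2 y1 y2 i1 i2 j1 j2 : int) : x1 + j1 = y1 + i1 -> x2 + j2 = y2 + i2 ->
    2 * x1 + 1 * x2 = 2 * y1 + 1 * y2 + (2 * i1 + 1 * i2 - (2 * j1 + 1 * j2)) by lia.
exact: H E1 E2.
Qed.

(** Lowering strictly decreases the height, so at the height of [v] and above only multiples of [v]
    remain. *)
Lemma low_top v b s x : hwv v b s -> low v x ->
  exists c, forall i, hgt b <= hgt (w i) -> x i 0 = c * v i 0.
Proof.
move=> hv; elim=> {x} [|c x y _ [cx Ex] _ [cy Ey]|i j x ij lx [cx Ex]].
- by exists 1 => i _; rewrite mul1r.
- by exists (c * cx + cy) => i hi; rewrite !mxE Ex // Ey //; ring.
have ij' : i != j by apply: contraTneq ij => ->; rewrite ltxx.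
exists 0 => a ha; rewrite mul0r mxE big1 // => l _.
have [->|/(unit_hgt ij') E] := eqVneq (unit_op V i j a l) 0; first by rewrite mul0r.
have [vl|/(weight_entry (hw_weight hv)) vl] := eqVneq (v l 0) 0.
  by rewrite Ex ?vl ?mulr0 //; move: ij ha; rewrite E; lia.
by move: ij ha; rewrite E vl; lia.
Qed.

(** A basis vector of height at least that of [b] agrees there with a multiple of [v] by [low_top].
    Hence there is just one such basis vector, and the leading coefficient is a sign. *)
Lemma low_lead v b s : hwv v b s -> v != 0 -> (forall x, low v x) ->
  is_lead (2, 1) b (ch char0 V).
Proof.
move=> hv v0 full.
have [i1 vi1] : exists i, v i 0 != 0.
  apply/existsP; apply: contraNT v0; rewrite negb_exists => /forallP H.
  by apply/eqP/matrixP => i j; rewrite ord1 mxE; apply/eqP; have := H i; rewrite negbK.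
have wi1 := weight_entry (hw_weight hv) vi1.
have uniq i : hgt b <= hgt (w i) -> i = i1.
  move=> hi; have [c cE] := low_top hv (full (delta_mx i 0)).
  have := cE i hi; rewrite mxE !eqxx /= => Ei; have := cE i1; rewrite wi1 lexx mxE => /(_ isT).
  rewrite eqxx andbT; have [//|_] := eqVneq i1 i.
  move=> /esym/eqP; rewrite mulf_eq0 (negPf vi1) orbF => /eqP c0.
  by move/eqP: Ei; rewrite c0 mul0r oner_eq0.
rewrite (ch_weighted char0 wV); split.
  have C (q : pred _) : #|[pred i | (w i == b) && q i]| = q i1 :> nat.
    case: (boolP (q i1)) => qi.
      rewrite -[RHS](card1 i1); apply: eq_card => i; rewrite !inE.
      by apply/andP/eqP => [[/eqP wi _]|->]; [apply: uniq; rewrite wi|rewrite wi1].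
    apply: eq_card0 => i; rewrite !inE; apply/negP => /andP[/eqP wi].
    by rewrite (uniq i) ?wi // (negPf qi).
  have -> : coef (wsum (rep_par V) w) b = (~~ rep_par V i1)%:Z - (rep_par V i1)%:Z.
    apply: etrans (wsum_coef _ _ _) _.
    by rewrite (C (fun i => ~~ rep_par V i)) (C (rep_par V)).
  by case: (rep_par V i1).
move=> d db dn.
suff [i wi] : exists i, w i = d.
  rewrite ltNge; apply: contra db => le; rewrite -wi (uniq i) ?wi1 // wi //.
case: (pickP [pred i | w i == d]) => [i /eqP <-|none]; first by exists i.
case/eqP: dn; apply: etrans (wsum_coef _ _ _) _.
by rewrite !eq_card0 // => i; rewrite !inE; have := none i; rewrite /= => ->.
Qed.

Record substable (S : cV -> Prop) : Prop := Substable {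
  sub_zero : S 0;
  sub_lin : forall (c : k) x y, S x -> S y -> S (c *: x + y);
  sub_lie : forall p M, homog p M -> str M = 0 -> forall x, S x -> S (dmx (rep_mx V) M *m x);
  sub_par : forall x, S x -> S (par_mx V *m x) }.

Lemma low_substable v b s : hwv v b s -> substable (low v).
Proof.
move=> hv; split; [exact: low0|exact: low_lin| |by move=> x; apply: low_par hv].
by move=> p M hM sM x lx; apply: low_lie hv lx hM sM.
Qed.
End HighestWeight.

(** * Subrepresentations, quotients and direct sums *)

Lemma subspace_mx (k : fieldType) n (S : 'cV[k]_n -> Prop) : S 0 ->
  (forall c x y, S x -> S y -> S (c *: x + y)) ->
  exists U : 'M[k]_n, forall x, S x <-> (x^T <= U)%MS.
Proof.
move=> S0 Sl.
(* A row space contained in [S] and of maximal rank must be all of [S]. *)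
pose P r := `[< exists U : 'M[k]_n, (forall x, (x^T <= U)%MS -> S x) /\ \rank U = r >].
have ex : exists r, P r.
  exists 0%N; apply/asboolP; exists 0; split; last exact: mxrank0.
  by move=> x; rewrite submx0 => /eqP /(congr1 trmx); rewrite trmxK trmx0 => ->.
have ub r : P r -> (r <= n)%N by move=> /asboolP[U [_ <-]]; exact: rank_leq_row.
case: (ex_maxnP ex ub) => r /asboolP[U [US Ur]] max; exists U => x; split; last exact: US.
move=> Sx; apply: contraT => xU.
have : P (\rank (U + x^T)%MS).
  apply/asboolP; exists (U + x^T)%MS; split=> // y /sub_addsmxP[[u1 u2] /= E].
  have -> : y = u2 0 0 *: x + (u1 *m U)^T.
    rewrite -[y]trmxK E linearD /= addrC; congr (_ + _).
    rewrite trmx_mul trmxK [u2]mx11_scalar mul_mx_scalar' || rewrite trmx_mul trmxK.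
    by apply/matrixP => i j; rewrite !mxE big_ord1 !mxE mulrC (ord1 j).
  by apply: Sl => //; apply: US; rewrite trmxK submxMl.
move/max; rewrite leqNgt -Ur (ltn_leqif (mxrank_leqif_sup (addsmxSl _ _))).
by rewrite negbK addsmx_sub => /andP[_]; rewrite (negPf xU).
Qed.

Lemma mx_eq_col (k : fieldType) m n (A B : 'M[k]_(m, n)) :
  (forall x : 'cV_n, A *m x = B *m x) -> A = B.
Proof.
move=> H; apply/matrixP => i j; have /matrixP/(_ i 0) := H (delta_mx j 0).
by rewrite -!colE !mxE.
Qed.

Section SubRep.
Variables (k : closedFieldType) (char0 : [pchar k] =i pred0) (V : rep k).
Local Notation cV := 'cV[k]_(rep_dim V).

(** The average of a projector on [S] and of its conjugate by the parity involution commutes with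
    the involution, and its image is still [S]. *)
Lemma sub_projector (S : cV -> Prop) : substable S -> exists Pi : 'M[k]_(rep_dim V),
  [/\ Pi *m Pi = Pi, par_mx V *m Pi = Pi *m par_mx V,
      forall x, S (Pi *m x), forall x, S x -> Pi *m x = x &
      forall p M, homog p M -> str M = 0 -> absorb false Pi (dmx (rep_mx V) M)].
Proof.
move=> hS; have h2 : (2%:R : k) != 0 by rewrite natk_eq0.
have [U UE] := subspace_mx (sub_zero hS) (sub_lin hS).
pose Q := (pinvmx U *m U)^T.
have QS x : S (Q *m x).
  by apply/UE; rewrite /Q trmx_mul trmxK mulmxA submxMl.
have QK x : S x -> Q *m x = x.
  by move=> /UE sx; apply: trmx_inj; rewrite /Q trmx_mul trmxK mulmxA mulmxKpV.
have SZ c x : S x -> S (c *: x).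
  by move=> sx; rewrite -[_ *: x]addr0; apply: (sub_lin hS) => //; exact: sub_zero.
have SD x y : S x -> S y -> S (x + y).
  by move=> sx sy; rewrite -[x]scale1r; apply: (sub_lin hS).
pose P := 2^-1 *: (Q + par_mx V *m Q *m par_mx V).
have PS x : S (P *m x).
  rewrite /P -scalemxAl mulmxDl -!mulmxA; apply/SZ/SD; first exact: QS.
  by apply: (sub_par hS); exact: QS.
have PK x : S x -> P *m x = x.
  move=> sx; rewrite /P -scalemxAl mulmxDl -!mulmxA QK // (QK (par_mx V *m x)).
    by rewrite mulmxA par_mx_sq mul1mx -mulr2n -scaler_nat scalerA mulVf // scale1r.
  exact: (sub_par hS).
exists P; split=> //.
- by apply: mx_eq_col => x; rewrite -mulmxA PK.
- rewrite /P -scalemxAr -scalemxAl mulmxDr mulmxDl !mulmxA par_mx_sq mul1mx.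
  by rewrite -[_ *m par_mx V *m par_mx V]mulmxA par_mx_sq mulmx1 addrC.
- move=> p M hM sM; apply: mx_eq_col => x; rewrite -!mulmxA (PK (dmx _ _ *m _)) //.
  by apply: (sub_lie hS hM sM).
Qed.

Lemma short_exact_dim (V1 V0 V2 : rep k) f g : @short_exact k V1 V0 V2 f g ->
  rep_dim V0 = (rep_dim V1 + rep_dim V2)%N.
Proof.
move=> /short_exact_split [r [s [gs rf eq1]]].
have rs : r *m s = 0.
  have : f *m r *m s = 0.
    by rewrite -[f *m r](addrK (s *m g)) eq1 mulmxBl mul1mx -mulmxA gs mulmx1 subrr.
  by move/(congr1 (mulmx r)); rewrite mulmx0 !mulmxA rf mul1mx.
have gf : g *m f = 0.
  have : g *m f *m r = 0.
    rewrite -mulmxA -[f *m r](addrK (s *m g)) eq1 mulmxBr mulmx1 mulmxA gs mul1mx subrr //.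
  by move/(congr1 (fun X => X *m f)); rewrite mul0mx -mulmxA rf mulmx1.
have E1 : row_mx f s *m col_mx r g = 1%:M by rewrite mul_row_col.
have E2 : col_mx r g *m row_mx f s = 1%:M.
  by rewrite mul_col_row rf rs gf gs; exact: esym (scalar_mx_block _ _ _).
by apply/eqP; rewrite eqn_leq (mulmx1_min E1) (mulmx1_min E2).
Qed.

(** [Pi] compresses to the subrepresentation, and [1%:M - Pi], whose kernel is stable, to the
    quotient. *)
Lemma sub_rep (S : cV -> Prop) : substable S ->
  exists (U1 U2 : rep k) f g (w : 'I_(rep_dim U1) -> P0), [/\ @short_exact k U1 V U2 f g, weighted U1 w &
    forall x, S x <-> exists y, x = f *m y].
Proof.
move=> hS; have [Pi [PP SP PS PK st]] := sub_projector hS.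
have PP' : (1%:M - Pi) *m (1%:M - Pi) = 1%:M - Pi.
  by rewrite mulmxBr mulmx1 mulmxBl mul1mx PP subrr subr0.
have SP' : par_mx V *m (1%:M - Pi) = (1%:M - Pi) *m par_mx V.
  by rewrite mulmxBr mulmxBl mulmx1 mul1mx SP.
have st' p M : homog p M -> str M = 0 -> absorb true (1%:M - Pi) (dmx (rep_mx V) M).
  move=> hM sM; rewrite /absorb mulmxBr mulmx1.
  have -> : (1%:M - Pi) *m dmx (rep_mx V) M *m Pi = 0.
    by rewrite -mulmxA (st p M hM sM) mulmxBl mul1mx !mulmxA PP subrr.
  by rewrite subr0.
have [U1 [P1 [Q1 [w1 [PQ1 QP1 UE1 [pP1 pQ1] wU1]]]]] := compress char0 PP SP st.
have [U2 [P2 [Q2 [w2 [PQ2 QP2 UE2 [pP2 pQ2] wU2]]]]] := compress char0 PP' SP' st'.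
have PQA m n' (P : 'M[k]_(m, n')) Q (A : superalg k) : P *m Q = 1%:M ->
    map_mx (in_alg A) P *m map_mx (in_alg A) Q = 1%:M by move=> E; rewrite -map_mxM E map_mx1.
have PiQ : Pi *m Q1 = Q1 by rewrite -QP1 -mulmxA PQ1 mulmx1.
have PPi : P2 *m (1%:M - Pi) = P2 by rewrite -QP2 mulmxA PQ2 mul1mx.
have RR := rep_repmx V.
exists U1, U2, Q1, P2, w1; split=> //; last first.
  move=> x; split=> [sx|[y ->]]; last by rewrite -PiQ -mulmxA.
  by exists (P1 *m x); rewrite mulmxA QP1 PK.
have CB : (1%:M - Pi) + Pi = 1%:M by rewrite subrK.
have dst p M : homog p M -> str M = 0 -> (1%:M - Pi) *m dmx (rep_mx V) M *m Pi = 0.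
  by move=> hM sM; rewrite -mulmxA (st p M hM sM) mulmxBl mul1mx !mulmxA PP subrr.
have stA (A : superalg k) (g : SL22 A) : map_mx (in_alg A) (1%:M - Pi) *m act V g *m map_mx (in_alg A) Pi = 0.
  exact: (stable_all char0 RR CB PP dst).
split.
- split=> // A g; rewrite UE1.
  rewrite !mulmxA -map_mxM QP1.
  have -> : map_mx (in_alg A) Q1 = map_mx (in_alg A) Pi *m map_mx (in_alg A) Q1 by rewrite -map_mxM PiQ.
  have := stA A g; rewrite map_mxB map_mx1 !mulmxBl mul1mx => /eqP; rewrite subr_eq0 => /eqP E.
  by rewrite !mulmxA -E.
- split=> // A g; rewrite UE2.
  have Z : map_mx (in_alg A) P2 *m act V g *m map_mx (in_alg A) Pi = 0.
    rewrite -PPi map_mxM -[_ *m act V g]mulmxA -mulmxA.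
    by rewrite (stA A g : map_mx (in_alg A) (1%:M - Pi) *m act V g *m map_mx (in_alg A) Pi = 0) mulmx0.
  by rewrite -[RHS]mulmxA -map_mxM QP2 map_mxB map_mx1 mulmxBr mulmx1 Z subr0.
- by move=> v /(congr1 (mulmx P1)); rewrite mulmxA PQ1 mul1mx mulmx0.
- by move=> u; exists (Q2 *m u); rewrite mulmxA PQ2 mul1mx.
- move=> v; split=> [/(congr1 (mulmx Q2))|[y ->]].
    rewrite mulmx0 mulmxA QP2 mulmxBl mul1mx => /eqP; rewrite subr_eq0 => /eqP E.
    by exists (P1 *m v); rewrite mulmxA QP1 -E.
  have Z : P2 *m Q1 = 0.
    by rewrite -PPi -PiQ -mulmxA (mulmxA (1%:M - Pi)) mulmxBl mul1mx PP subrr mul0mx mulmx0.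
  by rewrite mulmxA Z mul0mx.
Qed.
End SubRep.

Section DirectSum.
Variables (k : closedFieldType) (char0 : [pchar k] =i pred0) (V W : rep k).

Definition sum_par (x : 'I_(rep_dim V + rep_dim W)) : bool :=
  match split x with inl i => rep_par V i | inr p => rep_par W p end.

Lemma sum_even (A : superalg k) (g : SL22 A) x y :
  sa_hom (sum_par x (+) sum_par y) (reval g (sum_mx (rep_mx V) (rep_mx W) x y)).
Proof.
rewrite /sum_par /sum_mx; case: (split x) => i; case: (split y) => j; try exact: rep_even;
  by rewrite /= scale0r; apply: sa_hom0.
Qed.

Definition sumrep : rep k :=
  Rep sum_even (rmx_scal (sum_repmx (rep_repmx V) (rep_repmx W)))
    (rmx_mul (sum_repmx (rep_repmx V) (rep_repmx W))).

Lemma sumrep_lie M (x : 'cV_(rep_dim V)) (y : 'cV_(rep_dim W)) :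
  dmx (rep_mx sumrep) M *m col_mx x y = col_mx (dmx (rep_mx V) M *m x) (dmx (rep_mx W) M *m y).
Proof.
rewrite [dmx _ _](dmx_sum (rep_mx V) (rep_mx W)) mul_block_col.
by rewrite !mul0mx addr0 add0r.
Qed.

Lemma sumrep_par (x : 'cV_(rep_dim V)) (y : 'cV_(rep_dim W)) :
  par_mx sumrep *m col_mx x y = col_mx (par_mx V *m x) (par_mx W *m y).
Proof.
apply/matrixP => i j; rewrite mul_diag_mx [LHS]mxE [(\row__ _) _ _]mxE /= /sum_par.
case: (split_ordP i) => u ->; rewrite ?split_l ?split_r ?col_mxEu ?col_mxEd mul_diag_mx !mxE //.
Qed.

Variables (v : 'I_(rep_dim V) -> P0) (w : 'I_(rep_dim W) -> P0).
Hypotheses (hv : weighted V v) (hw : weighted W w).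
Definition sumrep_wt (x : 'I_(rep_dim sumrep)) : P0 :=
  match split (x : 'I_(rep_dim V + rep_dim W)) with inl i => v i | inr p => w p end.

Lemma sumrep_weighted : weighted sumrep sumrep_wt.
Proof.
move=> c; rewrite [LHS](dmx_sum (rep_mx V) (rep_mx W)) hv hw.
apply/matrixP => x y; rewrite [RHS]mxE [(\row__ _) _ _]mxE /sumrep_wt.
case: (split_ordP x) => i ->; case: (split_ordP y) => j ->;
  rewrite ?block_mxEul ?block_mxEur ?block_mxEdl ?block_mxEdr ?split_l ?split_r ?mxE
    ?eq_lshift ?eq_rshift ?eq_lrshift ?eq_rlshift ?mulr0n //.
Qed.
End DirectSum.

(** * Simple representations and injectivity *)

Section Simple.
Variables (k : closedFieldType) (char0 : [pchar k] =i pred0).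
Implicit Types V W L : rep k.

Definition simple V := (exists v : 'cV[k]_(rep_dim V), v != 0) /\
  forall S, substable (V := V) S -> (forall x, S x -> x = 0) \/ (forall x, S x).

Lemma simple_iso V W : iso_rep V W -> simple V -> simple W.
Proof.
move=> [P [Q [mP mQ PQ QP]]] [[v v0] hV].
have K x : Q *m (P *m x) = x by rewrite mulmxA QP mul1mx.
have K' x : P *m (Q *m x) = x by rewrite mulmxA PQ mul1mx.
split.
  by exists (P *m v); apply: contra_neq v0 => E; rewrite -[v]K E mulmx0.
move=> S hS; have [] := hV (fun x => S (P *m x)); first split.
- by rewrite mulmx0; exact: sub_zero.
- by move=> c x y sx sy; rewrite mulmxDr -scalemxAr; exact: sub_lin.
- by move=> p M hM sM x sx; rewrite mulmxA (mor_lie mP hM sM) -mulmxA; exact: (sub_lie hS hM sM).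
- by move=> x sx; rewrite mulmxA (par_mx_mor mP) -mulmxA; exact: sub_par.
- by move=> H; left => x; rewrite -[x]K' => /H ->; rewrite mulmx0.
- by move=> H; right => x; rewrite -[x]K'; exact: H.
Qed.

Lemma simple_parity V : simple V -> simple (parity_change V).
Proof.
move=> [v0 hV]; split=> // S hS; apply: (hV S); split.
- exact: sub_zero hS.
- exact: sub_lin hS.
- exact: sub_lie hS.
move=> x sx; have -> : par_mx V *m x = -1 *: (par_mx (parity_change V) *m x) + 0.
  by rewrite par_mx_parity mulNmx scalerN scaleN1r opprK addr0.
by apply: (sub_lin hS); [exact: (sub_par hS)|exact: sub_zero hS].
Qed.

Lemma hwv_parity V v b s : hwv (V := V) v b s -> hwv (V := parity_change V) v b (~~ s).
Proof.
move=> [h1 h2 h3]; split; [exact: h1|exact: h2|].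
by rewrite par_mx_parity mulNmx h3 signrN scaleNr.
Qed.

Lemma int_argmax (T : finType) (f : T -> int) (x0 : T) : exists x, forall y, f y <= f x.
Proof. by case: (@arg_maxP _ _ T x0 xpredT f isT) => x _ H; exists x => y; exact: H. Qed.

Lemma simple_hwv V w : weighted V w -> simple V -> exists v b s, [/\ hwv (V := V) v b s, v != 0 & forall x, low v x].
Proof.
move=> wV [[u u0] hV].
have [i1 _] : exists i1 : 'I_(rep_dim V), u i1 0 != 0.
  apply/existsP; apply: contraNT u0; rewrite negb_exists => /forallP H.
  by apply/eqP/matrixP => i j; rewrite ord1 mxE; apply/eqP; have := H i; rewrite negbK.
have [i0 top] := int_argmax (fun i => hgt (w i)) i1.
pose v : 'cV[k]_(rep_dim V) := delta_mx i0 0.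
have v0 : v != 0.
  by apply/eqP => /matrixP/(_ i0 0); rewrite !mxE !eqxx => /eqP; rewrite oner_eq0.
have hv : hwv (V := V) v (w i0) (rep_par V i0).
  split=> [i j ij|c|].
  - apply/matrixP => a c; rewrite ord1 -colE [LHS]mxE [RHS]mxE; apply/eqP; apply: contraT => D.
    have ij' : i != j by apply: contraTneq ij => ->; rewrite ltxx.
    have := unit_hgt char0 wV ij' D; have := top a; move: ij; lia.
  - apply/matrixP => a d; rewrite ord1 /dh wV mul_diag_mx !mxE.
    by have [->|_] := eqVneq a i0; rewrite /= ?mulr0.
  - apply/matrixP => a d; rewrite ord1 mul_diag_mx !mxE.
    by have [->|_] := eqVneq a i0; rewrite /= ?mulr0.
exists v, (w i0), (rep_par V i0); split=> //.
case: (hV _ (low_substable char0 hv)) => // H; have := H _ (low_gen v).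
by move/eqP; rewrite (negPf v0).
Qed.

(** A total and single-valued linear relation is the graph of a matrix, found on basis vectors. Its
    invariance is equivariance under the Lie superalgebra, which [is_mor_lie] lifts to the group. *)
Lemma graph_mor V W (G : 'cV[k]_(rep_dim V) -> 'cV[k]_(rep_dim W) -> Prop) :
  (forall c x y x' y', G x y -> G x' y' -> G (c *: x + x') (c *: y + y')) ->
  (forall p M, homog p M -> str M = 0 -> forall x y, G x y -> G (dmx (rep_mx V) M *m x) (dmx (rep_mx W) M *m y)) ->
  (forall x y, G x y -> G (par_mx V *m x) (par_mx W *m y)) ->
  (forall x, exists y, G x y) -> (forall y, G 0 y -> y = 0) ->
  exists F, @is_mor k V W F /\ forall x, G x (F *m x).
Proof.
move=> Gl Gm Gp Gt Gu.
have /fin_all_exists [y yE] (i : 'I_(rep_dim V)) := Gt (delta_mx i 0).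
pose F := \matrix_(a, i) y i a 0.
have G00 : G 0 0.
  have [z z0] := Gt 0; have := Gl (-1) _ _ _ _ z0 z0.
  by rewrite !scaleN1r !addNr.
have uniq x z z' : G x z -> G x z' -> z = z'.
  move=> h h'; apply/eqP; rewrite -subr_eq0; apply/eqP/Gu.
  by have := Gl (-1) _ _ _ _ h' h; rewrite !scaleN1r addNr addrC.
have GF x : G x (F *m x).
  have -> : F *m x = \sum_i x i 0 *: y i.
    apply/matrixP => a c; rewrite ord1 summxE mxE; apply: eq_bigr => i _.
    by rewrite !mxE mulrC.
  have {1}-> : x = \sum_i x i 0 *: delta_mx i 0.
    by rewrite {1}[x]matrix_sum_delta; apply: eq_bigr => i _; rewrite big_ord1.
  elim: (index_enum _) => [|i r IH]; first by rewrite !big_nil.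
  by rewrite !big_cons; apply: Gl.
exists F; split=> //; apply: (is_mor_lie char0) => [i j Fij|p M hM sM].
  have E : F *m par_mx V = par_mx W *m F.
    apply: mx_eq_col => x; apply: (uniq (par_mx V *m x)).
      by rewrite -mulmxA; exact: GF.
    by rewrite -mulmxA; apply: Gp; exact: GF.
  move/matrixP/(_ i j): E; rewrite mul_mx_diag mul_diag_mx [LHS]mxE [RHS]mxE [X in _ * X = _]mxE [X in _ = X * _]mxE.
  by rewrite mulrC => /(mulIf Fij) /(sgn_inj char0) ->.
apply: mx_eq_col => x; apply: (uniq (dmx (rep_mx V) M *m x)).
  by rewrite -mulmxA; exact: GF.
by rewrite -mulmxA; apply: (Gm p M hM sM); exact: GF.
Qed.

(** In the direct sum, the submodule generated by (x, y) is the graph of an isomorphism. By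
    [low_top] its top component consists of multiples of (x, y), so it contains neither (0, y) nor
    (x, 0); simplicity then makes it meet both summands in 0 and project onto both. *)
Lemma simple_uniq V W v w x y b s : weighted V v -> weighted W w -> simple V -> simple W ->
  hwv (V := V) x b s -> hwv (V := W) y b s -> x != 0 -> y != 0 -> iso_rep V W.
Proof.
move=> wV wW sV sW hx hy x0 y0; pose T := sumrep V W.
pose u : 'cV[k]_(rep_dim T) := col_mx x y.
have hu : hwv (V := T) u b s.
  split=> [i j ij|c|].
  - by rewrite [LHS]sumrep_lie (hw_raise hx ij) (hw_raise hy ij) col_mx0.
  - rewrite [LHS]sumrep_lie -/(dh V c) -/(dh W c) (hw_weight hx) (hw_weight hy); exact: esym (scale_col_mx _ _ _).
  - rewrite [LHS]sumrep_par (hw_par hx) (hw_par hy); exact: esym (scale_col_mx _ _ _).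
pose G (p : 'cV[k]_(rep_dim V)) (q : 'cV[k]_(rep_dim W)) := low (V := T) u (col_mx p q).
have wT := sumrep_weighted wV wW.
have Gl c p q p' q' : G p q -> G p' q' -> G (c *: p + p') (c *: q + q').
  move=> g g'; rewrite /G -add_col_mx -scale_col_mx; exact: low_lin.
have G0 : G 0 0 by rewrite /G col_mx0; exact: low0.
have Gm r M : homog r M -> str M = 0 -> forall p q, G p q -> G (dmx (rep_mx V) M *m p) (dmx (rep_mx W) M *m q).
  move=> hM sM p q g; rewrite /G -sumrep_lie; exact: (low_lie char0 hu g hM sM).
have Gp p q : G p q -> G (par_mx V *m p) (par_mx W *m q).
  by move=> g; rewrite /G -sumrep_par; exact: (low_par hu g).
have nz n (z : 'cV[k]_n) : z != 0 -> exists i, z i 0 != 0.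
  move=> z0; apply/existsP; apply: contraNT z0; rewrite negb_exists => /forallP H.
  by apply/eqP/matrixP => i j; rewrite ord1 mxE; apply/eqP; have := H i; rewrite negbK.
have [i1 xi1] := nz _ _ x0; have [p1 yp1] := nz _ _ y0.
have wi1 := weight_entry char0 wV (hw_weight hx) xi1.
have wp1 := weight_entry char0 wW (hw_weight hy) yp1.
have top p q : G p q -> exists c, p i1 0 = c * x i1 0 /\ q p1 0 = c * y p1 0.
  move=> /(low_top char0 wT hu) [c cE]; exists c; split.
    have := cE (lshift _ i1); rewrite /sumrep_wt split_l wi1 lexx /u !col_mxEu; exact.
  have := cE (rshift _ p1); rewrite /sumrep_wt split_r wp1 lexx /u !col_mxEd; exact.
have n0y : ~ G 0 y.
  move=> /top [c []]; rewrite mxE => /esym/eqP; rewrite mulf_eq0 (negPf xi1) orbF => /eqP -> /eqP.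
  by rewrite mul0r (negPf yp1).
have nx0 : ~ G x 0.
  move=> /top [c [E]]; rewrite mxE => /esym/eqP; rewrite mulf_eq0 (negPf yp1) orbF => /eqP c0; move/eqP: E.
  by rewrite c0 mul0r (negPf xi1).
have u1 q : G 0 q -> q = 0.
  case: (sW.2 (fun q => G 0 q)); [split|by move=> H; apply: H|by move=> H; case: (n0y (H y))].
  - exact: G0.
  - by move=> c a d ga gd; have := Gl c _ _ _ _ ga gd; rewrite scaler0 addr0.
  - by move=> r M hM sM a ga; have := Gm r M hM sM _ _ ga; rewrite mulmx0.
  - by move=> a ga; have := Gp _ _ ga; rewrite mulmx0.
have u2 p : G p 0 -> p = 0.
  case: (sV.2 (fun p => G p 0)); [split|by move=> H; apply: H|by move=> H; case: (nx0 (H x))].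
  - exact: G0.
  - by move=> c a d ga gd; have := Gl c _ _ _ _ ga gd; rewrite scaler0 addr0.
  - by move=> r M hM sM a ga; have := Gm r M hM sM _ _ ga; rewrite mulmx0.
  - by move=> a ga; have := Gp _ _ ga; rewrite mulmx0.
have Gxy : G x y by exact: low_gen.
have t1 p : exists q, G p q.
  case: (sV.2 (fun p => exists q, G p q)) => [|H|H]; [|by have := H x (ex_intro _ y Gxy); move/eqP: x0|exact: H].
  split; first by exists 0.
  - by move=> c a d [a' ga] [d' gd]; exists (c *: a' + d'); exact: Gl.
  - by move=> r M hM sM a [a' ga]; exists (dmx (rep_mx W) M *m a'); exact: (Gm r M hM sM).
  - by move=> a [a' ga]; exists (par_mx W *m a'); exact: Gp.
have t2 q : exists p, G p q.
  case: (sW.2 (fun q => exists p, G p q)) => [|H|H]; [|by have := H y (ex_intro _ x Gxy); move/eqP: y0|exact: H].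
  split; first by exists 0.
  - by move=> c a d [a' ga] [d' gd]; exists (c *: a' + d'); exact: Gl.
  - by move=> r M hM sM a [a' ga]; exists (dmx (rep_mx V) M *m a'); exact: (Gm r M hM sM).
  - by move=> a [a' ga]; exists (par_mx V *m a'); exact: Gp.
have [F [mF FG]] := @graph_mor V W G Gl Gm Gp t1 u1.
have [F' [mF' FG']] := @graph_mor W V (fun q p => G p q)
  (fun c p q p' q' => @Gl c q p q' p') (fun r M hM sM p q => @Gm r M hM sM q p)
  (fun p q => @Gp q p) t2 u2.
exists F, F'; split=> //; apply: mx_eq_col => z; rewrite mul1mx -mulmxA.
  have := Gl (-1) _ _ _ _ (FG (F' *m z)) (FG' z); rewrite !scaleN1r addNr addrC => /u1 /eqP.
  by rewrite subr_eq0 => /eqP.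
have := Gl (-1) _ _ _ _ (FG' (F *m z)) (FG z); rewrite !scaleN1r addNr addrC => /u2 /eqP.
by rewrite subr_eq0 => /eqP.
Qed.

Lemma groth_simple_ind (Q : groth k -> Prop) : Q 0 -> (forall x y, Q x -> Q y -> Q (x - y)) ->
  (forall V, simple V -> Q (groth_cls V)) -> forall x, Q x.
Proof.
move=> Q0 QB QS; apply: groth_ind => // V.
have QD y z : Q y -> Q z -> Q (y + z).
  by move=> hy hz; rewrite -[z]opprK; apply: (QB) => //; rewrite -sub0r; apply: (QB).
have [d] := ubnP (rep_dim V); elim: d V => // d IH V; rewrite ltnS => Vd.
case: (pselect (simple V)) => [/QS//|nS].
case: (pselect (exists v : 'cV[k]_(rep_dim V), v != 0)) => [vn|none]; last first.
  have z (x : 'cV[k]_(rep_dim V)) : x = 0.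
    by apply/eqP; apply: contraT => x0; case: none; exists x.
  (* When V is zero this sequence is exact, so [V] = [V] + [V] and the class vanishes. *)
  have ex : @short_exact k V V V 1%:M 1%:M.
    split; try exact: is_mor1; [by move=> x _; exact: z|by move=> x; exists x; rewrite mul1mx|].
    by move=> x; rewrite (z x) mulmx0; split=> // _; exists 0; rewrite mulmx0.
  have /eqP := groth_exact ex; rewrite -subr_eq subrr => /eqP <- //.
have [S [hS [[x Sx x0] [y nSy]]]] : exists S : 'cV[k]_(rep_dim V) -> Prop,
    substable S /\ (exists2 x, S x & x <> 0) /\ exists y, ~ S y.
  apply: contrapT => H; apply: nS; split=> // S hS.
  case: (pselect (exists2 x, S x & x <> 0)) => [e|ne].
    right=> y; apply: contrapT => nSy; apply: H; exists S; split=> //; split=> //; by exists y.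
  by left=> x Sx; apply: contrapT => x0; apply: ne; exists x.
have [U1 [U2 [f [g [w [ex _ fS]]]]]] := sub_rep char0 hS.
have dV := short_exact_dim ex; rewrite (groth_exact ex).
have d1 : (0 < rep_dim U1)%N.
  rewrite lt0n; apply/eqP => e; have [z zE] := (fS x).1 Sx; apply: x0; rewrite zE.
  by clear -e; move: z f; rewrite e => z f; rewrite (flatmx0 z) mulmx0.
have d2 : (0 < rep_dim U2)%N.
  rewrite lt0n; apply/eqP => e; apply: nSy; case: ex => _ _ _ _ ex; apply/fS/ex.
  by clear -e; move: g; rewrite e => g; rewrite (flatmx0 g) mul0mx.
by apply: QD; apply: IH; move: Vd; rewrite dV; lia.
Qed.

Definition top V (b : P0) (s : bool) := exists w x,
  [/\ weighted V w, simple V, hwv (V := V) x b s & x != 0].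

Lemma top_exists V : simple V -> exists U b s, iso_rep V U /\ top U b s.
Proof.
move=> sV; have [U [w [wU i]]] := weighted_iso char0 V; have sU := simple_iso i sV.
have [x [b [s [hx x0 _]]]] := simple_hwv wU sU.
by exists U, b, s; split=> //; exists w, x.
Qed.

Lemma top_lead V b s : top V b s -> is_lead (2, 1) b (ch char0 V).
Proof.
move=> [w [x [wV sV hx x0]]]; apply: (low_lead char0 wV hx x0).
case: (sV.2 _ (low_substable char0 hx)) => // H; have := H _ (low_gen x).
by move/eqP: x0.
Qed.

Lemma top_parity V b s : top V b s -> top (parity_change V) b (~~ s).
Proof.
move=> [w [x [wV sV hx x0]]]; exists w, x; split=> //; [exact: simple_parity|exact: hwv_parity].
Qed.

Lemma top_cls V W b s t : top V b s -> top W b t ->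
  groth_cls V = if s == t then groth_cls W else - groth_cls W.
Proof.
move=> hV hW; case: eqP hW => [<- |/eqP st] hW.
  have [v [x [wV sV hx x0]]] := hV; have [w [y [wW sW hy y0]]] := hW.
  exact/groth_iso/(simple_uniq wV wW sV sW hx hy).
have {}hW := top_parity hW; have tE : ~~ t = s by case: (s) (t) st => [] [].
rewrite tE in hW; rewrite -groth_parity.
have [v [x [wV sV hx x0]]] := hV; have [w [y [wW sW hy y0]]] := hW.
exact/groth_iso/(simple_uniq wV wW sV sW hx hy).
Qed.

Definition good b := exists V s, top V b s.
(** One simple class is selected for each highest weight; by [top_cls] the classes with this highest
    weight are equal to it or opposite to it. *)
Definition simple_cls (b : P0) : groth k :=
  if pselect (good b) is left h then groth_cls (sval (cid h)) else 0.

Lemma simple_clsP b : good b -> exists V s, top V b s /\ simple_cls b = groth_cls V.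
Proof.
move=> h; rewrite /simple_cls; case: pselect => // h'.
by have [s sE] := svalP (cid h'); exists (sval (cid h')), s.
Qed.

Lemma seq_argmax (T : eqType) (f : T -> int) (s : seq T) : s != [::] ->
  exists2 x, x \in s & forall y, y \in s -> f y <= f x.
Proof.
elim: s => // a [|c s] IH _; first by exists a; rewrite ?inE // => y /[!inE] /eqP ->.
have [x xs xmax] := IH isT; case: (lerP (f a) (f x)) => h.
  by exists x; [rewrite in_cons xs orbT|] => // y; rewrite in_cons => /predU1P[->//|/xmax].
exists a; rewrite ?inE ?eqxx // => y; rewrite in_cons => /predU1P[->//|/xmax].
by move=> le; apply: le_trans le (ltW h).
Qed.

Lemma groth_expand x : exists h : {malg int[P0]},
  (forall b, mcoeff b h != 0 -> good b) /\ x = linext simple_cls h.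
Proof.
elim/groth_simple_ind: x => [|x y [h [hg ->]] [h' [hg' ->]]|V sV].
- by exists 0; split=> [b|]; rewrite ?mcoeff0 ?eqxx // raddf0.
- exists (h - h'); split; last by rewrite raddfB.
  move=> b; rewrite mcoeffB; have [->|/hg//] := eqVneq (mcoeff b h) 0.
  by rewrite sub0r oppr_eq0 => /hg'.
have [U [b [s [i tU]]]] := top_exists sV; rewrite (groth_iso i).
have gb : good b by exists U, s.
have [W [t [tW cW]]] := simple_clsP gb; have := top_cls tU tW; rewrite -cW => ->.
exists << (if s == t then 1 else -1) *g b >>; split.
  by move=> d; rewrite mcoeffU; have [<-|_] := eqVneq b d; rewrite ?mulr0n ?eqxx.
by rewrite liftU; case: eqP; rewrite ?mulr1z ?mulrN1z.
Qed.

(** Among the weights of a nonzero combination of simple classes choose one of maximal height. Any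
    other class reaches that height at most at its own leading weight, so it contributes nothing
    there and the coefficient survives. *)
Lemma sch_inj (sch : {rmorphism groth k -> ZP0}) :
  (forall V, sch (groth_cls V) = ch char0 V) -> injective sch.
Proof.
move=> schE; suff H x : sch x = 0 -> x = 0.
  by move=> x y E; apply/eqP; rewrite -subr_eq0; apply/eqP/H; rewrite rmorphB E; exact: subrr.
have [h [hg ->]] := groth_expand x => sch0.
have [->|/eqP hn] := eqVneq h 0; first exact: raddf0.
have sn : (msupp h : seq P0) != [::].
  apply/eqP => e; case: hn; apply/malgP => b; rewrite mcoeff0; apply/eqP.
  by rewrite mcoeff_eq0 -[_ \in _]/(b \in (msupp h : seq P0)) e.
have [b bs bmax] := seq_argmax hgt sn.
have hb : mcoeff b h != 0 by rewrite mcoeff_neq0.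
have [V [s [tV cV]]] := simple_clsP (hg b hb).
have E : coef (sch (linext simple_cls h)) b = linext (fun d => coef (sch (simple_cls d)) b) h.
  rewrite (lift_comp sch); exact: (lift_comp (mcoeff b)).
have := E; rewrite sch0 coef0_P0 (@lift_only _ _ _ _ b) => [|d db dh].
  rewrite cV schE => /esym/eqP; rewrite mulrz_eq0 (negPf hb) /=.
  by case: (top_lead tV) => /orP[] /eqP -> _.
have [W [t [tW cW]]] := simple_clsP (hg d dh); rewrite cW schE.
have [_ lead] := top_lead tW; apply/eqP; apply: contraT => cn.
have := lead b _ cn; rewrite eq_sym db => /(_ isT).
by rewrite ltNge bmax // -mcoeff_neq0.
Qed.
End Simple.

(** * Odd reflections and surjectivity *)

Section Reflection.
Variables (k : closedFieldType) (char0 : [pchar k] =i pred0) (V : rep k).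
Local Notation D := (unit_op V).
Local Notation cV := 'cV[k]_(rep_dim V).

Lemma unit_swap i j p q (u : cV) : i != j -> p != q ->
  D i j *m (D p q *m u) =
  (-1) ^+ ((par22 i (+) par22 j) && (par22 p (+) par22 q)) *: (D p q *m (D i j *m u))
  + ((if j == p then D i q *m u else 0)
  - (-1) ^+ ((par22 i (+) par22 j) && (par22 p (+) par22 q)) *: (if q == i then D p j *m u else 0)).
Proof.
move=> ij pq; have /eqP := unit_bracket V ij pq; rewrite subr_eq addrC => /eqP E.
rewrite mulmxA E mulmxDl -scalemxAl -mulmxA; congr (_ + _).
set s := (-1) ^+ _.
have L (X Y : 'M[k]_(2 + 2)) : dmx (rep_mx V) (X - s *: Y) = dmx (rep_mx V) X - s *: dmx (rep_mx V) Y.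
  by rewrite linearB /= linearZ.
rewrite L mulmxBl -scalemxAl /unit_op; congr (_ - _ *: _).
  by case: eqP => _; rewrite ?mulr1n // mulr0n linear0 mul0mx.
by case: eqP => _; rewrite ?mulr1n // mulr0n linear0 mul0mx.
Qed.

Lemma unit_weight i j c (u : cV) (t : int) : i != j -> dh V c *m u = t%:~R *: u ->
  dh V c *m (D i j *m u) = (t + wcomp c (wt i) - wcomp c (wt j))%:~R *: (D i j *m u).
Proof.
move=> ij hu.
have := dmx_bracket (rep_repmx V) (@homog_hdiag k (~~ c)%:R c%:R) (@homog_delta k i j)
    (str_hdiag _ _) (str_delta k ij).
rewrite bracket_hdiag expr0 scale1r.
have -> : (\matrix_(u, v) ((wval (~~ c)%:R c%:R u - wval (~~ c)%:R c%:R v) * delta_mx i j u v)) =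
      (wval (~~ c)%:R c%:R i - wval (~~ c)%:R c%:R j) *: (delta_mx i j : 'M[k]_(2 + 2)).
  apply/matrixP => a b; rewrite !mxE; have [->|_] := eqVneq a i => /=; last by rewrite !mulr0.
  by have [->|_] := eqVneq b j => /=; rewrite ?mulr0.
have L t' : dmx (rep_mx V) (t' *: delta_mx i j) = t' *: D i j by exact: linearZ.
rewrite L -/(hb k c) -/(dh V c) -/(D i j) !wval_wt => /eqP; rewrite subr_eq addrC => /eqP E.
rewrite mulmxA E mulmxDl -mulmxA hu -scalemxAr -scalemxAl -scalerDl.
by congr (_ *: _); rewrite !intrB intrD; ring.
Qed.

(* Vectors killed by the root vectors that are positive for both orderings
   [e0 > f0 > f1 > e1] and [f0 > e0 > e1 > f1]. *)
Definition common (u : cV) := [/\ D e0 f1 *m u = 0, D e0 e1 *m u = 0,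
  D f0 f1 *m u = 0 & D f0 e1 *m u = 0].

Lemma common_op i j u : (i, j) = (e0, f0) \/ (i, j) = (f1, e1) -> common u -> common (D i j *m u).
Proof.
move=> ij [h1 h2 h3 h4]; case: ij => -[-> ->]; split;
  rewrite unit_swap // ?h1 ?h2 ?h3 ?h4 mulmx0 scaler0 add0r /= ?h1 ?h2 ?h3 ?h4;
  by rewrite ?scaler0 ?subr0.
Qed.

Lemma odd_square i j (u : cV) : par22 i (+) par22 j -> D i j *m (D i j *m u) = 0.
Proof.
move=> pij; have ij : i != j by apply: contraTneq pij => ->; rewrite addbb.
have := unit_swap u ij ij; rewrite [j == i]eq_sym (negPf ij) pij /= expr1 !scaleN1r oppr0 subr0 addr0.
have h2 : (2%:R : k) != 0 by rewrite natk_eq0.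
move/eqP; rewrite -addr_eq0 -mulr2n -scaler_nat scaler_eq0 (negPf h2) /= => /eqP //.
Qed.

(** The two orderings differ by the odd root ε - δ, of multiplicity two, so two reflections are
    made: v' = E_e0f0 E_f1e1 v. Applying E_f0e0 and then E_e1f1 to v' returns v up to factors ± (b1
    + b2) / 2, whence v' is nonzero; each step adds ε - δ to the weight. *)
Lemma odd_reflection (v : cV) (b1 b2 : int) (s : bool) : common v -> D f0 e0 *m v = 0 -> D e1 f1 *m v = 0 ->
  (forall c, dh V c *m v = (wcomp c (b1, b2))%:~R *: v) -> par_mx V *m v = (-1) ^+ s *: v ->
  v != 0 -> b1 + b2 != 0 ->
  exists2 v', v' != 0 & hwv (V := V) v' (b1 + 2, b2 - 2) s.
Proof.
move=> cv Zv Zv' wv pv v0 b0.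
pose x := D f1 e1 *m v; pose v' := D e0 f0 *m x.
have cx : common x by apply: common_op => //; right.
have cv' : common v' by apply: common_op => //; left.
have wx c : dh V c *m x = (wcomp c (b1 + 1, b2 - 1))%:~R *: x.
  rewrite (unit_weight (isT : f1 != e1) (wv c)); congr (_%:~R *: _).
  by case: c; rewrite /wt /=; lia.
have wv' c : dh V c *m v' = (wcomp c (b1 + 2, b2 - 2))%:~R *: v'.
  rewrite (unit_weight (isT : e0 != f0) (wx c)); congr (_%:~R *: _).
  by case: c; rewrite /wt /=; lia.
have px : par_mx V *m x = (-1) ^+ (~~ s) *: x.
  by rewrite /x mulmxA (unit_par V (isT : f1 != e1)) -scalemxAl -mulmxA pv -scalemxAr scalerA -signr_addb.
have pv' : par_mx V *m v' = (-1) ^+ s *: v'.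
  rewrite /v' mulmxA (unit_par V (isT : e0 != f0)) -scalemxAl -mulmxA px -scalemxAr scalerA -signr_addb.
  by rewrite parE /= negbK.
have h2 : (2%:R : k) != 0 by rewrite natk_eq0.
have s2 : 2^-1 * (b1 + b2)%:~R != 0 :> k by rewrite mulf_neq0 ?invr_eq0 // intk_eq0.
have [C1 C2] := unit_cartan char0 V.
have Zx : D f0 e0 *m x = 0.
  by rewrite /x unit_swap // Zv mulmx0 scaler0 add0r /= ?scaler0 ?subr0 ?scale0r ?addr0.
have Zv'E : D f0 e0 *m v' = (2^-1 * (b1 + b2)%:~R) *: x.
  have : (D e0 f0 *m D f0 e0 + D f0 e0 *m D e0 f0) *m x = (2^-1 * (b1 + b2)%:~R) *: x.
    rewrite C1 -scalemxAl mulmxDl !wx -scalerDl scalerA -intrD; congr (_ * _%:~R *: _).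
    by rewrite /=; lia.
  by rewrite mulmxDl -!mulmxA Zx mulmx0 add0r.
have Z'x : D e1 f1 *m x = - (2^-1 * (b1 + b2)%:~R) *: v.
  have : (D f1 e1 *m D e1 f1 + D e1 f1 *m D f1 e1) *m v = - (2^-1 * (b1 + b2)%:~R) *: v.
    by rewrite C2 mulNmx -scalemxAl mulmxDl !wv -scalerDl scalerA -intrD scaleNr.
  by rewrite mulmxDl -!mulmxA Zv' mulmx0 add0r.
have x0 : x != 0.
  apply: contra_eq_neq Z'x => ->; rewrite mulmx0 eq_sym scaler_eq0 negb_or oppr_eq0 s2 //.
have v'0 : v' != 0.
  apply: contra_eq_neq Zv'E => ->; rewrite mulmx0 eq_sym scaler_eq0 negb_or s2 //.
exists v' => //; split=> // i j.
have X0 : D e0 f0 *m v' = 0 by exact: odd_square.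
have X'0 : D f1 e1 *m v' = 0.
  by rewrite /v' unit_swap // (odd_square (i := f1) (j := e1)) // mulmx0 scaler0 add0r /= ?scaler0 ?subr0 ?addr0.
case: cv' => h1 h2' h3 h4.
by move: i j; apply: ord4_ind; apply: ord4_ind.
Qed.

(** The subrepresentation generated by the reflected vector is taken. It may fail to be simple, but
    it is generated by its highest weight vector, which fixes the leading term. *)
Lemma reflection_rep v w (b1 b2 : int) (s : bool) : weighted V w ->
  common v -> D f0 e0 *m v = 0 -> D e1 f1 *m v = 0 ->
  (forall c, dh V c *m v = (wcomp c (b1, b2))%:~R *: v) -> par_mx V *m v = (-1) ^+ s *: v ->
  v != 0 -> b1 + b2 != 0 ->
  exists U, is_lead (2, 1) (b1 + 2, b2 - 2) (ch char0 U).
Proof.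
move=> wV cv Zv Zv' wv pv v0 b0; have [v' v'0 hv'] := odd_reflection cv Zv Zv' wv pv v0 b0.
have [U1 [U2 [f [g [w1 [ex wU fS]]]]]] := sub_rep char0 (low_substable char0 hv').
have [mf _ fI _ _] := ex; exists U1.
have inj (x y : 'cV_(rep_dim U1)) : f *m x = f *m y -> x = y.
  by move=> E; apply/eqP; rewrite -subr_eq0; apply/eqP/fI; rewrite mulmxBr E subrr.
have [y0 y0E] := (fS v').1 (low_gen v').
have fD i j : i != j -> f *m unit_op U1 i j = D i j *m f.
  by move=> ij; apply: (mor_lie mf (@homog_delta k i j) (str_delta k ij)).
have hy : hwv (V := U1) y0 (b1 + 2, b2 - 2) s.
  split=> [i j ij|c|]; apply: inj.
  - have ij' : i != j by apply: contraTneq ij => ->; rewrite ltxx.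
    by rewrite mulmxA fD // -mulmxA -y0E (hw_raise hv' ij) mulmx0.
  - by rewrite mulmxA (mor_dh c mf) -mulmxA -y0E (hw_weight hv') -scalemxAr -y0E.
  - by rewrite mulmxA (par_mx_mor mf) -mulmxA -y0E (hw_par hv') -scalemxAr -y0E.
apply: (low_lead char0 wU hy).
  by apply: contra_neq v'0 => y00; rewrite y0E y00 mulmx0.
move=> y; have : low v' (f *m y) by apply/fS; exists y.
suff H z : low v' z -> exists2 x, z = f *m x & low y0 x.
  by move=> /H [x /inj ->].
elim=> {z} [|c x x' _ [z -> lz] _ [z' -> lz']|i j x ij _ [z -> lz]].
- by exists y0 => //; exact: low_gen.
- by exists (c *: z + z'); [rewrite mulmxDr scalemxAr|exact: low_lin].
have ij' : i != j by apply: contraTneq ij => ->; rewrite ltxx.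
by exists (unit_op U1 i j *m z); [rewrite mulmxA -fD // mulmxA|exact: low_op].
Qed.
End Reflection.

(** * The standard representation, its dual and their product *)

Section TensorMatrix.
Variables (k : fieldType) (n m : nat) (pn : 'I_n -> bool) (pm : 'I_m -> bool).
Variables (R : 'I_n -> 'I_n -> regexpr k) (R' : 'I_m -> 'I_m -> regexpr k).
Hypothesis evR : forall (A : superalg k) (g : SL22 A) i j, sa_hom (pn i (+) pn j) (reval g (R i j)).
Hypothesis evR' : forall (A : superalg k) (g : SL22 A) i j, sa_hom (pm i (+) pm j) (reval g (R' i j)).
Hypothesis mulR : forall (A : superalg k) (g h gh : SL22 A),
  sl_mx gh = sl_mx g *m sl_mx h -> evalmx R gh = evalmx R g *m evalmx R h.
Hypothesis mulR' : forall (A : superalg k) (g h gh : SL22 A),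
  sl_mx gh = sl_mx g *m sl_mx h -> evalmx R' gh = evalmx R' g *m evalmx R' h.

(** The sign rule of [tensor], for factors on which scalars may act nontrivially: the standard
    representation and its dual are representations of SL(2,2), and only their product descends to
    PSL(2,2). *)
Definition tmx_par (x : 'I_(n * m)) : bool := pn (mxtens_unindex x).1 (+) pm (mxtens_unindex x).2.
Definition tmx (x y : 'I_(n * m)) : regexpr k :=
  let: (i, p) := mxtens_unindex x in let: (j, q) := mxtens_unindex y in
  Mul (Const ((-1) ^+ ((pn i (+) pn j) && pm p))) (Mul (R i j) (R' p q)).

Lemma tmxE (A : superalg k) (g : SL22 A) i p j q :
  reval g (tmx (mxtens_index (i, p)) (mxtens_index (j, q))) =
  (-1) ^+ ((pn i (+) pn j) && pm p) * (reval g (R i j) * reval g (R' p q)).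
Proof. by rewrite /tmx !mxtens_indexK /= in_alg_sign. Qed.

Lemma tmx_even (A : superalg k) (g : SL22 A) x y : sa_hom (tmx_par x (+) tmx_par y) (reval g (tmx x y)).
Proof.
case: (mxtens_indexP x) => i p; case: (mxtens_indexP y) => j q.
rewrite tmxE /tmx_par !mxtens_indexK addbACA.
by apply/hom_sign/sa_homM.
Qed.

Lemma tmx_mul (A : superalg k) (g h gh : SL22 A) : sl_mx gh = sl_mx g *m sl_mx h ->
  evalmx tmx gh = evalmx tmx g *m evalmx tmx h.
Proof.
move=> E; apply/matrixP => x y; case: (mxtens_indexP x) => i p; case: (mxtens_indexP y) => j q.
have /matrixP/(_ i j) := mulR E; have /matrixP/(_ p q) := mulR' E; rewrite !mxE tmxE => -> ->.
rewrite sum_tens mulr_suml mulr_sumr; apply: eq_bigr => l _.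
rewrite mulr_sumr mulr_sumr; apply: eq_bigr => r _; rewrite !mxE !tmxE mulsignA.
set a := reval g (R i l); set b := reval h (R l j).
set c := reval g (R' p r); set d := reval h (R' r q).
have cb : b * c = (-1) ^+ ((pm p (+) pm r) && (pn l (+) pn j)) * (c * b).
  exact: (sa_comm (evR' g p r) (evR h l j)).
have -> : a * b * (c * d) = (-1) ^+ ((pm p (+) pm r) && (pn l (+) pn j)) * (a * c * (b * d)).
  rewrite -[a * b * _]mulrA [b * (c * d)]mulrA cb -!mulrA.
  by rewrite mulrA commr_sign !mulrA.
rewrite mulrA -signr_addb; congr (_ ^+ nat_of_bool _ * _).
by case: (pn i) (pn j) (pn l) (pm p) (pm r) => [] [] [] [] [].
Qed.
End TensorMatrix.

Section Inverse.
Variable k : closedFieldType.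
Local Notation rm := ('I_2 -> 'I_2 -> regexpr k).

Definition radd (F G : rm) : rm := fun i j => Add (F i j) (G i j).
Definition rneg (F : rm) : rm := fun i j => Mul (Const (-1)) (F i j).
Definition rmul (F G : rm) : rm := fun i j => Add (Mul (F i 0) (G 0 j)) (Mul (F i 1) (G 1 j)).
Definition radj (F : rm) : rm := fun i j =>
  if i == 0 then (if j == 0 then F 1 1 else Mul (Const (-1)) (F 0 1))
  else (if j == 0 then Mul (Const (-1)) (F 1 0) else F 0 0).
(** [InvDetD] inverts the determinant of the lower block and, by the Berezinian condition, that of
    its Schur complement; [rinv] is applied to these two blocks. *)
Definition rinv (F : rm) : rm := fun i j => Mul InvDetD (radj F i j).

Definition blkA : rm := fun i j => Entry (lshift 2 i) (lshift 2 j).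
Definition blkB : rm := fun i j => Entry (lshift 2 i) (rshift 2 j).
Definition blkC : rm := fun i j => Entry (rshift 2 i) (lshift 2 j).
Definition blkD : rm := fun i j => Entry (rshift 2 i) (rshift 2 j).

Section Eval.
Variables (A : superalg k) (g : SL22 A).

Lemma raddE F G : evalmx (radd F G) g = evalmx F g + evalmx G g.
Proof. by apply/matrixP => i j; rewrite !mxE. Qed.
Lemma rnegE F : evalmx (rneg F) g = - evalmx F g.
Proof. by apply/matrixP => i j; rewrite !mxE /= scaleN1r mulN1r. Qed.
Lemma rmulE F G : evalmx (rmul F G) g = evalmx F g *m evalmx G g.
Proof. by apply/matrixP => i j; rewrite !mxE sum2 !mxE. Qed.
Lemma rinvE F : evalmx (rinv F) g = (sl_invD g)%:M *m \adj (evalmx F g).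
Proof.
have [j00 j11 j01 j10] := adj2E (evalmx F g); rewrite mul_scalar_mx.
apply/matrixP; apply: ord2_ind; apply: ord2_ind;
  by rewrite [LHS]mxE [RHS]mxE ?j00 ?j11 ?j01 ?j10 ?mxE /rinv /radj /= ?scaleN1r ?mulN1r.
Qed.
Lemma blkAE : evalmx blkA g = ulsubmx g. Proof. by apply/matrixP => i j; rewrite !mxE. Qed.
Lemma blkBE : evalmx blkB g = ursubmx g. Proof. by apply/matrixP => i j; rewrite !mxE. Qed.
Lemma blkCE : evalmx blkC g = dlsubmx g. Proof. by apply/matrixP => i j; rewrite !mxE. Qed.
Lemma blkDE : evalmx blkD g = drsubmx g. Proof. by apply/matrixP => i j; rewrite !mxE. Qed.
End Eval.

Definition invD : rm := rinv blkD.
Definition schur : rm := radd blkA (rneg (rmul (rmul blkB invD) blkC)).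
Definition invS : rm := rinv schur.

(* Block inversion through the Schur complement. *)
Definition ginv (x y : 'I_(2 + 2)) : regexpr k :=
  match split x, split y with
  | inl i, inl j => invS i j
  | inl i, inr j => rneg (rmul (rmul invS blkB) invD) i j
  | inr i, inl j => rneg (rmul (rmul invD blkC) invS) i j
  | inr i, inr j => radd invD (rmul (rmul (rmul (rmul invD blkC) invS) blkB) invD) i j
  end.

Lemma block_inverse (A : pzRingType) n (S S' D E B C : 'M[A]_n) :
  S *m S' = 1%:M -> S' *m S = 1%:M -> D *m E = 1%:M -> E *m D = 1%:M ->
  let G := block_mx S' (- (S' *m B *m E)) (- (E *m C *m S')) (E + E *m C *m S' *m B *m E) in
  block_mx (S + B *m E *m C) B C D *m G = 1%:M /\ G *m block_mx (S + B *m E *m C) B C D = 1%:M.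
Proof.
move=> SS S'S DE ED G; split; rewrite mulmx_block scalar_mx_block; congr block_mx.
- by rewrite mulmxDl SS mulmxN !mulmxA addrK.
- rewrite mulmxN mulmxDl mulmxDr !mulmxA SS mul1mx addrC opprD addrACA.
  by rewrite subrr add0r subrr.
- by rewrite mulmxN !mulmxA DE mul1mx subrr.
- by rewrite mulmxN mulmxDr !mulmxA DE !mul1mx addrCA addNr addr0.
- by rewrite mulmxDr S'S mulNmx !mulmxA addrK.
- by rewrite mulNmx -[S' *m B *m E *m D]mulmxA ED mulmx1 subrr.
- rewrite mulNmx mulmxDr mulmxDl -[E *m C *m S' *m S]mulmxA S'S mulmx1 !mulmxA opprD.
  by rewrite addrACA addNr addNr addr0.
- rewrite mulNmx mulmxDl ED -[_ *m B *m E *m D]mulmxA ED mulmx1 addrCA addNr addr0 //.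
Qed.

Lemma ginv_spec (A : superalg k) (g : SL22 A) :
  [/\ sl_mx g *m evalmx ginv g = 1%:M, evalmx ginv g *m sl_mx g = 1%:M &
      forall i j, sa_hom (par22 i (+) par22 j) (reval g (ginv i j))].
Proof.
set A0 := ulsubmx g; set B0 := ursubmx g; set C0 := dlsubmx g; set D0 := drsubmx g.
have hb b i j : par22 i (+) par22 j = b -> sa_hom b (g i j) by exact: hom_entry.
have hA0 i j : sa_hom false (A0 i j) by rewrite !mxE; apply: hb; rewrite !par_l.
have hB0 i j : sa_hom true (B0 i j) by rewrite !mxE; apply: hb; rewrite par_l par_r.
have hC0 i j : sa_hom true (C0 i j) by rewrite !mxE; apply: hb; rewrite par_l par_r.
have hD0 i j : sa_hom false (D0 i j) by rewrite !mxE; apply: hb; rewrite !par_r.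
have Dx : \det D0 * sl_invD g = 1 := sl_invDP g.
have hx : sa_hom false (sl_invD g) := hom_inv (detD_even g) Dx.
have hM b c (M M' : 'M[A]_2) : (forall i j, sa_hom b (M i j)) ->
    (forall i j, sa_hom c (M' i j)) -> forall i j, sa_hom (b (+) c) ((M *m M') i j).
  by move=> h h' i j; rewrite mxE; apply: hom_sum => l _; apply: sa_homM.
have hinv (M : 'M[A]_2) : (forall i j, sa_hom false (M i j)) ->
    forall i j, sa_hom false (((sl_invD g)%:M *m \adj M) i j).
  move=> h i j; have [j00 j11 j01 j10] := adj2E M.
  rewrite mul_scalar_mx mxE; apply: homM_even => //; move: i j.
  by apply: ord2_ind; apply: ord2_ind; rewrite ?j00 ?j11 ?j01 ?j10 //; apply: homN.
set E := (sl_invD g)%:M *m \adj D0; have hE := hinv _ hD0.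
have [DE ED] : D0 *m E = 1%:M /\ E *m D0 = 1%:M := adj_inv hD0 hx Dx.
set S := A0 - B0 *m E *m C0.
have hS i j : sa_hom false (S i j).
  rewrite /S mxE [X in _ + X]mxE; apply: homB => //; apply: (hM true true) => //; exact: (hM true false).
have Sx : \det S * sl_invD g = 1 := sl_berP g.
set S' := (sl_invD g)%:M *m \adj S; have hS' := hinv _ hS.
have [SS S'S] : S *m S' = 1%:M /\ S' *m S = 1%:M := adj_inv hS hx Sx.
have eE : evalmx invD g = E by rewrite rinvE blkDE.
have eS : evalmx schur g = S by rewrite raddE rnegE !rmulE blkAE blkBE blkCE eE.
have eS' : evalmx invS g = S' by rewrite rinvE eS.
have e12 : evalmx (rneg (rmul (rmul invS blkB) invD)) g = - (S' *m B0 *m E).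
  by rewrite rnegE !rmulE eS' blkBE eE.
have e21 : evalmx (rneg (rmul (rmul invD blkC) invS)) g = - (E *m C0 *m S').
  by rewrite rnegE !rmulE eS' blkCE eE.
have e22 : evalmx (radd invD (rmul (rmul (rmul (rmul invD blkC) invS) blkB) invD)) g =
    E + E *m C0 *m S' *m B0 *m E by rewrite raddE !rmulE eS' blkBE blkCE eE.
have eG : evalmx ginv g = block_mx S' (- (S' *m B0 *m E)) (- (E *m C0 *m S')) (E + E *m C0 *m S' *m B0 *m E).
  rewrite -e12 -e21 -e22 -eS'; apply/matrixP => x y.
  case: (split_ordP x) => i ->; case: (split_ordP y) => j ->;
  by rewrite ?block_mxEul ?block_mxEur ?block_mxEdl ?block_mxEdr [LHS]mxE /ginv ?split_l ?split_r [RHS]mxE.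
have gE : sl_mx g = block_mx (S + B0 *m E *m C0) B0 C0 D0 by rewrite /S subrK submxK.
have [Gl Gr] := block_inverse B0 C0 SS S'S DE ED.
split.
- by rewrite eG gE.
- by rewrite eG gE.
- move=> x y; have -> : reval g (ginv x y) = evalmx ginv g x y by rewrite mxE.
  rewrite eG; case: (split_ordP x) => i ->; case: (split_ordP y) => j ->.
  + by rewrite block_mxEul !par_l.
  + rewrite block_mxEur par_l par_r mxE; apply: homN; apply: (hM true false) => //; exact: (hM false true).
  + rewrite block_mxEdl par_l par_r mxE; apply: homN; apply: (hM true false) => //; exact: (hM false true).
  + rewrite block_mxEdr !par_r mxE; apply: homD => //; apply: (hM false false) => //.
    apply: (hM true true) => //; apply: (hM true false) => //; exact: (hM false true).
Qed.

Lemma ginv_mul (A : superalg k) (g h gh : SL22 A) : sl_mx gh = sl_mx g *m sl_mx h ->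
  evalmx ginv gh = evalmx ginv h *m evalmx ginv g.
Proof.
move=> E; have [_ l _] := ginv_spec gh; have [r _ _] := ginv_spec g; have [r' _ _] := ginv_spec h.
rewrite -[LHS]mulmx1 -r -[sl_mx g]mulmx1 -r' !mulmxA -[_ *m sl_mx g *m sl_mx h]mulmxA -E.
by rewrite l mul1mx.
Qed.

(** The supertranspose of the inverse: its sign absorbs the one that appears when two entries are
    exchanged, and the result is multiplicative. *)
Definition dual_mx (p q : 'I_(2 + 2)) : regexpr k :=
  Mul (Const ((-1) ^+ (par22 p && (par22 p (+) par22 q)))) (ginv q p).

Lemma dual_mxE (A : superalg k) (g : SL22 A) p q : reval g (dual_mx p q) =
  (-1) ^+ (par22 p && (par22 p (+) par22 q)) * evalmx ginv g q p.
Proof. by rewrite /= in_alg_sign mxE. Qed.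

Lemma dual_even (A : superalg k) (g : SL22 A) p q : sa_hom (par22 p (+) par22 q) (reval g (dual_mx p q)).
Proof.
rewrite dual_mxE mxE; apply: hom_sign; have [_ _] := ginv_spec g; rewrite addbC; exact.
Qed.

Lemma dual_mul (A : superalg k) (g h gh : SL22 A) : sl_mx gh = sl_mx g *m sl_mx h ->
  evalmx dual_mx gh = evalmx dual_mx g *m evalmx dual_mx h.
Proof.
move=> E; apply/matrixP => p q; rewrite [LHS]mxE [RHS]mxE dual_mxE (ginv_mul E) mxE mulr_sumr.
apply: eq_bigr => l _; rewrite [evalmx dual_mx g p l]mxE [evalmx dual_mx h l q]mxE !dual_mxE mulsignA !mxE.
have [_ _ hg] := ginv_spec g; have [_ _ hh] := ginv_spec h.
rewrite (sa_comm (hg l p) (hh q l)) mulrA -signr_addb; congr (_ ^+ nat_of_bool _ * _).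
by case: (par22 p) (par22 q) (par22 l) => [] [] [].
Qed.

Lemma std_mul (A : superalg k) (g h gh : SL22 A) : sl_mx gh = sl_mx g *m sl_mx h ->
  evalmx (@Entry k) gh = evalmx (@Entry k) g *m evalmx (@Entry k) h.
Proof.
have eE (x : SL22 A) : evalmx (@Entry k) x = sl_mx x by apply/matrixP => i j; rewrite mxE.
by rewrite !eE.
Qed.

Lemma std_even (A : superalg k) (g : SL22 A) i j : sa_hom (par22 i (+) par22 j) (reval g (@Entry k i j)).
Proof. exact: sl_even. Qed.

Definition adj_mx := tmx par22 par22 (@Entry k) dual_mx.

(** A scalar [a] acts by [a] on the first factor and by its inverse on the second. *)
Lemma adj_scal (A : superalg k) (g : SL22 A) (a : A) : sl_mx g = a%:M -> evalmx adj_mx g = 1%:M.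
Proof.
move=> gE; have [gI _ _] := ginv_spec g.
have aI i j : a * evalmx ginv g i j = (i == j)%:R.
  by have /matrixP/(_ i j) := gI; rewrite gE mul_scalar_mx !mxE.
apply/matrixP => x y; case: (mxtens_indexP x) => i p; case: (mxtens_indexP y) => j q.
rewrite [LHS]mxE tmxE dual_mxE [reval g _]/= gE mxE [RHS]mxE (can_eq (@mxtens_indexK _ _)) xpair_eqE.
have [->|_] := eqVneq i j; last by rewrite mulr0n mul0r mulr0.
rewrite addbb mul1r mulr1n mulrA (commr_sign a) -mulrA aI eq_sym.
by have [->|_] := eqVneq p q; rewrite ?addbb ?andbF ?mulr0 // mul1r.
Qed.

(* The tensor product of the standard representation and of its dual. *)
Definition adj_rep : rep k :=
  Rep (tmx_even std_even dual_even) adj_scal (tmx_mul std_even dual_even std_mul dual_mul).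

Definition adj_wt (x : 'I_((2 + 2) * (2 + 2))) : P0 :=
  ((wt (mxtens_unindex x).1).1 - (wt (mxtens_unindex x).2).1,
   (wt (mxtens_unindex x).1).2 - (wt (mxtens_unindex x).2).2).

(** The inverse of 1 + y h is 1 - y h, so the dual contributes the opposite weights. *)
Lemma adj_weighted : weighted adj_rep adj_wt.
Proof.
move=> c; have [g [gE RE]] := @inf_point k false (hb k c) (homog_hdiag _ _) (str_hdiag _ _).
have := RE _ _ (rep_repmx adj_rep) => /(congr1 (map_mx (@q1 k))); rewrite q1mx_inf => <-.
have [gI Ig _] := ginv_spec g.
pose y := qy k false false.
have yy : y * y = 0 by apply: quad_eq => /=; ring.
have gJ : sl_mx g *m (1%:M - y *: map_mx (in_alg _) (hb k c)) = 1%:M.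
  rewrite gE mulmxBr mulmx1 mulmxDl mul1mx -addrA -[RHS]addr0; congr (_ + _).
  rewrite opprD addrA subrr sub0r; apply/eqP; rewrite oppr_eq0; apply/eqP/matrixP => i j.
  by rewrite !mxE big1 // => l _; rewrite !mxE; apply: quad_eq => /=; ring.
have IE : evalmx ginv g = 1%:M - y *: map_mx (in_alg _) (hb k c).
  by have := congr1 (mulmx (evalmx ginv g)) gJ; rewrite mulmxA Ig mul1mx mulmx1 => ->.
apply/matrixP => x z; case: (mxtens_indexP x) => i p; case: (mxtens_indexP z) => j q.
rewrite [LHS]mxE [X in q1 X]mxE tmxE dual_mxE IE [reval g _]/= gE /hb hdiag_diag.
rewrite [RHS]mxE (can_eq (@mxtens_indexK _ _)) xpair_eqE [(\row__ _) _ _]mxE.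
have -> : wcomp c (adj_wt (mxtens_index (i, p))) = wcomp c (wt i) - wcomp c (wt p).
  by rewrite /adj_wt mxtens_indexK; case: c {g gE RE gI Ig gJ IE}.
rewrite !mxE !wval_wt intrB [q == p]eq_sym.
have sg (b : bool) (t : qalg k false false) : q1 ((-1) ^+ b * t) = (-1) ^+ b * q1 t.
  by case: b; rewrite ?expr1 ?expr0 ?mul1r // !mulN1r.
rewrite !sg; have [->|_] := eqVneq i j; have [->|_] := eqVneq p q;
  rewrite ?addbb ?andbF /= ?mulr0n ?mulr1n ?expr0; by ring.
Qed.
End Inverse.

(** * Tensor powers and prescribed leading weights *)

Notation psi := (height (1, 2)).

Section TensorPowers.
Variables (k : closedFieldType) (char0 : [pchar k] =i pred0).

Fixpoint tpow (m : nat) : rep k := if m is m'.+1 then tensor (adj_rep k) (tpow m') else rep1 k.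

Fixpoint tpow_wt (m : nat) : 'I_(rep_dim (tpow m)) -> P0 :=
  match m return 'I_(rep_dim (tpow m)) -> P0 with
  | 0 => fun=> 0
  | m'.+1 => @wtensor k (adj_rep k) (tpow m') adj_wt (@tpow_wt m')
  end.

Lemma tpow_weighted m : weighted (tpow m) (@tpow_wt m).
Proof.
elim: m => [|m IH]; first exact: weighted1.
exact: weighted_tensor (adj_weighted k) IH.
Qed.

Definition adj_idx (i p : 'I_(2 + 2)) : 'I_(rep_dim (adj_rep k)) := mxtens_index (i, p).
Definition tpow_idx m (x : 'I_(rep_dim (adj_rep k))) (y : 'I_(rep_dim (tpow m))) :
  'I_(rep_dim (tpow m.+1)) := mxtens_index (x, y).

Lemma tpow_idxP m (z : 'I_(rep_dim (tpow m.+1))) : exists x y, z = tpow_idx x y.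
Proof. by case: (mxtens_indexP (z : 'I_(rep_dim (adj_rep k) * rep_dim (tpow m)))) => x y; exists x, y. Qed.

Lemma tpow_idx_inj m x y x' y' : @tpow_idx m x y = tpow_idx x' y' -> x = x' /\ y = y'.
Proof. by move=> /(can_inj (@mxtens_indexK _ _)) [-> ->]. Qed.

Lemma tpow_wtE m x y : @tpow_wt m.+1 (tpow_idx x y) = (adj_wt x : P0) + tpow_wt y.
Proof. by rewrite /= /wtensor mxtens_indexK. Qed.

Lemma psiD (a b : P0) : psi (a + b) = psi a + psi b.
Proof.
have H (a1 a2 b1 b2 : int) : 1 * (a1 + b1) + 2 * (a2 + b2) = 1 * a1 + 2 * a2 + (1 * b1 + 2 * b2) by ring.
exact: H.
Qed.

Lemma adj_idxP (x : 'I_(rep_dim (adj_rep k))) : exists i p, x = adj_idx i p.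
Proof. by case: (mxtens_indexP (x : 'I_((2 + 2) * (2 + 2)))) => i p; exists i, p. Qed.

Lemma adj_wtE i p : adj_wt (adj_idx i p) = ((wt i).1 - (wt p).1, (wt i).2 - (wt p).2).
Proof. by rewrite /adj_wt mxtens_indexK. Qed.

(** [psi] is the height for the order f0 > e0 > e1 > f1; its largest value 4 is the difference
    between the extreme vectors f0 and f1, of weight 2 δ. *)
Lemma adj_psi x : psi (adj_wt x) <= 4 /\ (psi (adj_wt x) = 4 -> x = adj_idx f0 f1).
Proof.
have [i [p ->]] := adj_idxP x; rewrite adj_wtE.
by move: i p; apply: ord4_ind; apply: ord4_ind.
Qed.

(** The parity is a function of the weight, so that weight vectors in tensor powers are
    automatically homogeneous. *)
Lemma adj_par x : rep_par (adj_rep k) x = odd `|(adj_wt x).2|.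
Proof.
have [i [p ->]] := adj_idxP x; rewrite adj_wtE [LHS]/(tmx_par _ _ _) /tmx_par mxtens_indexK.
by move: i p; apply: ord4_ind; apply: ord4_ind.
Qed.

Fixpoint tpow_top m : 'I_(rep_dim (tpow m)) :=
  match m return 'I_(rep_dim (tpow m)) with
  | 0 => ord0
  | m'.+1 => tpow_idx (adj_idx f0 f1) (@tpow_top m')
  end.

Lemma tpow_psi m x : psi (@tpow_wt m x) <= 4 * m%:Z /\ (psi (@tpow_wt m x) = 4 * m%:Z -> x = tpow_top m).
Proof.
elim: m x => [|m IH] x; first by split=> // _; exact: (ord1 x).
have [y [z ->]] := tpow_idxP x; rewrite tpow_wtE psiD.
have [h1 h2] := adj_psi y; have [h3 h4] := IH z.
have H (p q : int) : p <= 4 -> q <= 4 * m%:Z -> p + q <= 4 * m.+1%:Z /\ (p + q = 4 * m.+1%:Z -> p = 4 /\ q = 4 * m%:Z).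
  by move=> ? ?; split=> [|?]; lia.
have [le eq] := H _ _ h1 h3; split=> // /eq [e1 e2].
by rewrite (h2 e1) (h4 e2).
Qed.

Lemma tpow_par m x : rep_par (tpow m) x = odd `|(@tpow_wt m x).2|.
Proof.
elim: m x => [|m IH] x //; have [y [z ->]] := tpow_idxP x.
rewrite tpow_wtE [LHS]par_tensor adj_par IH -odd_absD //.
Qed.

Lemma tpow_top_wt m : @tpow_wt m (tpow_top m) = (0, 2 * m%:Z).
Proof.
elim: m => [|m IH] //; rewrite [tpow_top _]/= tpow_wtE IH adj_wtE.
apply: P0_eq => //.
by change (2 + 2 * m%:Z = 2 * m.+1%:Z); lia.
Qed.

Lemma tpow_next m : (0 < m)%N -> exists x, @tpow_wt m x = (1, 2 * m%:Z - 1).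
Proof.
have E m' : (0 < m')%N -> exists x, @tpow_wt m' x = (1, 2 * m'%:Z - 1).
  case: m' => // m' _; exists (tpow_idx (adj_idx e0 f1) (tpow_top m')).
  rewrite tpow_wtE tpow_top_wt adj_wtE; apply: P0_eq => //.
  by change (1 + 2 * m'%:Z = 2 * m'.+1%:Z - 1); lia.
exact: E.
Qed.

(** The weight ε + (2m - 1) δ lies just below the top 2m δ for [psi]. A tensor factor can produce it
    in two ways, through (e0, f1) or (f0, e1), so two factors give at least three vectors, one more
    than the number of linear conditions imposed in [lead_3]. *)
Lemma tpow_next3 m : (1 < m)%N -> exists x : 'I_3 -> 'I_(rep_dim (tpow m)),
  injective x /\ forall r, tpow_wt (x r) = (1, 2 * m%:Z - 1).
Proof.
case: m => // m m0; have [y yE] := tpow_next m0.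
pose x (r : 'I_3) : 'I_(rep_dim (tpow m.+1)) := if r == 0 then tpow_idx (adj_idx e0 f1) (tpow_top m)
  else if r == 1 then tpow_idx (adj_idx f0 e1) (tpow_top m) else tpow_idx (adj_idx f0 f1) y.
have wE i p (u : 'I_(rep_dim (tpow m))) a b : (wt i).1 - (wt p).1 + a = 1 -> (wt i).2 - (wt p).2 + b = 2 * m.+1%:Z - 1 ->
    tpow_wt u = (a, b) -> tpow_wt (tpow_idx (adj_idx i p) u) = (1, 2 * m.+1%:Z - 1).
  by move=> h1 h2 uE; rewrite tpow_wtE uE adj_wtE; apply: P0_eq.
exists x; split=> [r s|r].
  have ai i p i' p' : adj_idx i p = adj_idx i' p' -> i = i' /\ p = p'.
    by move=> /(can_inj (@mxtens_indexK _ _)) [-> ->].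
  by case: r s => [[|[|[|//]]] hr] [[|[|[|//]]] hs] /=; rewrite /x /= => /tpow_idx_inj [] E _;
    try (by apply/val_inj); case: (ai _ _ _ _ E).
rewrite /x; case: eqP => _; last case: eqP => _.
- by apply: wE (tpow_top_wt m); rewrite /wt //=; lia.
- by apply: wE (tpow_top_wt m); rewrite /wt //=; lia.
- by apply: wE yE; rewrite /wt //=; lia.
Qed.

Lemma tpow_raise m i j x (a : 'I_(rep_dim (tpow m))) : i != j -> unit_op (tpow m) i j a x != 0 ->
  psi (tpow_wt a) = psi (tpow_wt x) + (psi (wt i) - psi (wt j)).
Proof.
move=> ij /(dmx_shift char0 (tpow_weighted m) ij) E.
have E1 : (tpow_wt a).1 + (wt j).1 = (tpow_wt x).1 + (wt i).1 :> int := congr1 fst E.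
have E2 : (tpow_wt a).2 + (wt j).2 = (tpow_wt x).2 + (wt i).2 :> int := congr1 snd E.
have H (x1 x2 y1 y2 i1 i2 j1 j2 : int) : x1 + j1 = y1 + i1 -> x2 + j2 = y2 + i2 ->
    1 * x1 + 2 * x2 = 1 * y1 + 2 * y2 + (1 * i1 + 2 * i2 - (1 * j1 + 2 * j2)) by lia.
exact: H E1 E2.
Qed.

Lemma tpow_kill m (v : 'cV[k]_(rep_dim (tpow m))) b i j : (forall x, v x 0 != 0 -> tpow_wt x = b) ->
  i != j -> 4 * m%:Z < psi b + (psi (wt i) - psi (wt j)) -> unit_op (tpow m) i j *m v = 0.
Proof.
move=> hv ij big; apply/matrixP => a c; rewrite (ord1 c) [LHS]mxE [RHS]mxE big1 // => x _.
have [->|vx] := eqVneq (v x 0) 0; first by rewrite mulr0.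
have [->|D] := eqVneq (unit_op (tpow m) i j a x) 0; first by rewrite mul0r.
have E := tpow_raise ij D; have [le _] := tpow_psi a; rewrite (hv x vx) in E.
by move: big le; rewrite E; lia.
Qed.

Lemma tpow_vec m (v : 'cV[k]_(rep_dim (tpow m))) b : (forall x, v x 0 != 0 -> tpow_wt x = b) ->
  (forall c, dh (tpow m) c *m v = (wcomp c b)%:~R *: v) /\
  par_mx (tpow m) *m v = (-1) ^+ (odd `|b.2|) *: v.
Proof.
move=> hv; split=> [c|]; apply/matrixP => a d; rewrite (ord1 d).
  rewrite /dh (tpow_weighted m) mul_diag_mx [LHS]mxE [RHS]mxE [(\row__ _) _ _]mxE.
  by have [->|/hv ->] := eqVneq (v a 0) 0; rewrite ?mulr0.
rewrite mul_diag_mx [LHS]mxE [RHS]mxE [(\row__ _) _ _]mxE tpow_par.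
by have [->|/hv ->] := eqVneq (v a 0) 0; rewrite ?mulr0.
Qed.

(** The vector of maximal [psi], of weight (0, 2m), is killed by every root vector positive for
    [psi]; the reflection moves its weight to (2, 2m - 2). *)
Lemma lead_2 m : (0 < m)%N -> exists U, is_lead (2, 1) (2, 2 * m%:Z - 2) (ch char0 U).
Proof.
move=> m0; pose v : 'cV[k]_(rep_dim (tpow m)) := delta_mx (tpow_top m) 0.
have hv x : v x 0 != 0 -> tpow_wt x = (0, 2 * m%:Z).
  rewrite mxE andbT; have [->|_] := eqVneq x (tpow_top m); last by rewrite eqxx.
  by rewrite tpow_top_wt.
have [wv pv] := tpow_vec hv.
have K i j : i != j -> 0 < psi (wt i) - psi (wt j) -> unit_op (tpow m) i j *m v = 0.
  move=> ij pos; apply: (tpow_kill hv ij); move: pos; rewrite [psi (0, _)]/height /=; lia.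
have v0 : v != 0.
  by apply/eqP => /matrixP/(_ (tpow_top m) 0); rewrite !mxE !eqxx => /eqP; rewrite oner_eq0.
have [||||U] := @reflection_rep k char0 (tpow m) v (@tpow_wt m) 0 (2 * m%:Z) _ (tpow_weighted m) _ _ _ wv pv v0.
- by split; apply: K.
- exact: K.
- exact: K.
- by lia.
by rewrite add0r => ?; exists U.
Qed.

(** A vector of weight (1, 2m - 1) is one unit of [psi] below the top. Root vectors raising [psi] by
    more kill it; the two that raise it by 1, E_f0e0 and E_e1f1, send it to multiples of the top
    vector. That is two equations on a space of dimension at least three. *)
Lemma lead_3 m : (1 < m)%N -> exists U, is_lead (2, 1) (3, 2 * m%:Z - 3) (ch char0 U).
Proof.
move=> m1; have [x [xI xE]] := tpow_next3 m1.
(* The two linear conditions on combinations of the three vectors [x r]; a nonzero row in the kernel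
   is a solution. *)
pose M : 'M[k]_(3, 2) := \matrix_(r, c) unit_op (tpow m) (if c == 0 then f0 else e1) (if c == 0 then e0 else f1) (tpow_top m) (x r).
have [c cM c0] : exists2 c : 'rV_3, c *m M = 0 & c != 0.
  have nf : kermx M != 0.
    by rewrite kermx_eq0 /row_free; apply/negP => /eqP E; have := rank_leq_col M; rewrite E.
  by have /rowV0Pn [c /sub_kermxP cM c0] := nf; exists c.
pose v : 'cV[k]_(rep_dim (tpow m)) := \sum_r c 0 r *: delta_mx (x r) 0.
have vE y : v y 0 = \sum_r c 0 r * (y == x r)%:R.
  by rewrite summxE; apply: eq_bigr => r _; rewrite !mxE andbT.
have vx r : v (x r) 0 = c 0 r.
  by rewrite vE (bigD1 r) //= eqxx mulr1 big1 ?addr0 // => s sr; rewrite (inj_eq xI) eq_sym (negPf sr) mulr0.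
have hv y : v y 0 != 0 -> tpow_wt y = (1, 2 * m%:Z - 1).
  rewrite vE => vy; suff [r ->] : exists r, y = x r by exact: xE.
  case: (pickP (fun r => y == x r)) => [r /eqP ->|none]; first by exists r.
  by case/eqP: vy; rewrite big1 // => r _; rewrite none mulr0.
have [wv pv] := tpow_vec hv.
have v0 : v != 0.
  apply: contra_neq c0 => v00; apply/rowP => r; by rewrite -vx v00 !mxE.
have K i j : i != j -> 1 < psi (wt i) - psi (wt j) -> unit_op (tpow m) i j *m v = 0.
  move=> ij pos; apply: (tpow_kill hv ij); move: pos; rewrite [psi (1, _)]/height /=; lia.
have Z (c' : 'I_2) : unit_op (tpow m) (if c' == 0 then f0 else e1) (if c' == 0 then e0 else f1) *m v = 0.
  have : \sum_r c 0 r * M r c' = 0 by move: cM => /matrixP/(_ 0 c'); rewrite [RHS]mxE [LHS]mxE.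
  under eq_bigr do rewrite mxE.
  have : (if c' == 0 then f0 else e1) != (if c' == 0 then e0 else f1) by case: ifP.
  have : psi (wt (if c' == 0 then f0 else e1)) - psi (wt (if c' == 0 then e0 else f1)) = 1 by case: ifP.
  move: (if c' == 0 then f0 else e1) (if c' == 0 then e0 else f1) => i j pij ij E.
  apply/matrixP => a d; rewrite (ord1 d) [LHS]mxE [RHS]mxE.
  have [->|an] := eqVneq a (tpow_top m).
    rewrite -[RHS]E [LHS](eq_bigr (fun y => \sum_r c 0 r * (unit_op (tpow m) i j (tpow_top m) y * (y == x r)%:R))).
      rewrite exchange_big; apply: eq_bigr => r _; rewrite -mulr_sumr; congr (_ * _).
      by rewrite (bigD1 (x r)) //= eqxx mulr1 big1 ?addr0 // => y yr; rewrite (negPf yr) mulr0.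
    by move=> y _; rewrite vE mulr_sumr; apply: eq_bigr => r _; rewrite mulrCA.
  rewrite big1 // => y _; have [->|vy] := eqVneq (v y 0) 0; first by rewrite mulr0.
  have [->|D] := eqVneq (unit_op (tpow m) i j a y) 0; first by rewrite mul0r.
  have P := tpow_raise ij D; rewrite (hv y vy) pij in P.
  have [_ top] := tpow_psi a; case/eqP: an; apply: top; rewrite P /height /=; lia.
have [||||U] := @reflection_rep k char0 (tpow m) v (@tpow_wt m) 1 (2 * m%:Z - 1) _ (tpow_weighted m) _ _ _ wv pv v0.
- by split; apply: K.
- exact: (Z 0).
- exact: (Z 1).
- by lia.
have -> : 1 + 2 = 3 :> int by [].
have -> : 2 * m%:Z - 1 - 2 = 2 * m%:Z - 3 by lia.
by move=> ?; exists U.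
Qed.

(** As a and b have equal parity, [lead_2] covers a = 2 and [lead_3] covers a = 3. Tensoring with
    the representation of leading weight (2, 0), the case m = 1 of [lead_2], then raises a by 2. *)
Lemma lead_exists (a b : int) : 2 <= a -> 0 <= b -> odd `|(a + b)%R| = false ->
  exists U, is_lead (2, 1) (a, b) (ch char0 U).
Proof.
move=> a2 b0 ev.
have [n nE] : exists n : nat, a = n%:Z + 2 by exists `|a - 2|%N; lia.
rewrite {}nE in ev * => {a a2}.
have [d] := ubnP n; elim: d n ev => // d IH [|[|n]] ev; rewrite ltnS => nd.
- have [m mE] : exists m : nat, b = 2 * m%:Z by exists (`|b|%N)./2; lia.
  have [U hU] := @lead_2 m.+1 isT; exists U.
  have e : 2 * m.+1%:Z - 2 = b by lia.
  by rewrite e in hU.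
- have [m mE] : exists m : nat, b = 2 * m%:Z + 1 by exists (`|b|%N)./2; lia.
  have [U hU] := @lead_3 m.+2 isT; exists U.
  have e : 2 * m.+2%:Z - 3 = b by lia.
  by rewrite e in hU.
have [||U hU] := IH n; [by lia|by lia|].
have [W hW] := @lead_2 1 isT.
exists (tensor W U); rewrite ch_tensor.
have := is_leadM hW hU.
have -> : 2 + (n%:Z + 2) = n.+2%:Z + 2 by lia.
have -> : 2 * 1%N%:Z - 2 + b = b by lia.
exact.
Qed.

(** The descent [Jstr_ind] is run inside the image of [sch], with the supercharacters from
    [lead_exists] in the place of the products (u - v)^2 u^i v^j. *)
Lemma sch_surj (sch : groth k -> ZP0) : {morph sch : x y / x - y} -> sch 1 = 1 ->
  (forall V, sch (groth_cls V) = ch char0 V) ->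
  forall f, Jstr f -> par_supp false f -> exists x, sch x = f.
Proof.
move=> sB s1 sV; apply: Jstr_ind => [f g [x <-] [y <-]||a b a2 b0 ev].
- by exists (x - y).
- by exists 1.
have [U hU] := lead_exists a2 b0 ev; have [J p] := ch_Jstr char0 U.
by exists (ch char0 U); split=> //; exists (groth_cls U).
Qed.
End TensorPowers.

Theorem proposition8p3 (k : closedFieldType) (char0 : [pchar k] =i pred0) :
  (forall f : ZP0,
     inJ f <-> exists (c : int) (g : ZUV), f = c%:~R + (uvar - vvar) ^+ 2 * evalUV g) /\
  (exists sch : {rmorphism groth k -> ZP0},
     [/\ forall V : rep k, is_supercharacter V (sch (groth_cls V)),
         injective sch &
         forall f : ZP0, inJplus f <-> exists x : groth k, sch x = f]).
Proof.
split; first exact: inJ_form.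
have [sch schE] := sch_exists char0.
have sV V : sch (groth_cls V) = ch char0 V by rewrite schE; exact: sch_fun_cls.
exists sch; split.
- by move=> V; rewrite sV; exact: ch_supercharacter.
- exact: (sch_inj sV).
move=> f; split=> [/inJplusP[J p]|[x <-]].
  by apply: (sch_surj (char0 := char0) _ _ sV J p); [exact: rmorphB|exact: rmorph1].
by apply/inJplusP; rewrite schE; exact: sch_fun_Jstr.
Qed.
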